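(* Let $\epsilon>0$, let $\Omega\subset\mathbb{C}^n$ be a domain with boundary $b\Omega\in H^{2+n+\epsilon}$, let $z_o\in b\Omega$ and let $U$ be a (small) neighborhood of $z_o$. Let $f:\mathbb{R}^+\to\mathbb{R}^+$ be smooth and increasing. (1) If $\frac{f(t)}{t}$ is decreasing, then there is a constant $c$ such that for every $u\in C^1(\bar\Omega\cap U)$ with compact support in $\bar\Omega\cap U$, $$\|f(\Lambda)u\|\le c\Big(\|\delta f(\delta^{-1})\nabla u\|+\sum_{j=1}^n\|\bar L_j u\|\Big).$$ (2) If $\frac{f(t)}{t^\eta}$ is decreasing for some $\eta<\frac12$, then there is a constant $c$ such that for every $u\in C^1(\bar\Omega\cap U)$ with compact support in $\bar\Omega\cap U$, $$\|f(\Lambda)u\|\le c\Big(\|f(\delta^{-1})u\|+\sum_{j=1}^n\|\bar L_j u\|\Big).$$ In both cases $c$ does not depend on $u$, and its dependence on the domain is controlled by the $H^{2+n+\epsilon}$ norm of the boundary.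
   Context: Identify $\mathbb{C}^n$ with $\mathbb{R}^{2n}$. The condition $b\Omega\in H^{2+n+\epsilon}$ means that near $z_o$ the domain $\Omega$ is given by $r<0$ for a real defining function $r$ in the $L^2$-Sobolev space $H^{2+n+\epsilon}$ with $\partial r\neq0$ on $b\Omega$ (in particular $b\Omega$ is $C^2$); the $H^{2+n+\epsilon}$ norm of the boundary is the norm of $r$. Complete $r$ to a system of local coordinates $(a,r)\in\mathbb{R}^{2n-1}\times\mathbb{R}$ on $U$ (of class at least $C^2$). $\|\cdot\|$ is the $L^2$ norm on $\Omega$. $\delta=\delta(z)$ is the distance from $z$ to $b\Omega$. $\nabla u$ is the full gradient of $u$. $L_1,\dots,L_n$ is a basis on $U$ of $(1,0)$ vector fields with $L_jr=\kappa_{jn}$ (Kronecker symbol), so $L_1,\dots,L_{n-1}$ restricted to $b\Omega$ are a basis of $T^{1,0}b\Omega$; $\bar L_j$ are the conjugate $(0,1)$ vector fields. With $\xi\in\mathbb{R}^{2n-1}$ the variables dual to $a$ and $\Lambda_\xi=(1+|\xi|^2)^{1/2}$, $f(\Lambda)$ is the tangential pseudodifferential operator $$f(\Lambda)u(a,r)=(2\pi)^{-(2n-1)}\int_{\mathbb{R}^{2n-1}}e^{i\langle a,\xi\rangle}f(\Lambda_\xi)\tilde u(\xi,r)\,d\xi,$$ where $\tilde u(\xi,r)=\int e^{-i\langle a,\xi\rangle}u(a,r)\,da$ is the partial Fourier transform in $a$ ($u$ being extended by $0$ outside $U$ in the $a$ variables). *)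

(* Defs.v *)
From HB Require Import structures.
From mathcomp Require Import all_boot all_order all_algebra.
From mathcomp Require Import all_classical all_reals all_analysis.
From mathcomp Require Import complex.

Set Implicit Arguments.
Unset Strict Implicit.
Unset Printing Implicit Defensive.

Import Order.TTheory GRing.Theory Num.Theory.
Import numFieldNormedType.Exports.
Import Normc.

Local Open Scope classical_set_scope.
Local Open Scope ring_scope.

(* Lebesgue measure on R^N, obtained by iterating the product with the Lebesgue
   measure of the line.  It lives on N.-tuple R, which carries the product
   sigma-algebra; [rvec] is the passage to row vectors, where the topology and
   the derivatives are. *)
Section lebesgue_measure_tuple.
Context (R : realType).
Local Notation T := (measurableTypeR R).

Definition tcons N (p : T * N.-tuple T) : N.+1.-tuple T := [tuple of p.1 :: p.2].

Lemma measurable_tcons N : measurable_fun setT (@tcons N).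
Proof. by apply: measurable_cons => //; exact: measurable_snd. Qed.

Section step.
Variables (N : nat) (mu : {sigma_finite_measure set (N.-tuple T) -> \bar R}).

Definition leb_step : set (N.+1.-tuple T) -> \bar R :=
  pushforward (lebesgue_measure \x mu)%E (@tcons N).

HB.instance Definition _ := Measure.copy leb_step
  (measure_function_pushforward__canonical__measure_function_Measure
    (lebesgue_measure \x mu)%E (@measurable_tcons N)).

Lemma leb_step_sigma_finite : sigma_finite setT leb_step.
Proof.
have [F [FT mF]] : exists F : (set (T * N.-tuple T))^nat, setT = \bigcup_k F k /\
    forall k, measurable (F k) /\ ((lebesgue_measure \x mu)%E (F k) < +oo)%E.
  have /sigma_finiteP[F [FT ndF Foo]] := sigma_finiteT (@lebesgue_measure R).
  have /sigma_finiteP[G [GT ndG Goo]] := sigma_finiteT mu.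
  exists (fun k => F k `*` G k); split.
    apply/seteqP; split=> // -[x t] _.
    have : setT x by []. rewrite FT => -[i _ Fi].
    have : setT t by []. rewrite GT => -[j _ Gj].
    exists (maxn i j) => //; split.
      by move/subsetPset: (ndF _ _ (leq_maxl i j)); exact.
    by move/subsetPset: (ndG _ _ (leq_maxr i j)); exact.
  move=> k; have [? ?] := Foo k; have [? ?] := Goo k.
  split; first exact: measurableX.
  by rewrite product_measure1E// lte_mul_pinfty// ge0_fin_numE.
exists (fun k => [set t | F k (thead t, [tuple of behead t])]).
  apply/seteqP; split=> // t _.
  have : [set: T * N.-tuple T] (thead t, [tuple of behead t]) by [].
  by rewrite FT => -[k _ Fk]; exists k.
move=> k; have [mFk Foo] := mF k; split.
  rewrite -[X in measurable X]setTI.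
  have m : measurable_fun setT
    (fun t : N.+1.-tuple T => (thead t, [tuple of behead t])).
    by apply/measurable_fun_pair; [exact: measurable_tnth|exact: measurable_behead].
  exact: m.
rewrite /leb_step /pushforward (_ : _ @^-1` _ = F k)//.
have tK (x : T) (t : N.-tuple T) : [tuple of behead (tcons (x, t))] = t.
  exact: val_inj.
by apply/seteqP; split=> -[x t] /=; rewrite theadE tK.
Qed.

HB.instance Definition _ :=
  @Measure_isSigmaFinite.Build _ _ _ leb_step leb_step_sigma_finite.
End step.

Fixpoint leb (N : nat) : {sigma_finite_measure set (N.-tuple T) -> \bar R} :=
  match N with
  | 0 => [the {sigma_finite_measure set (0.-tuple T) -> \bar R} of
           \d_ ([tuple] : 0.-tuple T)]
  | N'.+1 => [the {sigma_finite_measure set (N'.+1.-tuple T) -> \bar R} of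
           leb_step (leb N')]
  end.
End lebesgue_measure_tuple.

Section euclidean.
Context (R : realType).
Local Notation T := (measurableTypeR R).

Definition rvec N (t : N.-tuple T) : 'rV[R]_N := \row_i tnth t i.

Definition edot N (x y : 'rV[R]_N) : R := \sum_i x 0 i * y 0 i.
(* the norm `|x| of the library on row vectors is the sup norm *)
Definition enorm N (x : 'rV[R]_N) : R := Num.sqrt (edot x x).

Definition boundary N (A : set 'rV[R]_N) : set 'rV[R]_N := closure A `\` A°.
(* distance to the boundary, for the Euclidean norm *)
Definition delta N (A : set 'rV[R]_N) (z : 'rV[R]_N) : R :=
  inf [set enorm (z - w) | w in boundary A].

Definition pd N (i : 'I_N) (g : 'rV[R]_N -> R) (z : 'rV[R]_N) : R :=
  'D_(delta_mx 0 i) g z.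
Definition C1_on N (V : set 'rV[R]_N) (g : 'rV[R]_N -> R) :=
  forall z, V z -> forall i, derivable g z (delta_mx 0 i) /\
    {for z, continuous (pd i g)}.
Definition C2_on N (V : set 'rV[R]_N) (g : 'rV[R]_N -> R) :=
  C1_on V g /\ forall i, C1_on V (pd i g).

Definition cpd N (i : 'I_N) (u : 'rV[R]_N -> R[i]) (z : 'rV[R]_N) : R[i] :=
  (pd i (fun x => complex.Re (u x)) z +i* pd i (fun x => complex.Im (u x)) z)%C.
Definition grad_norm N (u : 'rV[R]_N -> R[i]) (z : 'rV[R]_N) : R :=
  Num.sqrt (\sum_i normc (cpd i u z) ^+ 2).

Definition L2norm N (A : set 'rV[R]_N) (g : 'rV[R]_N -> R) : \bar R :=
  Lnorm (leb R N) 2%:E (fun t => (\1_A (rvec t) * g (rvec t))%:E).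

Definition cintegral d (X : measurableType d) (mu : {measure set X -> \bar R})
    (D : set X) (g : X -> R[i]) : R[i] :=
  ((\int[mu]_(x in D) complex.Re (g x)) +i* (\int[mu]_(x in D) complex.Im (g x)))%C.
Definition cmeasurable d (X : measurableType d) (D : set X) (g : X -> R[i]) :=
  measurable_fun D (fun x => complex.Re (g x)) /\
  measurable_fun D (fun x => complex.Im (g x)).
Definition expi (x : R) : R[i] := (cos x +i* sin x)%C.
Definition Lambda N (xi : 'rV[R]_N) : R := Num.sqrt (1 + edot xi xi).

(* [sobolev s r M]: r is in H^s(R^N) with norm at most M, i.e. r is the inverse
   Fourier transform of some g with ||(1+|xi|^2)^(s/2) g|| <= M.  To be used for
   s > N/2 only: g is then integrable, so the inversion integral converges
   absolutely, and r is the continuous representative of its class. *)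
Definition sobolev N (s : R) (r : 'rV[R]_N -> R) (M : R) :=
  exists g : 'rV[R]_N -> R[i],
  [/\ cmeasurable setT (fun t : N.-tuple T => g (rvec t)),
      forall x, (r x)%:C%C = ((2 * pi) ^- N)%:C%C *
        cintegral (leb R N) setT (fun t => expi (edot x (rvec t)) * g (rvec t)) &
      (Lnorm (leb R N) 2%:E
        (fun t => (Lambda (rvec t) `^ s * normc (g (rvec t)))%:E) <= M%:E)%E].
End euclidean.

(* The operator f(Lambda) on functions of (a, r) in R^d x {r < 0}. *)
Section tangential.
Context (R : realType) (d : nat).
Local Notation T := (measurableTypeR R).
Implicit Types (f : R -> R) (u w : 'rV[R]_d * R -> R[i]).

Definition tfourier u (xi : 'rV[R]_d) (r : R) : R[i] :=
  cintegral (leb R d) setT (fun a => expi (- edot (rvec a) xi) * u (rvec a, r)).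

Definition fLambda_trunc f u (rho : R) : 'rV[R]_d * R -> R[i] := fun p =>
  ((2 * pi) ^- d)%:C%C *
  cintegral (leb R d) [set t | enorm (rvec t) <= rho]
    (fun t => expi (edot p.1 (rvec t)) * (f (Lambda (rvec t)))%:C%C *
              tfourier u (rvec t) p.2).

Definition L2norm_half w : \bar R :=
  Lnorm (leb R d \x (@lebesgue_measure R))%E 2%:E
    (fun q : d.-tuple T * T => (\1_[set x : R | x < 0] q.2 *
       normc (w (rvec q.1, q.2)))%:E).

(* [is_fLambda f u w]: w = f(Lambda)u.  For u only C^1 up to the boundary the
   integral over all xi need not converge absolutely; as usual it is the limit
   in L^2 of the integrals over |xi| <= rho. *)
Definition is_fLambda f u w :=
  cmeasurable [set q : d.-tuple T * T | q.2 < 0] (fun q => w (rvec q.1, q.2)) /\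
  L2norm_half (fun p => fLambda_trunc f u rho p - w p) @[rho --> +oo] --> 0%E.
End tangential.

(* C^n is R^(n + n): z_k = x_k + i y_k with x_k = z 0 (lshift n k) and
   y_k = z 0 (rshift n k). *)
Section domain.
Context (R : realType) (n : nat).
Local Notation Cn := 'rV[R]_(n + n).
Local Notation Rt := 'rV[R]_(n + n).-1.
Implicit Types (Omega U V W : set Cn) (r : Cn -> R) (a : Cn -> Rt).
Implicit Types (L : Cn -> 'M[R[i]]_n) (u : Cn -> R[i]) (z : Cn).

Definition dz (k : 'I_n) u z : R[i] :=
  (cpd (lshift n k) u z - 'i%C * cpd (rshift n k) u z) / 2.
Definition dzbar (k : 'I_n) u z : R[i] :=
  (cpd (lshift n k) u z + 'i%C * cpd (rshift n k) u z) / 2.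

(* L z j k is the coefficient of d/dz_k in the (1,0) vector field L_j. *)
Definition vf L (j : 'I_n) u z : R[i] := \sum_k L z j k * dz k u z.
Definition vfbar L (j : 'I_n) u z : R[i] := \sum_k conjc (L z j k) * dzbar k u z.

Definition defining_function Omega V r :=
  [/\ Omega `&` V = [set z | r z < 0] `&` V,
      C2_on V r &
      forall z, V z -> boundary Omega z -> exists k, dz k (fun x => (r x)%:C%C) z != 0].

Definition acoord a (k : 'I_(n + n).-1) : Cn -> R := fun z => a z 0 k.

Definition chart a r : Cn -> Rt * R := fun z => (a z, r z).

Definition coordinates V a r :=
  [/\ forall k, C2_on V (acoord a k),
      C2_on V r,
      {in V &, injective (chart a r)} &
      forall z v, V z -> (forall k, 'D_v (acoord a k) z = 0) -> 'D_v r z = 0 ->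
        v = 0].

(* The index n of the text is the last element of 'I_n. *)
Definition frame V r L :=
  [/\ forall j k z, V z -> {for z, continuous (fun x => complex.Re (L x j k))} /\
        {for z, continuous (fun x => complex.Im (L x j k))},
      forall z, V z -> L z \in unitmx &
      forall j z, V z ->
        vf L j (fun x => (r x)%:C%C) z = (j.+1 == n :> nat)%:R].

(* Size on W of the auxiliary choices (a and the frame) and quantitative
   nondegeneracy of the coordinates.  When these are given on a neighbourhood of
   a compact closure of W, all the bounds hold for some K by continuity.  No
   bound on r is imposed here. *)
Definition controlled W a r L (K : R) :=
  forall z, W z ->
  [/\ forall k i, `|pd i (acoord a k) z| <= K,
      forall k i j, `|pd i (pd j (acoord a k)) z| <= K,
      forall v, enorm v <=
        K * Num.sqrt (\sum_k 'D_v (acoord a k) z ^+ 2 + 'D_v r z ^+ 2) &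
      forall j k, normc (L z j k) <= K /\ normc (invmx (L z) j k) <= K].

(* C^1 up to the boundary: the derivatives on Omega extend continuously to the
   part of the closure of Omega lying in U. *)
Definition C1_closure Omega U (g : Cn -> R) :=
  {within closure Omega `&` U, continuous g} /\
  forall i, (forall z, (Omega `&` U) z -> derivable g z (delta_mx 0 i)) /\
    exists2 h : Cn -> R, {within closure Omega `&` U, continuous h} &
      forall z, (Omega `&` U) z -> h z = pd i g z.

(* u vanishes off a compact subset of its domain: it is extended by 0. *)
Definition test_function Omega U u :=
  [/\ C1_closure Omega U (fun z => complex.Re (u z)),
      C1_closure Omega U (fun z => complex.Im (u z)) &
      exists2 A, compact A /\ A `<=` closure Omega `&` U &
        forall z, ~ A z -> u z = 0].

Definition in_coordinates U a r u : Rt * R -> R[i] :=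
  patch (fun=> 0) (chart a r @` U) (u \o 'pinv_(fun=> 0) U (chart a r)).

End domain.

Section weights.
Context (R : realType).
Implicit Type f : R -> R.

Definition smooth_pos f := forall k t, 0 < t -> derivable (derive1n k f) t 1.
(* monotonicity on ]0, +oo[, in the wide sense *)
Definition increasing_pos f := forall s t, 0 < s -> s <= t -> f s <= f t.
Definition decreasing_pos f := forall s t, 0 < s -> s <= t -> f t <= f s.
End weights.

(* Main.v *)
(** Put s = -r and omega(s) = s f(1/s).  As f(Lambda) acts only in the variables a, it can be
    studied one frequency xi at a time: Hardy's inequality in s, split at s = 1/|xi|, bounds
    f(Lambda_xi)^2 times the integral of |u~(xi, .)|^2 by the integral of
    omega(s)^2 (|d_r u~|^2 + |xi|^2 |u~|^2), since f(t) increases and f(t)/t decreases.  With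
    Bessel's inequality for the partial Fourier transform this yields
    ||f(Lambda) u|| <= C ||omega(s) grad u||, where f(Lambda) u is constructed as the limit of its
    truncations in frequency.  A function in H^(2 + n + eps) of R^(2n) is Lipschitz with a constant
    controlled by its norm, so s <= C delta, and omega(s) <= C delta f(1/delta): this is (1).
    For (2), v = omega(s) ((1 - eps/s)_+)^2 u is C^1 with compact support in Omega, so that
    ||grad v|| = 2 ||dbar v||; the derivative of the weight is O(f(1/s)), and f(1/s) <= C f(1/delta)
    because the nondegenerate coordinates give delta <= C s.  Let eps tend to 0. *)

Require Import Defs.
From mathcomp Require Import all_boot all_order all_algebra.
From mathcomp Require Import all_classical all_reals all_analysis.
From mathcomp Require Import measurable_realfun simple_functions complex ring lra.

Set Implicit Arguments.
Unset Strict Implicit.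
Unset Printing Implicit Defensive.

Import Order.TTheory GRing.Theory Num.Theory.
Import numFieldNormedType.Exports.
Import Normc.
Local Open Scope classical_set_scope.
Local Open Scope ring_scope.

(** * Lebesgue measure on row vectors *)

Section rn_measure.
Context (R : realType).
Local Notation T := (measurableTypeR R).

(** The constant may see the domain only through [K] and [M], so none may come from the compactness
    of a set that depends on Omega or [u]. Every inequality carries an explicit constant built from
    the Lipschitz bound of [r], the size of [U], the margin between [U] and the complement of [W],
    and [K]. Only upper bounds are needed. Hence Bessel's inequality replaces Plancherel's identity,
    once for the partial Fourier transform and once for its inversion, and a covering by small cubes
    replaces the change of variables formula with its Jacobian. Transforms are split into cosine and
    sine parts, which keeps all integrals real. The function [u] has one derivative and does not
    vanish on the boundary. Hardy's inequality gets rid of its boundary term by sign. The identity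
    between the gradient and dbar is applied to compactly supported functions only, and is proved by
    differentiating translates instead of commuting second derivatives. The square on the cutoff
    makes it C^1 across s = eps. *)

Lemma measurable_preimage_open d (X : measurableType d) (V : pseudoMetricType R)
    (D : nat -> V) (h : X -> V) :
  (forall (v : V) (e : R), 0 < e -> exists n, ball v e (D n)) ->
  (forall (v : V) (e : R), 0 < e -> measurable (h @^-1` ball v e)) ->
  forall O : set V, open O -> measurable (h @^-1` O).
Proof.
move=> dD mh O oO.
(* Balls of radius [1/(k+1)] about the dense points, kept only when contained in [O]: countably
   many, and their union is [O]. *)
pose F (p : nat * nat) : set X :=
  if `[< ball (D p.1) (p.2.+1%:R^-1) `<=` O >]
  then h @^-1` ball (D p.1) (p.2.+1%:R^-1) else set0.
have -> : h @^-1` O = \bigcup_p F p.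
  apply/seteqP; split=> [x /= Ohx|x [p _]]; last first.
    by rewrite /F; case: asboolP => // /[apply].
  have /nbhs_ballP[e e0 He] : nbhs (h x) O by exact: open_nbhs_nbhs.
  have [k ke] : exists k, k.+1%:R^-1 < e / 2.
    have [k _ Hk] := near_infty_natSinv_lt (PosNum (divr_gt0 e0 (ltr0Sn R 1))).
    by exists k; exact: (Hk k (leqnn k)).
  have [n Hn] := dD (h x) (k.+1%:R^-1) (ltac:(by rewrite invr_gt0)).
  exists (n, k) => //; rewrite /F; case: asboolP => /=.
    by move=> _; exact: ball_sym.
  case=> y Hy; apply: He; apply: ball_split (_ : ball (h x) (e / 2) (D n)) _.
    by apply: le_ball Hn; apply: ltW.
  exact: le_ball (ltW ke) _ Hy.
have : countable [set: nat * nat] by exact: countableP.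
move=> cN; apply: countable_bigcupT_measurable => // p.
by rewrite /F; case: asboolP => // _; apply: mh; rewrite invr_gt0.
Qed.

Lemma dense_row N : exists D : nat -> 'rV[R]_N,
  forall (v : 'rV[R]_N) (e : R), 0 < e -> exists n, ball v e (D n).
Proof.
exists (fun n => \row_i ratr (odflt (0 : 'rV[rat]_N) (unpickle n) 0 i)).
move=> v e e0.
have /choice[q Hq] : forall i : 'I_N, exists q : rat, `|v 0 i - ratr q| < e.
  move=> i; have /rat_in_itvoo[q] : v 0 i - e < v 0 i + e by lra.
  rewrite in_itv /= => /andP[q1 q2]; exists q.
  by rewrite ltr_norml; apply/andP; split; lra.
exists (pickle (\row_i q i : 'rV[rat]_N)); rewrite pickleK /=.
by split=> // i j; rewrite !mxE ord1; exact: Hq.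
Qed.

Lemma ball_rV N (v w : 'rV[R]_N) e : 0 < e ->
  ball v e w <-> forall i, `|v 0 i - w 0 i| < e.
Proof.
move=> e0; split=> [[_ H] i|H]; first exact: H.
by split=> // i j; rewrite ord1; exact: H.
Qed.

(** The sigma-algebra lives on tuples, the topology on row vectors; this and [measurable_rvecR] link
    the two. A ball of the sup norm is a finite intersection of conditions on the coordinates. *)
Lemma measurable_to_rV d (X : measurableType d) N (h : X -> 'rV[R]_N) :
  (forall i, measurable_fun setT (fun x => h x 0 i : T)) ->
  forall O : set 'rV[R]_N, open O -> measurable (h @^-1` O).
Proof.
move=> mh; have [D dD] := dense_row N.
apply: (measurable_preimage_open dD) => v e e0.
have -> : h @^-1` ball v e = \bigcap_(i in [set: 'I_N]) ((fun x => h x 0 i : T) @^-1` (ball (v 0 i) e)).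
  apply/seteqP; split=> x; first by move=> /(ball_rV _ _ e0) H i _; exact: H.
  by move=> H; apply/ball_rV => // i; exact: (H i I).
apply: fin_bigcap_measurable => //.
move=> i _; rewrite -[X in measurable X]setTI; apply: mh => //.
rewrite ball_itv; exact: measurable_itv.
Qed.

Lemma measurable_rvec_coord N i : measurable_fun setT (fun t : N.-tuple T => rvec t 0 i : T).
Proof.
rewrite (_ : (fun t => _) = (fun t => tnth t i)); last by apply/funext => t; rewrite mxE.
exact: measurable_tnth.
Qed.

Lemma measurable_rvec N (O : set 'rV[R]_N) : open O -> measurable (@rvec R N @^-1` O).
Proof. by apply: measurable_to_rV => i; exact: measurable_rvec_coord. Qed.

Lemma dense_rowR N : exists D : nat -> 'rV[R]_N * R,
  forall (v : 'rV[R]_N * R) (e : R), 0 < e -> exists n, ball v e (D n).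
Proof.
have [D1 H1] := dense_row N; have [D2 H2] := dense_row 1.
exists (fun n => let p := odflt (0%N, 0%N) (unpickle n) in (D1 p.1, D2 p.2 0 0)).
move=> [v x] e e0; have [n Hn] := H1 v e e0; have [m Hm] := H2 (\row__ x) e e0.
exists (pickle (n, m)); rewrite pickleK /=; split => //=.
by have /(ball_rV _ _ e0)/(_ 0) := Hm; rewrite mxE.
Qed.

Definition rvecR N (q : N.-tuple T * T) : 'rV[R]_N * R := (rvec q.1, q.2).

Lemma measurable_rvecR N (O : set ('rV[R]_N * R)) : open O ->
  measurable (@rvecR N @^-1` O).
Proof.
have [D dD] := dense_rowR N; move: O.
apply: (measurable_preimage_open dD) => -[v x] e e0.
have -> : @rvecR N @^-1` ball (v, x) e = (@rvec R N @^-1` ball v e) `*` (ball x e).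
  by apply/seteqP; split => q /=.
apply: measurableX; last by rewrite ball_itv; exact: measurable_itv.
by apply: measurable_rvec; exact: ball_open.
Qed.

Lemma measurable_comp_open d (X : measurableType d) (V : topologicalType) (h : X -> V)
   (F : V -> R) (O : set V) :
  (forall O, open O -> measurable (h @^-1` O)) -> open O ->
  (forall x, O x -> {for x, continuous F}) ->
  measurable_fun (h @^-1` O) (F \o h).
Proof.
move=> mh oO cF; apply: (measurability _ (RGenOInfty.measurableE R)).
move=> _ [_ [x ->] <-].
have -> : (h @^-1` O) `&` (F \o h) @^-1` `]x, +oo[ = h @^-1` (O `&` F @^-1` `]x, +oo[) by [].
apply: mh; rewrite openE => y [Oy Fy]; apply: filterI.
  exact: open_nbhs_nbhs.
apply: cF => //; apply: open_nbhs_nbhs; split => //; exact: interval_open.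
Qed.


(** The cubes are half-open so that translates by multiples of [l] tile the space, as the cube
    decomposition behind [chart_integral_le] requires. *)
Lemma lebN_box N (c : 'I_N -> R) (l : R) : 0 <= l ->
  leb R N [set t | forall i, tnth t i \in `[c i, c i + l[] = (l ^+ N)%:E.
Proof.
move=> l0; elim: N c => [|N IH] c.
  rewrite /= diracE expr0 mem_set//= => -[]//.
pose c' i := c (lift ord0 i).
have mC : measurable [set t : N.-tuple T | forall i, tnth t i \in `[c' i, c' i + l[].
  have -> : [set t : N.-tuple T | forall i, tnth t i \in `[c' i, c' i + l[] =
      \bigcap_(i in [set: 'I_N]) ((fun t : N.-tuple T => tnth t i) @^-1` `[c' i, c' i + l[%classic).
    apply/seteqP; split=> t /=; first by move=> H i _; exact: H.
    by move=> H i; exact: H.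
  apply: fin_bigcap_measurable => // i _.
  rewrite -[X in measurable X]setTI; exact: measurable_tnth.
rewrite /= /leb_step /pushforward.
have -> : @tcons R N @^-1` [set t | forall i, tnth t i \in `[c i, c i + l[] =
   `[c ord0, c ord0 + l[%classic `*` [set t : N.-tuple T | forall i, tnth t i \in `[c' i, c' i + l[].
  apply/seteqP; split=> -[x t] /=.
    move=> H; split; first by have := H ord0; rewrite /tnth /=.
    by move=> i; have := H (lift ord0 i); rewrite tnthS.
  move=> [H1 H2] i; case: (unliftP ord0 i) => [j ->|->]; last exact: H1.
  by rewrite tnthS; exact: H2.
rewrite product_measure1E //= lebesgue_measure_itv /= lte_fin.
rewrite [X in (_ * X)%E]IH exprS.
case: ifPn => [_|]; first by rewrite -EFinB addrAC subrr add0r -EFinM.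
rewrite -leNgt gerDl => l0'; have -> : l = 0 by lra.
by rewrite mul0r mul0e.
Qed.

Lemma ge0_integral_lebS N (F : N.+1.-tuple T -> \bar R) :
  measurable_fun setT F -> (forall t, 0 <= F t)%E ->
  (\int[leb R N.+1]_t F t =
   \int[lebesgue_measure]_x \int[leb R N]_t F (tcons (x, t)))%E.
Proof.
move=> mF F0.
rewrite [LHS](@ge0_integral_pushforward _ _ _ _ _ _ (measurable_tcons (N:=N)) _ setT)//=.
rewrite preimage_setT fubini_tonelli1//=.
apply: measurableT_comp => //; exact: measurable_tcons.
Qed.

Definition tshift N (v : 'I_N -> R) (t : N.-tuple T) : N.-tuple T :=
  [tuple tnth t i + v i | i < N].

Lemma measurable_tshift N v : measurable_fun setT (@tshift N v).
Proof.
apply/measurable_fun_tnthP => i /=.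
rewrite (_ : _ \o _ = (fun t => tnth t i + v i)); last first.
  by apply/funext => t /=; rewrite tnth_mktuple.
by apply: measurable_funD => //; exact: measurable_tnth.
Qed.

(** The pushforward of Lebesgue measure under a translation gives half-open intervals their length,
    hence is Lebesgue measure by uniqueness. *)
Lemma ge0_integral_shift (c : R) (F : T -> \bar R) :
  measurable_fun setT F -> (forall t, 0 <= F t)%E ->
  (\int[lebesgue_measure]_x F (x + c)%R = \int[lebesgue_measure]_x F x)%E.
Proof.
move=> mF F0.
have mc : measurable_fun setT (fun x : T => x + c : T) by exact: measurable_funD.
transitivity (\int[pushforward lebesgue_measure (fun x : T => (x + c)%R : T)]_x F x)%E.
  by rewrite ge0_integral_pushforward //= preimage_setT.
apply: eq_measure_integral => A mA _.
apply/esym/lebesgue_measure_unique => //= _ [[a b]] _ <-.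
rewrite /pushforward.
have -> : (fun x : T => x + c) @^-1` `]a, b] = `]a - c, b - c]%classic.
  by apply/seteqP; split => x /=; rewrite !in_itv /= ltrBlDr lerBrDr.
rewrite !lebesgue_measure_itv /= !lte_fin ltrD2r; case: ifP => // _.
by rewrite -!EFinB opprD opprK addrACA addNr addr0.
Qed.

Lemma rvec_tshift N v (t : N.-tuple T) : rvec (tshift v t) = rvec t + \row_i v i.
Proof. by apply/rowP => i; rewrite !mxE tnth_mktuple. Qed.

Lemma ge0_integral_tshift N (v : 'I_N -> R) (F : N.-tuple T -> \bar R) :
  measurable_fun setT F -> (forall t, 0 <= F t)%E ->
  (\int[leb R N]_t F (tshift v t) = \int[leb R N]_t F t)%E.
Proof.
elim: N v F => [|N IH] v F mF F0.
  apply: eq_integral => t _; congr F; apply: eq_from_tnth => -[]//.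
rewrite (ge0_integral_lebS mF F0) ge0_integral_lebS; last 2 first.
  by apply: measurableT_comp => //; exact: measurable_tshift.
  by move=> t; exact: F0.
have E x t : tshift v (tcons (x, t)) = tcons (x + v ord0, tshift (fun i => v (lift ord0 i)) t).
  apply: eq_from_tnth => i; rewrite tnth_mktuple.
  case: (unliftP ord0 i) => [j ->|->]; last by rewrite /tnth.
  by rewrite !tnthS tnth_mktuple.
transitivity (\int[lebesgue_measure]_x (fun y => \int[leb R N]_t F (tcons (y, t))) (x + v ord0)%R)%E.
  apply: eq_integral => x _ /=; rewrite -[RHS](IH (fun i => v (lift ord0 i)))//.
    by apply: eq_integral => t _; rewrite E.
  apply: measurableT_comp => //.
  apply: (measurableT_comp (measurable_tcons (N:=N))); exact: measurable_pair1.
apply: (ge0_integral_shift (v ord0) (F := fun y => \int[leb R N]_t F (tcons (y, t))))%E.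
  apply: (@measurable_fun_fubini_tonelli_F _ _ _ _ _ (leb R N) (F \o @tcons R N)) => //.
  by apply: measurableT_comp => //; exact: measurable_tcons.
  by move=> x; exact: F0.
by move=> x; apply: integral_ge0 => t _; exact: F0.
Qed.

End rn_measure.

(** * Bessel's inequality for trigonometric transforms *)

Section bms.
Context d (X : measurableType d) (R : realType) (mu : {measure set X -> \bar R}).

Definition bdm (h : X -> R) := measurable_fun setT h /\ exists B, forall x, `|h x| <= B.

(** Bounded, measurable and zero off a set of finite measure. The class is stable under sums and
    under products with [bdm] functions and its members are integrable, so the trigonometric
    computations need no separate integrability proofs. *)
Definition bms (g : X -> R) := bdm g /\
  exists D, [/\ measurable D, (mu D < +oo)%E & forall x, ~ D x -> g x = 0].

Lemma bms_integrable g : bms g -> mu.-integrable setT (EFin \o g).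
Proof.
move=> [[mg [B gB]] [D [mD Doo gD]]].
have -> : EFin \o g = (EFin \o g) \_ D.
  apply/funext => x; rewrite /patch /=; case: ifPn => //.
  by rewrite notin_setE => /gD ->.
apply/(integrable_mkcond _ mD).
apply: measurable_bounded_integrable => //.
  exact: measurable_funTS.
exists B; split; first exact: num_real.
by move=> M BM x _ /=; apply: le_trans (gB x) _; exact: ltW.
Qed.

Lemma bdmM g h : bdm g -> bdm h -> bdm (fun x => g x * h x).
Proof.
move=> [mg [B gB]] [mh [C hC]]; split; first exact: measurable_funM.
exists (B * C) => x; rewrite normrM; apply: ler_pM => //.
Qed.

Lemma bdmD g h : bdm g -> bdm h -> bdm (fun x => g x + h x).
Proof.
move=> [mg [B gB]] [mh [C hC]]; split; first exact: measurable_funD.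
by exists (B + C) => x; rewrite (le_trans (ler_normD _ _))// lerD.
Qed.

Lemma bdm_cst c : bdm (fun=> c).
Proof. by split => //; exists `|c|. Qed.

Lemma bdmZ c g : bdm g -> bdm (fun x => c * g x).
Proof. by move=> hg; apply: (bdmM (bdm_cst c) hg). Qed.

Lemma bdmN g : bdm g -> bdm (fun x => - g x).
Proof.
by move=> hg; rewrite (_ : (fun x => _) = (fun x => -1 * g x));
  [exact: bdmZ | apply/funext => x; rewrite mulN1r].
Qed.

Lemma bdmB g h : bdm g -> bdm h -> bdm (fun x => g x - h x).
Proof. by move=> hg hh; apply: bdmD => //; exact: bdmN. Qed.

Lemma bdm_sum (I : Type) (s : seq I) (g : I -> X -> R) :
  (forall i, bdm (g i)) -> bdm (fun x => \sum_(i <- s) g i x).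
Proof.
move=> hg; elim: s => [|i s IH].
  by under eq_fun do rewrite big_nil; exact: bdm_cst.
by under eq_fun do rewrite big_cons; exact: bdmD.
Qed.

Lemma bms_bdm g : bms g -> bdm g. Proof. by case. Qed.

Lemma bmsMl g h : bdm g -> bms h -> bms (fun x => g x * h x).
Proof.
move=> bg [bh [D [mD Doo hD]]]; split; first exact: bdmM.
by exists D; split => // x Dx; rewrite hD// mulr0.
Qed.

Lemma bmsMr g h : bms g -> bdm h -> bms (fun x => g x * h x).
Proof. by move=> bg bh; under eq_fun do rewrite mulrC; exact: bmsMl. Qed.

Lemma bmsZ c g : bms g -> bms (fun x => c * g x).
Proof. by move=> hg; apply: (bmsMl (bdm_cst c) hg). Qed.

Lemma bmsD g h : bms g -> bms h -> bms (fun x => g x + h x).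
Proof.
move=> [bg [D [mD Doo gD]]] [bh [E [mE Eoo hE]]]; split; first exact: bdmD.
exists (D `|` E); split; first exact: measurableU.
  by rewrite (le_lt_trans (measureU2 _ _ _))// lte_add_pinfty.
by move=> x /not_orP[Dx Ex]; rewrite gD// hE// addr0.
Qed.

Lemma bmsN g : bms g -> bms (fun x => - g x).
Proof.
by move=> hg; rewrite (_ : (fun x => _) = (fun x => -1 * g x));
  [exact: bmsZ | apply/funext => x; rewrite mulN1r].
Qed.

Lemma bmsB g h : bms g -> bms h -> bms (fun x => g x - h x).
Proof. by move=> hg hh; apply: bmsD => //; exact: bmsN. Qed.

Lemma bms0 : bms (fun=> 0).
Proof. by split; [exact: bdm_cst|exists set0; split => //; rewrite measure0]. Qed.

Lemma bms_sum (I : Type) (s : seq I) (g : I -> X -> R) :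
  (forall i, bms (g i)) -> bms (fun x => \sum_(i <- s) g i x).
Proof.
move=> hg; elim: s => [|i s IH].
  by under eq_fun do rewrite big_nil; exact: bms0.
by under eq_fun do rewrite big_cons; exact: bmsD.
Qed.

Lemma bms_RintD g h : bms g -> bms h ->
  \int[mu]_x (g x + h x) = \int[mu]_x g x + \int[mu]_x h x.
Proof. by move=> hg hh; rewrite RintegralD //; exact: bms_integrable. Qed.

Lemma bms_RintB g h : bms g -> bms h ->
  \int[mu]_x (g x - h x) = \int[mu]_x g x - \int[mu]_x h x.
Proof. by move=> hg hh; rewrite RintegralB //; exact: bms_integrable. Qed.

Lemma bms_RintZ c g : bms g ->
  \int[mu]_x (c * g x) = c * \int[mu]_x g x.
Proof. by move=> hg; rewrite RintegralZl //; exact: bms_integrable. Qed.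

Lemma Rint0 : \int[mu]_x (0 : R) = 0.
Proof. by rewrite /Rintegral integral0. Qed.

Lemma bms_Rint_sum (I : Type) (s : seq I) (g : I -> X -> R) :
  (forall i, bms (g i)) ->
  \int[mu]_x (\sum_(i <- s) g i x) = \sum_(i <- s) \int[mu]_x g i x.
Proof.
move=> hg; elim: s => [|i s IH].
  by under eq_Rintegral do rewrite big_nil; rewrite big_nil Rint0.
under eq_Rintegral do rewrite big_cons.
by rewrite bms_RintD //; [rewrite big_cons IH|exact: bms_sum].
Qed.

Lemma bms_EFin g : bms g -> (\int[mu]_x (g x)%:E)%E = (\int[mu]_x g x)%:E.
Proof.
move=> hg; rewrite /Rintegral fineK//; apply: integrable_fin_num => //.
exact: bms_integrable.
Qed.

End bms.

(** The positive and negative parts have measurable integrals in the parameter by Tonelli, and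
    [fine] is measurable. Integrability is not assumed, [Rintegral] having a default value. *)
Lemma measurable_Rint_param d1 d2 (X : measurableType d1) (Y : measurableType d2)
  (R : realType) (m : {sigma_finite_measure set Y -> \bar R}) (F : X * Y -> R) :
  measurable_fun setT F -> measurable_fun setT (fun x => \int[m]_y F (x, y)).
Proof.
move=> mF; rewrite /Rintegral.
have mE : measurable_fun setT (EFin \o F) by exact/measurable_EFinP.
apply: (measurableT_comp (fine_measurable _)) => //=.
under eq_fun do rewrite integralE.
apply: emeasurable_funB.
  have -> : (fun x => \int[m]_y (fun y0 => (F (x, y0))%:E)^\+ y)%E = fubini_F m (EFin \o F)^\+%E.
    by apply/funext => x; apply: eq_integral => y _; rewrite !funeposE.
  apply: measurable_fun_fubini_tonelli_F => //.
  exact: measurable_funepos.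
have -> : (fun x => \int[m]_y (fun y0 => (F (x, y0))%:E)^\- y)%E = fubini_F m (EFin \o F)^\-%E.
    by apply/funext => x; apply: eq_integral => y _; rewrite !funenegE.
apply: measurable_fun_fubini_tonelli_F => //.
exact: measurable_funeneg.
Qed.

Lemma derivable_cvg (R : realType) (F : R -> R) x : derivable F x 1 ->
  F y @[y --> x] --> F x.
Proof. by move=> /derivable1_diffP/differentiable_continuous. Qed.

Section trig1.
Context (R : realType).
Local Notation T := (measurableTypeR R).
Local Notation leb1 := (@lebesgue_measure R).

(** The tag selects the cosine ([true]) or the sine ([false]); [Ctr], [tr] and [half_tr] use the
    same convention. *)
Definition ct (b : bool) (x : R) := if b then cos x else sin x.

Lemma ct_le1 b x : `|ct b x| <= 1.
Proof.
by case: b; rewrite /ct ler_norml ?cos_geN1 ?cos_le1 ?sin_geN1 ?sin_le1.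
Qed.

Lemma ct_continuous b : continuous (ct b).
Proof. by case: b; [exact: continuous_cos|exact: continuous_sin]. Qed.

Lemma ct_measurable b : measurable_fun setT (ct b : T -> T).
Proof. by apply: continuous_measurable_fun; exact: ct_continuous. Qed.

Lemma bdm_ct d (X : measurableType d) b (h : X -> R) :
  measurable_fun setT h -> bdm (fun x => ct b (h x)).
Proof.
move=> mh; split; last by exists 1 => x; exact: ct_le1.
apply: (measurableT_comp (ct_measurable b)); exact: mh.
Qed.

Lemma sin_natpi (m : nat) : sin (m%:R * pi) = 0 :> R.
Proof.
elim: m => [|m IH]; first by rewrite mul0r sin0.
by rewrite -natr1 mulrDl mul1r sinDpi IH oppr0.
Qed.

Variable L : R.
Hypothesis L0 : 0 < L.

Definition ind (x : T) : R := \1_(`[- L, L]%classic : set R) x.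

Lemma bms_ind : bms leb1 ind.
Proof.
split.
  split; first by apply: measurable_indic; exact: measurable_itv.
  by exists 1 => x; rewrite /ind indicE; case: (_ \in _); rewrite ?normr1 ?normr0.
exists [set` `[- L, L]]; split; first exact: measurable_itv.
  apply: (eq_ind_r (fun z => z < +oo)%E _ (lebesgue_measure_itv `[- L, L])) => /=.
  by case: ifP => // _; rewrite -EFinB ltry.
by move=> x nx; rewrite /ind indicE memNset.
Qed.

Lemma Rint_ind (h : R -> R) : \int[leb1]_x (ind x * h x) = \int[leb1]_(x in `[- L, L]) h x.
Proof.
rewrite [RHS]Rintegral_mkcond; apply: eq_Rintegral => x _.
rewrite /ind /patch indicE; case: (_ \in _); by rewrite ?mul1r ?mul0r.
Qed.

Lemma Rint_sin (c : R) : \int[leb1]_x (ind x * sin (c * x)) = 0.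
Proof.
rewrite Rint_ind /Rintegral.
have [->|c0] := eqVneq c 0.
  by under eq_integral do rewrite mul0r sin0; rewrite integral0.
have NLL : - L < L by rewrite gtrN.
rewrite (continuous_FTC2 (F := fun x => - (c^-1 * cos (c * x))) NLL).
- by rewrite mulrN cosN subee.
- apply: continuous_subspaceT => x; apply: continuous_comp.
    by apply: cvgM; [exact: cvg_cst|exact: cvg_id].
  exact: continuous_sin.
- have D x : derivable (fun x : R => - (c^-1 * cos (c * x))) x 1 by [].
  split.
  + by move=> x _; exact: D.
  + apply: cvg_at_right_filter; exact: (derivable_cvg (D _)).
  + apply: cvg_at_left_filter; exact: (derivable_cvg (D _)).
- move=> x _; rewrite derive1E derive_val /GRing.scale /=; field; exact: c0.
Qed.

Lemma Rint_cos (m n : nat) : m != n ->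
  \int[leb1]_x (ind x * cos ((m%:R - n%:R) * (pi / L) * x)) = 0.
Proof.
move=> mn; rewrite Rint_ind /Rintegral.
set c := (_ * (pi / L)).
have mn0 : m%:R - n%:R != 0 :> R by rewrite subr_eq0 eqr_nat.
have c0 : c != 0.
  rewrite /c; apply: mulf_neq0 => //; apply: mulf_neq0; last by rewrite invr_neq0// gt_eqF.
  by rewrite gt_eqF// pi_gt0.
have NLL : - L < L by rewrite gtrN.
have sL : sin (c * L) = 0.
  have -> : c * L = m%:R * pi - n%:R * pi by rewrite /c; field; rewrite gt_eqF.
  by rewrite sinB !sin_natpi mul0r mulr0 subrr.
rewrite (continuous_FTC2 (F := fun x => c^-1 * sin (c * x)) NLL).
- by rewrite mulrN sinN sL oppr0 mulr0 subee.
- apply: continuous_subspaceT => x; apply: continuous_comp.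
    by apply: cvgM; [exact: cvg_cst|exact: cvg_id].
  exact: continuous_cos.
- have D x : derivable (fun x : R => c^-1 * sin (c * x)) x 1 by [].
  split.
  + by move=> x _; exact: D.
  + apply: cvg_at_right_filter; exact: (derivable_cvg (D _)).
  + apply: cvg_at_left_filter; exact: (derivable_cvg (D _)).
- move=> x _; rewrite derive1E derive_val /GRing.scale /=; field; exact: c0.
Qed.


Definition Ctr (b : bool) (g : T -> R) (y : R) := \int[leb1]_x (ct b (y * x) * g x).

(** Let [c_k] be the coefficient of [g] at the frequency [y_k = y + k pi/L], and expand the
    nonnegative integral over [[-L, L]] of [|2L g - sum_k c_k e^{i y_k x}|^2]. The exponentials are
    orthogonal there with squared norm [2L], so the result is [2L (2L ||g||^2 - sum_k |c_k|^2)]. *)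
Lemma bessel1_sum (g : T -> R) (y : R) (n : nat) :
  bms leb1 g -> (forall x, ~ `[- L, L]%classic x -> g x = 0) ->
  \sum_(k < n) (Ctr true g (y + k%:R * (pi / L)) ^+ 2 +
                Ctr false g (y + k%:R * (pi / L)) ^+ 2) <=
  2 * L * \int[leb1]_x (g x ^+ 2).
Proof.
move=> bg gL.
pose yy (k : 'I_n) := y + k%:R * (pi / L).
pose C b k := Ctr b g (yy k).
(* [P] and [Q] are the real and imaginary parts of [sum_k c_k e^{i y_k x}], where
   [c_k = C true k - i C false k]. *)
pose P (x : T) := \sum_k (C true k * ct true (yy k * x) + C false k * ct false (yy k * x)).
pose Q (x : T) := \sum_k (C true k * ct false (yy k * x) - C false k * ct true (yy k * x)).
set B := \sum_(k < n) _.
have bc b k : bdm (fun x : T => ct b (yy k * x)) by apply: bdm_ct; exact: measurable_funM.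
have bP : bdm P by apply: bdm_sum => k; apply: bdmD; exact: bdmZ.
have bQ : bdm Q by apply: bdm_sum => k; apply: bdmB; exact: bdmZ.
have bi := bms_ind.
have EB : \int[leb1]_x (P x * g x) = B.
  under eq_Rintegral do rewrite /P mulr_suml.
  rewrite bms_Rint_sum; last first.
    by move=> k; apply: bmsMl => //; apply: bdmD; exact: bdmZ.
  apply: eq_bigr => k _.
  under eq_Rintegral do rewrite mulrDl -!mulrA.
  rewrite bms_RintD; [|by apply: bmsZ; exact: bmsMl..].
  by rewrite !bms_RintZ; [rewrite -!expr2|exact: bmsMl..].
have EPQ : \int[leb1]_x (ind x * (P x ^+ 2 + Q x ^+ 2)) = 2 * L * B.
  pose c1 j k := C true j * C true k + C false j * C false k.
  pose c2 j k := C false j * C true k - C true j * C false k.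
  have E x : ind x * (P x ^+ 2 + Q x ^+ 2) = \sum_j \sum_k
     (c1 j k * (ind x * cos ((j%:R - k%:R) * (pi / L) * x)) +
      c2 j k * (ind x * sin ((j%:R - k%:R) * (pi / L) * x))).
    rewrite !expr2 /P /Q !big_distrlr /= -big_split mulr_sumr; apply: eq_bigr => j _.
    rewrite -big_split mulr_sumr; apply: eq_bigr => k _ /=.
    have -> : (j%:R - k%:R) * (pi / L) * x = yy j * x - yy k * x by rewrite /yy; ring.
    rewrite cosB sinB /c1 /c2; ring.
  under eq_Rintegral do rewrite E.
  have bb j k : bms leb1 (fun x => c1 j k * (ind x * cos ((j%:R - k%:R) * (pi / L) * x))).
    apply: bmsZ; apply: bmsMr => //; apply: (bdm_ct true); exact: measurable_funM.
  have bb' j k : bms leb1 (fun x => c2 j k * (ind x * sin ((j%:R - k%:R) * (pi / L) * x))).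
    apply: bmsZ; apply: bmsMr => //; apply: (bdm_ct false); exact: measurable_funM.
  rewrite bms_Rint_sum; last by move=> j; apply: bms_sum => k; exact: bmsD.
  rewrite mulr_sumr; apply: eq_bigr => j _.
  rewrite bms_Rint_sum; last by move=> k; exact: bmsD.
  rewrite (bigD1 j) //= big1 ?addr0; last first.
    move=> k kj; rewrite bms_RintD //.
    rewrite bms_RintZ; last by apply: bmsMr => //; apply: (bdm_ct true); exact: measurable_funM.
    rewrite bms_RintZ; last by apply: bmsMr => //; apply: (bdm_ct false); exact: measurable_funM.
    by rewrite Rint_sin Rint_cos ?mulr0 ?addr0// eq_sym.
  rewrite bms_RintD //.
  rewrite bms_RintZ; last by apply: bmsMr => //; apply: (bdm_ct true); exact: measurable_funM.
  rewrite bms_RintZ; last by apply: bmsMr => //; apply: (bdm_ct false); exact: measurable_funM.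
  rewrite Rint_sin mulr0 addr0.
  under eq_Rintegral do rewrite subrr !mul0r cos0.
  have -> : \int[leb1]_x (ind x * 1) = 2 * L.
    rewrite Rint_ind (@Rintegral_cst _ _ _ leb1 _ (measurable_itv `[- L, L]) 1) mul1r.
    apply: (eq_ind_r (fun z => fine z = 2 * L) _ (lebesgue_measure_itv `[- L, L])).
    rewrite /= lte_fin gtrN// -EFinB /=; ring.
  rewrite /c1 /C; ring.
have bg2 : bms leb1 (fun x => g x ^+ 2).
  by apply: bmsMr => //; exact: bms_bdm bg.
have : 0 <= \int[leb1]_x ((2 * L * g x - ind x * P x) ^+ 2 + (ind x * Q x) ^+ 2).
  by apply: Rintegral_ge0 => x _; apply: addr_ge0; exact: sqr_ge0.
have E x : (2 * L * g x - ind x * P x) ^+ 2 + (ind x * Q x) ^+ 2 =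
   (4 * L ^+ 2) * (g x ^+ 2) - (4 * L) * (P x * g x) + ind x * (P x ^+ 2 + Q x ^+ 2).
  have [xI|xI] := pselect (`[- L, L]%classic x).
    rewrite /ind indicE mem_set //=; ring.
  rewrite gL// /ind indicE memNset //=; ring.
under eq_Rintegral do rewrite E.
rewrite bms_RintD; last 2 first.
- apply: bmsB; apply: bmsZ => //; exact: bmsMl.
- by apply: bmsMr => //; apply: bdmD; exact: bdmM.
rewrite bms_RintB; last 2 first.
- exact: bmsZ.
- by apply: bmsZ; exact: bmsMl.
rewrite !bms_RintZ ?EB ?EPQ //; last exact: bmsMl.
move=> H; have : 0 <= 2 * L * (2 * L * \int[leb1]_x g x ^+ 2 - B) by lra.
by rewrite pmulr_rge0 ?mulr_gt0// subr_ge0.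
Qed.


Lemma measurable_Ctr b (g : T -> R) : measurable_fun setT g ->
  measurable_fun setT (Ctr b g : T -> T).
Proof.
move=> mg.
apply: (@measurable_Rint_param _ _ T T R leb1 (fun p : T * T => ct b (p.1 * p.2) * g p.2)).
apply: measurable_funM; last by apply: measurableT_comp.
apply: (measurableT_comp (ct_measurable b)); exact: measurable_funM.
Qed.

Lemma integral_itv_shift (c l : R) (h : T -> \bar R) :
  measurable_fun setT h -> (forall x, 0 <= h x)%E ->
  (\int[leb1]_(x in `[c, (c + l)%R[) h x = \int[leb1]_(x in `[0%R, l[) h (x + c)%R)%E.
Proof.
move=> mh h0; rewrite integral_mkcond [RHS]integral_mkcond.
rewrite -(ge0_integral_shift c); last 2 first.
- apply/(measurable_restrict _ (measurable_itv _)) => //.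
  by rewrite setTI; exact: measurable_funTS.
- by move=> x; rewrite /patch; case: ifP.
apply: eq_integral => x _; rewrite /patch !mem_setE.
have -> : (x + c \in `[c, c + l[) = (x \in `[0, l[).
  by rewrite !in_itv /= lerDr [X in _ < X]addrC ltrD2r.
by [].
Qed.

(** Folding [n] consecutive intervals of length [l] onto [[0, l[] turns the integral into that of a
    sum of translates, to which the pointwise bound applies. *)
Lemma integral_itv_sum (c l A : R) (n : nat) (h : T -> R) : 0 < l ->
  measurable_fun setT h -> (forall x, 0 <= h x) ->
  (forall x, \sum_(k < n) h (x + c + k%:R * l) <= A) ->
  (\int[leb1]_(x in `[c, (c + n%:R * l)%R[) (h x)%:E <= (l * A)%:E)%E.
Proof.
move=> l0 mh h0 hA.
have ms k : measurable_fun setT (fun x : T => h (x + c + k%:R * l) : T).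
  by apply: measurableT_comp => //; apply: measurable_funD => //; exact: measurable_funD.
have mS n' : measurable_fun setT (fun x : T => (\sum_(k < n') h (x + c + k%:R * l))%:E).
  by apply/measurable_EFinP; apply: measurable_sum => k; exact: ms.
have -> : (\int[leb1]_(x in `[c, (c + n%:R * l)%R[) (h x)%:E =
   \int[leb1]_(x in `[0%R, l[) (\sum_(k < n) h (x + c + k%:R * l)%R)%:E)%E.
  elim: n {hA} => [|n IH].
    rewrite mul0r addr0 set_itvco0 integral_set0.
    by rewrite integral0_eq// => x _; rewrite big_ord0.
  have -> : `[c, c + n.+1%:R * l[%classic = `[c, c + n%:R * l[%classic `|`
      `[c + n%:R * l, (c + n%:R * l) + l[%classic.
    rewrite -natr1 mulrDl mul1r addrA.
    by rewrite -itv_bndbnd_setU // bnd_simp ?lerDl ?mulr_ge0// ?ltW.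
  have H1 : measurable_fun (`[c, c + n%:R * l[%classic `|`
      `[c + n%:R * l, (c + n%:R * l) + l[%classic) (fun x : T => (h x)%:E).
    by apply: measurable_funTS; exact/measurable_EFinP.
  have H2 : [disjoint `[c, c + n%:R * l[%classic &
      `[c + n%:R * l, (c + n%:R * l) + l[%classic].
    apply/disj_setPS => x /=; rewrite !in_itv /= => -[/andP[_ h1] /andP[h2 _]].
    by move: (lt_le_trans h1 h2); rewrite ltxx.
  rewrite (ge0_integral_setU leb1 (measurable_itv _) (measurable_itv _) H1 _ H2); last first.
    by move=> x _; rewrite lee_fin.
  rewrite IH integral_itv_shift; [|exact/measurable_EFinP|by move=> x; rewrite lee_fin].
  have m1 : measurable_fun `[0, l[%classic (fun x : T => (h (x + (c + n%:R * l)))%:E).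
    apply: measurable_funTS; apply/measurable_EFinP; apply: measurableT_comp => //.
    exact: measurable_funD.
  rewrite -(ge0_integralD leb1 (measurable_itv _) _ (measurable_funTS (mS n)) _ m1); last 2 first.
  - by move=> x _; rewrite lee_fin; apply: sumr_ge0.
  - by move=> x _; rewrite lee_fin.
  by apply: eq_integral => x _; rewrite big_ord_recr /= EFinD addrA.
apply: (@le_trans _ _ (\int[leb1]_(x in `[0%R, l[) (cst A%:E) x)%E).
  apply: ge0_le_integral => //.
  - by move=> x _; rewrite lee_fin; apply: sumr_ge0.
  - exact: measurable_funTS.
  - by move=> x _; rewrite lee_fin.
rewrite integral_cst; last exact: measurable_itv.
apply: (eq_ind_r (fun z => A%:E * z <= (l * A)%:E)%E _ (lebesgue_measure_itv `[0, l[)).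
by rewrite /= lte_fin l0 -EFinB subr0 -EFinM mulrC.
Qed.

(* Cut the frequency line into translates of [0, pi/L[: for each y the frequencies y + k pi/L
   belong to a trigonometric system that is orthogonal on [-L, L]. *)
Lemma bessel1 (g : T -> R) :
  bms leb1 g -> (forall x, ~ `[- L, L]%classic x -> g x = 0) ->
  (\int[leb1]_y (Ctr true g y ^+ 2 + Ctr false g y ^+ 2)%:E <=
    (2 * pi * \int[leb1]_x (g x ^+ 2))%:E)%E.
Proof.
move=> bg gL.
pose h (y : T) : T := Ctr true g y ^+ 2 + Ctr false g y ^+ 2.
have mg : measurable_fun setT g by case: bg => -[].
have mh : measurable_fun setT h.
  by apply: measurable_funD; apply: measurable_funX; exact: measurable_Ctr.
have h0 y : 0 <= h y by apply: addr_ge0; exact: sqr_ge0.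
pose l := pi / L.
have l0 : 0 < l by rewrite divr_gt0// pi_gt0.
pose F (m : nat) : set T := `[- (m%:R * l), - (m%:R * l) + (2 * m)%:R * l[%classic.
have FE m : F m = `[- (m%:R * l), m%:R * l[%classic.
  by rewrite /F; rewrite (_ : - (m%:R * l) + (2 * m)%:R * l = m%:R * l)// natrM; ring.
have FT : \bigcup_m F m = setT.
  apply/seteqP; split => // x _.
  pose m := (Num.truncn (`|x| / l)).+1.
  have : `|x| < m%:R * l by rewrite -ltr_pdivrMr// /m truncnS_gt.
  rewrite ltr_norml => /andP[x1 x2].
  by exists m => //; rewrite FE /= in_itv /= x2 ltW.
have := @ge0_nondecreasing_set_cvg_integral _ _ _ F (EFin \o h) leb1.
rewrite FT => /(_ _ _ _ _)/cvg_lim <- //.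
- apply: lime_le.
    apply: ereal_nondecreasing_is_cvgn => m n mn.
    apply: ge0_subset_integral => //.
    + exact: measurable_itv.
    + exact: measurable_itv.
    + by apply: measurable_funTS; exact/measurable_EFinP.
    + by move=> x _; rewrite lee_fin.
    rewrite !FE; apply: subset_itv; rewrite bnd_simp ?lerN2 ler_pM2r// ler_nat//.
  apply: nearW => m.
  (* [l * (2 * L)] is [2 * pi]: the half-width of the support cancels, and the constant is the same
     for all supports. *)
  have -> : 2 * pi * \int[leb1]_x g x ^+ 2 = l * (2 * L * \int[leb1]_x g x ^+ 2).
    by rewrite /l; field; rewrite gt_eqF.
  apply: integral_itv_sum => // x; exact: bessel1_sum.
- move=> m n mn; apply/subsetPset; rewrite !FE; apply: subset_itv; rewrite bnd_simp ?lerN2 ler_pM2r// ler_nat//.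
- by move=> m; exact: measurable_itv.
- by move=> m; apply: measurable_funTS; exact/measurable_EFinP.
- by move=> m x _; rewrite lee_fin.
Qed.

End trig1.

(** * Cosine and sine transforms in several variables *)

Section tuple_transform.
Context (R : realType).
Local Notation T := (measurableTypeR R).
Local Notation leb1 := (@lebesgue_measure R).

(** The support is bounded coordinate by coordinate, a condition that the slices [g (tcons (x, t))]
    inherit in the induction on the dimension. *)
Definition bbs N (g : N.-tuple T -> R) := bdm g /\
  exists2 L : R, 0 < L & forall x, (exists i, L < `|tnth x i|) -> g x = 0.

Definition tdot N (x y : N.-tuple T) : R := edot (rvec x) (rvec y).

Lemma tdot_sum N (x y : N.-tuple T) : tdot x y = \sum_i tnth x i * tnth y i.
Proof. by apply: eq_bigr => i _; rewrite !mxE. Qed.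

Lemma tdot_cons N (a b : T) (x y : N.-tuple T) :
  tdot (tcons (a, x)) (tcons (b, y)) = a * b + tdot x y.
Proof.
rewrite !tdot_sum big_ord_recl; congr (_ + _); apply: eq_bigr => i _.
by rewrite !tnthS.
Qed.

Lemma measurable_tdot d (X : measurableType d) N (f g : X -> N.-tuple T) :
  measurable_fun setT f -> measurable_fun setT g ->
  measurable_fun setT (fun x => tdot (f x) (g x) : T).
Proof.
move=> mf mg; under eq_fun do rewrite tdot_sum.
apply: measurable_sum => i; apply: measurable_funM.
  by apply: (measurableT_comp (measurable_tnth i)).
by apply: (measurableT_comp (measurable_tnth i)).
Qed.

Definition tr (b : bool) N (g : N.-tuple T -> R) (y : N.-tuple T) : R :=
  \int[leb R N]_x (ct b (tdot x y) * g x).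

(** The half-width is [L + 1] and not [L], so that this half-open cube contains the closed cube off
    which a [bbs] function vanishes; its shape is that of [lebN_box]. *)
Definition tbox N (L : R) : set (N.-tuple T) :=
  [set t | forall i, tnth t i \in `[- (L + 1), - (L + 1) + (2 * (L + 1))[].

Lemma measurable_tbox N L : measurable (@tbox N L).
Proof.
rewrite (_ : @tbox N L = \bigcap_(i in [set: 'I_N]) ((fun t : N.-tuple T => tnth t i) @^-1` `[- (L + 1), - (L + 1) + 2 * (L + 1)[%classic)); last first.
  apply/seteqP; split=> t /=; first by move=> H i _; exact: H.
  by move=> H i; exact: H.
apply: fin_bigcap_measurable => // i _.
rewrite -[X in measurable X]setTI; exact: measurable_tnth.
Qed.

Lemma leb_tbox N L : 0 < L -> leb R N (@tbox N L) = ((2 * (L + 1)) ^+ N)%:E.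
Proof. by move=> L0; rewrite /tbox (lebN_box (fun=> - (L + 1)))//; lra. Qed.

Lemma ntbox N L (x : N.-tuple T) : ~ tbox L x -> exists i, L < `|tnth x i|.
Proof.
move=> /existsNP[i xi]; exists i; rewrite ltNge; apply/negP => H; apply: xi.
move: H; rewrite in_itv /= ler_norml => /andP[h1 h2]; apply/andP; split; lra.
Qed.

Lemma bbs_bms N (g : N.-tuple T -> R) : bbs g -> bms (leb R N) g.
Proof.
move=> [bg [L L0 gL]]; split => //.
exists (tbox L); split; first exact: measurable_tbox.
  by apply: (eq_ind_r (fun z => z < +oo)%E _ (leb_tbox N L0)); rewrite ltry.
by move=> x /ntbox; exact: gL.
Qed.

Lemma Rint_bound N (g : N.-tuple T -> R) (B L : R) : measurable_fun setT g ->
  0 < L -> (forall x, `|g x| <= B) -> (forall x, (exists i, L < `|tnth x i|) -> g x = 0) ->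
  `|\int[leb R N]_x g x| <= B * (2 * (L + 1)) ^+ N.
Proof.
move=> mg L0 gB gL.
have bg : bbs g by split; [split => //; exists B|exists L].
apply: (le_trans (le_normr_Rintegral _ (bms_integrable (bbs_bms bg)))) => //.
have B0 : 0 <= B by apply: le_trans (gB [tuple of nseq N 0]).
have <- : \int[leb R N]_(x in tbox L) (cst B x) = B * (2 * (L + 1)) ^+ N.
  rewrite (@Rintegral_cst _ _ _ (leb R N) _ (@measurable_tbox N L) B); congr (_ * _).
  exact: (congr1 fine (leb_tbox N L0)).
rewrite [leRHS]Rintegral_mkcond; apply: le_Rintegral => //.
- exact/integrable_norm/bms_integrable/bbs_bms.
- apply: bms_integrable; split; [split|exists (tbox L); split].
  + apply/(measurable_restrict _ (@measurable_tbox N L)) => //.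
  + by exists B => x; rewrite /patch; case: ifP => _; rewrite ?normr0 ?ger0_norm.
  + exact: measurable_tbox.
  + by apply: (eq_ind_r (fun z => z < +oo)%E _ (leb_tbox N L0)); rewrite ltry.
  + by move=> x nx; rewrite /patch memNset.
- move=> x _; rewrite /patch; case: ifPn => //=.
  by rewrite notin_setE => /ntbox/gL ->; rewrite normr0.
Qed.

Lemma bbs_cons N (g : N.+1.-tuple T -> R) (a : T) : bbs g -> bbs (fun t => g (tcons (a, t))).
Proof.
move=> [[mg [B gB]] [L L0 gL]]; split; [split|].
- apply: (measurableT_comp mg); apply: (measurableT_comp (measurable_tcons (N:=N))).
  exact: measurable_pair1.
- by exists B => x; exact: gB.
- by exists L => // x [i xi]; apply: gL; exists (lift ord0 i); rewrite tnthS.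
Qed.

Lemma bbsMl N (h g : N.-tuple T -> R) : bdm h -> bbs g -> bbs (fun x => h x * g x).
Proof.
move=> bh [bg [L L0 gL]]; split; first exact: bdmM.
by exists L => // x /gL ->; rewrite mulr0.
Qed.

Lemma bdm_cttdot b N (y : N.-tuple T) : bdm (fun x : N.-tuple T => ct b (tdot x y)).
Proof. by apply: bdm_ct; apply: measurable_tdot. Qed.

Lemma bms_tr b N (g : N.-tuple T -> R) y : bbs g -> bms (leb R N) (fun x => ct b (tdot x y) * g x).
Proof. by move=> bg; apply: bmsMl; [exact: bdm_cttdot|exact: bbs_bms]. Qed.

Lemma measurable_tr_param d (X : measurableType d) b N (g : X * N.-tuple T -> R)
    (h : X -> N.-tuple T) :
  measurable_fun setT g -> measurable_fun setT h ->
  measurable_fun setT (fun x => tr b (fun t => g (x, t)) (h x) : T).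
Proof.
move=> mg mh.
apply: (@measurable_Rint_param _ _ X (N.-tuple T) R (leb R N)
  (fun p : X * N.-tuple T => ct b (tdot p.2 (h p.1)) * g p)).
apply: measurable_funM => //.
apply: (measurableT_comp (ct_measurable b)).
by apply: measurable_tdot => //; exact: measurableT_comp.
Qed.

Lemma measurable_tr b N (g : N.-tuple T -> R) : measurable_fun setT g ->
  measurable_fun setT (tr b g : N.-tuple T -> T).
Proof.
move=> mg; apply: (measurable_tr_param b (g := fun p : N.-tuple T * N.-tuple T => g p.2) (h := id)) => //.
exact: measurableT_comp.
Qed.

Lemma bms_Rint_cons N (g : N.+1.-tuple T -> R) : bbs g ->
  bms leb1 (fun x => \int[leb R N]_t g (tcons (x, t))).
Proof.
move=> [[mg [B gB]] [L L0 gL]].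
have B0 : 0 <= B by apply: le_trans (gB [tuple of nseq _ 0]).
split; [split|].
- apply: (@measurable_Rint_param _ _ T (N.-tuple T) R (leb R N) (g \o @tcons R N)).
  by apply: measurableT_comp => //; exact: measurable_tcons.
- exists (B * (2 * (L + 1)) ^+ N) => x; apply: Rint_bound => //.
  + apply: (measurableT_comp mg); apply: (measurableT_comp (measurable_tcons (N:=N))).
    exact: measurable_pair1.
  + by move=> t [i ti]; apply: gL; exists (lift ord0 i); rewrite tnthS.
- exists `[- L, L]%classic; split; first exact: measurable_itv.
    apply: (eq_ind_r (fun z => z < +oo)%E _ (lebesgue_measure_itv `[- L, L])) => /=.
    by case: ifP => // _; rewrite -EFinB ltry.
  move=> x xL; under eq_Rintegral => t _.
    rewrite gL; first over.
    exists ord0; rewrite /tnth /= ltNge; apply/negP => H; apply: xL.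
    by rewrite /= in_itv /= -ler_norml.
  exact: Rint0.
Qed.

Lemma ge0_Rint_lebS N (g : N.+1.-tuple T -> R) : bbs g -> (forall x, 0 <= g x) ->
  \int[leb R N.+1]_t g t = \int[leb1]_x \int[leb R N]_t g (tcons (x, t)).
Proof.
move=> bg g0; rewrite [LHS]/Rintegral ge0_integral_lebS.
- congr fine; apply: eq_integral => x _; rewrite bms_EFin//.
  exact/bbs_bms/bbs_cons.
- by apply/measurable_EFinP; case: bg => -[].
- by move=> t; rewrite lee_fin.
Qed.

Lemma bbs_max0 N (g : N.-tuple T -> R) : bbs g -> bbs (fun x => Num.max (g x) 0).
Proof.
move=> [[mg [B gB]] [L L0 gL]]; split; [split|].
- exact: measurable_maxr.
- exists B => x; apply: le_trans (gB x).
  by case: (leP (g x) 0) => [|_]; rewrite ?normr0.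
- by exists L => // x /gL ->; rewrite maxxx.
Qed.

Lemma bbsN N (g : N.-tuple T -> R) : bbs g -> bbs (fun x => - g x).
Proof.
move=> [bg [L L0 gL]]; split; first exact: bdmN.
by exists L => // x /gL ->; rewrite oppr0.
Qed.

(** Tonelli for the positive and the negative part; [bbs] makes every integral finite, so the two
    can be subtracted. *)
Lemma Rint_lebS N (g : N.+1.-tuple T -> R) : bbs g ->
  \int[leb R N.+1]_t g t = \int[leb1]_x \int[leb R N]_t g (tcons (x, t)).
Proof.
move=> bg; have bp := bbs_max0 bg; have bn := bbs_max0 (bbsN bg).
have E x : g x = Num.max (g x) 0 - Num.max (- g x) 0.
  by case: (leP (g x) 0); case: (leP (- g x) 0) => /=; lra.
under [LHS]eq_Rintegral do rewrite E.
rewrite bms_RintB; [|exact: bbs_bms..].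
rewrite !ge0_Rint_lebS //; last 2 first.
- by move=> x; rewrite le_max lexx orbT.
- by move=> x; rewrite le_max lexx orbT.
rewrite -(bms_RintB (bms_Rint_cons bp) (bms_Rint_cons bn)).
apply: eq_Rintegral => x _; rewrite -bms_RintB.
- by apply: eq_Rintegral => t _; rewrite -E.
- exact: (bbs_bms (bbs_cons x bp)).
- exact: (bbs_bms (bbs_cons x bn)).
Qed.

Lemma tr_bound b N (g : N.-tuple T -> R) B L : measurable_fun setT g ->
  0 < L -> (forall x, `|g x| <= B) -> (forall x, (exists i, L < `|tnth x i|) -> g x = 0) ->
  forall y, `|tr b g y| <= B * (2 * (L + 1)) ^+ N.
Proof.
move=> mg L0 gB gL y; apply: Rint_bound => //.
- apply: measurable_funM => //; exact: (bdm_cttdot b y).1.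
- move=> x; rewrite normrM -[leRHS]mul1r; apply: ler_pM => //; exact: ct_le1.
- by move=> x /gL ->; rewrite mulr0.
Qed.

(** The phase is the sum of [a x_0] and of the phase in the remaining variables; the addition
    formulas and Fubini give a one-dimensional transform of the partial transforms [G]. *)
Lemma tr_cons b N (g : N.+1.-tuple T -> R) (a : T) (y : N.-tuple T) : bbs g ->
  let G c x := tr c (fun t => g (tcons (x, t))) y in
  tr b g (tcons (a, y)) =
  if b then Ctr true (G true) a - Ctr false (G false) a
  else Ctr false (G true) a + Ctr true (G false) a.
Proof.
move=> bg G.
have bG c c' : bbs (fun x : N.+1.-tuple T => ct c (a * thead x) *
    (ct c' (tdot [tuple of behead x] y) * g x)).
  apply: bbsMl.
    by apply: bdm_ct; apply: measurable_funM => //; exact: measurable_tnth.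
  apply: bbsMl => //; apply: bdm_ct; apply: measurable_tdot => //.
  exact: measurable_behead.
have tK (x : T) (t : N.-tuple T) : [tuple of behead (tcons (x, t))] = t by exact: val_inj.
have E c c' : \int[leb R N.+1]_x (ct c (a * thead x) *
    (ct c' (tdot [tuple of behead x] y) * g x)) = Ctr c (G c') a.
  rewrite Rint_lebS// /Ctr; apply: eq_Rintegral => x _.
  rewrite -bms_RintZ; last by apply: bms_tr; exact: bbs_cons.
  by apply: eq_Rintegral => t _; rewrite theadE tK.
have et (x : N.+1.-tuple T) : tdot x (tcons (a, y)) = a * thead x + tdot [tuple of behead x] y.
  by rewrite {1}(tuple_eta x) (_ : [tuple of _ :: _] = tcons (thead x, [tuple of behead x]))// tdot_cons mulrC.
rewrite /tr; under eq_Rintegral do rewrite et.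
case: b => /=; [under eq_Rintegral do rewrite cosD|under eq_Rintegral do rewrite sinD].
- rewrite -!E -bms_RintB; [|exact/bbs_bms/bG..].
  by apply: eq_Rintegral => x _; rewrite /ct mulrBl !mulrA.
- rewrite -!E -bms_RintD; [|exact/bbs_bms/bG..].
  by apply: eq_Rintegral => x _; rewrite /ct mulrDl !mulrA.
Qed.

(** Induction on the dimension: by [tr_cons] the squared transform is at most twice the sum of the
    four squared one-dimensional transforms of [G true] and [G false]. Then [bessel1] applies in the
    new frequency and the induction hypothesis on slices. The factor [8 pi] is 2 from squaring a
    sum, [2 pi] from [bessel1] and 2 from the two values of the tag. [C] depends on [N] alone. *)
Lemma bessel N : exists2 C : R, 0 <= C & forall b (g : N.-tuple T -> R), bbs g ->
  (\int[leb R N]_y (tr b g y ^+ 2)%:E <= C%:E * \int[leb R N]_x (g x ^+ 2)%:E)%E.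
Proof.
elim: N => [|N [C C0 IH]].
  (* [leb R 0] is the Dirac mass at the empty tuple, so the transform multiplies [g] by a number of
     modulus at most 1. *)
  exists 1 => // b g bg; rewrite mul1e.
  have D0 (h : 0.-tuple T -> R) : measurable_fun setT h ->
      (\int[leb R 0]_y (h y)%:E = (h [tuple])%:E)%E.
    move=> mh; have := @integral_dirac _ _ ([tuple] : 0.-tuple T) R setT measurableT (EFin \o h).
    move=> /(_ ltac:(exact/measurable_EFinP)) /= ->.
    by rewrite diracT mul1e.
  have mg : measurable_fun setT g by case: bg => -[].
  rewrite !D0; [|exact: measurable_funX|by apply: measurable_funX; exact: measurable_tr].
  rewrite lee_fin /tr /Rintegral D0 /=; last first.
    by apply: measurable_funM => //; exact: (bdm_cttdot b [tuple]).1.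
  rewrite exprMn -[leRHS]mul1r ler_wpM2r ?sqr_ge0// -[leRHS](expr1n _ 2).
  by have := ct_le1 b (tdot [tuple] [tuple]); rewrite ler_norml => /andP[? ?]; nra.
have pi0 : 0 <= pi :> R by exact: pi_ge0.
exists (8 * pi * C); first by rewrite !mulr_ge0.
move=> b g bg.
have mg : measurable_fun setT g by case: bg => -[].
have [_ [L L0 gL]] := bg.
have [_ [B gB]] := bg.1.
have B0 : 0 <= B by apply: le_trans (gB [tuple of nseq _ 0]).
pose G c (x : T) (y : N.-tuple T) := tr c (fun t => g (tcons (x, t))) y.
have mG c : measurable_fun setT (fun p : T * N.-tuple T => G c p.1 p.2 : T).
  apply: (@measurable_tr_param _ (T * N.-tuple T)%type c N
    (fun q => g (tcons (q.1.1, q.2))) snd) => //.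
  apply: measurableT_comp => //.
  apply: (measurableT_comp (measurable_tcons (N:=N))).
  by apply: measurable_fun_pair => //; exact: measurableT_comp.
have GB c y : bms leb1 (G c ^~ y) /\ forall x, ~ `[- L, L]%classic x -> G c x y = 0.
  have GL x : ~ `[- L, L]%classic x -> G c x y = 0.
    move=> xL; rewrite /G /tr; under eq_Rintegral => t _.
      rewrite gL ?mulr0; first over.
      exists ord0; rewrite /tnth /= ltNge; apply/negP => H; apply: xL.
      by rewrite /= in_itv /= -ler_norml.
    exact: Rint0.
  split => //; split; [split|].
  - exact: (measurableT_comp (mG c) (measurable_pair2 y)).
  - exists (B * (2 * (L + 1)) ^+ N) => x; apply: tr_bound => //.
    + apply: (measurableT_comp mg); apply: (measurableT_comp (measurable_tcons (N:=N))).
      exact: measurable_pair1.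
    + by move=> t [i ti]; apply: gL; exists (lift ord0 i); rewrite tnthS.
  - exists `[- L, L]%classic; split => //.
    apply: (eq_ind_r (fun z => z < +oo)%E _ (lebesgue_measure_itv `[- L, L])) => /=.
    by case: ifP => // _; rewrite -EFinB ltry.
pose H c c' (a : T) (y : N.-tuple T) := Ctr c (G c' ^~ y) a.
have mH c c' : measurable_fun setT (fun p : T * N.-tuple T => H c c' p.1 p.2 : T).
  apply: (@measurable_Rint_param _ _ (T * N.-tuple T)%type T R leb1
    (fun q => ct c (q.1.1 * q.2) * G c' q.2 q.1.2)).
  apply: measurable_funM.
    apply: (measurableT_comp (ct_measurable c)); apply: measurable_funM => //.
    exact: measurableT_comp.
  apply: (measurableT_comp (mG c') (g := fun q : T * N.-tuple T * T => (q.2, q.1.2))).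
  by apply: measurable_fun_pair => //; exact: measurableT_comp.
pose S c' (a : T) (y : N.-tuple T) : T := H true c' a y ^+ 2 + H false c' a y ^+ 2.
have mS c' : measurable_fun setT (fun p : T * N.-tuple T => S c' p.1 p.2 : T).
  by apply: measurable_funD; apply: measurable_funX; exact: mH.
have S0 c' a y : 0 <= S c' a y by apply: addr_ge0; exact: sqr_ge0.
have mtr : measurable_fun setT (fun y => (tr b g y ^+ 2)%:E).
  by apply/measurable_EFinP; apply: measurable_funX; exact: measurable_tr.
rewrite ge0_integral_lebS //; last by move=> y; rewrite lee_fin sqr_ge0.
apply: (@le_trans _ _ (\int[leb1]_a \int[leb R N]_y (2 * (S true a y + S false a y))%:E)%E).
  have mST : measurable_fun setT (fun p : T * N.-tuple T => (2 * (S true p.1 p.2 + S false p.1 p.2))%:E).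
    by apply/measurable_EFinP; apply: measurable_funM => //; exact: (measurable_funD (mS _) (mS _)).
  apply: ge0_le_integral => //.
  - by move=> x _; apply: integral_ge0 => y _; rewrite lee_fin sqr_ge0.
  - apply: (@measurable_fun_fubini_tonelli_F _ _ _ _ _ (leb R N) (fun p : T * N.-tuple T => (tr b g (tcons p) ^+ 2)%:E)).
      by apply: (measurableT_comp mtr); exact: measurable_tcons.
    by move=> x; rewrite lee_fin sqr_ge0.
  - apply: (@measurable_fun_fubini_tonelli_F _ _ _ _ _ (leb R N) _ mST).
    by move=> x; rewrite lee_fin mulr_ge0// addr_ge0.
  - move=> a _; apply: ge0_le_integral => //.
    + by move=> x _; rewrite lee_fin sqr_ge0.
    + apply: (measurableT_comp mtr); apply: (measurableT_comp (measurable_tcons (N:=N))).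
      exact: measurable_pair1.
    + exact: (measurableT_comp mST (measurable_pair1 a)).
    + move=> y _; rewrite lee_fin tr_cons//.
      have sq (p q u v : R) : (p - q) ^+ 2 <= 2 * ((p ^+ 2 + u ^+ 2) + (v ^+ 2 + q ^+ 2)).
        by have := sqr_ge0 (p + q); have := sqr_ge0 u; have := sqr_ge0 v; nra.
      have sq' (p q u v : R) : (u + v) ^+ 2 <= 2 * ((p ^+ 2 + u ^+ 2) + (v ^+ 2 + q ^+ 2)).
        by have := sqr_ge0 (u - v); have := sqr_ge0 p; have := sqr_ge0 q; nra.
      by rewrite /S /H; case: (b); [exact: sq|exact: sq'].
have mSc c' : measurable_fun setT (fun p : T * N.-tuple T => (S c' p.1 p.2)%:E) by apply/measurable_EFinP; exact: mS.
have mST : measurable_fun setT (fun p : T * N.-tuple T => (2 * (S true p.1 p.2 + S false p.1 p.2))%:E).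
  by apply/measurable_EFinP; apply: measurable_funM => //; exact: (measurable_funD (mS _) (mS _)).
have mG2 c : measurable_fun setT (fun p : T * N.-tuple T => (G c p.1 p.2 ^+ 2)%:E).
  by apply/measurable_EFinP; apply: measurable_funX; exact: mG.
have mGy c : measurable_fun setT (fun y => \int[leb1]_x (G c x y ^+ 2)%:E)%E.
  apply: (@measurable_fun_fubini_tonelli_G _ _ _ _ _ leb1 _ (mG2 c)).
  by move=> x; rewrite lee_fin sqr_ge0.
have mST0 (p : T * N.-tuple T) : (0 <= (2 * (S true p.1 p.2 + S false p.1 p.2))%:E)%E.
  by rewrite lee_fin mulr_ge0// addr_ge0.
have /= -> := @fubini_tonelli _ _ _ _ _ leb1 (leb R N) _ mST mST0.
apply: (@le_trans _ _ (\int[leb R N]_y ((4 * pi)%:E * (\int[leb1]_x (G true x y ^+ 2)%:E + \int[leb1]_x (G false x y ^+ 2)%:E)))%E).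
  apply: ge0_le_integral => //.
  - by move=> y _; apply: integral_ge0 => a _; rewrite lee_fin mulr_ge0// addr_ge0.
  - apply: (@measurable_fun_fubini_tonelli_G _ _ _ _ _ leb1 _ mST).
    by move=> x; rewrite lee_fin mulr_ge0// addr_ge0.
  - by apply: measurable_funeM; exact: emeasurable_funD.
  - move=> y _.
    have ms c : measurable_fun setT (fun a => (S c a y)%:E).
      exact: (measurableT_comp (mSc c) (measurable_pair2 y)).
    under eq_integral do rewrite EFinM (EFinD (S true _ _)).
    rewrite ge0_integralZl_EFin //; last 2 first.
      by move=> a _; rewrite adde_ge0// lee_fin.
      exact: emeasurable_funD.
    rewrite ge0_integralD //; last 2 first.
      by move=> a _; rewrite lee_fin.
      by move=> a _; rewrite lee_fin.
    have Hb c : (\int[leb1]_a (S c a y)%:E <= (2 * pi)%:E * \int[leb1]_x (G c x y ^+ 2)%:E)%E.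
      have [b1 b2] := GB c y; have := bessel1 L0 b1 b2.
      by rewrite [(2 * pi * _)%:E]EFinM -bms_EFin//; apply: bmsMr => //; exact: bms_bdm b1.
    apply: (@le_trans _ _ (2%:E * ((2 * pi)%:E * \int[leb1]_x (G true x y ^+ 2)%:E + (2 * pi)%:E * \int[leb1]_x (G false x y ^+ 2)%:E))%E).
      by apply: lee_wpmul2l => //; apply: leeD; exact: Hb.
    rewrite -muleDr // ?ge0_adde_def ?inE ?integral_ge0//; last 2 first.
    - by move=> x _; rewrite lee_fin sqr_ge0.
    - by move=> x _; rewrite lee_fin sqr_ge0.
    by rewrite muleA -EFinM mulrA -natrM.
rewrite ge0_integralZl_EFin //; last 3 first.
- by move=> y _; rewrite adde_ge0// integral_ge0// => x _; rewrite lee_fin sqr_ge0.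
- exact: emeasurable_funD.
- by rewrite mulr_ge0.
rewrite ge0_integralD //; last 2 first.
- by move=> y _; rewrite integral_ge0// => x _; rewrite lee_fin sqr_ge0.
- by move=> y _; rewrite integral_ge0// => x _; rewrite lee_fin sqr_ge0.
have Hc c : (\int[leb R N]_y \int[leb1]_x (G c x y ^+ 2)%:E <= C%:E * \int[leb R N.+1]_x (g x ^+ 2)%:E)%E.
  have mG20 (p : T * N.-tuple T) : (0 <= (G c p.1 p.2 ^+ 2)%:E)%E by rewrite lee_fin sqr_ge0.
  have /= <- := @fubini_tonelli _ _ _ _ _ leb1 (leb R N) _ (mG2 c) mG20.
  have mg2 : measurable_fun setT (fun y => (g y ^+ 2)%:E).
    by apply/measurable_EFinP; apply: measurable_funX.
  have mgc : measurable_fun setT (fun p : T * N.-tuple T => (g (tcons p) ^+ 2)%:E).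
    by apply: (measurableT_comp mg2); exact: measurable_tcons.
  have mgx : measurable_fun setT (fun x : T => \int[leb R N]_t (g (tcons (x, t)) ^+ 2)%:E)%E.
    apply: (@measurable_fun_fubini_tonelli_F _ _ _ _ _ (leb R N) _ mgc).
    by move=> x; rewrite lee_fin sqr_ge0.
  rewrite ge0_integral_lebS //; last by move=> y; rewrite lee_fin sqr_ge0.
  rewrite -ge0_integralZl_EFin //; last first.
    by move=> x _; apply: integral_ge0 => t _; rewrite lee_fin sqr_ge0.
  apply: ge0_le_integral => //.
  - by move=> x _; apply: integral_ge0 => t _; rewrite lee_fin sqr_ge0.
  - apply: (@measurable_fun_fubini_tonelli_F _ _ _ _ _ (leb R N) _ (mG2 c)).
    by move=> x; rewrite lee_fin sqr_ge0.
  - exact: measurable_funeM.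
  - by move=> x _; apply: IH; exact: bbs_cons.
apply: (@le_trans _ _ ((4 * pi)%:E * (C%:E * \int[leb R N.+1]_x (g x ^+ 2)%:E + C%:E * \int[leb R N.+1]_x (g x ^+ 2)%:E))%E).
  by apply: lee_wpmul2l; [rewrite lee_fin mulr_ge0|apply: leeD; exact: Hc].
have I0 : (0 <= \int[leb R N.+1]_x (g x ^+ 2)%:E)%E.
  by apply: integral_ge0 => t _; rewrite lee_fin sqr_ge0.
rewrite -ge0_muleDl ?lee_fin// muleA -EFinD -EFinM.
by rewrite (_ : 4 * pi * (C + C) = 8 * pi * C)//; ring.
Qed.

End tuple_transform.

(** * Charts of class C1 *)

Section calculus.
Context (R : realType).

Lemma coord_le_norm N (v : 'rV[R]_N) i : `|v 0 i| <= `|v|.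
Proof.
rewrite [leRHS]mx_normrE; exact: (@le_bigmax _ _ _ (0 : R) (fun ij : 'I_1 * 'I_N => `|v ij.1 ij.2|) (0, i)).
Qed.

Lemma norm_le_coord N (v : 'rV[R]_N) c : 0 <= c -> (forall i, `|v 0 i| <= c) -> `|v| <= c.
Proof.
move=> c0 H; rewrite [leLHS]mx_normrE; apply: bigmax_le => //= -[i j] _.
by rewrite ord1.
Qed.

Lemma nbhs_norm (V : normedModType R) (x : V) (P : set V) :
  nbhs x P <-> exists2 e : R, 0 < e & forall y, `|y - x| < e -> P y.
Proof.
split=> [/nbhs_normP[e /= e0 H]|[e e0 H]].
  by exists e => // y xy; apply: H; rewrite /= distrC.
by apply/nbhs_normP; exists e => // y /= xy; apply: H; rewrite distrC.
Qed.

Lemma cvg_at_norm (V W : normedModType R) (f : V -> W) (x : V) (l : W) :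
  f y @[y --> x] --> l <->
  forall e : R, 0 < e -> exists2 d : R, 0 < d & forall y, `|y - x| < d -> `|f y - l| < e.
Proof.
split=> [/cvgrPdist_lt H e e0|H].
  have /nbhs_norm[d d0 Hd] := H e e0.
  by exists d => // y /Hd; rewrite distrC.
apply/cvgrPdist_lt => e e0; apply/nbhs_norm; have [d d0 Hd] := H e e0.
by exists d => // y /Hd; rewrite distrC.
Qed.

(** The difference quotient without division: the remainder bound also makes sense at [h = 0], so
    such estimates can be transported through charts and restrictions without excluding that
    point. *)
Lemma derivable_eps (V : normedModType R) (g : V -> R) z v (l : R) :
  (forall e : R, 0 < e -> exists2 d : R, 0 < d & forall h : R, `|h| < d ->
     `|g (h *: v + z) - g z - h * l| <= e * `|h|) ->
  is_derive z v g l.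
Proof.
move=> H; suff : (h^-1 *: (g (h *: v + z) - g z)) @[h --> 0^'] --> l.
  by move=> Hl; split; [apply/cvg_ex; exists l|exact: cvg_lim].
apply/cvgrPdist_le => e e0; have [d d0 Hd] := H e e0.
exists d => //= h; rewrite /= sub0r normrN => hd h0.
have h0' : 0 < `|h| by rewrite normr_gt0.
rewrite distrC -(ler_pM2r h0') -normrM mulrBl (mulrC l).
by rewrite /GRing.scale /= mulrAC mulVf// mul1r Hd.
Qed.

Lemma eps_derivable (V : normedModType R) (g : V -> R) z v :
  derivable g z v -> forall e : R, 0 < e -> exists2 d : R, 0 < d & forall h : R, `|h| < d ->
     `|g (h *: v + z) - g z - h * 'D_v g z| <= e * `|h|.
Proof.
move=> /cvg_ex[l Hl] e e0; have -> : 'D_v g z = l by exact: cvg_lim.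
move/cvgrPdist_le : Hl => /(_ e e0)[d /= d0 Hd].
exists d => // h hd; have [->|h0] := eqVneq h 0.
  by rewrite scale0r add0r mul0r subr0 subrr normr0 mulr0.
have := Hd h; rewrite /= sub0r normrN => /(_ hd h0).
have h0' : 0 < `|h| by rewrite normr_gt0.
rewrite distrC -(ler_pM2r h0') -normrM mulrBl (mulrC l).
by rewrite /GRing.scale /= mulrAC mulVf// mul1r.
Qed.

Lemma is_derive_line (V : normedModType R) (g : V -> R) p v (t : R) :
  derivable g (p + t *: v) v ->
  is_derive t 1 (fun x : R => g (p + x *: v)) ('D_v g (p + t *: v)).
Proof.
move=> dg; apply: derivable_eps => e e0; have [d d0 Hd] := eps_derivable dg e0.
exists d => // h /Hd; rewrite scaler1 scalerDl.
by rewrite (_ : p + (h *: v + t *: v) = h *: v + (p + t *: v))// addrCA.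
Qed.

Lemma MVT_line (V : normedModType R) (g : V -> R) p v :
  (forall t : R, 0 <= t <= 1 -> derivable g (p + t *: v) v) ->
  exists2 t : R, 0 < t < 1 & g (p + v) - g p = 'D_v g (p + t *: v).
Proof.
move=> dg.
have D (t : R) : 0 <= t <= 1 -> is_derive (t : R) 1 (fun x : R => g (p + x *: v)) ('D_v g (p + t *: v)).
  by move=> t01; apply: is_derive_line => //; exact: dg.
have [t| |t tI E] := @MVT R (fun x : R => g (p + x *: v)) (fun t => 'D_v g (p + t *: v)) 0 1 ltr01.
- by rewrite in_itv /= => /andP[t0 t1]; apply: D; rewrite !ltW.
- apply: derivable_within_continuous => t; rewrite in_itv /= => t01.
  by have [] := D t t01.
- exists t; first by move: tI; rewrite in_itv.
  by move: E; rewrite scale1r scale0r addr0 subr0 mulr1.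
Qed.

Lemma derivable_scale (V : normedModType R) (g : V -> R) z v (c : R) :
  derivable g z v -> is_derive z (c *: v) g (c * 'D_v g z).
Proof.
move=> dg; have [->|c0] := eqVneq c 0.
  rewrite scale0r mul0r; apply: derivable_eps => e e0; exists 1 => // h _.
  by rewrite scaler0 add0r mulr0 subr0 subrr normr0 mulr_ge0// ltW.
apply: derivable_eps => e e0.
have [d d0 Hd] := eps_derivable dg (divr_gt0 e0 (ltac:(by rewrite normr_gt0) : 0 < `|c|)).
exists (d / `|c|); first by rewrite divr_gt0// normr_gt0.
move=> h; rewrite ltr_pdivlMr ?normr_gt0// -normrM => /Hd.
by rewrite scalerA mulrA => /le_trans; apply; rewrite normrM (mulrC `|h|) mulrA divfK ?normr_eq0.
Qed.

(** The differential assembled from the partial derivatives, linear in [v] by construction;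
    [C1_derive] identifies it with ['D_v g] where [g] is C^1. *)
Definition dir N (g : 'rV[R]_N -> R) (z v : 'rV[R]_N) : R := \sum_i v 0 i * pd i g z.

Lemma dirD N (g : 'rV[R]_N -> R) z v w : dir g z (v + w) = dir g z v + dir g z w.
Proof. by rewrite /dir -big_split; apply: eq_bigr => i _ /=; rewrite mxE mulrDl. Qed.

Lemma dirZ N (g : 'rV[R]_N -> R) z c v : dir g z (c *: v) = c * dir g z v.
Proof. by rewrite /dir mulr_sumr; apply: eq_bigr => i _ /=; rewrite mxE mulrA. Qed.

Lemma dirB N (g : 'rV[R]_N -> R) z v w : dir g z (v - w) = dir g z v - dir g z w.
Proof. by rewrite dirD -scaleN1r dirZ mulN1r. Qed.

Lemma dir_le N (g : 'rV[R]_N -> R) z v : `|dir g z v| <= (\sum_i `|pd i g z|) * `|v|.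
Proof.
apply: (le_trans (ler_norm_sum _ _ _)); rewrite mulr_suml; apply: ler_sum => i _.
by rewrite normrM mulrC ler_wpM2l// coord_le_norm.
Qed.

(** Continuous partial derivatives imply differentiability: go from [z] to [x] changing one
    coordinate at a time and apply the mean value theorem on each segment. *)
Lemma C1_eps N (V : set 'rV[R]_N) (g : 'rV[R]_N -> R) z : open V -> C1_on V g -> V z ->
  forall e : R, 0 < e -> exists2 d : R, 0 < d & forall x, `|x - z| < d ->
    V x /\ `|g x - g z - dir g z (x - z)| <= e * `|x - z|.
Proof.
move=> oV gV Vz e e0.
have /nbhs_norm[d0 d00 Hd0] : nbhs z V by exact: open_nbhs_nbhs.
(* One share of [e] for each coordinate; [N.+1] in place of [N] also covers [N = 0]. *)
pose e' := e / N.+1%:R.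
have e'0 : 0 < e' by rewrite divr_gt0.
have /choice[d1 Hd1] : forall i : 'I_N, exists d : R, 0 < d /\
    forall y, `|y - z| < d -> `|pd i g y - pd i g z| < e'.
  move=> i; have [_ /cvg_at_norm/(_ e' e'0)[d dd Hd]] := gV z Vz i.
  by exists d.
pose d := \big[Num.min/d0]_i d1 i.
have dd0 : d <= d0 by rewrite /d; apply: bigmin_le_id.
have dd1 i : d <= d1 i by rewrite /d; exact: bigmin_inf.
have dgt : 0 < d by rewrite /d; apply: lt_bigmin => // i _; case: (Hd1 i).
exists d => // x xd; split; first by apply: Hd0; exact: lt_le_trans dd0.
(* [p k] has the first [k] coordinates of [x] and the others of [z]. *)
pose p (k : nat) : 'rV[R]_N := \row_i (if (i < k)%N then x 0 i else z 0 i).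
have p0 : p 0%N = z by apply/rowP => i; rewrite mxE.
have pN : p N = x by apply/rowP => i; rewrite mxE ltn_ord.
pose s (i : 'I_N) := x 0 i - z 0 i.
have pS (i : 'I_N) : p i.+1 = p i + s i *: delta_mx 0 i.
  apply/rowP => j; rewrite !mxE eqxx /= ltnS.
  have [->|ji] := eqVneq j i; first by rewrite leqnn ltnn mulr1 /s addrC subrK.
  by rewrite mulr0 addr0 leq_eqVlt (negbTE (_ : nat_of_ord j != i)).
have pd_close (i : 'I_N) (t : R) : 0 <= t <= 1 -> `|p i + t *: (s i *: delta_mx 0 i) - z| <= `|x - z|.
  move=> /andP[t0 t1]; apply: norm_le_coord => // j; rewrite !mxE eqxx /=.
  have := coord_le_norm (x - z) j; rewrite !mxE => H.
  have [->|ji] := eqVneq j i.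
    rewrite ltnn mulr1 [z 0 i + _]addrC addrK normrM ger0_norm//.
    by have := coord_le_norm (x - z) i; rewrite !mxE => /(le_trans _); apply; rewrite ler_piMl.
  by rewrite mulr0 mulr0 addr0; case: ifP => // _; rewrite subrr normr0.
have step (i : 'I_N) : `|g (p i.+1) - g (p i) - s i * pd i g z| <= e' * `|x - z|.
  rewrite pS.
  have close (t : R) : 0 <= t <= 1 -> `|p i + t *: (s i *: delta_mx 0 i) - z| < d.
    by move=> /(pd_close i) H; exact: le_lt_trans H xd.
  have V' (t : R) : 0 <= t <= 1 -> V (p i + t *: (s i *: delta_mx 0 i)).
    by move=> /close H; apply: Hd0; exact: lt_le_trans dd0.
  have [t t01 ->] : exists2 t : R, 0 < t < 1 & g (p i + s i *: delta_mx 0 i) - g (p i) =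
      'D_(s i *: delta_mx 0 i) g (p i + t *: (s i *: delta_mx 0 i)).
    apply: MVT_line => t t01; have [dg _] := gV _ (V' t t01) i.
    by case: (derivable_scale (s i) dg).
  have t01' : 0 <= t <= 1 by move/andP : t01 => [? ?]; rewrite !ltW.
  have [dg _] := gV _ (V' t t01') i.
  have [_ ->] := derivable_scale (s i) dg.
  rewrite -mulrBr normrM mulrC; apply: ler_pM => //.
    by apply: ltW; apply: (Hd1 i).2; apply: lt_le_trans (close _ t01') (dd1 i).
  by have := coord_le_norm (x - z) i; rewrite !mxE.
have -> : g x - g z - dir g z (x - z) = \sum_(i < N) (g (p i.+1) - g (p i) - s i * pd i g z).
  rewrite sumrB; congr (_ - _).
    by rewrite -(big_mkord xpredT (fun k => g (p k.+1) - g (p k))) telescope_sumr// pN p0.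
  by apply: eq_bigr => i _; rewrite !mxE.
apply: (le_trans (ler_norm_sum _ _ _)).
apply: (le_trans (ler_sum _ (fun i _ => step i))).
rewrite sumr_const card_ord -mulr_natl mulrA; apply: ler_wpM2r => //.
rewrite /e' mulrCA ler_piMr ?ltW//.
by rewrite ltr_pdivrMr// mul1r ltr_nat.
Qed.

Lemma C1_derive N (V : set 'rV[R]_N) (g : 'rV[R]_N -> R) z v : open V -> C1_on V g -> V z ->
  is_derive z v g (dir g z v).
Proof.
move=> oV gV Vz; apply: derivable_eps => e e0.
have [|d d0 Hd] := C1_eps oV gV Vz (e := e / (`|v| + 1)); first by rewrite divr_gt0// ltr_wpDl.
have v1 : 0 < `|v| + 1 by rewrite ltr_wpDl.
exists (d / (`|v| + 1)); first by rewrite divr_gt0.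
move=> h; rewrite ltr_pdivlMr// => hd.
have hv : `|h *: v| <= `|h| * (`|v| + 1) by rewrite normrZ ler_wpM2l// lerDl.
have := Hd (h *: v + z); rewrite addrK => /(_ (le_lt_trans hv hd))[_].
rewrite dirZ => /le_trans; apply.
by rewrite mulrAC ler_pdivrMr// -mulrA ler_wpM2l// ltW.
Qed.

Lemma C1_continuous N (V : set 'rV[R]_N) (g : 'rV[R]_N -> R) z : open V -> C1_on V g -> V z ->
  {for z, continuous g}.
Proof.
move=> oV gV Vz; apply/cvg_at_norm => e e0.
have [d d0 Hd] := C1_eps oV gV Vz ltr01.
pose S := \sum_i `|pd i g z|.
have S0 : 0 <= S by apply: sumr_ge0.
exists (Num.min d (e / (S + 1 + 1))); first by rewrite lt_min d0 divr_gt0// ltr_wpDl// addr_ge0.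
move=> x; rewrite lt_min ltr_pdivlMr; last by rewrite ltr_wpDl// addr_ge0.
move=> /andP[/Hd[_ H] xe].
have H2 := dir_le g z (x - z).
have -> : g x - g z = (g x - g z - dir g z (x - z)) + dir g z (x - z) by rewrite subrK.
rewrite (le_lt_trans (ler_normD _ _))//; apply: le_lt_trans xe.
rewrite -/S in H2; have := normr_ge0 (x - z); nra.
Qed.

Lemma C1_lipschitz N (V : set 'rV[R]_N) (g : 'rV[R]_N -> R) (K : R) x y : open V -> C1_on V g ->
  (forall t : R, 0 <= t <= 1 -> V (x + t *: (y - x))) ->
  (forall i (t : R), 0 <= t <= 1 -> `|pd i g (x + t *: (y - x))| <= K) ->
  `|g y - g x| <= N%:R * K * `|y - x|.
Proof.
move=> oV gV Vxy HK.
have [t t01|t t01] := @MVT_line _ g x (y - x).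
  by have [] := C1_derive (y - x) oV gV (Vxy t t01).
have t01' : 0 <= t <= 1 by move/andP : t01 => [? ?]; rewrite !ltW.
have [_ ->] := C1_derive (y - x) oV gV (Vxy t t01').
rewrite [x + (y - x)]addrC subrK => ->.
apply: (le_trans (dir_le _ _ _)); rewrite ler_wpM2r//.
apply: (le_trans (ler_sum _ (fun i _ => HK i t t01'))).
by rewrite sumr_const card_ord mulr_natl.
Qed.


Lemma norm_sub_continuous (V : normedModType R) (z x : V) :
  {for x, continuous (fun x : V => `|x - z| : R)}.
Proof.
apply/cvg_at_norm => e e0; exists e => // y; apply: le_lt_trans.
by apply: le_trans (ler_dist_dist _ _) _; rewrite opprB addrA subrK.
Qed.

Lemma compact_ball_rV N (z : 'rV[R]_N) (e : R) : compact [set x | `|x - z| <= e].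
Proof.
apply: bounded_closed_compact.
  exists (`|z| + e); split; first exact: num_real.
  move=> M HM x /= xz; apply: le_trans (ltW HM).
  by rewrite -[x](subrK z) (le_trans (ler_normD _ _))// addrC lerD2l.
have -> : [set x : 'rV[R]_N | `|x - z| <= e] = (fun x => `|x - z|) @^-1` [set y | y <= e] by [].
apply: (@preimage_closed _ _ (fun x : 'rV[R]_N => `|x - z| : R)); last exact: closed_le.
by move=> x _; exact: norm_sub_continuous.
Qed.

Lemma compact_sphere_rV N (z : 'rV[R]_N) (e : R) : compact [set x | `|x - z| = e].
Proof.
apply: (@subclosed_compact _ _ [set x | `|x - z| <= e]); last by move=> x /= ->.
  have -> : [set x : 'rV[R]_N | `|x - z| = e] = (fun x => `|x - z|) @^-1` [set y | y = e] by [].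
  apply: (@preimage_closed _ _ (fun x : 'rV[R]_N => `|x - z| : R)); last exact: closed_eq.
  by move=> x _; exact: norm_sub_continuous.
exact: compact_ball_rV.
Qed.

End calculus.

Lemma for_continuousM (R : realType) (V : topologicalType) (f g : V -> R) (x : V) :
  {for x, continuous f} -> {for x, continuous g} -> {for x, continuous (fun y => f y * g y)}.
Proof. by move=> cf cg; apply: cvgM. Qed.

Lemma for_continuous_cst (R : realType) (V : topologicalType) (c : R) (x : V) :
  {for x, continuous (fun=> c : R)}.
Proof. exact: cvg_cst. Qed.

Lemma continuous_sum_fin (R : realType) (V : topologicalType) (I : finType)
    (F : I -> V -> R) (z : V) :
  (forall i, {for z, continuous (F i)}) ->
  {for z, continuous (fun x => \sum_i F i x)}.
Proof.
move=> H.
suff Hs : forall s : seq I, (\sum_(i <- s) F i x) @[x --> z] --> \sum_(i <- s) F i z by exact: Hs.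
elim=> [|i s IH].
  by rewrite big_nil; under eq_fun do rewrite big_nil; exact: cvg_cst.
by rewrite big_cons; under eq_fun do rewrite big_cons; apply: cvgD; [exact: H|exact: IH].
Qed.

(** * A C^1 chart is open and its inverse is C^1 *)

Section chart.
Context (R : realType) (d N : nat).
Variables (O : set 'rV[R]_N) (a : 'rV[R]_N -> 'rV[R]_d) (r : 'rV[R]_N -> R) (K : R).
Hypothesis dN : N = d.+1.
Hypothesis oO : open O.
Let ac k : 'rV[R]_N -> R := fun z => a z 0 k.
Hypothesis aC1 : forall k, C1_on O (ac k).
Hypothesis rC1 : C1_on O r.
Hypothesis K0 : 0 < K.

Definition DPhi (z v : 'rV[R]_N) : 'rV[R]_d * R :=
  (\row_k dir (fun x => a x 0 k) z v, dir r z v).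

Hypothesis HK : forall z, O z -> forall v, `|v| <= K * `|DPhi z v|.

Let Phi (x : 'rV[R]_N) : 'rV[R]_d * R := (a x, r x).
Hypothesis injPhi : forall x y, O x -> O y -> Phi x = Phi y -> x = y.

Lemma prod_norm_le (p : 'rV[R]_d * R) c : `|p.1| <= c -> `|p.2| <= c -> `|p| <= c.
Proof. by move=> h1 h2; rewrite prod_normE /= ge_max h1. Qed.

Lemma DPhiB z v w : DPhi z (v - w) = DPhi z v - DPhi z w.
Proof.
by congr pair; [apply/rowP => k; rewrite !mxE|]; rewrite dirB.
Qed.

Lemma DPhiZ z c v : DPhi z (c *: v) = c *: DPhi z v.
Proof.
by congr pair; [apply/rowP => k; rewrite !mxE|]; rewrite dirZ.
Qed.

(** [HK] makes the differential injective, and source and target have the same dimension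
    [N = d + 1]. *)
Lemma DPhi_surj z w : O z -> exists v, DPhi z v = w.
Proof.
move=> Oz.
pose M : 'M[R]_(N, d + 1) := row_mx (\matrix_(i, k) pd i (ac k) z) (\matrix_(i, _) pd i r z).
have ME v : v *m M = row_mx (DPhi z v).1 (\row__ (DPhi z v).2).
  rewrite mul_mx_row; congr row_mx; apply/rowP => k; rewrite !mxE.
    by apply: eq_bigr => i _; rewrite !mxE.
  by apply: eq_bigr => i _; rewrite !mxE.
have Mfree : row_free M.
  rewrite -kermx_eq0; apply/eqP/row_matrixP => i; rewrite row0; apply/eqP.
  have : row i (kermx M) *m M = 0 by rewrite -row_mul mulmx_ker row0.
  rewrite ME => /eqP; rewrite -row_mx0 => /eqP/eq_row_mx[E1 E2].
  rewrite -normr_le0; apply: le_trans (HK Oz _) _.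
  have -> : DPhi z (row i (kermx M)) = 0.
    move: E1 E2; case: (DPhi z _) => p q /= -> /rowP/(_ 0); rewrite !mxE => -> //.
  by rewrite normr0 mulr0.
have Mfull : row_full M.
  by move: Mfree; rewrite /row_free /row_full => /eqP ->; rewrite dN addn1.
have /submxP[D DE] := submx_full (row_mx w.1 (\row__ w.2) : 'rV_(d + 1)) Mfull.
exists D; move: DE; rewrite ME => /eq_row_mx[E1 /rowP/(_ 0)]; rewrite !mxE => E2.
by rewrite [LHS]surjective_pairing -E1 -E2 -surjective_pairing.
Qed.

(** Each [P i] is required for all [y < e], which makes the minimum of the finitely many radii serve
    every index. *)
Lemma min_delta (I : finType) (P : I -> R -> Prop) :
  (forall i, exists2 e : R, 0 < e & forall y, y < e -> P i y) ->
  exists2 e : R, 0 < e & forall i y, y < e -> P i y.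
Proof.
move=> H; have /choice[e He] : forall i, exists e : R, 0 < e /\ forall y, y < e -> P i y.
  by move=> i; have [e e0 He] := H i; exists e.
exists (\big[Num.min/1]_i e i); first by apply: lt_bigmin => // i _; case: (He i).
move=> i y hy; apply: (He i).2; apply: lt_le_trans hy _; exact: bigmin_inf.
Qed.

Lemma Phi_eps z (e : R) : O z -> 0 < e -> exists2 dl : R, 0 < dl &
  forall x, `|x - z| < dl -> O x /\ `|Phi x - Phi z - DPhi z (x - z)| <= e * `|x - z|.
Proof.
move=> Oz e0.
have [d1 d10 H1] := C1_eps oO rC1 Oz e0.
have [d2 d20 H2] : exists2 d2 : R, 0 < d2 & forall k (y : R), y < d2 -> forall x, `|x - z| <= y ->
    O x /\ `|ac k x - ac k z - dir (ac k) z (x - z)| <= e * `|x - z|.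
  apply: min_delta => k; have [d2 d20 H2] := C1_eps oO (aC1 k) Oz e0.
  by exists d2 => // y yd x xy; apply: H2; exact: le_lt_trans yd.
exists (Num.min d1 d2); first by rewrite lt_min d10.
move=> x; rewrite lt_min => /andP[/H1[Ox h1] xd2]; split => //.
apply: prod_norm_le => //=.
apply: norm_le_coord => [|k]; first by rewrite mulr_ge0// ltW.
by have [_] := H2 k _ xd2 x (lexx _); rewrite !mxE.
Qed.

Lemma Phi_continuous z : O z -> {for z, continuous Phi}.
Proof.
move=> Oz; apply/cvg_at_norm => e e0.
have [d1 d10 H1] : exists2 d1 : R, 0 < d1 & forall k (y : R), y < d1 -> forall x, `|x - z| <= y ->
   `|ac k x - ac k z| < e / 2.
  apply: min_delta => k.
  have /cvg_at_norm/(_ (e / 2)) := C1_continuous oO (aC1 k) Oz.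
  rewrite divr_gt0// => /(_ isT)[d1 d10 H]; exists d1 => // y yd x xy.
  by apply: H; exact: le_lt_trans yd.
have /cvg_at_norm/(_ (e / 2)) := C1_continuous oO rC1 Oz.
rewrite divr_gt0// => /(_ isT)[d2 d20 H2].
exists (Num.min d1 d2); first by rewrite lt_min d10.
move=> x; rewrite lt_min => /andP[xd1 /H2 h2].
have e2 : e / 2 < e by rewrite ltr_pdivrMr// ltr_pMr// ltr1n.
apply: le_lt_trans e2; apply: prod_norm_le => /=; last exact: ltW.
apply: norm_le_coord => [|k]; first by rewrite divr_ge0// ltW.
by rewrite !mxE; apply: ltW; exact: (H1 k _ xd1 x (lexx _)).
Qed.

(* At an interior minimum of |Phi x - y| the Newton step would decrease the norm unless Phi x = y. *)
Lemma Phi_open z (rho : R) : O z -> 0 < rho -> exists2 m : R, 0 < m &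
  forall y, `|y - Phi z| < m -> exists x, [/\ `|x - z| < rho, O x & Phi x = y].
Proof.
move=> Oz rho0.
have /nbhs_norm[d0 d00 Hd0] : nbhs z O by exact: open_nbhs_nbhs.
pose q := Num.min rho d0 / 2.
have q0 : 0 < q by rewrite divr_gt0// lt_min rho0.
have q2 : q < Num.min rho d0 by rewrite /q ltr_pdivrMr// ltr_pMr ?ltr1n// lt_min rho0.
have BO x : `|x - z| <= q -> O x.
  by move=> xq; apply: Hd0; apply: (le_lt_trans xq); apply: (lt_le_trans q2); rewrite ge_min lexx orbT.
have cH y x : O x -> {for x, continuous (fun x => `|Phi x - y| : R)}.
  move=> Ox; apply: (@continuous_comp _ _ _ Phi (fun p => `|p - y| : R)).
    exact: Phi_continuous.
  exact: norm_sub_continuous.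
(* By injectivity [|Phi x - Phi z|] is positive on the sphere, which is compact. When
   [|y - Phi z| < m / 2], this keeps the minimiser of [|Phi x - y|] off the sphere. *)
have [m m0 Hm] : exists2 m : R, 0 < m & forall x, `|x - z| = q -> m <= `|Phi x - Phi z|.
  have [/set0P[x0 x0S]|/negPn/eqP S0] := boolP ([set x : 'rV[R]_N | `|x - z| = q] != set0); last first.
    exists 1 => // x xq.
    by have : [set x : 'rV[R]_N | `|x - z| = q] x by []; rewrite S0.
  have [||c] := @compact_EVT_min _ R (fun x => `|Phi x - Phi z|) [set x | `|x - z| = q] _ (@compact_sphere_rV R N z q).
  - by exists x0.
  - apply: continuous_in_subspaceT => x /set_mem /= xq; apply: cH.
    by apply: BO; rewrite xq.
  - move=> /set_mem /= cq Hc; exists `|Phi c - Phi z|.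
      rewrite normr_gt0 subr_eq0; apply/eqP => /injPhi E.
      have Oc : O c by apply: BO; rewrite cq.
      by move: q0; rewrite -cq (E Oc Oz) subrr normr0 ltxx.
    by move=> x xq; apply: Hc; rewrite inE.
exists (m / 2); first by rewrite divr_gt0.
move=> y ym.
have [||c] := @compact_EVT_min _ R (fun x => `|Phi x - y|) [set x | `|x - z| <= q] _ (@compact_ball_rV R N z q).
- by exists z; rewrite /= subrr normr0 ltW.
- by apply: continuous_in_subspaceT => x /set_mem /= xq; apply: cH; exact: BO.
move=> /set_mem /= cq Hc.
have Oc := BO _ cq.
have Hz : `|Phi c - y| <= `|Phi z - y| by apply: Hc; rewrite inE /= subrr normr0 ltW.
have zy : `|Phi z - y| < m / 2 by rewrite distrC.
have cq' : `|c - z| < q.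
  rewrite lt_neqAle cq andbT; apply/eqP => /Hm mc.
  have := ler_normD (Phi c - y) (y - Phi z); rewrite addrA subrK => h.
  have h2 : m <= `|Phi c - y| + `|y - Phi z| by exact: le_trans h.
  lra.
exists c; split => //; first by apply: lt_trans cq' _; apply: lt_le_trans q2 _; rewrite ge_min lexx.
apply/eqP; rewrite -subr_eq0 -normr_le0 leNgt; apply/negP => H0.
set h := `|Phi c - y| in Hz H0 Hc.
have [w Hw] := DPhi_surj (y - Phi c) Oc.
have w1 : 0 < `|w| + 1 by rewrite ltr_wpDl.
(* With this tolerance a Newton step of length [t] has error at most [t h / 2], less than its gain
   [t h]. The [t] chosen next keeps the step inside the ball of radius [q]. *)
have [|d1 d10 H1] := Phi_eps (e := h / 2 / (`|w| + 1)) Oc; first by rewrite !divr_gt0.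
pose t := Num.min 1 (Num.min (d1 / 2) ((q - `|c - z|) / 2) / (`|w| + 1)).
have qc : 0 < q - `|c - z| by rewrite subr_gt0.
have t0 : 0 < t by rewrite lt_min ltr01 /= divr_gt0// lt_min !divr_gt0.
have t1 : t <= 1 by rewrite ge_min lexx.
have tw : t * (`|w| + 1) <= Num.min (d1 / 2) ((q - `|c - z|) / 2).
  by rewrite -ler_pdivlMr// ge_min lexx orbT.
have tw' : `|t *: w| <= t * (`|w| + 1).
  by rewrite normrZ gtr0_norm// ler_wpM2l ?lerDl// ltW.
have tw1 : `|t *: w| < d1.
  by move: tw; rewrite le_min => /andP[]; lra.
have tw2 : `|t *: w| <= q - `|c - z|.
  by move: tw; rewrite le_min => /andP[]; lra.
have [|_ H2] := H1 (c + t *: w); first by rewrite addrAC subrr add0r.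
have : h <= `|Phi (c + t *: w) - y|.
  apply: Hc; rewrite inE /= addrAC (le_trans (ler_normD _ _))//; lra.
move: H2; rewrite [c + _]addrC addrK DPhiZ Hw => H2.
set P := Phi _ in H2 *.
have -> : P - y = (P - Phi c - t *: (y - Phi c)) + (1 - t) *: (Phi c - y).
  set X := Phi c - y.
  have -> : y - Phi c = - X by rewrite opprB.
  by rewrite scalerN opprK scalerBl scale1r addrA (addrAC _ (t *: X) X) addrK /X addrA subrK.
have : `|(1 - t) *: (Phi c - y)| = (1 - t) * h by rewrite normrZ ger0_norm ?subr_ge0.
move: (ler_normD (P - Phi c - t *: (y - Phi c)) ((1 - t) *: (Phi c - y))).
have : h / 2 / (`|w| + 1) * `|t *: w| <= h / 2 * t.
  rewrite mulrAC ler_pdivrMr// -(mulrA _ t); apply: ler_wpM2l => //.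
  by rewrite ltW// divr_gt0.
move: H2 => /=; have := mulr_gt0 t0 H0.
set A := `| _ + _ |; set B := `| _ *: _ |; set D := `| _ - _ - _|; set E := _ / _ * _.
lra.
Qed.


(** [Phi_open] is the continuity of the inverse of [Phi]; it also shows that the image contains a
    neighbourhood of [Phi z], where [P] is therefore known. *)
Lemma pullback_continuous (F : 'rV[R]_N -> R) (P : 'rV[R]_d * R -> R) z :
  (forall x, O x -> P (Phi x) = F x) -> O z -> {for z, continuous F} ->
  {for Phi z, continuous P}.
Proof.
move=> PF Oz /cvg_at_norm cF; apply/cvg_at_norm => e e0.
have [d0 d00 Hd0] := cF e e0.
have [m m0 Hm] := Phi_open Oz d00.
by exists m => // y /Hm[x [xz Ox <-]]; rewrite !PF//; exact: Hd0.
Qed.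

(** The point [x] with [Phi x = Phi z + h e] satisfies [x - z = h w + o(h)]: apply [HK] to
    [x - z - h w], whose image under the differential is the remainder of [Phi]. *)
Lemma pullback_is_derive (F : 'rV[R]_N -> R) (P : 'rV[R]_d * R -> R) z w e :
  C1_on O F -> (forall x, O x -> P (Phi x) = F x) -> O z -> DPhi z w = e ->
  is_derive (Phi z) e P (dir F z w).
Proof.
move=> FC1 PF Oz we; apply: derivable_eps => e' e'0.
pose S := \sum_i `|pd i F z|.
have S0 : 0 <= S by apply: sumr_ge0.
have e1 : 0 <= `|e| by [].
(* The bound [k' <= 1/(2K)] lets half of [|x - z|] be absorbed in [h4]; the denominator of [k] is
   what the final estimate [h7] accumulates. *)
pose k := e' / (2 * K * (`|e| + 1) * (S * K + 1)).
have SK1 : 0 < S * K + 1 by rewrite ltr_wpDl// mulr_ge0// ltW.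
have e2 : 0 < `|e| + 1 by rewrite ltr_wpDl.
have k0 : 0 < k by rewrite divr_gt0// !mulr_gt0.
pose k' := Num.min k (2 * K)^-1.
have k'0 : 0 < k' by rewrite lt_min k0 invr_gt0 mulr_gt0.
have [d1 d10 H1] := Phi_eps Oz k'0.
have [d2 d20 H2] := C1_eps oO FC1 Oz k'0.
have d12 : 0 < Num.min d1 d2 by rewrite lt_min d10.
have [m m0 Hm] := Phi_open Oz d12.
exists (m / (`|e| + 1)); first by rewrite divr_gt0.
move=> h; rewrite ltr_pdivlMr// => hm.
have he : `|h *: e| <= `|h| * (`|e| + 1) by rewrite normrZ ler_wpM2l// lerDl.
have [|x [xz Ox Ex]] := Hm (h *: e + Phi z).
  by rewrite addrK; exact: le_lt_trans hm.
move: xz; rewrite lt_min => /andP[/H1[_ h1] /H2[_ h2]].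
rewrite -Ex !PF//.
have dPhi : Phi x - Phi z = h *: e by rewrite Ex addrK.
rewrite dPhi in h1.
have kk1 : k' <= k by rewrite ge_min lexx.
have kk2 : k' * (2 * K) <= 1.
  by rewrite -ler_pdivlMr ?mulr_gt0// mul1r ge_min lexx orbT.
have X0 : 0 <= `|x - z| by [].
have h3 : `|x - z| <= K * `|h *: e| + K * (k' * `|x - z|).
  apply: le_trans (HK Oz _) _; rewrite -mulrDr; apply: ler_wpM2l; first exact: ltW.
  have -> : DPhi z (x - z) = h *: e - (h *: e - DPhi z (x - z)) by rewrite opprB addrCA subrr addr0.
  by apply: le_trans (ler_normB _ _) _; rewrite lerD2l.
have h4 : `|x - z| <= 2 * K * (`|e| + 1) * `|h|.
  have : K * (k' * `|x - z|) <= `|x - z| / 2 by nra.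
  have : K * `|h *: e| <= K * (`|h| * (`|e| + 1)) by rewrite ler_wpM2l// ltW.
  by move=> a1 a2; lra.
have h5 : `|x - z - h *: w| <= K * (k' * `|x - z|).
  apply: le_trans (HK Oz _) _; apply: ler_wpM2l; first exact: ltW.
  by rewrite DPhiB DPhiZ we distrC.
have -> : F x - F z - h * dir F z w = (F x - F z - dir F z (x - z)) + dir F z (x - z - h *: w).
  by rewrite (dirB _ _ (x - z)) dirZ addrA subrK.
apply: le_trans (ler_normD _ _) _.
have h6 : `|dir F z (x - z - h *: w)| <= S * (K * (k' * `|x - z|)).
  by apply: le_trans (dir_le _ _ _) _; rewrite ler_wpM2l.
have h7 : (S * K + 1) * k * (2 * K * (`|e| + 1) * `|h|) = e' * `|h|.
  by rewrite /k; field; rewrite !gt_eqF.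
rewrite -h7; apply: le_trans (lerD h2 h6) _.
have -> : k' * `|x - z| + S * (K * (k' * `|x - z|)) = (S * K + 1) * (k' * `|x - z|) by ring.
rewrite -mulrA; apply: ler_wpM2l; first exact: ltW.
by apply: ler_pM => //; exact: ltW.
Qed.

Lemma DPhi_continuous z v : O z -> {for z, continuous (fun x => DPhi x v)}.
Proof.
have cdir (G : 'rV[R]_N -> R) : C1_on O G -> O z -> {for z, continuous (fun x => dir G x v)}.
  move=> GC1 Oz; apply: continuous_sum_fin => i.
  apply: for_continuousM; first exact: for_continuous_cst.
  by have [] := GC1 z Oz i.
move=> Oz; apply/cvg_at_norm => e e0.
have [d1 d10 H1] : exists2 d1 : R, 0 < d1 & forall k (y : R), y < d1 -> forall x, `|x - z| <= y ->
   `|dir (ac k) x v - dir (ac k) z v| < e / 2.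
  apply: min_delta => k.
  have /cvg_at_norm/(_ (e / 2)) := cdir _ (aC1 k) Oz.
  rewrite divr_gt0// => /(_ isT)[d1 d10 H]; exists d1 => // y yd x xy.
  by apply: H; exact: le_lt_trans yd.
have /cvg_at_norm/(_ (e / 2)) := cdir _ rC1 Oz.
rewrite divr_gt0// => /(_ isT)[d2 d20 H2].
exists (Num.min d1 d2); first by rewrite lt_min d10.
move=> x; rewrite lt_min => /andP[xd1 /H2 h2].
have e2 : e / 2 < e by rewrite ltr_pdivrMr// ltr_pMr// ltr1n.
apply: le_lt_trans e2; apply: prod_norm_le => /=; last exact: ltW.
apply: norm_le_coord => [|k]; first by rewrite divr_ge0// ltW.
by rewrite !mxE; apply: ltW; exact: (H1 k _ xd1 x (lexx _)).
Qed.

(** The derivative at [Phi x] is [dir F x (w x)] with [w x] the preimage of [e] under the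
    differential at [x]. It is continuous because [|w x - w z|] is at most [K] times the norm of
    [DPhi z (w z) - DPhi x (w z)]. *)
Lemma pullback_C1 (F : 'rV[R]_N -> R) (P : 'rV[R]_d * R -> R) z e :
  C1_on O F -> (forall x, O x -> P (Phi x) = F x) -> O z ->
  [/\ {for Phi z, continuous P}, derivable P (Phi z) e,
      {for Phi z, continuous ('D_e P)} &
      `|'D_e P (Phi z)| <= (\sum_i `|pd i F z|) * (K * `|e|)].
Proof.
move=> FC1 PF Oz.
have /choice[w Hw] : forall x, exists v, O x -> DPhi x v = e.
  move=> x; have [Ox|nOx] := pselect (O x); last by exists 0.
  by have [v Hv] := DPhi_surj e Ox; exists v.
have D x : O x -> is_derive (Phi x) e P (dir F x (w x)).
  by move=> Ox; apply: pullback_is_derive => //; exact: Hw.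
have DE x : O x -> 'D_e P (Phi x) = dir F x (w x) by move=> Ox; have [_ ->] := D x Ox.
have we x : O x -> `|w x| <= K * `|e| by move=> Ox; have := HK Ox (w x); rewrite Hw.
split.
- exact: pullback_continuous (C1_continuous oO FC1 Oz).
- by have [] := D z Oz.
- apply: (pullback_continuous DE Oz).
  have cw : {for z, continuous w}.
    apply/cvg_at_norm => e' e'0.
    have /cvg_at_norm/(_ (e' / K)) := DPhi_continuous (v := w z) Oz.
    rewrite divr_gt0// => /(_ isT)[d1 d10 H1].
    have /nbhs_norm[d0 d00 Hd0] : nbhs z O by exact: open_nbhs_nbhs.
    exists (Num.min d1 d0); first by rewrite lt_min d10.
    move=> x; rewrite lt_min => /andP[/H1 h1 /Hd0 Ox].
    apply: le_lt_trans (HK Ox _) _; rewrite DPhiB (Hw x Ox) -(Hw z Oz) distrC.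
    by move: h1; rewrite ltr_pdivlMr// mulrC.
  apply: continuous_sum_fin => i; apply: for_continuousM; last by have [] := FC1 z Oz i.
  apply: (@continuous_comp _ _ _ w (fun v : 'rV[R]_N => v 0 i)) => //.
  exact: coord_continuous.
- rewrite DE//; apply: le_trans (dir_le _ _ _) _.
  by rewrite ler_wpM2l ?sumr_ge0// we.
Qed.

End chart.

(** * Change of variables *)

Section einf.
Context (R : realType).
Implicit Types u : (\bar R)^nat.

Lemma limn_einf_le u (C : \bar R) : (forall n, u n <= C)%E -> (limn_einf u <= C)%E.
Proof.
move=> uC; rewrite limn_einf_lim; apply: lime_le; first exact: is_cvg_einfs.
apply: nearW => n; apply: le_trans (uC n); apply: ereal_inf_lbound.
by exists n => //=.
Qed.

Lemma limn_einf_ge u (C : \bar R) N : (forall n, (N <= n)%N -> C <= u n)%E -> (C <= limn_einf u)%E.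
Proof.
move=> uC; rewrite limn_einf_lim; apply: lime_ge; first exact: is_cvg_einfs.
exists N => // n /= Nn; apply: le_ereal_inf_tmp => _ [p /= np <-].
by apply: uC; exact: leq_trans np.
Qed.

Lemma measurable_limn_einf d (X : measurableType d) (f : (X -> \bar R)^nat) :
  (forall n, measurable_fun setT (f n)) ->
  measurable_fun setT (fun x => limn_einf (f ^~ x)).
Proof.
move=> mf; apply: measurableT_comp => //; apply: measurable_fun_limn_esup => n.
exact: measurableT_comp.
Qed.

Lemma fatou_le d (X : measurableType d) (mu : {measure set X -> \bar R})
    (f : X -> \bar R) (F : (X -> \bar R)^nat) (C : \bar R) :
  measurable_fun setT f -> (forall x, 0 <= f x)%E ->
  (forall n, measurable_fun setT (F n)) -> (forall n x, 0 <= F n x)%E ->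
  (forall x, f x <= limn_einf (F ^~ x))%E ->
  (forall n, \int[mu]_x F n x <= C)%E -> (\int[mu]_x f x <= C)%E.
Proof.
move=> mf f0 mF F0 fF FC.
apply: (@le_trans _ _ (\int[mu]_x limn_einf (F ^~ x))%E).
  by apply: ge0_le_integral => //; exact: measurable_limn_einf.
apply: le_trans (fatou mu measurableT mF _) _ => //.
exact: limn_einf_le.
Qed.

End einf.

Section change_of_variables.
Context (R : realType) (d N : nat).
Local Notation T := (measurableTypeR R).
Local Notation leb1 := (@lebesgue_measure R).
Hypothesis dN : N = d.+1.
Variables (O : set 'rV[R]_N) (a : 'rV[R]_N -> 'rV[R]_d) (r : 'rV[R]_N -> R) (L : R).
Hypothesis oO : open O.
Hypothesis L0 : 0 < L.
Hypothesis Lip : forall x y, (forall t : R, 0 <= t <= 1 -> O (x + t *: (y - x))) ->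
  `|a y - a x| <= L * `|y - x| /\ `|r y - r x| <= L * `|y - x|.
Variables (G : 'rV[R]_N -> R) (H : 'rV[R]_d * R -> R).
Hypothesis G0 : forall x, 0 <= G x.
Hypothesis GO : forall x, ~ O x -> G x = 0.
Hypothesis cG : forall x, O x -> {for x, continuous G}.
Hypothesis H0 : forall y, 0 <= H y.
Hypothesis mH : measurable_fun setT (fun q : d.-tuple T * T => H (rvecR q)).
Hypothesis HG : forall y, H y = 0 \/ exists2 x, O x & (a x, r x) = y /\ H y <= G x.

Let len (k : nat) : R := k.+1%:R^-1.
Let len0 k : 0 < len k. Proof. by rewrite invr_gt0. Qed.

Let corner k (q : N.-tuple int) : 'I_N -> R := fun i => (tnth q i)%:~R * len k.
Let ncube k (q : N.-tuple int) : set (N.-tuple T) :=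
  [set t | forall i, tnth t i \in `[corner k q i, corner k q i + len k[].
(** The infimum keeps the step function below [G], and by continuity it tends to [G x] as the cubes
    shrink to [x]. *)
Let coef k (q : N.-tuple int) : R := inf [set G (rvec t) | t in ncube k q].

Let corner_in k q : ncube k q [tuple corner k q i | i < N].
Proof. by move=> i; rewrite tnth_mktuple in_itv /= lexx ltrDl len0. Qed.

Let coef_ge0 k q : 0 <= coef k q.
Proof.
apply: lb_le_inf.
  by exists (G (rvec [tuple corner k q i | i < N])); exists [tuple corner k q i | i < N] => //; exact: corner_in.
by move=> _ [t _ <-].
Qed.

Let coef_le k q t : ncube k q t -> coef k q <= G (rvec t).
Proof.
move=> qt; apply: ge_inf; last by exists t.
by exists 0 => _ [s _ <-].
Qed.

Let base k q : 'rV[R]_N := rvec [tuple corner k q i | i < N].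

(** The image of a cube deviates from the image of its corner by at most [L * len k] in each
    direction. The side [3 L len k] leaves a margin above the necessary [2 L len k], so the
    half-open box contains the image; this is the origin of [(3 L)^N]. *)
Let abox k q : set (d.-tuple T * T) :=
  [set t | forall i, tnth t i \in `[a (base k q) 0 i - L * len k, a (base k q) 0 i - L * len k + 3 * L * len k[]
  `*` `[r (base k q) - L * len k, r (base k q) - L * len k + 3 * L * len k[%classic.

Let mbox n (c : 'I_n -> R) (l : R) :
  measurable [set t : n.-tuple T | forall i, tnth t i \in `[c i, c i + l[].
Proof.
rewrite (_ : [set t | _] = \bigcap_(i in [set: 'I_n]) ((fun t : n.-tuple T => tnth t i) @^-1` `[c i, c i + l[%classic)); last first.
  apply/seteqP; split=> t /=; first by move=> h i _; exact: h.
  by move=> h i; exact: h.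
apply: fin_bigcap_measurable => // i _.
rewrite -[X in measurable X]setTI; exact: measurable_tnth.
Qed.

Let mabox k q : measurable (abox k q).
Proof. apply: measurableX => //; exact: mbox. Qed.

Let abox_measure k q : ((leb R d \x leb1) (abox k q) = ((3 * L) ^+ N * len k ^+ N)%:E)%E.
Proof.
have l0 : 0 < 3 * L * len k by rewrite !mulr_gt0.
rewrite /abox product_measure1E //; last exact: mbox.
transitivity (((3 * L * len k) ^+ d)%:E * (3 * L * len k)%:E)%E; last first.
  by rewrite -EFinM -exprMn dN [in RHS]exprSr.
congr (_ * _)%E; first exact: (lebN_box (fun i => a (base k q) 0 i - L * len k) (ltW l0)).
apply: (eq_ind_r (fun z => z = (3 * L * len k)%:E) _ (lebesgue_measure_itv `[_, _[)).
by rewrite /= lte_fin ltrDl l0 -EFinB; congr EFin; rewrite addrAC subrr add0r.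
Qed.

Let in_abox k q t : ncube k q `<=` (fun t => O (rvec t)) -> ncube k q t ->
  abox k q ([tuple a (rvec t) 0 i | i < d], r (rvec t)).
Proof.
move=> qO qt.
have qlen : `|rvec t - base k q| <= len k.
  rewrite [leLHS]mx_normrE; apply: bigmax_le => [|[i j] _ /=]; first exact: ltW.
  rewrite !mxE !tnth_mktuple; have := qt j; rewrite in_itv /= => /andP[h1 h2].
  by rewrite ler_norml; apply/andP; split; lra.
have [|La Lr] := @Lip (base k q) (rvec t).
  move=> s /andP[s0 s1].
  have -> : base k q + s *: (rvec t - base k q) =
     rvec [tuple corner k q i + s * (tnth t i - corner k q i) | i < N].
    by apply/rowP => i; rewrite !mxE !tnth_mktuple.
  apply: qO => i; rewrite tnth_mktuple in_itv /=.
  have := qt i; rewrite in_itv /= => /andP[h1 h2]; have lk := len0 k; apply/andP; split; nra.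
have Ll : L * `|rvec t - base k q| <= L * len k by rewrite ler_wpM2l// ltW.
have lL : 0 < L * len k by rewrite mulr_gt0.
split => /=.
  move=> i; rewrite tnth_mktuple in_itv /=.
  have : `|(a (rvec t) - a (base k q)) 0 i| <= L * len k.
    apply: le_trans Ll; apply: le_trans La.
    rewrite [leRHS]mx_normrE.
    exact: (@le_bigmax _ _ _ (0 : R) (fun ij : 'I_1 * 'I_d => `|(a (rvec t) - a (base k q)) ij.1 ij.2|) (0, i)).
  rewrite !mxE ler_norml => /andP[h1 h2]; apply/andP; split; lra.
have : `|r (rvec t) - r (base k q)| <= L * len k by exact: le_trans Ll.
rewrite in_itv /= ler_norml => /andP[h1 h2]; apply/andP; split; lra.
Qed.

Let cubeof k (t : N.-tuple T) : N.-tuple int := [tuple Num.floor (tnth t i / len k) | i < N].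

Let cubeof_in k t : ncube k (cubeof k t) t.
Proof.
move=> i; rewrite in_itv /= /corner tnth_mktuple.
have := floor_le (tnth t i / len k); have := floorD1_gt (tnth t i / len k).
rewrite ltr_pdivrMr// ler_pdivlMr// intrD mulrDl mul1r => -> -> //.
Qed.

Let cubeof_uniq k t q : ncube k q t -> q = cubeof k t.
Proof.
move=> qt; apply: eq_from_tnth => i; rewrite tnth_mktuple; apply/esym/floor_def.
have := qt i; rewrite in_itv /= /corner intrD mulr1z => /andP[h1 h2].
by rewrite ler_pdivlMr// ltr_pdivrMr// mulrDl mul1r h1.
Qed.

(** The cubes are enumerated through [pickle_inv]; an index that codes no cube contributes 0. *)
Let term (X : Type) (S : N.-tuple int -> set X) k (n : nat) (x : X) : \bar R :=
  if (pickle_inv n : option (N.-tuple int)) is Some q then (coef k q * \1_(S q) x)%:E else 0%E.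

Let term_ge0 X (S : N.-tuple int -> set X) k n x : (0 <= term S k n x)%E.
Proof.
rewrite /term; case: pickle_inv => // q; by rewrite lee_fin mulr_ge0.
Qed.

Let measurable_term dd (X : measurableType dd) (S : N.-tuple int -> set X) k n :
  (forall q, measurable (S q)) -> measurable_fun setT (term S k n).
Proof.
move=> mS; rewrite /term; case: pickle_inv => // q.
by apply/measurable_EFinP; apply: measurable_funM => //; exact: measurable_indic.
Qed.

Let Hk k q : \bar R := (\sum_(n <oo) term (abox k) k n q)%E.

Let int_term_box k n : (\int[(leb R d \x leb1)%E]_q term (abox k) k n q =
  ((3 * L) ^+ N)%:E * \int[leb R N]_t term (ncube k) k n t)%E.
Proof.
rewrite /term; case: pickle_inv => [q|]; last by rewrite !integral0 mule0.
have mc : measurable (ncube k q) by exact: mbox.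
under eq_integral do rewrite EFinM.
under [in RHS]eq_integral do rewrite EFinM.
have mb := mabox k q.
have m1 : measurable_fun setT (fun x => (\1_(abox k q) x)%:E : \bar R).
  by apply/measurable_EFinP; exact: measurable_indic.
have m2 : measurable_fun setT (fun x => (\1_(ncube k q) x)%:E : \bar R).
  by apply/measurable_EFinP; exact: measurable_indic.
rewrite !ge0_integralZl_EFin ?coef_ge0 //.
have E1 : (\int[(leb R d \x leb1)%E]_x (\1_(abox k q) x)%:E = ((3 * L) ^+ N * len k ^+ N)%:E)%E.
  by rewrite integral_indic// setIT; exact: abox_measure.
have E2 : (\int[leb R N]_x (\1_(ncube k q) x)%:E = (len k ^+ N)%:E)%E.
  by rewrite integral_indic// setIT; exact: (lebN_box _ (ltW (len0 k))).
by rewrite E2 [X in (_ * X)%E]E1 -!EFinM; congr EFin; ring.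
Qed.

(** The cubes are disjoint, so only the index of [cubeof k t] contributes at [t]. *)
Let sum_cube_le k t : (\sum_(n <oo) term (ncube k) k n t <= (G (rvec t))%:E)%E.
Proof.
apply: lime_le; first by apply: is_cvg_nneseries => n _ _; exact: term_ge0.
apply: nearW => m.
pose n0 := pickle (cubeof k t).
have tz n : n != n0 -> term (ncube k) k n t = 0%E.
  rewrite /term; case E : pickle_inv => [q|] // nn0.
  rewrite indicE memNset ?mulr0// => /cubeof_uniq qE.
  move: (@pickle_invK [the countType of N.-tuple int] n); rewrite E /= => En.
  by move/eqP: nn0; apply; rewrite /n0 -qE.
have tn0 : (term (ncube k) k n0 t <= (G (rvec t))%:E)%E.
  rewrite /term /n0 pickleK_inv indicE mem_set ?mulr1 ?lee_fin.
    by apply: coef_le; exact: cubeof_in.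
  exact: cubeof_in.
have [mn|nm] := leqP m n0.
  rewrite big_nat_cond big1 ?lee_fin// => n /andP[/andP[_ nm] _].
  by apply: tz; rewrite ltn_eqF// (leq_trans nm).
rewrite big_mkord (bigD1 (Ordinal nm)) //= big1 ?adde0// => n nn0.
exact: tz.
Qed.

Let Hk_ge k t q : ncube k (cubeof k t) `<=` (fun t => O (rvec t)) ->
  rvecR q = (a (rvec t), r (rvec t)) ->
  ((coef k (cubeof k t))%:E <= Hk k q)%E.
Proof.
move=> qO qt; pose n0 := pickle (cubeof k t).
apply: le_trans (nneseries_lim_ge n0.+1 _); last by move=> n _ _; exact: term_ge0.
rewrite big_nat_recr //= [leRHS]addeC.
apply: le_trans (leeDl _ _); last by apply: sume_ge0 => n _; exact: term_ge0.
rewrite /term /n0 pickleK_inv indicE mem_set ?mulr1//.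
have -> : q = ([tuple a (rvec t) 0 i | i < d], r (rvec t)).
  case: q qt => q1 q2 [E1 ->]; congr pair; apply: eq_from_tnth => i.
  by rewrite tnth_mktuple -E1 mxE.
exact: in_abox (cubeof_in k t).
Qed.

(* Cut R^N into cubes of side len k; by Lip the chart maps each cube inside O into a box (abox)
   whose volume is (3 L)^N times larger, and Fatou's lemma refines the cubes. *)
Lemma chart_integral_le :
  (\int[(leb R d \x leb1)%E]_q (H (rvecR q))%:E <=
   ((3 * L) ^+ N)%:E * \int[leb R N]_t (G (rvec t))%:E)%E.
Proof.
have mG : measurable_fun setT (fun t : N.-tuple T => G (rvec t) : T).
  have -> : (fun t : N.-tuple T => G (rvec t)) = (G \o @rvec R N) \_ (@rvec R N @^-1` O).
    apply/funext => t; rewrite /patch; case: ifPn => //=.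
    by rewrite notin_setE => /GO.
  have mO : measurable (@rvec R N @^-1` O) by exact: measurable_rvec.
  apply/(measurable_restrict _ mO) => //; rewrite setTI.
  by apply: measurable_comp_open => //; exact: measurable_rvec.
have mnc k q : measurable (ncube k q) by exact: mbox.
have mterm k n : measurable_fun setT (term (abox k) k n).
  by apply: measurable_term => q; exact: mabox.
have mtermc k n : measurable_fun setT (term (ncube k) k n) by apply: measurable_term.
apply: (@fatou_le _ _ _ _ _ Hk).
- exact/measurable_EFinP.
- by move=> q; rewrite lee_fin.
- by move=> k; apply: ge0_emeasurable_sum => // n q _ _; exact: term_ge0.
- by move=> k q; apply: nneseries_ge0 => n _ _; exact: term_ge0.
- move=> q; have [->|[x Ox [Eq Hx]]] := HG (rvecR q).
    by apply: (@limn_einf_ge _ _ _ 0) => n _; apply: nneseries_ge0 => m _ _; exact: term_ge0.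
  apply: (@le_trans _ _ (G x)%:E); first by rewrite lee_fin.
  pose t : N.-tuple T := [tuple x 0 i | i < N].
  have tx : rvec t = x by apply/rowP => i; rewrite !mxE tnth_mktuple.
  apply/lee_addgt0Pr => e e0.
  rewrite -leeBlDr//.
  (* Once the side is below [dl], the cube around [x] lies in [O], where [Lip] applies, and its
     infimum is within [e] of [G x]. *)
  have /nbhs_normP[dl /= dl0 Hdl] : nbhs x [set y | O y /\ `|G x - G y| < e].
    apply: filterI; first exact: open_nbhs_nbhs.
    by have /cvgrPdist_lt := cG Ox; apply.
  have [M _ HM] := near_infty_natSinv_lt (PosNum dl0).
  apply: (@limn_einf_ge _ _ _ M) => k Mk.
  have close s : ncube k (cubeof k t) s -> O (rvec s) /\ `|G x - G (rvec s)| < e.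
    move=> sq; apply: Hdl => /=; apply: le_lt_trans (HM k Mk).
    rewrite -tx [leLHS]mx_normrE; apply: bigmax_le => [|[i j] _ /=]; first exact: ltW.
    rewrite !mxE; have := sq j; have := cubeof_in k t j; rewrite !in_itv /= => /andP[h1 h2] /andP[h3 h4].
    by rewrite ler_norml; apply/andP; split; rewrite -/(len k); lra.
  apply: (@le_trans _ _ (coef k (cubeof k t))%:E); last first.
    by apply: (Hk_ge (t := t)) => [s /close[]//|]; rewrite tx Eq.
  rewrite -EFinB lee_fin; apply: lb_le_inf.
    by exists (G (rvec t)); exists t => //; exact: cubeof_in.
  move=> _ [s /close[_]] + <-.
  by rewrite ltr_norml => /andP[h1 h2]; lra.
- move=> k; rewrite integral_nneseries //.
  under eq_eseriesr do rewrite int_term_box.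
  rewrite nneseriesZl; last by move=> n _; apply: integral_ge0 => t _; exact: term_ge0.
  rewrite -integral_nneseries //.
  apply: lee_wpmul2l; first by rewrite lee_fin exprn_ge0// mulr_ge0// ltW.
  apply: ge0_le_integral => //.
  + by move=> t _; apply: nneseries_ge0 => n _ _; exact: term_ge0.
  + by apply: ge0_emeasurable_sum => // n q _ _; exact: term_ge0.
  + exact/measurable_EFinP.
Qed.

End change_of_variables.

(** * Integrals depending on a parameter *)

Section param.
Context (R : realType) (N : nat).
Local Notation T := (measurableTypeR R).

Lemma Rint_tshift (v : 'I_N -> R) (g : N.-tuple T -> R) : measurable_fun setT g ->
  \int[leb R N]_t g (tshift v t) = \int[leb R N]_t g t.
Proof.
move=> mg; rewrite /Rintegral [in LHS]integralE [in RHS]integralE.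
have mE : measurable_fun setT (EFin \o g) by exact/measurable_EFinP.
have -> : (\int[leb R N]_x (fun t => (g (tshift v t))%:E)^\+ x = \int[leb R N]_x (EFin \o g)^\+ x)%E.
  rewrite -(ge0_integral_tshift v (measurable_funepos mE)) //.
  by apply: eq_integral => t _; rewrite !funeposE.
have -> : (\int[leb R N]_x (fun t => (g (tshift v t))%:E)^\- x = \int[leb R N]_x (EFin \o g)^\- x)%E.
  rewrite -(ge0_integral_tshift v (measurable_funeneg mE)) //.
  by apply: eq_integral => t _; rewrite !funenegE.
by [].
Qed.

Variables (f : R -> N.-tuple T -> R) (s0 e M L : R).
Hypothesis e0 : 0 < e.
Hypothesis L0 : 0 < L.
Hypothesis mf : forall s, `|s - s0| < e -> measurable_fun setT (f s : N.-tuple T -> T).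
Hypothesis fM : forall s y, `|s - s0| < e -> `|f s y| <= M.
Hypothesis fL : forall s y, `|s - s0| < e -> (exists i, L < `|tnth y i|) -> f s y = 0.

Let I_in s : (`]s0 - e, s0 + e[%classic : set R) s -> `|s - s0| < e.
Proof. by rewrite /= in_itv /= => /andP[h1 h2]; rewrite ltr_norml; apply/andP; split; lra. Qed.

Let s0_in : (`]s0 - e, s0 + e[%classic : set R) s0.
Proof. by rewrite /= in_itv /= ltrBlDr ltrDl e0. Qed.

Lemma param_bbs s : `|s - s0| < e -> bbs (f s).
Proof.
move=> se; split; [split; [exact: mf|by exists M => y; exact: fM]|].
by exists L => // y; exact: fL.
Qed.

(** A common dominating function: [M] bounds [f] and later its derivative in the parameter, [B]
    bounds [h], and everything vanishes off one fixed box. *)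
Let dom B (y : N.-tuple T) : R := (M * B) * \1_(tbox L) y.

Let dom_int B : (leb R N).-integrable setT (EFin \o dom B).
Proof.
apply: bms_integrable; apply: bmsZ; split; [split|exists (tbox L); split].
- apply: measurable_indic; exact: measurable_tbox.
- by exists 1 => y; rewrite indicE; case: (_ \in _); rewrite ?normr0 ?normr1.
- exact: measurable_tbox.
- by apply: (eq_ind_r (fun z => z < +oo)%E _ (leb_tbox N L0)); rewrite ltry.
- by move=> y ny; rewrite indicE memNset.
Qed.

Let dom_le B (g h : N.-tuple T -> R) y : 0 <= B -> `|h y| <= B -> `|g y| <= M ->
  ((exists i, L < `|tnth y i|) -> g y = 0) -> `|g y * h y| <= dom B y.
Proof.
move=> B0 hB gM gL; rewrite /dom indicE.
have [yt|/[dup] /ntbox/gL -> ny] := pselect (tbox L y).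
  by rewrite mem_set// mulr1 normrM; apply: ler_pM.
by rewrite mul0r normr0 memNset// mulr0.
Qed.

Variables (h : N.-tuple T -> R).
Hypothesis bh : bdm h.

Lemma continuous_param_int : (forall y, {for s0, continuous (f ^~ y)}) ->
  (forall s y, `|s - s0| < e -> {for s, continuous (f ^~ y)}) ->
  {for s0, continuous (fun s => \int[leb R N]_y (f s y * h y))}.
Proof.
move=> _ cf; have [mh [B hB]] := bh.
have B0 : 0 <= B by apply: le_trans (hB [tuple of nseq N 0]).
have := @continuity_under_integral R _ _ (leb R N) (fun s y => f s y * h y) setT measurableT
  (s0 - e) (s0 + e) _ _ (dom B) (dom_int B) _ s0.
apply.
- move=> s /I_in se; apply: bms_integrable; apply: bmsMr => //.
  exact/bbs_bms/param_bbs.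
- apply: aeW => y _ s /set_mem /I_in se; apply: cvgM; last exact: cvg_cst.
  exact: cf.
- move=> s /I_in se; apply: aeW => y _; apply: dom_le => //; [exact: fM|exact: fL].
- exact/mem_set/s0_in.
Qed.

Hypothesis df : forall s y, `|s - s0| < e -> derivable (f ^~ y) s 1.
Hypothesis dfM : forall s y, `|s - s0| < e -> `|'D_1 (f ^~ y) s| <= M.

Let dfL s y : `|s - s0| < e -> (exists i, L < `|tnth y i|) -> 'D_1 (f ^~ y) s = 0.
Proof.
move=> se yL; transitivity ('D_(1 : R) (cst (0 : R)) s); last exact: derive_cst.
apply: near_eq_derive => //.
have : nbhs s [set x | `|x - s0| < e].
  apply/nbhs_norm; exists (e - `|s - s0|); first by rewrite subr_gt0.
  move=> x xs; rewrite /= -[x - s0](subrKA s) (le_lt_trans (ler_normD _ _))//; lra.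
by apply: filterS => x xe; rewrite fL.
Qed.

Lemma is_derive_param_int :
  is_derive s0 1 (fun s => \int[leb R N]_y (f s y * h y))
    (\int[leb R N]_y ('D_1 (f ^~ y) s0 * h y)).
Proof.
have [mh [B hB]] := bh.
have B0 : 0 <= B by apply: le_trans (hB [tuple of nseq N 0]).
have M0 : 0 <= M.
  apply: le_trans (fM (s := s0) [tuple of nseq N 0] _) => //.
  by rewrite subrr normr0.
have ee : `|s0 - s0| < e by rewrite subrr normr0.
have dfh s y : `|s - s0| < e ->
   is_derive s 1 (fun s => f s y * h y) ('D_1 (f ^~ y) s * h y).
  move=> se; have /derivableP H := @df s y se.
  have -> : (fun s => f s y * h y) = h y \*: (f ^~ y) by apply/funext => x; rewrite mulrC.
  by apply: is_derive_eq; rewrite mulrC.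
have p1 s y : `|s - s0| < e -> partial1of2 (fun s y => f s y * h y) s y = 'D_1 (f ^~ y) s * h y.
  by move=> se; rewrite partial1of2E; have [_ ->] := dfh s y se.
have A1 s : (`]s0 - e, s0 + e[%classic : set R) s ->
    (leb R N).-integrable setT (EFin \o (fun y => f s y * h y)).
  move=> /I_in se; apply: bms_integrable; apply: bmsMr => //.
  exact/bbs_bms/param_bbs.
have A2 s y : (`]s0 - e, s0 + e[%classic : set R) s -> setT y -> derivable ((fun s y => f s y * h y) ^~ y) s 1.
  by move=> /I_in se _; have [] := dfh s y se.
have A3 y : 0 <= dom B y by rewrite /dom mulr_ge0// mulr_ge0.
have A4 s y : (`]s0 - e, s0 + e[%classic : set R) s -> setT y ->
    `|partial1of2 (fun s y => f s y * h y) s y| <= dom B y.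
  move=> /I_in se _; rewrite p1//; apply: (dom_le (g := fun y => 'D_1 (f ^~ y) s)) => //; first exact: dfM.
  exact: dfL.
have D1 := @derivable_under_integral R _ _ (leb R N) _ setT measurableT s0 _ _ s0_in A1 A2 _ A3 (dom_int B) A4.
have D2 := @differentiation_under_integral R _ _ (leb R N) _ setT measurableT s0 _ _ s0_in A1 A2 _ A3 (dom_int B) A4.
split => //; rewrite -derive1E D2; apply: eq_Rintegral => y _; exact: p1.
Qed.

End param.

Lemma derive_trig_comb (R : realType) (c A B : R) :
  'D_1 (fun x : R => cos (x * c) * A + sin (x * c) * B) 0 = c * B.
Proof.
rewrite derive_val /GRing.scale /= mul0r sin0 cos0; ring.
Qed.

(** * Transforms of derivatives of compactly supported functions *)

Section C1c.
Context (R : realType).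
Local Notation T := (measurableTypeR R).

Definition C1c N (p : 'rV[R]_N -> R) :=
  [/\ continuous p, forall k (x : 'rV[R]_N), derivable p x (delta_mx 0 k), forall k, continuous (pd k p) &
      exists2 L : R, 0 < L & forall x : 'rV[R]_N, (exists i, L < `|x 0 i|) -> p x = 0].

Lemma bounded_compact_supp N (g : 'rV[R]_N -> R) (L : R) : continuous g -> 0 < L ->
  (forall x : 'rV[R]_N, (exists i, L < `|x 0 i|) -> g x = 0) -> exists2 B : R, 0 <= B & forall x, `|g x| <= B.
Proof.
move=> cg L0 gL.
have [||c _ Hc] := @compact_EVT_max _ R (fun x => `|g x|) [set x | `|x - 0| <= L] _ (@compact_ball_rV R N 0 L).
- by exists 0; rewrite /= subrr normr0 ltW.
- apply: continuous_subspaceT => x; apply: continuous_comp; [exact: cg|exact: norm_continuous].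
exists `|g c| => // x; have [xL|Lx] := leP `|x| L; first by apply: Hc; rewrite inE /= subr0.
rewrite gL ?normr0//; apply/not_existsP => H.
move: Lx; rewrite ltNge => /negP; apply; apply: norm_le_coord => [|i]; first exact: ltW.
by rewrite leNgt; apply/negP; exact: H.
Qed.

Lemma pd_supp N k (p : 'rV[R]_N -> R) (L : R) :
  (forall x : 'rV[R]_N, (exists i, L < `|x 0 i|) -> p x = 0) ->
  forall x : 'rV[R]_N, (exists i, L < `|x 0 i|) -> pd k p x = 0.
Proof.
move=> pL x [i xi]; transitivity ('D_(delta_mx 0 k) (cst (0 : R)) x); last exact: derive_cst.
apply: near_eq_derive.
apply/nbhs_norm; exists (`|x 0 i| - L); first by rewrite subr_gt0.
move=> y yx; rewrite pL//; exists i.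
have := coord_le_norm (y - x) i; rewrite !mxE => H.
have := ler_normD (x 0 i - y 0 i) (y 0 i); rewrite subrK distrC; lra.
Qed.

Lemma continuous_measurable_rvec N (g : 'rV[R]_N -> R) : continuous g ->
  measurable_fun setT (fun t : N.-tuple T => g (rvec t) : T).
Proof.
move=> cg; have := @measurable_comp_open R _ (N.-tuple T) _ (@rvec R N) g setT.
rewrite preimage_setT; apply; [exact: measurable_rvec|exact: openT|by move=> x _; exact: cg].
Qed.

Lemma cont_supp_bbs N (g : 'rV[R]_N -> R) (L : R) : continuous g -> 0 < L ->
  (forall x : 'rV[R]_N, (exists i, L < `|x 0 i|) -> g x = 0) -> bbs (fun t : N.-tuple T => g (rvec t)).
Proof.
move=> cg L0 gL; have [B B0 HB] := bounded_compact_supp cg L0 gL.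
split; [split; [exact: continuous_measurable_rvec|by exists B => x; exact: HB]|].
by exists L => // x [i xi]; apply: gL; exists i; rewrite mxE.
Qed.

Lemma C1c_bbs N (p : 'rV[R]_N -> R) : C1c p -> bbs (fun t : N.-tuple T => p (rvec t)).
Proof. by move=> [cp _ _ [L L0 pL]]; exact: (cont_supp_bbs cp L0). Qed.

Lemma C1c_pd_bbs N k (p : 'rV[R]_N -> R) : C1c p -> bbs (fun t : N.-tuple T => pd k p (rvec t)).
Proof.
by move=> [_ _ cp [L L0 pL]]; apply: (cont_supp_bbs (cp k) L0); exact: pd_supp.
Qed.

(** Translation turns [pd k] into a derivative in the real variable [s]. Combined with translation
    invariance of the integral, it yields [tr_pd], integration by parts and the symmetry of mixed
    derivatives. *)
Lemma C1c_translate N k (p : 'rV[R]_N -> R) (h : N.-tuple T -> R) : C1c p -> bdm h ->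
  is_derive (0 : R) 1 (fun s : R => \int[leb R N]_y (p (rvec y + s *: delta_mx 0 k) * h y))
    (\int[leb R N]_y (pd k p (rvec y) * h y)).
Proof.
move=> pC bh; have [cp dp cdp [L L0 pL]] := pC.
have [B1 B10 HB1] := bounded_compact_supp cp L0 pL.
have [B2 B20 HB2] := bounded_compact_supp (cdp k) L0 (@pd_supp N k p L pL).
have D (s : R) (y : N.-tuple T) : is_derive s 1 (fun s : R => p (rvec y + s *: delta_mx 0 k))
    (pd k p (rvec y + s *: delta_mx 0 k)).
  by apply: is_derive_line; exact: dp.
(* Translates by [|s| < 1] have their support in the cube of half-width [L + 1]. *)
have L1 : 0 < L + 1 by rewrite addr_gt0.
have := @is_derive_param_int R N (fun s y => p (rvec y + s *: delta_mx 0 k)) 0 1 (Num.max B1 B2) (L + 1)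
  ltr01 L1 _ _ _ h bh _ _.
have -> : (fun y : N.-tuple T => 'D_1 (fun s : R => p (rvec y + s *: delta_mx 0 k)) 0 * h y) =
    (fun y => pd k p (rvec y) * h y).
  by apply/funext => y; have [_ ->] := D 0 y; rewrite scale0r addr0.
apply.
- move=> s _.
  have -> : (fun y : N.-tuple T => p (rvec y + s *: delta_mx 0 k)) =
     (fun y => p (rvec (tshift (fun i => s * (i == k)%:R) y))).
    apply/funext => y; rewrite rvec_tshift; congr p; congr (_ + _).
    by apply/rowP => i; rewrite !mxE eqxx.
  apply: (measurableT_comp (continuous_measurable_rvec cp)); exact: measurable_tshift.
- by move=> s y _; rewrite le_max HB1.
- move=> s y; rewrite subr0 => s1 [i yi]; apply: pL; exists i; rewrite !mxE eqxx /=.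
  have : `|s * (i == k)%:R| <= 1.
    by rewrite normrM; case: (i == k); rewrite ?normr1 ?normr0 ?mulr1 ?mulr0// ltW.
  have := ler_normB (tnth y i + s * (i == k)%:R) (s * (i == k)%:R); rewrite addrK; lra.
- by move=> s y _; have [] := D s y.
- by move=> s y _; have [_ ->] := D s y; rewrite le_max HB2 orbT.
Qed.

Lemma tdot_shift N k (s : R) (x y : N.-tuple T) :
  tdot (tshift (fun i => s * (i == k)%:R) x) y = tdot x y + s * tnth y k.
Proof.
rewrite !tdot_sum.
under eq_bigr do rewrite tnth_mktuple mulrDl.
rewrite big_split /=; congr (_ + _).
rewrite (bigD1 k) //= eqxx mulr1 big1 ?addr0// => i ik.
by rewrite (negbTE ik) mulr0 mul0r.
Qed.

(** Translating [p] by [s] along [e_k] rotates the pair of cosine and sine transforms by the angle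
    [s y_k]; differentiate the rotation at [s = 0]. *)
Lemma tr_pd N k (p : 'rV[R]_N -> R) (y : N.-tuple T) : C1c p ->
  tr true (fun t => pd k p (rvec t)) y = tnth y k * tr false (fun t => p (rvec t)) y /\
  tr false (fun t => pd k p (rvec t)) y = - (tnth y k * tr true (fun t => p (rvec t)) y).
Proof.
move=> pC.
have bp := C1c_bbs pC.
pose P b := tr b (fun t : N.-tuple T => p (rvec t)) y.
have trl b s : \int[leb R N]_x (p (rvec x + s *: delta_mx 0 k) * ct b (tdot x y)) =
   if b then cos (s * tnth y k) * P true + sin (s * tnth y k) * P false
   else cos (s * tnth y k) * P false - sin (s * tnth y k) * P true.
  pose g (x : N.-tuple T) := p (rvec x) * ct b (tdot x y - s * tnth y k).
  have mg : measurable_fun setT g.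
    apply: measurable_funM; first by case: bp => -[].
    apply: (measurableT_comp (ct_measurable b)); apply: measurable_funB => //.
    exact: measurable_tdot.
  transitivity (\int[leb R N]_x g x).
    rewrite -(Rint_tshift (fun i => s * (i == k)%:R) mg); apply: eq_Rintegral => x _.
    rewrite /g tdot_shift addrK rvec_tshift; congr (p _ * _); congr (_ + _).
    by apply/rowP => i; rewrite !mxE eqxx.
  rewrite /g; case: b {g mg} => /=.
    under eq_Rintegral do rewrite cosB mulrDr.
    have E x : p (rvec x) * (cos (tdot x y) * cos (s * tnth y k)) +
       p (rvec x) * (sin (tdot x y) * sin (s * tnth y k)) =
       cos (s * tnth y k) * (ct true (tdot x y) * p (rvec x)) +
       sin (s * tnth y k) * (ct false (tdot x y) * p (rvec x)) by rewrite /ct; ring.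
    under eq_Rintegral do rewrite E.
    by rewrite bms_RintD ?bms_RintZ//; try (apply: bmsZ); exact: bms_tr.
  under eq_Rintegral do rewrite sinB mulrBr.
  have E x : p (rvec x) * (sin (tdot x y) * cos (s * tnth y k)) -
     p (rvec x) * (cos (tdot x y) * sin (s * tnth y k)) =
     cos (s * tnth y k) * (ct false (tdot x y) * p (rvec x)) -
     sin (s * tnth y k) * (ct true (tdot x y) * p (rvec x)) by rewrite /ct; ring.
  under eq_Rintegral do rewrite E.
  by rewrite bms_RintB ?bms_RintZ//; try (apply: bmsZ); exact: bms_tr.
have Dtr b : is_derive (0 : R) 1 (fun s : R => \int[leb R N]_x (p (rvec x + s *: delta_mx 0 k) * ct b (tdot x y)))
   (tr b (fun t => pd k p (rvec t)) y).
  rewrite /tr; under eq_Rintegral do rewrite mulrC.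
  by apply: C1c_translate => //; exact: bdm_cttdot.
split.
- have [_ <-] := Dtr true; under eq_fun do rewrite (trl true).
  exact: derive_trig_comb.
- have [_ <-] := Dtr false; under eq_fun do rewrite (trl false) -mulrN.
  by rewrite derive_trig_comb mulrN.
Qed.

End C1c.

(** * Hardy's inequality at a fixed frequency *)

Section hardy.
Context (R : realType).
Local Notation T := (measurableTypeR R).
Local Notation leb1 := (@lebesgue_measure R).
Implicit Types (g : R -> R).

Lemma FTC_Rint (F f : R -> R) (a b : R) : a < b ->
  (forall s, s \in `[a, b] -> is_derive s 1 F (f s)) ->
  (forall s, s \in `[a, b] -> {for s, continuous f}) ->
  \int[leb1]_(s in `[a, b]) f s = F b - F a.
Proof.
move=> ab dF cf.
have a_in : a \in `[a, b] by rewrite in_itv /= lexx ltW.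
have b_in : b \in `[a, b] by rewrite in_itv /= lexx ltW.
rewrite /Rintegral (continuous_FTC2 (F := F) ab) //=.
- by apply: continuous_in_subspaceT => s /set_mem; exact: cf.
- split.
  + by move=> s /subset_itv_oo_cc /dF[].
  + by apply: cvg_at_right_filter; apply: derivable_cvg; have [] := dF a a_in.
  + by apply: cvg_at_left_filter; apply: derivable_cvg; have [] := dF b b_in.
- by move=> s /subset_itv_oo_cc /dF[_ <-]; rewrite derive1E.
Qed.

Lemma continuous_int_cc (h : R -> R) (a b : R) : (forall s, s \in `[a, b] -> {for s, continuous h}) ->
  leb1.-integrable `[a, b]%classic (EFin \o h).
Proof.
move=> ch; apply: continuous_compact_integrable; first exact: segment_compact.
by apply: continuous_in_subspaceT => s /set_mem; exact: ch.
Qed.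

Lemma sqsq_ge0 (x y : R) : 0 <= x ^+ 2 * y ^+ 2.
Proof. by apply: mulr_ge0; exact: sqr_ge0. Qed.

Variables (g : R -> R) (S : R).
Hypothesis dg : forall s : R, s < 0 -> derivable g s 1.
Hypothesis cdg : forall s : R, s < 0 -> {for s, continuous ('D_1 g)}.
Hypothesis gS : forall s : R, s <= - S -> g s = 0.
Let g' := 'D_1 g.

Let cg (s : R) : s < 0 -> {for s, continuous g}.
Proof. by move=> s0; apply: derivable_cvg; exact: dg. Qed.

Let dphi (s : R) : s < 0 -> is_derive s 1 (fun s : R => g s ^+ 2) (2 * g s * g' s).
Proof.
move=> s0; have /derivableP H := @dg s s0.
have E : (fun s : R => g s ^+ 2) = g * g by apply/funext => t; rewrite expr2.
by rewrite E; apply: is_derive_eq; rewrite /GRing.scale /= -/g' -mulrDl -mulr2n mulr_natl.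
Qed.

(* Integrating (s g^2)' and absorbing half of g^2. *)
Let hardy_near (c e : R) : 0 < e -> e < c ->
  (\int[leb1]_(s in `[(- c)%R, (- e)%R]) (g s ^+ 2)%:E <=
   \int[leb1]_(s in `[(- c)%R, (- e)%R]) (4 * (s ^+ 2 * g' s ^+ 2))%:E + (2 * (c * g (- c) ^+ 2))%:E)%E.
Proof.
move=> e0 ec.
have neg (s : R) : s \in `[- c, - e] -> s < 0 by rewrite in_itv /= => /andP[_ h]; lra.
have ce : - c < - e by lra.
have cid (s : R) : {for s, continuous (fun s : R => s)} by exact: cvg_id.
have cg2 (s : R) : s < 0 -> {for s, continuous (fun s : R => g s ^+ 2)}.
  by move=> s0; apply: cvgM; exact: cg.
have c1 (s : R) : s < 0 -> {for s, continuous (fun s : R => s ^+ 2 * g' s ^+ 2)}.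
  by move=> s0; do 2 ?apply: cvgM => //; try exact: cvg_id; exact: cdg.
have c2 (s : R) : s < 0 -> {for s, continuous (fun s : R => g s ^+ 2 + s * (2 * g s * g' s))}.
  move=> s0; apply: cvgD; first exact: cg2.
  apply: cvgM; first exact: cvg_id.
  apply: cvgM; last exact: cdg.
  by apply: cvgM; [exact: cvg_cst|exact: cg].
have dsphi (s : R) : s < 0 -> is_derive s 1 (fun s : R => s * g s ^+ 2) (g s ^+ 2 + s * (2 * g s * g' s)).
  move=> s0; have H := dphi s0.
  by apply: is_derive_eq; rewrite /GRing.scale /= mulr1 addrC.
have i1 : leb1.-integrable `[- c, - e]%classic (EFin \o (fun s : R => g s ^+ 2)).
  by apply: continuous_int_cc => s /neg; exact: cg2.
have i2 : leb1.-integrable `[- c, - e]%classic (EFin \o (fun s : R => 4 * (s ^+ 2 * g' s ^+ 2))).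
  by apply: continuous_int_cc => s /neg s0; apply: cvgM; [exact: cvg_cst|exact: c1].
have i3 : leb1.-integrable `[- c, - e]%classic (EFin \o (fun s : R => g s ^+ 2 + s * (2 * g s * g' s))).
  by apply: continuous_int_cc => s /neg; exact: c2.
have E := FTC_Rint ce (fun s hs => dsphi s (neg s hs)) (fun s hs => c2 s (neg s hs)).
have : \int[leb1]_(s in `[- c, - e]) g s ^+ 2 <=
    \int[leb1]_(s in `[- c, - e]) (4 * (s ^+ 2 * g' s ^+ 2) + 2 * (g s ^+ 2 + s * (2 * g s * g' s))).
  apply: le_Rintegral => //.
    apply: continuous_int_cc => s /neg s0; apply: cvgD; apply: cvgM; try exact: cvg_cst.
      exact: c1.
    exact: c2.
  by move=> s _; have := sqr_ge0 (g s + 2 * s * g' s); nra.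
rewrite RintegralD //; last first.
  by apply: continuous_int_cc => s /neg s0; apply: cvgM; [exact: cvg_cst|exact: c2].
rewrite (RintegralZl 2) // E => H.
have fin h : leb1.-integrable `[- c, - e]%classic (EFin \o h) ->
   (\int[leb1]_(s in `[(- c)%R, (- e)%R]) (h s)%:E)%E = (\int[leb1]_(s in `[- c, - e]) h s)%:E.
  by move=> ih; rewrite /Rintegral fineK// integrable_fin_num.
rewrite (fin _ i1) (fin _ i2) -EFinD lee_fin; apply: le_trans H _.
rewrite lerD2l; have := sqr_ge0 (g (- e)); nra.
Qed.

(** As [g] vanishes at [- S], the left-hand side is the integral of [2 c g g'] over [[- S, - c]],
    and [2 c g g' <= g^2 + c^2 g'^2]. *)
Let hardy_far (c : R) : 0 < c ->
  ((c * g (- c) ^+ 2)%:E <=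
    \int[leb1]_(s in `]-oo, (- c)%R]) (g s ^+ 2 + c ^+ 2 * g' s ^+ 2)%:E)%E.
Proof.
move=> c0.
have I0 (D : set T) : (0 <= \int[leb1]_(s in D) (g s ^+ 2 + c ^+ 2 * g' s ^+ 2)%:E)%E.
  apply: integral_ge0 => s _; rewrite lee_fin; apply: addr_ge0; first exact: sqr_ge0.
  by apply: mulr_ge0; exact: sqr_ge0.
have [Sc|cS] := leP S c.
  by rewrite gS ?lerN2// expr0n /= mulr0.
have neg (s : R) : s \in `[- S, - c] -> s < 0 by rewrite in_itv /= => /andP[_ h]; lra.
have Sc : - S < - c by lra.
have c1 (s : R) : s < 0 -> {for s, continuous (fun s : R => 2 * g s * g' s)}.
  move=> s0; apply: cvgM; last exact: cdg.
  by apply: cvgM; [exact: cvg_cst|exact: cg].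
have c2 (s : R) : s < 0 -> {for s, continuous (fun s : R => g s ^+ 2 + c ^+ 2 * g' s ^+ 2)}.
  move=> s0; apply: cvgD; first by apply: cvgM; exact: cg.
  by apply: cvgM; [exact: cvg_cst|apply: cvgM; exact: cdg].
have E := FTC_Rint Sc (fun s hs => dphi (neg s hs)) (fun s hs => c1 s (neg s hs)).
rewrite (gS (lexx _)) expr0n subr0 in E.
have i2 : leb1.-integrable `[- S, - c]%classic (EFin \o (fun s : R => g s ^+ 2 + c ^+ 2 * g' s ^+ 2)).
  by apply: continuous_int_cc => s /neg; exact: c2.
apply: (@le_trans _ _ (\int[leb1]_(s in `[(- S)%R, (- c)%R]) (g s ^+ 2 + c ^+ 2 * g' s ^+ 2)%:E)%E).
  have -> : (\int[leb1]_(s in `[(- S)%R, (- c)%R]) (g s ^+ 2 + c ^+ 2 * g' s ^+ 2)%:E)%E =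
     (\int[leb1]_(s in `[- S, - c]) (g s ^+ 2 + c ^+ 2 * g' s ^+ 2))%:E.
    by rewrite /Rintegral fineK// integrable_fin_num.
  rewrite lee_fin -E -RintegralZl //; last by apply: continuous_int_cc => s /neg; exact: c1.
  apply: le_Rintegral => //.
    by apply: continuous_int_cc => s /neg s0; apply: cvgM; [exact: cvg_cst|exact: c1].
  by move=> s _; have := sqr_ge0 (g s - c * g' s); nra.
have mo : measurable_fun `]-oo, (0:R)[%classic (fun s : T => (g s ^+ 2 + c ^+ 2 * g' s ^+ 2)%:E).
  apply/measurable_EFinP; apply: open_continuous_measurable_fun; first exact: interval_open.
  by move=> s /set_mem /=; rewrite in_itv /=; exact: c2.
apply: ge0_subset_integral => //.
- apply: measurable_funS mo => // s /=; rewrite !in_itv /=; lra.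
- move=> s _; rewrite lee_fin; apply: addr_ge0; first exact: sqr_ge0.
  by apply: mulr_ge0; exact: sqr_ge0.
- by move=> s /=; rewrite !in_itv /= => /andP[].
Qed.

Lemma measurable_neg (h : R -> R) (D : set T) : (forall s : R, s < 0 -> {for s, continuous h}) ->
  measurable D -> D `<=` `]-oo, (0:R)[%classic -> measurable_fun D (fun s : T => (h s)%:E).
Proof.
move=> ch mD Dneg; apply/measurable_EFinP; apply: (@measurable_funS _ _ _ _ `]-oo, (0:R)[%classic) => //.
apply: open_continuous_measurable_fun; first exact: interval_open.
by move=> s /set_mem /=; rewrite in_itv /=; exact: ch.
Qed.

(** In [hardy_near] the end point [- e] contributes [- 2 e g(- e)^2], which is dropped, so no
    boundary value at 0 enters and [e] can tend to 0. The value at [- c] is paid for by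
    [hardy_far]. *)
Lemma hardy (c : R) : 0 < c ->
  (\int[leb1]_(s in `[(- c)%R, 0%R[) (g s ^+ 2)%:E <=
   4%:E * \int[leb1]_(s in `[(- c)%R, 0%R[) (s ^+ 2 * g' s ^+ 2)%:E +
   2%:E * \int[leb1]_(s in `]-oo, (- c)%R]) (g s ^+ 2 + c ^+ 2 * g' s ^+ 2)%:E)%E.
Proof.
move=> c0.
have cg2 (s : R) : s < 0 -> {for s, continuous (fun s : R => g s ^+ 2)}.
  by move=> s0; apply: cvgM; exact: cg.
have c1 (s : R) : s < 0 -> {for s, continuous (fun s : R => s ^+ 2 * g' s ^+ 2)}.
  by move=> s0; do 2 ?apply: cvgM => //; try exact: cvg_id; exact: cdg.
(* [n.+2] keeps [c / n.+2] strictly below [c], as [hardy_near] asks, from the first index on. *)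
pose F (n : nat) : set T := `[- c, - (c / n.+2%:R)]%classic.
have n2 (n : nat) : 0 < c / n.+2%:R by rewrite divr_gt0.
have FU : \bigcup_n F n = `[- c, 0[%classic.
  apply/seteqP; split=> s /=.
    move=> [n _]; rewrite /F /= !in_itv /= => /andP[-> h] /=.
    by apply: le_lt_trans h _; rewrite oppr_lt0.
  rewrite in_itv /= => /andP[h1 h2].
  pose n := Num.truncn (c / (- s)).
  exists n => //; rewrite /F /= in_itv /= h1 /= lerNr.
  have s0 : 0 < - s by lra.
  rewrite ler_pdivrMr// -ler_pdivrMl// mulrC ltW//.
  apply: lt_trans (_ : n.+1%:R < n.+2%:R); last by rewrite ltr_nat.
  exact: truncnS_gt.
have Fneg n : F n `<=` `]-oo, (0:R)[%classic.
  by move=> s; rewrite /F /= !in_itv /= => /andP[_ h]; apply: le_lt_trans h _; rewrite oppr_lt0.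
have mF n : measurable (F n) by exact: measurable_itv.
have := @ge0_nondecreasing_set_cvg_integral _ _ _ F (fun s => (g s ^+ 2)%:E) leb1.
rewrite FU => /(_ _ _ _ _)/cvg_lim <- //.
- apply: lime_le.
    apply: ereal_nondecreasing_is_cvgn => m n mn.
    apply: ge0_subset_integral => //.
    + exact: (measurable_neg cg2).
    + by move=> x _; rewrite lee_fin sqr_ge0.
    apply: subset_itv; rewrite bnd_simp// lerN2 ler_pM2l// lef_pV2 ?posrE// ler_nat//.
  apply: nearW => n.
  apply: (le_trans (hardy_near (n2 n) _)).
    by rewrite ltr_pdivrMr// ltr_pMr// ltr1n.
  apply: leeD.
    under eq_integral do rewrite EFinM.
    rewrite ge0_integralZl_EFin //; last 2 first.
    + by move=> s _; rewrite lee_fin; exact: sqsq_ge0.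
    + by apply: (measurable_neg c1); [exact: measurable_itv|exact: (Fneg n)].
    apply: lee_wpmul2l => //; apply: ge0_subset_integral => //.
    + by apply: (measurable_neg c1) => //; move=> s /=; rewrite !in_itv /= => /andP[].
    + by move=> s _; rewrite lee_fin; exact: sqsq_ge0.
    + by move=> s /=; rewrite /F /= !in_itv /= => /andP[-> h]; apply: le_lt_trans h _; rewrite oppr_lt0.
  by rewrite EFinM; apply: lee_wpmul2l => //; exact: hardy_far.
- move=> m n mn; apply/subsetPset; apply: subset_itv; rewrite bnd_simp// lerN2 ler_pM2l// lef_pV2 ?posrE// ler_nat//.
- by move=> n; exact: (measurable_neg cg2).
- by move=> n x _; rewrite lee_fin sqr_ge0.
Qed.

End hardy.

Section frequency.
Context (R : realType) (f : R -> R).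
Local Notation T := (measurableTypeR R).
Local Notation leb1 := (@lebesgue_measure R).
Hypothesis f0 : forall t : R, 0 < t -> 0 <= f t.
Hypothesis f_incr : increasing_pos f.
Hypothesis f_decr : decreasing_pos (fun t => f t / t).
Hypothesis cf : forall t : R, 0 < t -> {for t, continuous f}.

(* (s f(1/s))^2 for s = - r. *)
Definition wgt (r : R) : R := (- r * f (- r)^-1) ^+ 2.

Lemma wgt_ge0 r : 0 <= wgt r. Proof. exact: sqr_ge0. Qed.

Lemma wgt_continuous (r : R) : r < 0 -> {for r, continuous wgt}.
Proof.
move=> r0; have r0' : 0 < - r by lra.
have H : {for r, continuous (fun r : R => - r * f (- r)^-1)}.
  apply: cvgM; first by apply: cvgN; exact: cvg_id.
  apply: (@continuous_comp _ _ _ (fun r : R => (- r)^-1) f); last first.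
    by apply: cf; rewrite invr_gt0.
  by apply: cvgV; [rewrite gt_eqF|apply: cvgN; exact: cvg_id].
by apply: cvgM.
Qed.

(** Here [l <= 1/(- r)] and [f] increases. *)
Lemma wgt_near (l r : R) : 0 < l -> r < 0 -> - r <= l^-1 -> f l ^+ 2 * r ^+ 2 <= wgt r.
Proof.
move=> l0 r0 rl; have r0' : 0 < - r by lra.
have : f l <= f (- r)^-1 by apply: f_incr => //; rewrite -[l]invrK lef_pV2 ?posrE ?invr_gt0.
rewrite /wgt exprMn sqrrN mulrC => H; apply: ler_wpM2l; first exact: sqr_ge0.
by rewrite lerXn2r ?nnegrE ?f0 ?invr_gt0.
Qed.

(** Here [1/(- r) <= l] and [f t / t] decreases. *)
Lemma wgt_far (l r : R) : 0 < l -> r <= - l^-1 -> f l ^+ 2 * (l^-1) ^+ 2 <= wgt r.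
Proof.
move=> l0 rl; have li : 0 < l^-1 by rewrite invr_gt0.
have r0' : 0 < - r by lra.
have : f l / l <= f (- r)^-1 / (- r)^-1.
  by apply: f_decr; rewrite ?invr_gt0// -[l]invrK lef_pV2 ?posrE ?invr_gt0//; lra.
rewrite invrK /wgt -exprMn => H.
by rewrite [X in _ <= X ^+ 2]mulrC lerXn2r ?nnegrE ?mulr_ge0 ?f0 ?invr_gt0// ltW.
Qed.

Lemma f_scale (l m : R) : 0 < l -> l <= m -> f m <= m / l * f l.
Proof.
move=> l0 lm; have m0 : 0 < m by exact: lt_le_trans lm.
have := f_decr l0 lm; rewrite ler_pdivrMr// => h.
by apply: le_trans h _; rewrite le_eqVlt; apply/orP; left; apply/eqP; ring.
Qed.

Variables (g : R -> R) (S x2 : R).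
Hypothesis S0 : 0 < S.
Hypothesis x20 : 0 <= x2.
Hypothesis dg : forall s : R, s < 0 -> derivable g s 1.
Hypothesis cdg : forall s : R, s < 0 -> {for s, continuous ('D_1 g)}.
Hypothesis gS : forall s : R, s <= - S -> g s = 0.

Let near_alg (F s2 d2 w q : R) : 0 <= d2 -> 0 <= q -> 0 <= x2 -> 0 <= w -> F * s2 <= w ->
  F * 4 * (s2 * d2) <= 4 * (w * (d2 + x2 * q)).
Proof.
move=> d0 q0 x0 w0 h.
have h1 : (F * s2) * d2 <= w * d2 by exact: ler_wpM2r.
have h2 : 0 <= w * (x2 * q) by apply: mulr_ge0 => //; exact: mulr_ge0.
lra.
Qed.

Let far_alg (F c2 d2 w q : R) : 0 <= d2 -> 0 <= q -> 0 <= x2 -> 0 <= w -> F * c2 <= w ->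
  F * q <= x2 * (w * q) -> F * q + F * 2 * (q + c2 * d2) <= 4 * (w * (d2 + x2 * q)).
Proof.
move=> d0 q0 x0 w0 h hq.
have h1 : (F * c2) * d2 <= w * d2 by exact: ler_wpM2r.
have h2 : 0 <= x2 * (w * q) by apply: mulr_ge0 => //; exact: mulr_ge0.
have h3 : 0 <= w * d2 by exact: mulr_ge0.
lra.
Qed.

(* Hardy's inequality at the scale c = 1/l, where l = max(|xi|, 1/S) and x2 = |xi|^2; the
   monotonicity of f and of f t / t compares f l with f (1/s) on either side of c. *)
Lemma freq_estimate :
  ((f (Num.sqrt (1 + x2)) ^+ 2)%:E * \int[leb1]_(s in `]-oo, 0%R[) (g s ^+ 2)%:E <=
   (8 * (1 + S ^+ 2))%:E *
     \int[leb1]_(s in `]-oo, 0%R[) (wgt s * ('D_1 g s ^+ 2 + x2 * g s ^+ 2))%:E)%E.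
Proof.
(* When [|xi| < 1/S] one gets [c = S], and [g] vanishes on the whole far region. Otherwise
   [l^2 = x2], and the term [x2 g^2] on the right controls [g^2] there. This is [far_g] below. *)
pose l := Num.max (Num.sqrt x2) S^-1.
have l0 : 0 < l by rewrite lt_max invr_gt0 S0 orbT.
pose c := l^-1.
have c0 : 0 < c by rewrite invr_gt0.
set La := Num.sqrt (1 + x2).
have La0 : 0 < La by rewrite sqrtr_gt0 ltr_pwDl.
have S2 : 1 <= S ^+ 2 * l ^+ 2.
  have : 1 <= S * l by rewrite -ler_pdivrMl// mulr1 le_max lexx orbT.
  by rewrite -exprMn => h; rewrite exprn_ege1.
have l2 : x2 <= l ^+ 2.
  rewrite -[x2]sqr_sqrtr// lerXn2r ?nnegrE ?sqrtr_ge0 ?(ltW l0)//.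
  by rewrite le_max lexx.
(* [1 + x2 <= (1 + S^2) l^2]; for [l <= La] the decrease of [f t / t] gives
   [f La <= (La / l) f l]. *)
have fL : f La ^+ 2 <= (1 + S ^+ 2) * f l ^+ 2.
  have fl0 := f0 l0; have fLa0 := f0 La0.
  have [lLa|Lal] := leP l La.
    have h := f_scale l0 lLa.
    have h2 : f La ^+ 2 <= (La / l * f l) ^+ 2.
      by rewrite lerXn2r ?nnegrE ?mulr_ge0 ?divr_ge0// ltW.
    apply: le_trans h2 _; rewrite exprMn; apply: ler_wpM2r; first exact: sqr_ge0.
    rewrite expr_div_n ler_pdivrMr ?exprn_gt0// sqr_sqrtr ?addr_ge0//.
    by rewrite mulrDl mul1r; lra.
  have h : f La <= f l by apply: f_incr => //; exact: ltW.
  have h2 : f La ^+ 2 <= f l ^+ 2 by rewrite lerXn2r ?nnegrE.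
  by apply: le_trans h2 _; rewrite ler_peMl ?sqr_ge0// lerDl sqr_ge0.
have far_g (s : R) : s <= - c -> f l ^+ 2 * g s ^+ 2 <= x2 * (wgt s * g s ^+ 2).
  move=> sc.
  have [Sx|xS] := leP (S^-1) (Num.sqrt x2).
    have E : l ^+ 2 = x2 by rewrite /l max_l// sqr_sqrtr.
    rewrite mulrA; apply: ler_wpM2r; first exact: sqr_ge0.
    have := wgt_far l0 sc; rewrite -E exprVn mulrC ler_pdivrMl ?exprn_gt0//.
  rewrite gS ?expr0n ?mulr0//=; move: sc.
  by rewrite /c /l max_r ?invrK// ltW.
have cg (s : R) : s < 0 -> {for s, continuous g} by move=> s0; apply: derivable_cvg; exact: dg.
have cg2 (s : R) : s < 0 -> {for s, continuous (fun s : R => g s ^+ 2)}.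
  by move=> s0; apply: cvgM; exact: cg.
have cW (s : R) : s < 0 -> {for s, continuous (fun s : R => wgt s * ('D_1 g s ^+ 2 + x2 * g s ^+ 2))}.
  move=> s0; apply: cvgM; first exact: wgt_continuous.
  apply: cvgD; first by apply: cvgM; exact: cdg.
  by apply: cvgM; [exact: cvg_cst|exact: cg2].
have cN (s : R) : s < 0 -> {for s, continuous (fun s : R => s ^+ 2 * 'D_1 g s ^+ 2)}.
  by move=> s0; do 2 ?apply: cvgM => //; try exact: cvg_id; exact: cdg.
have cF (s : R) : s < 0 -> {for s, continuous (fun s : R => g s ^+ 2 + c ^+ 2 * 'D_1 g s ^+ 2)}.
  move=> s0; apply: cvgD; first exact: cg2.
  by apply: cvgM; [exact: cvg_cst|apply: cvgM; exact: cdg].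
set J := (\int[leb1]_(s in `]-oo, 0%R[) (wgt s * ('D_1 g s ^+ 2 + x2 * g s ^+ 2))%:E)%E.
have W0 s : 0 <= wgt s * ('D_1 g s ^+ 2 + x2 * g s ^+ 2).
  apply: mulr_ge0; first exact: wgt_ge0.
  by apply: addr_ge0; [exact: sqr_ge0|apply: mulr_ge0 => //; exact: sqr_ge0].
have nearset : `[- c, (0:R)[%classic `<=` `]-oo, (0:R)[%classic.
  by move=> s /=; rewrite !in_itv /= => /andP[].
have farset : `]-oo, - c]%classic `<=` `]-oo, (0:R)[%classic.
  by move=> s /=; rewrite !in_itv /= => h; lra.
have subJ (D : set T) : measurable D -> D `<=` `]-oo, (0:R)[%classic ->
  (\int[leb1]_(s in D) (4 * (wgt s * ('D_1 g s ^+ 2 + x2 * g s ^+ 2)))%:E <= 4%:E * J)%E.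
  move=> mD Dneg; under eq_integral do rewrite EFinM.
  rewrite ge0_integralZl_EFin //; last 2 first.
  - by move=> s _; rewrite lee_fin.
  - exact: (measurable_neg cW).
  apply: lee_wpmul2l => //; apply: ge0_subset_integral => //.
  - exact: (measurable_neg cW).
  - by move=> s _; rewrite lee_fin.
have fl2 : 0 <= f l ^+ 2 by exact: sqr_ge0.
have fl0 := f0 l0.
have main : ((f l ^+ 2)%:E * \int[leb1]_(s in `]-oo, 0%R[) (g s ^+ 2)%:E <= 8%:E * J)%E.
  have split0 : (\int[leb1]_(s in `]-oo, 0%R[) (g s ^+ 2)%:E <=
     \int[leb1]_(s in `]-oo, (- c)%R]) (g s ^+ 2)%:E + \int[leb1]_(s in `[(- c)%R, 0%R[) (g s ^+ 2)%:E)%E.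
    have -> : `]-oo, (0:R)[%classic = `]-oo, - c[%classic `|` `[- c, (0:R)[%classic.
      by rewrite -itv_bndbnd_setU// bnd_simp; lra.
    have H2 : [disjoint `]-oo, - c[%classic & `[- c, (0:R)[%classic].
      apply/disj_setPS => x /=; rewrite !in_itv /= => -[h1 /andP[h2 _]].
      by move: (lt_le_trans h1 h2); rewrite ltxx.
    rewrite (ge0_integral_setU leb1 (measurable_itv _) (measurable_itv _) _ _ H2); last 2 first.
    - apply: (measurable_neg cg2) => //; first exact: measurableU.
      by move=> s /= []; rewrite !in_itv /=; [lra|move=> /andP[]].
    - by move=> s _; rewrite lee_fin sqr_ge0.
    apply: leeD => //; apply: ge0_subset_integral => //.
    - exact: (measurable_neg cg2).
    - by move=> s _; rewrite lee_fin sqr_ge0.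
    - by move=> s /=; rewrite !in_itv /=; exact: ltW.
  apply: le_trans (lee_wpmul2l _ split0) _; first by rewrite lee_fin.
  have I0 (D : set T) (h : R -> R) : (forall s, 0 <= h s) -> (0 <= \int[leb1]_(s in D) (h s)%:E)%E.
    by move=> h0; apply: integral_ge0 => s _; rewrite lee_fin.
  have h1 s : 0 <= g s ^+ 2 by exact: sqr_ge0.
  have h2 s : 0 <= s ^+ 2 * 'D_1 g s ^+ 2 by apply: mulr_ge0; exact: sqr_ge0.
  have h3 s : 0 <= g s ^+ 2 + c ^+ 2 * 'D_1 g s ^+ 2 by apply: addr_ge0 => //; apply: mulr_ge0; exact: sqr_ge0.
  rewrite ge0_muleDr ?I0//.
  apply: (@le_trans _ _ ((f l ^+ 2)%:E * \int[leb1]_(s in `]-oo, (- c)%R]) (g s ^+ 2)%:E +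
     ((f l ^+ 2)%:E * (4%:E * \int[leb1]_(s in `[(- c)%R, 0%R[) (s ^+ 2 * 'D_1 g s ^+ 2)%:E) +
     (f l ^+ 2)%:E * (2%:E * \int[leb1]_(s in `]-oo, (- c)%R]) (g s ^+ 2 + c ^+ 2 * 'D_1 g s ^+ 2)%:E)))%E).
    apply: leeD => //; rewrite -ge0_muleDr ?mule_ge0 ?I0//.
    by apply: lee_wpmul2l; [rewrite lee_fin|exact: (hardy dg cdg gS c0)].
  have J0 : (0 <= J)%E by exact: I0.
  clearbody J; rewrite addeCA !muleA -!EFinM.
  rewrite -!ge0_integralZl_EFin ?mulr_ge0 //; try (by move=> s _; rewrite lee_fin);
    try (exact: (measurable_neg cg2)); try (exact: (measurable_neg cN)); try (exact: (measurable_neg cF)).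
  rewrite -ge0_integralD //; last 4 first.
  - by move=> s _; rewrite lee_fin; apply: mulr_ge0.
  - by apply/measurable_funeM; exact: (measurable_neg cg2).
  - by move=> s _; rewrite lee_fin; apply: mulr_ge0 => //; apply: mulr_ge0.
  - by apply/measurable_funeM; exact: (measurable_neg cF).
  (* One [4 J] bounds the integral near 0, the other the two far integrals together. *)
  have -> : (8%:E * J = 4%:E * J + 4%:E * J)%E.
    by rewrite -ge0_muleDl// -EFinD; congr (_%:E * _)%E; ring.
  apply: leeD.
    apply: le_trans (subJ _ _ nearset) => //; apply: ge0_le_integral => //.
    - by move=> s _; rewrite lee_fin; apply: mulr_ge0 => //; apply: mulr_ge0.
    - by apply/measurable_funeM; exact: (measurable_neg cN).
    - apply: (measurable_neg (h := fun s => 4 * (wgt s * ('D_1 g s ^+ 2 + x2 * g s ^+ 2)))) => // s s0.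
      by apply: cvgM; [exact: cvg_cst|exact: cW].
    - move=> s /=; rewrite in_itv /= => /andP[s1 s2]; rewrite -EFinM lee_fin.
      have sl : - s <= l^-1 by rewrite -/c; lra.
      exact: (near_alg (sqr_ge0 _) (h1 s) x20 (wgt_ge0 s) (wgt_near l0 s2 sl)).
  apply: le_trans (subJ _ _ farset) => //; apply: ge0_le_integral => //.
  - by move=> s _; apply: adde_ge0; apply: mule_ge0; rewrite lee_fin// mulr_ge0// ?f0.
  - by apply: emeasurable_funD; apply/measurable_funeM; [exact: (measurable_neg cg2)|exact: (measurable_neg cF)].
  - apply: (measurable_neg (h := fun s => 4 * (wgt s * ('D_1 g s ^+ 2 + x2 * g s ^+ 2)))) => // s s0.
    by apply: cvgM; [exact: cvg_cst|exact: cW].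
  - move=> s /=; rewrite in_itv /= => sc; rewrite -!EFinM -EFinD lee_fin.
    exact: (far_alg (sqr_ge0 _) (h1 s) x20 (wgt_ge0 s) (wgt_far l0 sc) (far_g s sc)).
apply: (@le_trans _ _ ((1 + S ^+ 2)%:E * ((f l ^+ 2)%:E * \int[leb1]_(s in `]-oo, 0%R[) (g s ^+ 2)%:E))%E).
  rewrite muleA -EFinM; apply: lee_wpmul2r; last by rewrite lee_fin.
  by apply: integral_ge0 => s _; rewrite lee_fin sqr_ge0.
have -> : ((8 * (1 + S ^+ 2))%:E * J = (1 + S ^+ 2)%:E * (8%:E * J))%E.
  by rewrite muleA -EFinM mulrC.
apply: lee_wpmul2l => //.
by rewrite lee_fin addr_ge0// sqr_ge0.
Qed.

End frequency.

(** * Functions on a half slab *)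

Lemma near_eq_continuous (V W : topologicalType) (f g : V -> W) (x : V) :
  (\forall y \near x, f y = g y) -> {for x, continuous g} -> {for x, continuous f}.
Proof.
move=> E; rewrite /prop_for /continuous_at (nbhs_singleton E) => cg.
by apply: cvg_trans cg; apply: near_eq_cvg; apply: filterS E => y ->.
Qed.

Section slab.
Context (R : realType) (d : nat).
Local Notation T := (measurableTypeR R).
Local Notation leb1 := (@lebesgue_measure R).
Local Notation Y := ('rV[R]_d * R)%type.

(** Extension by zero to [r >= 0], so that measurability and Tonelli can be used on the whole
    product space. *)
Definition half_ext (P : Y -> R) (q : d.-tuple T * T) : R := if q.2 < 0 then P (rvecR q) else 0.

(* b selects the cosine (true) or the sine transform. *)
Definition half_tr (b : bool) (P : Y -> R) (q : d.-tuple T * T) : R :=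
  tr b (fun t => half_ext P (t, q.2)) q.1.

Lemma half_open : open [set y : Y | y.2 < 0].
Proof.
have -> : [set y : Y | y.2 < 0] = snd @^-1` [set x : R | x < 0] by [].
apply: (@open_comp Y R^o); last exact: open_lt.
by move=> y _; exact: cvg_snd.
Qed.

Lemma measurable_half_ext (P : Y -> R) : (forall y : Y, y.2 < 0 -> {for y, continuous P}) ->
  measurable_fun setT (half_ext P : _ -> T).
Proof.
move=> cP.
have -> : half_ext P = (P \o @rvecR R d) \_ (@rvecR R d @^-1` [set y | y.2 < 0]).
  apply/funext => q; rewrite /half_ext /patch; case: ifPn => h; case: ifPn => //.
    by rewrite notin_setE.
  by rewrite inE /= (negbTE h).
apply/(measurable_restrictT _ (measurable_rvecR half_open)).
by apply: measurable_comp_open; [exact: measurable_rvecR|exact: half_open|exact: cP].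
Qed.

Lemma measurable_half_tr b (P : Y -> R) : (forall y : Y, y.2 < 0 -> {for y, continuous P}) ->
  measurable_fun setT (half_tr b P : _ -> T).
Proof.
move=> cP; rewrite /half_tr.
apply: (@measurable_tr_param R _ (d.-tuple T * T)%type b d (fun p => half_ext P (p.2, p.1.2)) fst).
  apply: (measurableT_comp (measurable_half_ext cP)).
  by apply/measurable_fun_pair => //=; apply: measurableT_comp.
exact: measurable_fst.
Qed.

Definition pda (k : 'I_d) (F : Y -> R) : Y -> R := 'D_((delta_mx 0 k, 0) : Y) F.
Definition pdr (F : Y -> R) : Y -> R := 'D_((0, 1) : Y) F.

Lemma half_tr_ge0 b P (q : d.-tuple T * T) : 0 <= q.2 -> half_tr b P q = 0.
Proof.
move=> q2; rewrite /half_tr /tr /Rintegral integral0_eq // => t _.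
by rewrite /half_ext /= ltNge q2 /= mulr0.
Qed.

Definition slab_supp (L S : R) (P : Y -> R) := forall y : Y, y.2 < 0 ->
  (exists i, L < `|y.1 0 i|) \/ y.2 <= - S -> P y = 0.

(** [F] need not vanish at [r = 0], but [M] bounds it and its derivatives up to there; these uniform
    bounds and the fixed support in [a] allow differentiation under the integral on each slice. *)
Definition slab_C1 (M L S : R) (F : Y -> R) :=
  [/\ forall y : Y, y.2 < 0 -> {for y, continuous F} /\ `|F y| <= M,
      forall (y e : Y), y.2 < 0 -> [/\ derivable F y e, {for y, continuous ('D_e F)} & `|'D_e F y| <= M * `|e|] &
      slab_supp L S F].

Lemma slab_supp_derive L S (F : Y -> R) e : slab_supp L S F ->
  forall y : Y, y.2 < 0 -> (exists i, L < `|y.1 0 i|) -> 'D_e F y = 0.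
Proof.
move=> FS y y0 [i yi]; transitivity ('D_e (cst (0 : R)) y); last exact: derive_cst.
apply: near_eq_derive.
apply/nbhs_norm; exists (Num.min (`|y.1 0 i| - L) (- y.2)).
  by rewrite lt_min subr_gt0 yi oppr_gt0.
move=> x; rewrite prod_normE /= gt_max !lt_min => /andP[/andP[h1 _] /andP[_ h2]].
apply: FS; first by have := ler_norm (x.2 - y.2); lra.
left; exists i; have := coord_le_norm (x.1 - y.1) i; rewrite !mxE => H.
have := ler_normD (y.1 0 i - x.1 0 i) (x.1 0 i); rewrite subrK distrC; lra.
Qed.

Section one.
Variables (F : Y -> R) (M L S : R).
Hypothesis L0 : 0 < L.
Hypothesis FC : slab_C1 M L S F.

Let cF (y : Y) : y.2 < 0 -> {for y, continuous F}. Proof. by have [H _ _] := FC => /H[]. Qed.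
Let FM (y : Y) : y.2 < 0 -> `|F y| <= M. Proof. by have [H _ _] := FC => /H[]. Qed.
Let dF (y e : Y) : y.2 < 0 -> derivable F y e. Proof. by have [_ H _] := FC => /(H y e)[]. Qed.
Let cdF (y e : Y) : y.2 < 0 -> {for y, continuous ('D_e F)}. Proof. by have [_ H _] := FC => /(H y e)[]. Qed.
Let dFM (y e : Y) : y.2 < 0 -> `|'D_e F y| <= M * `|e|. Proof. by have [_ H _] := FC => /(H y e)[]. Qed.
Let FS : slab_supp L S F. Proof. by have [_ _ H] := FC. Qed.

Let slice_continuous (P : Y -> R) (r : R) (x : 'rV[R]_d) : {for (x, r), continuous P} ->
  {for x, continuous (fun a => P (a, r))}.
Proof.
move=> /cvg_at_norm cP; apply/cvg_at_norm => e e0; have [dl dl0 H] := cP e e0.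
exists dl => // y yx; apply: H; rewrite prod_normE /= subrr normr0 gt_max yx dl0 //.
Qed.

Let slice_pd k (r : R) (x : 'rV[R]_d) : r < 0 ->
  is_derive x (delta_mx 0 k) (fun a => F (a, r)) (pda k F (x, r)).
Proof.
move=> r0; apply: derivable_eps => e e0.
have [dl dl0 H] := eps_derivable (@dF (x, r) (delta_mx 0 k, 0) r0) e0.
exists dl => // h /H; rewrite /pda.
by have -> : (h *: (delta_mx 0 k, 0) + (x, r) : Y) = (h *: delta_mx 0 k + x, r)
  by congr pair => /=; rewrite scaler0 add0r.
Qed.

Let vslice_continuous (P : Y -> R) (r : R) (x : 'rV[R]_d) : {for (x, r), continuous P} ->
  {for r, continuous (fun s : R => P (x, s))}.
Proof.
move=> /cvg_at_norm cP; apply/cvg_at_norm => e e0; have [dl dl0 H] := cP e e0.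
exists dl => // y yx; apply: H; rewrite prod_normE /= subrr normr0 gt_max yx dl0 //.
Qed.

Let vslice_derive (r : R) (x : 'rV[R]_d) : r < 0 ->
  is_derive r 1 (fun s : R => F (x, s)) (pdr F (x, r)).
Proof.
move=> r0; apply: derivable_eps => e e0.
have [dl dl0 H] := eps_derivable (@dF (x, r) (0, 1) r0) e0.
exists dl => // h /H; rewrite /pdr.
by have -> : (h *: (0, 1) + (x, r) : Y) = (x, h *: 1 + r)
  by congr pair => /=; rewrite scaler0 add0r.
Qed.

Let slice_C1c (r : R) : r < 0 -> C1c (fun a => F (a, r)).
Proof.
move=> r0; split.
- by move=> x; apply: slice_continuous; exact: cF.
- by move=> k x; have [] := slice_pd k x r0.
- move=> k x.
  have -> : pd k (fun a => F (a, r)) = (fun a => pda k F (a, r)).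
    by apply/funext => z; have [_ <-] := slice_pd k z r0.
  by apply: slice_continuous; exact: cdF.
- by exists L => // x xi; apply: FS => //; left.
Qed.

Let normk k : `|((delta_mx 0 k, 0) : Y)| <= 1.
Proof.
rewrite prod_normE /= normr0 ge_max ler01 andbT; apply: norm_le_coord => // i.
by rewrite mxE eqxx /=; case: (i == k); rewrite ?normr1 ?normr0.
Qed.

Let norm1 : `|((0, 1) : Y)| <= 1.
Proof. by rewrite prod_normE /= normr0 normr1 ge_max ler01 lexx. Qed.

Let half_bbs (P : Y -> R) (M' : R) (r : T) : (forall y : Y, y.2 < 0 -> {for y, continuous P}) ->
  (forall y : Y, y.2 < 0 -> `|P y| <= M') ->
  (forall y : Y, y.2 < 0 -> (exists i, L < `|y.1 0 i|) -> P y = 0) ->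
  bbs (fun t => half_ext P (t, r)).
Proof.
move=> cP PM PL; split; [split|].
- exact: (measurableT_comp (measurable_half_ext cP) (measurable_pair2 r)).
- exists (Num.max M' 0) => t; rewrite /half_ext /=; case: ifPn => h.
    by rewrite le_max PM.
  by rewrite normr0 le_max lexx orbT.
- exists L => // t [i ti]; rewrite /half_ext /=; case: ifPn => // h.
  by apply: PL => //; exists i; rewrite mxE.
Qed.

Lemma slab_bbs r : bbs (fun t => half_ext F (t, r)).
Proof. by apply: (half_bbs (M' := M)) => // y y0 H; apply: FS => //; left. Qed.

Lemma slab_D_bbs e r : bbs (fun t => half_ext ('D_e F) (t, r)).
Proof.
apply: (half_bbs (M' := M * `|e|)); [by move=> y; exact: cdF|by move=> y; exact: dFM|].
exact: slab_supp_derive FS.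
Qed.

(** By [tr_pd] a derivative in [a_k] exchanges sine and cosine and multiplies by plus or minus the
    frequency; squaring removes the sign. *)
Lemma half_tr_pda b k (q : d.-tuple T * T) : q.2 < 0 ->
  tnth q.1 k ^+ 2 * half_tr b F q ^+ 2 = half_tr (~~ b) (pda k F) q ^+ 2.
Proof.
case: q => y r /= r0; have [H1 H2] := tr_pd k y (slice_C1c r0).
have E c : tr c (fun t => pd k (fun a => F (a, r)) (rvec t)) y = half_tr c (pda k F) (y, r).
  rewrite /half_tr /tr; apply: eq_Rintegral => x _; rewrite /half_ext /= r0; congr (_ * _).
  by have [_ <-] := slice_pd k (rvec x) r0.
have E2 c : tr c (fun t => F (rvec t, r)) y = half_tr c F (y, r).
  by rewrite /half_tr /tr; apply: eq_Rintegral => x _; rewrite /half_ext /= r0.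
rewrite E E2 in H1; rewrite E E2 in H2.
by case: b => /=; rewrite ?H1 ?H2 ?sqrrN exprMn.
Qed.

Lemma half_tr_derive b (y : d.-tuple T) (r : R) : r < 0 ->
  is_derive r 1 (fun s : R => half_tr b F (y, s)) (half_tr b (pdr F) (y, r)) /\
  {for r, continuous (fun s : R => half_tr b (pdr F) (y, s))}.
Proof.
(* The radius [- r] of the neighbourhood keeps every [s] in it negative. *)
move=> r0; have e0 : 0 < - r by lra.
have neg (s : R) : `|s - r| < - r -> s < 0 by have := ler_norm (s - r); lra.
have Et (P : Y -> R) : \forall s \near r, half_tr b P (y, s) =
    \int[leb R d]_x (P (rvec x, s) * ct b (tdot x y)).
  apply/nbhs_norm; exists (- r) => // s /neg s0; rewrite /half_tr /tr; apply: eq_Rintegral => x _.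
  by rewrite /half_ext /= s0 mulrC.
have mP (P : Y -> R) (s : R) : (forall y : Y, y.2 < 0 -> {for y, continuous P}) -> s < 0 ->
   measurable_fun setT (fun t : d.-tuple T => P (rvec t, s) : T).
  move=> cP s0; apply: (@continuous_measurable_rvec R d (fun a => P (a, s))) => x; apply: slice_continuous; exact: cP.
have pL (s : R) (t : d.-tuple T) : s < 0 -> (exists i, L < `|tnth t i|) -> exists i, L < `|((rvec t, s) : Y).1 0 i|.
  by move=> _ [i ti]; exists i; rewrite mxE.
have M0 : 0 <= M by apply: le_trans (@FM (0, r) r0).
have pdrM (y' : Y) : y'.2 < 0 -> `|pdr F y'| <= M.
  by move=> h; apply: le_trans (dFM _ h) _; rewrite ler_piMr.
have H := @is_derive_param_int R d (fun s t => F (rvec t, s)) r (- r) M L e0 L0.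
have H2 := @continuous_param_int R d (fun s t => pdr F (rvec t, s)) r (- r) M L e0 L0.
split.
  have -> : half_tr b (pdr F) (y, r) =
     \int[leb R d]_x ('D_1 (fun s : R => F (rvec x, s)) r * ct b (tdot x y)).
    rewrite /half_tr /tr; apply: eq_Rintegral => x _; rewrite /half_ext /= r0.
    by have [_ ->] := vslice_derive (rvec x) r0; exact: mulrC.
  have {}H : is_derive r 1 (fun s : R => \int[leb R d]_x (F (rvec x, s) * ct b (tdot x y)))
     (\int[leb R d]_x ('D_1 (fun s : R => F (rvec x, s)) r * ct b (tdot x y))).
    apply: H.
    - by move=> s /neg s0; exact: mP.
    - by move=> s t /neg s0; exact: FM.
    - by move=> s t /neg s0 /(pL s _ s0) ti; apply: FS => //; left.
    - exact: bdm_cttdot.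
    - by move=> s t /neg s0; have [] := vslice_derive (rvec t) s0.
    - by move=> s t /neg s0; have [_ ->] := vslice_derive (rvec t) s0; exact: pdrM.
  have [D1 D2] := H; split.
    by move: D1; apply: near_eq_derivable; apply: filterS (Et F) => s ->.
  by rewrite -D2; apply: near_eq_derive; exact: Et.
have {}H2 : {for r, continuous (fun s : R => \int[leb R d]_x (pdr F (rvec x, s) * ct b (tdot x y)))}.
  apply: H2.
  - move=> s /neg s0; apply: mP => // y'; exact: cdF.
  - by move=> s t /neg s0; exact: pdrM.
  - move=> s t /neg s0 /(pL s _ s0) ti; exact: (@slab_supp_derive L S F (0, 1) FS (rvec t, s) s0 ti).
  - exact: bdm_cttdot.
  - by move=> t; apply: vslice_continuous; exact: cdF.
  - by move=> s t /neg s0; apply: vslice_continuous; exact: cdF.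
exact: near_eq_continuous (Et (pdr F)) H2.
Qed.

End one.
End slab.

(** * The weighted estimate on the slab *)

Section slab_estimate.
Context (R : realType) (d : nat) (f : R -> R).
Local Notation T := (measurableTypeR R).
Local Notation leb1 := (@lebesgue_measure R).
Local Notation Y := ('rV[R]_d * R)%type.
Hypothesis f0 : forall t : R, 0 < t -> 0 <= f t.
Hypothesis f_incr : increasing_pos f.
Hypothesis f_decr : decreasing_pos (fun t => f t / t).
Hypothesis cf : forall t : R, 0 < t -> {for t, continuous f}.

Lemma Lambda_gt0 N (x : 'rV[R]_N) : 0 < Lambda x.
Proof. by rewrite sqrtr_gt0 ltr_pwDl//; apply: sumr_ge0 => i _; rewrite -expr2 sqr_ge0. Qed.

Lemma measurable_pos (h : R -> R) d' (X : measurableType d') (g : X -> T) :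
  (forall t : R, 0 < t -> {for t, continuous h}) -> measurable_fun setT g -> (forall x, 0 < g x) ->
  measurable_fun setT (fun x => h (g x) : T).
Proof.
move=> ch mg g0; have E : g @^-1` [set t | 0 < t] = setT by apply/seteqP; split => x // _; exact: g0.
rewrite -E; apply: (@measurable_comp_open R d' X R g h [set t | 0 < t]) => //.
  by move=> O oO; rewrite -[X in measurable X]setTI; apply: mg => //; exact: open_measurable.
Qed.

Lemma measurable_Lambda N : measurable_fun setT (fun t : N.-tuple T => Lambda (rvec t) : T).
Proof.
apply: (measurable_pos (h := Num.sqrt)); first by move=> t _; exact: sqrt_continuous.
  by apply: measurable_funD => //; apply: measurable_tdot.
by move=> t; rewrite ltr_pwDl//; apply: sumr_ge0 => i _; rewrite -expr2 sqr_ge0.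
Qed.

Definition wgt_neg (r : T) : R := if r < 0 then wgt f r else 0.

Lemma wgt_neg_ge0 r : 0 <= wgt_neg r.
Proof. by rewrite /wgt_neg; case: ifP => // _; exact: wgt_ge0. Qed.

Lemma measurable_wgt_neg : measurable_fun setT (wgt_neg : T -> T).
Proof.
have -> : wgt_neg = (wgt f) \_ `]-oo, (0:R)[%classic.
  apply/funext => r; rewrite /wgt_neg /patch; case: ifPn => h; case: ifPn => //.
    by rewrite notin_setE /= in_itv /= h.
  by rewrite inE /= in_itv /= (negbTE h).
apply/(measurable_restrictT _ (measurable_itv _)).
apply: open_continuous_measurable_fun; first exact: interval_open.
by move=> s /set_mem /=; rewrite in_itv /=; exact: wgt_continuous.
Qed.

Variables (F : Y -> R) (M L S C : R).
Hypothesis L0 : 0 < L.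
Hypothesis S0 : 0 < S.
Hypothesis C0 : 0 <= C.
Hypothesis FC : slab_C1 M L S F.
Hypothesis HC : forall b (g : d.-tuple T -> R), bbs g ->
  (\int[leb R d]_y (tr b g y ^+ 2)%:E <= C%:E * \int[leb R d]_x (g x ^+ 2)%:E)%E.

Let cF (y : Y) : y.2 < 0 -> {for y, continuous F}. Proof. by have [H _ _] := FC => /H[]. Qed.
Let cdF (e y : Y) : y.2 < 0 -> {for y, continuous ('D_e F)}. Proof. by have [_ H _] := FC => /(H y e)[]. Qed.

(** [D] and [E] are the squared gradients on the frequency side and on the slab; the tag flips in
    the tangential terms as in [half_tr_pda]. *)
Let D b (q : d.-tuple T * T) : R := half_tr b (pdr F) q ^+ 2 + \sum_k half_tr (~~ b) (pda k F) q ^+ 2.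
Let E (q : d.-tuple T * T) : R := half_ext (pdr F) q ^+ 2 + \sum_k half_ext (pda k F) q ^+ 2.

Let D0 b q : 0 <= D b q.
Proof. by apply: addr_ge0; [exact: sqr_ge0|apply: sumr_ge0 => k _; exact: sqr_ge0]. Qed.

Let E0 q : 0 <= E q.
Proof. by apply: addr_ge0; [exact: sqr_ge0|apply: sumr_ge0 => k _; exact: sqr_ge0]. Qed.

Let mD b : measurable_fun setT (D b : _ -> T).
Proof.
apply: measurable_funD.
  by apply: measurable_funX; apply: measurable_half_tr; exact: cdF.
by apply: measurable_sum => k; apply: measurable_funX; apply: measurable_half_tr; exact: cdF.
Qed.

Let mE : measurable_fun setT (E : _ -> T).
Proof.
apply: measurable_funD.
  by apply: measurable_funX; apply: measurable_half_ext; exact: cdF.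
by apply: measurable_sum => k; apply: measurable_funX; apply: measurable_half_ext; exact: cdF.
Qed.

Let at_freq b (y : d.-tuple T) :
  (\int[leb1]_r ((f (Lambda (rvec y)) * half_tr b F (y, r)) ^+ 2)%:E <=
   (8 * (1 + S ^+ 2))%:E * \int[leb1]_r (wgt_neg r * D b (y, r))%:E)%E.
Proof.
pose g (r : R) := half_tr b F (y, r).
have dg (s : R) (s0 : s < 0) := (half_tr_derive L0 FC b y s0).1.
have dgE (s : R) : s < 0 -> 'D_1 g s = half_tr b (pdr F) (y, s).
  by move=> s0; have [_ <-] := dg s s0.
have x2 : 0 <= edot (rvec y) (rvec y) by apply: sumr_ge0 => i _; rewrite -expr2 sqr_ge0.
have gS (s : R) : s <= - S -> g s = 0.
  move=> sS; rewrite /g /half_tr /tr /Rintegral integral0_eq// => t _.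
  have [_ _ FS] := FC; rewrite /half_ext /=; case: ifP => s0; rewrite ?mulr0// FS ?mulr0//.
  by right.
have := @freq_estimate R f f0 f_incr f_decr cf g S _ S0 x2 _ _ gS.
have -> : (\int[leb1]_r ((f (Lambda (rvec y)) * half_tr b F (y, r)) ^+ 2)%:E =
   (f (Lambda (rvec y)) ^+ 2)%:E * \int[leb1]_(s in `]-oo, 0%R[) (g s ^+ 2)%:E)%E.
  have mg2 : measurable_fun setT (fun s : T => (g s ^+ 2)%:E).
    apply/measurable_EFinP; apply: measurable_funX.
    exact: (measurableT_comp (measurable_half_tr b cF) (measurable_pair1 y)).
  under eq_integral do rewrite exprMn EFinM.
  rewrite ge0_integralZl_EFin ?sqr_ge0//; last by move=> s _; rewrite lee_fin sqr_ge0.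
  congr (_ * _)%E; rewrite [RHS]integral_mkcond; apply: eq_integral => s _.
  rewrite /patch; case: ifPn => //; rewrite notin_setE /= in_itv /= => /negP; rewrite -leNgt => s0.
  by rewrite half_tr_ge0// expr0n.
have -> : (\int[leb1]_r (wgt_neg r * D b (y, r))%:E =
   \int[leb1]_(s in `]-oo, 0%R[) (wgt f s * ('D_1 g s ^+ 2 + edot (rvec y) (rvec y) * g s ^+ 2))%:E)%E.
  rewrite [RHS]integral_mkcond; apply: eq_integral => s _; rewrite /patch /wgt_neg.
  case: ifPn => s0; case: ifPn => //.
  - move=> _; congr (_ * _)%:E; rewrite dgE// /D; congr (_ + _).
    rewrite /edot mulr_suml; apply: eq_bigr => k _.
    by rewrite -(half_tr_pda L0 FC)// mxE expr2.
  - by rewrite notin_setE /= in_itv /= s0.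
  - by rewrite inE /= in_itv /= (negbTE s0).
  - by rewrite mul0r.
apply.
- by move=> s s0; have [] := dg s s0.
- move=> s s0; apply: (near_eq_continuous _ (half_tr_derive L0 FC b y s0).2).
  apply/nbhs_norm; exists (- s); first by rewrite oppr_gt0.
  by move=> t ts; apply: dgE; have := ler_norm (t - s); lra.
Qed.

Let at_level b (r : T) :
  (\int[leb R d]_y (wgt_neg r * D b (y, r))%:E <= \int[leb R d]_y (C * (wgt_neg r * E (y, r)))%:E)%E.
Proof.
have mDr : measurable_fun setT (fun y : d.-tuple T => (D b (y, r))%:E).
  by apply/measurable_EFinP; exact: (measurableT_comp (mD b) (measurable_pair2 r)).
have mEr : measurable_fun setT (fun y : d.-tuple T => (E (y, r))%:E).
  by apply/measurable_EFinP; exact: (measurableT_comp mE (measurable_pair2 r)).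
under eq_integral do rewrite EFinM.
rewrite ge0_integralZl_EFin ?wgt_neg_ge0//; last by move=> y _; rewrite lee_fin.
under [leRHS]eq_integral do rewrite mulrCA EFinM.
rewrite (ge0_integralZl_EFin _ _ _ _ (wgt_neg_ge0 r))//; last 2 first.
- by move=> y _; rewrite lee_fin mulr_ge0.
- by under eq_fun do rewrite EFinM; exact: measurable_funeM.
apply: lee_wpmul2l; first by rewrite lee_fin wgt_neg_ge0.
under [leRHS]eq_integral do rewrite EFinM.
rewrite [leRHS]ge0_integralZl_EFin//; last by move=> y _; rewrite lee_fin.
have mt c (P : Y -> R) : (forall y : Y, y.2 < 0 -> {for y, continuous P}) ->
    measurable_fun setT (fun y : d.-tuple T => (half_tr c P (y, r) ^+ 2)%:E).
  move=> cP; apply/measurable_EFinP; apply: measurable_funX.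
  exact: (measurableT_comp (measurable_half_tr c cP) (measurable_pair2 r)).
have me (P : Y -> R) : (forall y : Y, y.2 < 0 -> {for y, continuous P}) ->
    measurable_fun setT (fun y : d.-tuple T => (half_ext P (y, r) ^+ 2)%:E).
  move=> cP; apply/measurable_EFinP; apply: measurable_funX.
  exact: (measurableT_comp (measurable_half_ext cP) (measurable_pair2 r)).
have sq0 (x : R) : (0%:E <= (x ^+ 2)%:E)%E by rewrite lee_fin sqr_ge0.
have split (P : option 'I_d -> d.-tuple T -> R) : (forall i, measurable_fun setT (fun y => (P i y ^+ 2)%:E)) ->
    (\int[leb R d]_y (P None y ^+ 2 + \sum_k P (Some k) y ^+ 2)%:E =
     \int[leb R d]_y (P None y ^+ 2)%:E + \sum_k \int[leb R d]_y (P (Some k) y ^+ 2)%:E)%E.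
  move=> mP; under eq_integral do rewrite EFinD -sumEFin.
  rewrite ge0_integralD//.
  - by congr (_ + _)%E; rewrite ge0_integral_sum.
  - by move=> y _; apply: sume_ge0.
  - exact: emeasurable_sum.
have := split (fun i y => if i is Some k then half_tr (~~ b) (pda k F) (y, r) else half_tr b (pdr F) (y, r)).
move=> /(_ _)/=->; last by case=> [k|]; apply: mt; exact: cdF.
have := split (fun i y => if i is Some k then half_ext (pda k F) (y, r) else half_ext (pdr F) (y, r)).
move=> /(_ _)/=->; last by case=> [k|]; apply: me; exact: cdF.
rewrite ge0_muleDr; last 2 first.
- exact: integral_ge0.
- by apply: sume_ge0 => k _; exact: integral_ge0.
rewrite ge0_sume_distrr; last by move=> k _; exact: integral_ge0.
apply: leeD; first exact: (HC b (slab_D_bbs L0 FC (0, 1) r)).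
by apply: lee_sum => k _; exact: (HC (~~ b) (slab_D_bbs L0 FC (delta_mx 0 k, 0) r)).
Qed.

(** [freq_estimate] acts in [r] at a fixed frequency, Bessel's inequality in [a] at a fixed [r]. The
    weight depends on [r] alone, so Tonelli suffices to pass from one to the other. *)
Lemma slab_estimate b :
  (\int[(leb R d \x leb1)%E]_q ((f (Lambda (rvec q.1)) * half_tr b F q) ^+ 2)%:E <=
   (8 * (1 + S ^+ 2) * C)%:E *
     \int[(leb R d \x leb1)%E]_q (wgt_neg q.2 * E q)%:E)%E.
Proof.
have mf : measurable_fun setT (fun q : d.-tuple T * T => ((f (Lambda (rvec q.1)) * half_tr b F q) ^+ 2)%:E).
  apply/measurable_EFinP; apply: measurable_funX; apply: measurable_funM.
    apply: (measurable_pos (g := fun q => Lambda (rvec q.1))) => //; last by move=> q; exact: Lambda_gt0.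
    exact: (measurableT_comp (@measurable_Lambda d) measurable_fst).
  exact: measurable_half_tr.
have mw : measurable_fun setT (fun q : d.-tuple T * T => wgt_neg q.2 : T).
  by apply: (measurableT_comp measurable_wgt_neg); exact: measurable_snd.
have mwD : measurable_fun setT (fun q : d.-tuple T * T => (wgt_neg q.2 * D b q)%:E).
  by apply/measurable_EFinP; apply: measurable_funM => //; exact: mD.
have mwE : measurable_fun setT (fun q : d.-tuple T * T => (wgt_neg q.2 * E q)%:E).
  by apply/measurable_EFinP; exact: measurable_funM.
have wD0 q : (0 <= (wgt_neg q.2 * D b q)%:E)%E by rewrite lee_fin mulr_ge0 ?wgt_neg_ge0.
have wE0 q : (0 <= (wgt_neg q.2 * E q)%:E)%E by rewrite lee_fin mulr_ge0 ?wgt_neg_ge0.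
have C1 : 0 <= 8 * (1 + S ^+ 2) by rewrite mulr_ge0// addr_ge0// sqr_ge0.
rewrite fubini_tonelli1//=; last by move=> q; rewrite lee_fin sqr_ge0.
apply: (@le_trans _ _ (\int[leb R d]_y ((8 * (1 + S ^+ 2))%:E * \int[leb1]_r (wgt_neg r * D b (y, r))%:E))%E).
  apply: ge0_le_integral => //=.
  - by move=> y _; apply: integral_ge0 => r _; rewrite lee_fin sqr_ge0.
  - by apply: (@measurable_fun_fubini_tonelli_F _ _ _ _ _ leb1 _ mf) => q; rewrite lee_fin sqr_ge0.
  - by apply: measurable_funeM; exact: (@measurable_fun_fubini_tonelli_F _ _ _ _ _ leb1 _ mwD).
  - by move=> y _; exact: at_freq.
rewrite ge0_integralZl_EFin//; last 2 first.
- by move=> y _; apply: integral_ge0 => r _; exact: (wD0 (y, r)).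
- exact: (@measurable_fun_fubini_tonelli_F _ _ _ _ _ leb1 _ mwD).
rewrite (EFinM (8 * (1 + S ^+ 2)) C) -muleA; apply: lee_wpmul2l => //.
have /= -> := @fubini_tonelli _ _ _ _ _ (leb R d) leb1 _ mwD wD0.
have -> : (C%:E * \int[(leb R d \x leb1)%E]_q (wgt_neg q.2 * E q)%:E =
   \int[(leb R d \x leb1)%E]_q (C * (wgt_neg q.2 * E q))%:E)%E.
  under [RHS]eq_integral do rewrite EFinM.
  by rewrite ge0_integralZl_EFin.
have mCE : measurable_fun setT (fun q : d.-tuple T * T => (C * (wgt_neg q.2 * E q))%:E).
  by under eq_fun do rewrite EFinM; exact: measurable_funeM.
have CE0 q : (0 <= (C * (wgt_neg q.2 * E q))%:E)%E by rewrite EFinM mule_ge0.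
rewrite (@fubini_tonelli2 _ _ _ _ _ (leb R d) leb1 _ mCE CE0) /fubini_G.
apply: ge0_le_integral => //=.
- by move=> y _; apply: integral_ge0 => r _; exact: (wD0 (r, y)).
- exact: (@measurable_fun_fubini_tonelli_G _ _ _ _ _ (leb R d) _ mwD).
- exact: (@measurable_fun_fubini_tonelli_G _ _ _ _ _ (leb R d) _ mCE).
Qed.

End slab_estimate.

(** * The operator f(Lambda) *)

Section L2_limit.
Context d (X : measurableType d) (R : realType) (mu : {measure set X -> \bar R}).

(** With [x = s_{n+1} - s_n], the inequality [|x| <= 2^(-n) + 2^n x^2] makes the telescoping series
    absolutely convergent. *)
Let cvg_real (s : R^nat) : (\sum_(n <oo) (2 ^+ n * (s n.+1 - s n) ^+ 2)%:E < +oo)%E -> cvgn s.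
Proof.
move=> Zoo; pose z n : R := 2 ^+ n * (s n.+1 - s n) ^+ 2.
have z0 n : 0 <= z n by apply: mulr_ge0; [exact: exprn_ge0|exact: sqr_ge0].
have cz : cvgn (series z).
  apply: nondecreasing_is_cvgn; first exact: nondecreasing_series.
  pose Z := (\sum_(n <oo) (z n)%:E)%E.
  have Zfin : Z \is a fin_num by rewrite ge0_fin_numE// nneseries_ge0// => n _ _; rewrite lee_fin.
  exists (fine Z) => _ [n _ <-]; rewrite -lee_fin fineK// /series /= -sumEFin big_mkord -(big_mkord predT (fun n => (z n)%:E)).
  by apply: nneseries_lim_ge => k _; rewrite lee_fin.
have cg : cvgn (series (geometric 1 (2^-1 : R))).
  by apply: is_cvg_geometric_series; rewrite ger0_norm ?invr_ge0// invf_lt1// ltr1n.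
have cD : cvgn (series (telescope s)).
  apply: normed_cvg; apply: (@series_le_cvg _ _ (fun n => geometric 1 (2^-1 : R) n + z n)).
  - by move=> n /=.
  - by move=> n; apply: addr_ge0 => //=; rewrite mul1r exprn_ge0// invr_ge0.
  - move=> n; rewrite /telescope /geometric /= /z mul1r exprVn.
    set x := s n.+1 - s n; have p0 : 0 < 2 ^+ n :> R by exact: exprn_gt0.
    have -> : x ^+ 2 = `|x| ^+ 2 by rewrite real_normK// num_real.
    have : (2 ^+ n)^-1 * (2 ^+ n) = 1 :> R by rewrite mulVf// gt_eqF.
    have i0 : 0 < (2 ^+ n)^-1 :> R by rewrite invr_gt0.
    move: (2 ^+ n) (_^-1) (`|x|) p0 i0 (normr_ge0 x) => p i y p0 i0 y0 ip.
    have := sqr_ge0 (1 - p * y); nra.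
  - have -> : series (fun n => geometric 1 (2^-1 : R) n + z n) = series (geometric 1 2^-1) \+ series z.
      by apply/funext => n; rewrite /series /= big_split.
    exact: is_cvgD.
have -> : s = (fun n => s 0%N + series (telescope s) n) by apply/funext => n; rewrite -eq_sum_telescope.
by apply: is_cvgD => //; exact: is_cvg_cst.
Qed.

(* The convergence is stated through arbitrary g, so that it can be used along a subsequence. *)
Lemma L2_limit (s : nat -> X -> R) (A : R) : (forall n, measurable_fun setT (s n)) ->
  (forall n, \int[mu]_x ((s n.+1 x - s n x) ^+ 2)%:E <= (A * (4 ^- n))%:E)%E ->
  exists2 w : X -> R, measurable_fun setT w &
  forall (g : X -> R) (C : \bar R) N, measurable_fun setT g ->
    (forall n, (N <= n)%N -> \int[mu]_x ((g x - s n x) ^+ 2)%:E <= C)%E ->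
    (\int[mu]_x ((g x - w x) ^+ 2)%:E <= C)%E.
Proof.
move=> ms sA.
(* The upper limit is measurable without any convergence; where the series [Z] below is finite,
   hence almost everywhere, it is the limit. *)
pose w x := fine (limn_esup (fun n => (s n x)%:E)).
have mw : measurable_fun setT w.
  apply: (measurableT_comp (fine_measurable _)) => //.
  by apply: measurable_fun_limn_esup => n; exact/measurable_EFinP.
exists w => // g C N mg gC.
pose z n x : \bar R := (2 ^+ n * (s n.+1 x - s n x) ^+ 2)%:E.
have z0 n x : (0 <= z n x)%E by rewrite lee_fin; apply: mulr_ge0; [exact: exprn_ge0|exact: sqr_ge0].
have mz n : measurable_fun setT (z n).
  apply/measurable_EFinP; apply: measurable_funM => //; apply: measurable_funX.
  exact: measurable_funB.
pose Z x := (\sum_(n <oo) z n x)%E.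
have mZ : measurable_fun setT Z by exact: ge0_emeasurable_sum.
have Z0 x : (0 <= Z x)%E by apply: nneseries_ge0.
have IZ : (\int[mu]_x Z x < +oo)%E.
  rewrite /Z integral_nneseries//.
  apply: (@le_lt_trans _ _ (\sum_(n <oo) (geometric A (2^-1 : R) n)%:E)%E).
    apply: lee_nneseries => [n _ _|n _]; first exact: integral_ge0.
    rewrite /z; under eq_integral do rewrite EFinM.
    rewrite ge0_integralZl_EFin ?exprn_ge0//; last 2 first.
    - by move=> x _; rewrite lee_fin sqr_ge0.
    - by apply/measurable_EFinP; apply: measurable_funX; exact: measurable_funB.
    apply: (@le_trans _ _ ((2 ^+ n)%:E * (A * (4 ^- n))%:E)%E).
      by apply: lee_wpmul2l => //; rewrite lee_fin exprn_ge0.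
    rewrite -EFinM lee_fin /geometric /= le_eqVlt; apply/orP; left; apply/eqP.
    rewrite mulrCA; congr (_ * _); rewrite (_ : 4 = 2 * 2); last by ring.
    by rewrite exprMn invfM mulrA mulfV ?mul1r ?exprVn// gt_eqF ?exprn_gt0.
  have -> : (fun n => \sum_(0 <= k < n) (geometric A (2^-1 : R) k)%:E)%E = EFin \o series (geometric A (2^-1 : R)).
    by apply/funext => n; rewrite sumEFin.
  rewrite EFin_lim ?ltry//.
  by apply: is_cvg_geometric_series; rewrite ger0_norm ?invr_ge0// invf_lt1// ltr1n.
have aeZ : {ae mu, forall x, setT x -> Z x \is a fin_num}.
  apply: integrable_ae => //; apply/integrableP; split => //.
  by under eq_integral do rewrite gee0_abs//.
(* Shifted by [N], since the bound on the integrals is available from [N] on only. *)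
pose F n x : \bar R := ((g x - s (n + N)%N x) ^+ 2)%:E.
have mF n : measurable_fun setT (F n).
  by apply/measurable_EFinP; apply: measurable_funX; exact: measurable_funB.
have F0 n x : (0 <= F n x)%E by rewrite lee_fin sqr_ge0.
apply: (@le_trans _ _ (\int[mu]_x limn_einf (F ^~ x))%E); last first.
  apply: le_trans (fatou mu measurableT mF _) _ => //.
  by apply: limn_einf_le => n; apply: gC; exact: leq_addl.
apply: ae_ge0_le_integral => //.
- by move=> x _; rewrite lee_fin sqr_ge0.
- by apply/measurable_EFinP; apply: measurable_funX; exact: measurable_funB.
- by move=> x _; apply: (@limn_einf_ge _ _ _ 0).
- exact: measurable_limn_einf.
apply: filterS aeZ => x Zx _.
have /cvg_ex[l sl] : cvgn (s ^~ x).
  by apply: cvg_real; have := Zx I; rewrite ge0_fin_numE.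
have wl : w x = l.
  rewrite /w; have -> // : limn_esup (fun n => (s n x)%:E) = l%:E.
  by apply: (cvg_limn_einf_sup _).2; apply: cvg_EFin => //; exact: nearW.
have H : F ^~ x @ \oo --> ((g x - l) ^+ 2)%:E.
  apply: cvg_EFin; first exact: nearW.
  have sl' : (fun n => s (n + N)%N x) @ \oo --> l by have -> := cvg_shiftn N (s ^~ x) (nbhs l).
  by apply: cvgM; apply: cvgB => //; exact: cvg_cst.
by rewrite (cvg_limn_einf_sup H).1 wl.
Qed.

End L2_limit.

(** * Truncation in frequency and its limit *)

Section truncation.
Context (R : realType) (d : nat) (C : R).
Local Notation T := (measurableTypeR R).
Local Notation leb1 := (@lebesgue_measure R).
Local Notation mu := (leb R d \x leb1)%E.
Hypothesis C0 : 0 <= C.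
Hypothesis HC : forall b (g : d.-tuple T -> R), bbs g ->
  (\int[leb R d]_y (tr b g y ^+ 2)%:E <= C%:E * \int[leb R d]_x (g x ^+ 2)%:E)%E.

Lemma measurable_enorm_le N (rho : R) : measurable [set t : N.-tuple T | enorm (rvec t) <= rho].
Proof.
have me : measurable_fun setT (fun t : N.-tuple T => enorm (rvec t) : T).
  apply: (measurableT_comp (f := (Num.sqrt : T -> T))).
    by apply: continuous_measurable_fun; exact: sqrt_continuous.
  exact: measurable_tdot.
have -> : [set t : N.-tuple T | enorm (rvec t) <= rho] =
    setT `&` (fun t => enorm (rvec t)) @^-1` `]-oo, rho]%classic.
  by apply/seteqP; split=> t /=; rewrite in_itv /=; [|case].
by apply: me => //; exact: measurable_itv.
Qed.

Lemma bessel_level b (G : d.-tuple T * T -> R) : measurable_fun setT G ->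
  (forall r, bbs (fun y => G (y, r))) ->
  (\int[mu]_q (tr b (fun y => G (y, q.2)) q.1 ^+ 2)%:E <= C%:E * \int[mu]_q (G q ^+ 2)%:E)%E.
Proof.
move=> mG bG.
have mt : measurable_fun setT (fun q : d.-tuple T * T => (tr b (fun y => G (y, q.2)) q.1 ^+ 2)%:E).
  apply/measurable_EFinP; apply: measurable_funX.
  apply: (@measurable_tr_param R _ (d.-tuple T * T)%type b d (fun p => G (p.2, p.1.2)) fst).
    apply: (measurableT_comp mG).
    by apply/measurable_fun_pair => //=; apply: measurableT_comp.
  exact: measurable_fst.
have mG2 : measurable_fun setT (fun q => (G q ^+ 2)%:E).
  by apply/measurable_EFinP; exact: measurable_funX.
have mCG2 : measurable_fun setT (fun q => (C%:E * (G q ^+ 2)%:E)%E) by exact: measurable_funeM.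
have t0 q : (0 <= (tr b (fun y => G (y, q.2)) q.1 ^+ 2)%:E)%E by rewrite lee_fin sqr_ge0.
have CG0 q : (0 <= C%:E * (G q ^+ 2)%:E)%E by rewrite mule_ge0 // lee_fin sqr_ge0.
rewrite -ge0_integralZl_EFin //; last by move=> q _; rewrite lee_fin sqr_ge0.
rewrite (@fubini_tonelli2 _ _ _ _ _ (leb R d) leb1 _ mt t0).
rewrite (@fubini_tonelli2 _ _ _ _ _ (leb R d) leb1 _ mCG2 CG0) /fubini_G.
apply: ge0_le_integral => //.
- by move=> r _; apply: integral_ge0 => y _; exact: (t0 (y, r)).
- exact: (@measurable_fun_fubini_tonelli_G _ _ _ _ _ (leb R d) _ mt).
- exact: (@measurable_fun_fubini_tonelli_G _ _ _ _ _ (leb R d) _ mCG2).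
move=> r _; rewrite ge0_integralZl_EFin //.
- exact: (HC b (bG r)).
- by move=> y _; rewrite lee_fin sqr_ge0.
- exact: (measurableT_comp mG2 (measurable_pair2 r)).
Qed.

Definition lowpass (rho : R) (y : d.-tuple T) : R := \1_[set t : d.-tuple T | enorm (rvec t) <= rho] y.

Lemma lowpassE rho y : lowpass rho y = (enorm (rvec y) <= rho)%R%:R.
Proof.
rewrite /lowpass indicE; congr (nat_of_bool _)%:R.
by apply/idP/idP => [/set_mem|h]; [|exact/mem_set].
Qed.

Lemma lowpass01 rho y : lowpass rho y = 0 \/ lowpass rho y = 1.
Proof. by rewrite lowpassE; case: (_ <= _); [right|left]. Qed.

Lemma measurable_lowpass rho : measurable_fun setT (lowpass rho : _ -> T).
Proof. by apply: measurable_indic; exact: measurable_enorm_le. Qed.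

Variable P : d.-tuple T * T -> R.
Hypothesis mP : measurable_fun setT P.
Hypothesis Poo : (\int[mu]_q (P q ^+ 2)%:E < +oo)%E.
Hypothesis bP : forall rho r, bbs (fun y => lowpass rho y * P (y, r)).

Definition lowpass_tr b rho (q : d.-tuple T * T) : R := tr b (fun y => lowpass rho y * P (y, q.2)) q.1.

(** The L^2 mass of [P] at frequencies beyond [rho]; it measures the distance between
    truncations. *)
Let tail rho : \bar R := (\int[mu]_q (((1 - lowpass rho q.1) * P q) ^+ 2)%:E)%E.

Let mcut2 rho : measurable_fun setT (fun q : d.-tuple T * T => lowpass rho q.1 : T).
Proof. exact: (measurableT_comp (measurable_lowpass rho) measurable_fst). Qed.

Let mtail rho : measurable_fun setT (fun q => (((1 - lowpass rho q.1) * P q) ^+ 2)%:E).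
Proof.
apply/measurable_EFinP; apply: measurable_funX; apply: measurable_funM => //.
by apply: measurable_funB => //; exact: mcut2.
Qed.

Let mcutP rho : measurable_fun setT (fun q => (lowpass rho q.1 * P q : T)).
Proof. by apply: measurable_funM => //; exact: mcut2. Qed.

Lemma measurable_lowpass_tr b rho : measurable_fun setT (lowpass_tr b rho : _ -> T).
Proof.
apply: (@measurable_tr_param R _ (d.-tuple T * T)%type b d (fun p => lowpass rho p.2 * P (p.2, p.1.2)) fst).
  apply: (measurableT_comp (mcutP rho) (f := fun q => lowpass rho q.1 * P q)
    (g := fun p : d.-tuple T * T * d.-tuple T => (p.2, p.1.2))).
  by apply/measurable_fun_pair => //=; apply: measurableT_comp.
exact: measurable_fst.
Qed.

Let sq0 (x : R) : (0 <= (x ^+ 2)%:E)%E. Proof. by rewrite lee_fin sqr_ge0. Qed.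

Let mP2 : measurable_fun setT (fun q => (P q ^+ 2)%:E).
Proof. by apply/measurable_EFinP; exact: measurable_funX. Qed.

Let lowpass_tr_le b rho :
  (\int[mu]_q (lowpass_tr b rho q ^+ 2)%:E <= C%:E * \int[mu]_q (P q ^+ 2)%:E)%E.
Proof.
apply: (le_trans (bessel_level b (mcutP rho) (bP rho))).
apply: lee_wpmul2l; first by rewrite lee_fin.
apply: ge0_le_integral => //; first by apply/measurable_EFinP; apply: measurable_funX; exact: mcutP.
move=> q _; rewrite lee_fin exprMn.
by case: (lowpass01 rho q.1) => ->; rewrite ?expr0n ?mul0r ?sqr_ge0// expr1n mul1r.
Qed.

(** Apply Bessel's inequality to the difference of the two truncated functions: it is nonzero only
    where exactly one of the cutoffs vanishes, hence is bounded by the tails. *)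
Let lowpass_trB b rho sig :
  (\int[mu]_q ((lowpass_tr b rho q - lowpass_tr b sig q) ^+ 2)%:E <= C%:E * (tail rho + tail sig))%E.
Proof.
have mB : measurable_fun setT (fun q => (lowpass rho q.1 - lowpass sig q.1) * P q : T).
  by apply: measurable_funM => //; apply: measurable_funB; exact: mcut2.
have bB r : bbs (fun y => (lowpass rho y - lowpass sig y) * P (y, r)).
  have [b1 [L1 L10 H1]] := bP rho r; have [b2 [L2 L20 H2]] := bP sig r.
  under eq_fun do rewrite mulrBl; split; first exact: bdmB.
  exists (Num.max L1 L2); first by rewrite lt_max L10.
  by move=> y [j]; rewrite gt_max => /andP[h1 h2]; rewrite H1 ?H2 ?subrr//; exists j.
have -> : (\int[mu]_q ((lowpass_tr b rho q - lowpass_tr b sig q) ^+ 2)%:E =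
   \int[mu]_q (tr b (fun y => (lowpass rho y - lowpass sig y) * P (y, q.2)) q.1 ^+ 2)%:E)%E.
  apply: eq_integral => q _; rewrite /lowpass_tr /tr -bms_RintB; try exact/bms_tr.
  by congr (_ ^+ 2)%:E; apply: eq_Rintegral => y _; ring.
apply: (le_trans (bessel_level b mB bB)).
apply: lee_wpmul2l; first by rewrite lee_fin.
rewrite /tail -ge0_integralD//.
apply: ge0_le_integral => //.
- by apply/measurable_EFinP; exact: measurable_funX.
- by apply: emeasurable_funD; exact: mtail.
move=> q _; rewrite -EFinD lee_fin !exprMn -mulrDl; apply: ler_wpM2r; first exact: sqr_ge0.
by case: (lowpass01 rho q.1) => ->; case: (lowpass01 sig q.1) => ->; lra.
Qed.

Let tail_le rho sig : rho <= sig -> (tail sig <= tail rho)%E.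
Proof.
move=> rs; apply: ge0_le_integral => //; try exact: mtail.
move=> q _; rewrite lee_fin !exprMn; apply: ler_wpM2r; first exact: sqr_ge0.
rewrite !lowpassE; have [h|h] := leP (enorm (rvec q.1)) rho.
  by rewrite (le_trans h rs) !subrr.
by rewrite subr0; case: (enorm _ <= sig); rewrite ?subrr ?subr0 ?expr0n ?expr1n /=.
Qed.

(** Monotone convergence over the balls [|xi| <= n]; the finiteness [Poo] allows the subtraction. *)
Let tail_small (e : R) : 0 < e -> exists rho, (tail rho <= e%:E)%E.
Proof.
move=> e0.
pose F (n : nat) : set (d.-tuple T * T) := [set q | enorm (rvec q.1) <= n%:R].
have mF n : measurable (F n).
  rewrite (_ : F n = [set t | enorm (rvec t) <= n%:R] `*` setT); last first.
    by apply/seteqP; split=> -[y r] //= [].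
  by apply: measurableX => //; exact: measurable_enorm_le.
have FT : \bigcup_n F n = setT.
  apply/seteqP; split=> // q _; exists (Num.truncn (enorm (rvec q.1))).+1 => //.
  by rewrite /F /=; apply: ltW; exact: truncnS_gt.
have := @ge0_nondecreasing_set_cvg_integral _ _ _ F (fun q => (P q ^+ 2)%:E) mu.
rewrite FT => /(_ _ _ _ _) H.
have {}H : (\int[mu]_(q in F i) (P q ^+ 2)%:E @[i --> \oo] --> \int[mu]_q (P q ^+ 2)%:E)%E.
  apply: H => // [m n mn|n]; last exact: measurable_funTS.
  by apply/subsetPset => q /= h; apply: le_trans h _; rewrite ler_nat.
have I0 : (0 <= \int[mu]_q (P q ^+ 2)%:E)%E by exact: integral_ge0.
have Ifin : (\int[mu]_q (P q ^+ 2)%:E)%E \is a fin_num by rewrite ge0_fin_numE.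
have Hn n : (\int[mu]_q (P q ^+ 2)%:E = \int[mu]_(q in F n) (P q ^+ 2)%:E + tail n%:R)%E.
  have -> : (\int[mu]_(q in F n) (P q ^+ 2)%:E = \int[mu]_q ((lowpass n%:R q.1 * P q) ^+ 2)%:E)%E.
    rewrite integral_mkcond; apply: eq_integral => q _; rewrite /patch lowpassE.
    have [h|h] := boolP (enorm (rvec q.1) <= n%:R).
      by rewrite (mem_set (A := F n) h) mul1r.
    by rewrite (memNset (A := F n) (negP h)) mul0r expr0n.
  rewrite /tail -ge0_integralD//; last by apply/measurable_EFinP; apply: measurable_funX; exact: mcutP.
  apply: eq_integral => q _; rewrite -EFinD; congr EFin.
  by case: (lowpass01 n%:R q.1) => ->; ring.
have : (\forall n \near \oo, \int[mu]_q (P q ^+ 2)%:E - e%:E < \int[mu]_(q in F n) (P q ^+ 2)%:E)%E.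
  apply: (H [set x | (_ < x)%E]); apply: open_nbhs_nbhs; split; first exact: open_ereal_gt_ereal.
  rewrite /= EFinN; by rewrite lteBlDr// lteDl.
move=> [n _ /(_ n (leqnn n))]; rewrite /= (Hn n) => h; exists n%:R.
have Fn0 : (0 <= \int[mu]_(q in F n) (P q ^+ 2)%:E)%E by exact: integral_ge0.
have Ffin : (\int[mu]_(q in F n) (P q ^+ 2)%:E)%E \is a fin_num.
  by rewrite ge0_fin_numE// (le_lt_trans _ Poo)// (Hn n) leeDl//; exact: integral_ge0.
move: h; rewrite EFinN lteBlDr// lteD2lE// => /ltW; exact.
Qed.

(** Choose radii with tail at most [4^(-n)] and take the limit along this sequence with [L2_limit].
    An arbitrary large radius is then compared with the terms of the sequence, which gives
    convergence of the whole family. *)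
Lemma lowpass_tr_limit b : exists w : d.-tuple T * T -> R,
  [/\ measurable_fun setT w,
      (\int[mu]_q (w q ^+ 2)%:E <= C%:E * \int[mu]_q (P q ^+ 2)%:E)%E &
      forall e : R, 0 < e -> exists rho0 : R, forall rho, rho0 <= rho ->
        (\int[mu]_q ((lowpass_tr b rho q - w q) ^+ 2)%:E <= e%:E)%E].
Proof.
have /choice[rho Hrho] : forall n : nat, exists rho, (tail rho <= (4 ^- n)%:E)%E.
  by move=> n; apply: tail_small; rewrite invr_gt0 exprn_gt0.
have tail0 s : (0 <= tail s)%E by exact: integral_ge0.
have [] := @L2_limit _ _ _ mu (fun n => lowpass_tr b (rho n)) (2 * C) (fun n => measurable_lowpass_tr b (rho n)).
  move=> n; apply: le_trans (lowpass_trB b _ _) _.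
  rewrite (mulrC 2) -mulrA EFinM; apply: lee_wpmul2l; first by rewrite lee_fin.
  rewrite mulrDl mul1r EFinD; apply: leeD; apply: le_trans (Hrho _) _ => //.
  by rewrite lee_fin lef_pV2 ?posrE ?exprn_gt0// ler_weXn2l// ler1n.
move=> w mw Hw; exists w; split => //.
  have E h : (\int[mu]_q ((cst 0 q - h q) ^+ 2)%:E = \int[mu]_q (h q ^+ 2)%:E)%E.
    by apply: eq_integral => q _; rewrite /= sub0r sqrrN.
  rewrite -E; apply: (Hw _ _ 0%N (measurable_cst _)) => n _; rewrite E.
  exact: lowpass_tr_le.
move=> e e0; pose e' := e / (2 * C + 1).
have C1 : 0 < 2 * C + 1 by rewrite ltr_wpDl// mulr_ge0.
have e'0 : 0 < e' by rewrite divr_gt0.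
have [rho0 H0] := tail_small e'0; exists rho0 => s rs.
pose N := (Num.truncn e'^-1).+1.
have NE : 4 ^- N <= e'.
  rewrite -[e']invrK lef_pV2 ?posrE ?exprn_gt0 ?invr_gt0//.
  apply: (le_trans (ltW (truncnS_gt _))); rewrite -/N.
  apply: (@le_trans _ _ (2 ^ N)%:R); first by rewrite ler_nat ltnW// ltn_expl.
  by rewrite natrX lerXn2r ?nnegrE// ler_nat.
apply: (Hw _ _ N (measurable_lowpass_tr b s)) => n Nn.
apply: le_trans (lowpass_trB b _ _) _.
apply: (@le_trans _ _ (C%:E * (e'%:E + e'%:E))%E).
  apply: lee_wpmul2l; first by rewrite lee_fin.
  apply: leeD; first exact: le_trans (tail_le rs) H0.
  apply: le_trans (Hrho n) _; rewrite lee_fin; apply: le_trans NE.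
  by rewrite lef_pV2 ?posrE ?exprn_gt0// ler_weXn2l// ler1n.
rewrite -EFinD -EFinM lee_fin.
have -> : e = e' * (2 * C + 1) by rewrite /e' divfK// gt_eqF.
by nra.
Qed.

End truncation.

Section Lnorm2.
Context d (X : measurableType d) (R : realType) (mu : {measure set X -> \bar R}).

Lemma Lnorm2E (h : X -> R) :
  (Lnorm mu 2%:E (fun x => (h x)%:E) = (\int[mu]_x (h x ^+ 2)%:E) `^ 2^-1)%E.
Proof.
rewrite unlock; congr (_ `^ _)%E; apply: eq_integral => x _.
by rewrite abse_EFin poweR_EFin powR_mulrn// real_normK// num_real.
Qed.

Lemma sqr_Lnorm2 (h : X -> R) :
  (\int[mu]_x (h x ^+ 2)%:E = Lnorm mu 2%:E (fun x => (h x)%:E) * Lnorm mu 2%:E (fun x => (h x)%:E))%E.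
Proof.
have I0 : (0 <= \int[mu]_x (h x ^+ 2)%:E)%E by apply: integral_ge0 => x _; rewrite lee_fin sqr_ge0.
rewrite Lnorm2E poweR12_sqrt//.
by rewrite -expe2 sqr_sqrte.
Qed.

Lemma poweR_half_le (c : R) (I J : \bar R) : 0 <= c -> (0 <= I)%E -> (0 <= J)%E -> (I <= (c ^+ 2)%:E * J)%E ->
  (I `^ 2^-1 <= c%:E * J `^ 2^-1)%E.
Proof.
move=> c0 I0 J0 IJ.
apply: (@le_trans _ _ (((c ^+ 2)%:E * J) `^ 2^-1)%E).
  by apply: gt0_ler_poweR; rewrite ?invr_ge0// in_itv /= ?leey ?andbT// mule_ge0// lee_fin sqr_ge0.
rewrite poweRM ?lee_fin ?sqr_ge0// poweR_EFin; apply: lee_wpmul2r; first exact: poweR_ge0.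
by rewrite lee_fin -powR_mulrn// -powRrM mulfV// powRr1.
Qed.

Lemma Lnorm2_le (c : R) (J : \bar R) (h : X -> R) : 0 <= c -> (0 <= J)%E ->
  (\int[mu]_x (h x ^+ 2)%:E <= (c ^+ 2)%:E * (J * J))%E ->
  (Lnorm mu 2%:E (fun x => (h x)%:E) <= c%:E * J)%E.
Proof.
move=> c0 J0 H; rewrite Lnorm2E.
apply: (le_trans (poweR_half_le c0 _ _ H)); first by apply: integral_ge0 => x _; rewrite lee_fin sqr_ge0.
  exact: mule_ge0.
apply: lee_wpmul2l; first by rewrite lee_fin.
by rewrite poweR12_sqrt ?mule_ge0// -expe2 sqrte_sqr gee0_abs.
Qed.

End Lnorm2.

(** * f(Lambda) u for a function on the slab *)

Section propA.
Context (R : realType) (d : nat) (f : R -> R).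
Local Notation T := (measurableTypeR R).
Local Notation leb1 := (@lebesgue_measure R).
Local Notation mu := (leb R d \x leb1)%E.
Local Notation Y := ('rV[R]_d * R)%type.
Hypothesis f0 : forall t : R, 0 < t -> 0 <= f t.
Hypothesis f_incr : increasing_pos f.
Hypothesis f_decr : decreasing_pos (fun t => f t / t).
Hypothesis cf : forall t : R, 0 < t -> {for t, continuous f}.

Variables (u : Y -> R[i]) (M L S C : R).
Hypothesis L0 : 0 < L.
Hypothesis S0 : 0 < S.
Hypothesis C0 : 0 <= C.
Let p (y : Y) : R := complex.Re (u y).
Let q (y : Y) : R := complex.Im (u y).
Hypothesis pC : slab_C1 M L S p.
Hypothesis qC : slab_C1 M L S q.
Hypothesis HC : forall b (g : d.-tuple T -> R), bbs g ->
  (\int[leb R d]_y (tr b g y ^+ 2)%:E <= C%:E * \int[leb R d]_x (g x ^+ 2)%:E)%E.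

(** The Dirichlet integral on [r < 0] with weight omega(s)^2; its finiteness is what makes the
    frequency-side functions [P1] and [P2] square integrable. *)
Definition slab_energy (P : Y -> R) : \bar R :=
  (\int[mu]_q (wgt_neg f q.2 * (half_ext (pdr P) q ^+ 2 + \sum_k half_ext (pda k P) q ^+ 2))%:E)%E.

Hypothesis Jp : (slab_energy p < +oo)%E.
Hypothesis Jq : (slab_energy q < +oo)%E.

Let D : R := 8 * (1 + S ^+ 2) * C.

Let FL (t : d.-tuple T) : R := f (Lambda (rvec t)).

(* Real and imaginary parts of f(Lambda_xi) times the partial Fourier transform of u. *)
Let P1 (x : d.-tuple T * T) : R := FL x.1 * half_tr true p x + FL x.1 * half_tr false q x.
Let P2 (x : d.-tuple T * T) : R := FL x.1 * half_tr true q x - FL x.1 * half_tr false p x.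

Let cp (y : Y) : y.2 < 0 -> {for y, continuous p}. Proof. by have [H _ _] := pC => /H[]. Qed.
Let cq (y : Y) : y.2 < 0 -> {for y, continuous q}. Proof. by have [H _ _] := qC => /H[]. Qed.

Let mFL : measurable_fun setT (FL : _ -> T).
Proof.
apply: (measurable_pos (g := fun t => Lambda (rvec t))) => //; last by move=> t; exact: Lambda_gt0.
exact: measurable_Lambda.
Qed.

Let mfh b (P : Y -> R) : (forall y : Y, y.2 < 0 -> {for y, continuous P}) ->
  measurable_fun setT (fun x => FL x.1 * half_tr b P x : T).
Proof.
move=> cP; apply: measurable_funM; last exact: measurable_half_tr.
exact: (measurableT_comp mFL measurable_fst).
Qed.

Let mP1 : measurable_fun setT (P1 : _ -> T). Proof. by apply: measurable_funD; exact: mfh. Qed.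
Let mP2 : measurable_fun setT (P2 : _ -> T). Proof. by apply: measurable_funB; exact: mfh. Qed.

Let int2 (g h : d.-tuple T * T -> R) : measurable_fun setT g -> measurable_fun setT h ->
  (\int[mu]_x ((g x + h x) ^+ 2)%:E <= 2%:E * (\int[mu]_x (g x ^+ 2)%:E + \int[mu]_x (h x ^+ 2)%:E))%E.
Proof.
move=> mg mh.
have sq0 (z : R) : (0 <= (z ^+ 2)%:E)%E by rewrite lee_fin sqr_ge0.
have m2 (k : d.-tuple T * T -> R) : measurable_fun setT k -> measurable_fun setT (fun x => (k x ^+ 2)%:E).
  by move=> mk; apply/measurable_EFinP; exact: measurable_funX.
have mgh := measurable_funD mg mh.
rewrite -ge0_integralD//; try exact: m2.
rewrite -ge0_integralZl_EFin//; last 2 first.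
- by move=> x _; exact: adde_ge0.
- by apply: emeasurable_funD; exact: m2.
apply: ge0_le_integral => //; first exact: m2.
- by apply: measurable_funeM; apply: emeasurable_funD; exact: m2.
- by move=> x _; rewrite -EFinD -EFinM lee_fin; have := sqr_ge0 (g x - h x); nra.
Qed.

Let est b (P : Y -> R) : slab_C1 M L S P ->
  (\int[mu]_x ((FL x.1 * half_tr b P x) ^+ 2)%:E <= D%:E * slab_energy P)%E.
Proof. by move=> PC; exact: (slab_estimate f0 f_incr f_decr cf L0 S0 C0 PC HC). Qed.

Let J := (slab_energy p + slab_energy q)%E.

Let en0 P : (0 <= slab_energy P)%E.
Proof.
apply: integral_ge0 => x _; rewrite lee_fin; apply: mulr_ge0; first exact: wgt_neg_ge0.
by apply: addr_ge0; [exact: sqr_ge0|apply: sumr_ge0 => k _; exact: sqr_ge0].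
Qed.

Let D0 : 0 <= D.
Proof. by rewrite /D; apply: mulr_ge0 => //; apply: mulr_ge0 => //; apply: addr_ge0 => //; exact: sqr_ge0. Qed.

Let estP1 : (\int[mu]_x (P1 x ^+ 2)%:E <= (2 * D)%:E * J)%E.
Proof.
apply: le_trans (int2 (mfh true cp) (mfh false cq)) _.
rewrite EFinM -muleA; apply: lee_wpmul2l => //; rewrite /J ge0_muleDr//.
by apply: leeD; exact: est.
Qed.

Let estP2 : (\int[mu]_x (P2 x ^+ 2)%:E <= (2 * D)%:E * J)%E.
Proof.
have mN : measurable_fun setT (fun x => - (FL x.1 * half_tr false p x) : T).
  by apply: measurableT_comp => //; exact: mfh.
apply: le_trans (int2 (mfh true cq) mN) _.
rewrite EFinM -muleA; apply: lee_wpmul2l => //; rewrite /J ge0_muleDr// addeC.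
apply: leeD; last exact: est.
by under eq_integral do rewrite sqrrN; exact: est.
Qed.

Let Joo : ((2 * D)%:E * J < +oo)%E.
Proof.
apply: lte_mul_pinfty => //; first by rewrite lee_fin; exact: mulr_ge0.
exact: (lte_add_pinfty Jp Jq).
Qed.

(** [f] may be unbounded, but being increasing it is at most [f (sqrt (1 + rho^2))] at the
    frequencies that the cutoff keeps. The absolute value of [rho] is used because [rho] may be
    negative. *)
Let cutFL rho (g : d.-tuple T -> R) : measurable_fun setT g -> (exists B, forall y, `|g y| <= B) ->
  bbs (fun y => lowpass rho y * (FL y * g y)).
Proof.
move=> mg [B gB]; pose r' := `|rho|.
have r0 : 0 <= r' by exact: normr_ge0.
have cutb (y : d.-tuple T) : lowpass rho y != 0 -> enorm (rvec y) <= r'.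
  rewrite lowpassE; case: leP => [h _|]; last by rewrite eqxx.
  by apply: le_trans h _; exact: ler_norm.
have edot0 (y : d.-tuple T) : 0 <= edot (rvec y) (rvec y).
  by apply: sumr_ge0 => i _; rewrite -expr2 sqr_ge0.
split; [split|].
- apply: measurable_funM; first exact: measurable_lowpass.
  exact: measurable_funM.
- exists (f (Num.sqrt (1 + r' ^+ 2)) * `|B|) => y.
  have [->|ny] := eqVneq (lowpass rho y) 0.
    by rewrite mul0r normr0 mulr_ge0// f0// sqrtr_gt0 ltr_pwDl// sqr_ge0.
  rewrite !normrM (_ : `|lowpass rho y| = 1); last by case: (lowpass01 rho y) ny => ->; rewrite ?eqxx ?normr1.
  rewrite mul1r; apply: ler_pM => //; last by apply: le_trans (gB y) _; exact: ler_norm.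
  rewrite ger0_norm ?f0 ?Lambda_gt0//; apply: f_incr; first exact: Lambda_gt0.
  apply: ler_wsqrtr; rewrite lerD2l.
  have := cutb y ny; rewrite /enorm => h.
  by rewrite -[leLHS]sqr_sqrtr// lerXn2r ?nnegrE ?sqrtr_ge0.
- exists (r' + 1); first by rewrite ltr_wpDl.
  move=> y [i yi]; have [->|ny] := eqVneq (lowpass rho y) 0; first by rewrite mul0r.
  have := cutb y ny; rewrite leNgt => /negP[].
  apply: lt_le_trans (_ : r' + 1 <= _); first by rewrite ltrDl.
  apply: (le_trans (ltW yi)); rewrite -[leLHS]ger0_norm// -sqrtr_sqr; apply: ler_wsqrtr.
  rewrite real_normK ?num_real// /edot (bigD1 i)//= !mxE -expr2 lerDl.
  by apply: sumr_ge0 => j _; rewrite !mxE -expr2 sqr_ge0.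
Qed.

Let hb b (P : Y -> R) r : slab_C1 M L S P -> exists B, forall y, `|half_tr b P (y, r)| <= B.
Proof.
move=> PC; have [[mg [B gB]] [L' L'0 gL]] := slab_bbs L0 PC r.
by exists (B * (2 * (L' + 1)) ^+ d) => y; exact: (tr_bound b mg L'0 gB gL y).
Qed.

Let bbsD (g h : d.-tuple T -> R) : bbs g -> bbs h -> bbs (fun y => g y + h y).
Proof.
move=> [bg [L1 L10 H1]] [bh [L2 L20 H2]]; split; first exact: bdmD.
exists (Num.max L1 L2); first by rewrite lt_max L10.
by move=> y [j]; rewrite gt_max => /andP[h1 h2]; rewrite H1 ?H2 ?addr0//; exists j.
Qed.

Let slice_m b (P : Y -> R) r : (forall y : Y, y.2 < 0 -> {for y, continuous P}) ->
  measurable_fun setT (fun y => half_tr b P (y, r) : T).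
Proof. by move=> cP; exact: (measurableT_comp (measurable_half_tr b cP) (measurable_pair2 r)). Qed.

Let bP1 rho r : bbs (fun y => lowpass rho y * P1 (y, r)).
Proof.
rewrite /P1 /=; under eq_fun do rewrite mulrDr.
by apply: bbsD; apply: cutFL; (exact: slice_m || exact: hb).
Qed.

Let bP2 rho r : bbs (fun y => lowpass rho y * P2 (y, r)).
Proof.
rewrite /P2 /=; under eq_fun do rewrite mulrDr.
apply: bbsD; first by apply: cutFL; (exact: slice_m || exact: hb).
under eq_fun do rewrite mulrN; apply: bbsN.
by apply: cutFL; (exact: slice_m || exact: hb).
Qed.

Let kap : R := (2 * pi) ^- d.

Let tuple_of (x : 'rV[R]_d) : d.-tuple T := [tuple x 0 i | i < d].

Let rvecK (t : d.-tuple T) : tuple_of (rvec t) = t.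
Proof. by apply: eq_from_tnth => i; rewrite tnth_mktuple mxE. Qed.

Let tfourierE (t : d.-tuple T) (r : R) : r < 0 ->
  tfourier u (rvec t) r =
   ((half_tr true p (t, r) + half_tr false q (t, r)) +i* (half_tr true q (t, r) - half_tr false p (t, r)))%C.
Proof.
move=> r0; rewrite /tfourier /cintegral.
have bh b P : slab_C1 M L S P -> bms (leb R d) (fun x => ct b (tdot x t) * half_ext P (x, r)).
  by move=> PC; apply: bms_tr; exact: (slab_bbs L0 PC).
rewrite /half_tr /tr /= -bms_RintD; try (exact: (bh true) || exact: (bh false)).
rewrite -bms_RintB; try (exact: (bh true) || exact: (bh false)).
congr (_ +i* _)%C; apply: eq_Rintegral => x _; rewrite /half_ext /= r0 /expi /p /q /tdot /=;
  case: (u (rvec x, r)) => a b /=; rewrite cosN sinN; ring.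
Qed.

Let scaleC (k a b : R) : (k%:C * (a +i* b) = (k * a) +i* (k * b))%C.
Proof. by simpc. Qed.

(** The real and imaginary parts of [e^{i <a, xi>} (P1 + i P2)]: the truncated inversion integral
    becomes four real low-pass transforms. *)
Let truncE rho (y : d.-tuple T) (r : T) : r < 0 ->
  fLambda_trunc f u rho (rvec y, r) =
   ((kap * (lowpass_tr P1 true rho (y, r) - lowpass_tr P2 false rho (y, r))) +i*
    (kap * (lowpass_tr P2 true rho (y, r) + lowpass_tr P1 false rho (y, r))))%C.
Proof.
move=> r0; rewrite /fLambda_trunc /cintegral -/kap.
have B1 c : bms (leb R d) (fun x => ct c (tdot x y) * (lowpass rho x * P1 (x, r))).
  exact: (bms_tr c y (bP1 rho r)).
have B2 c : bms (leb R d) (fun x => ct c (tdot x y) * (lowpass rho x * P2 (x, r))).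
  exact: (bms_tr c y (bP2 rho r)).
have -> : lowpass_tr P1 true rho (y, r) - lowpass_tr P2 false rho (y, r) =
   \int[leb R d]_t (ct true (tdot t y) * (lowpass rho t * P1 (t, r)) - ct false (tdot t y) * (lowpass rho t * P2 (t, r))).
  exact: esym (bms_RintB (B1 true) (B2 false)).
have -> : lowpass_tr P2 true rho (y, r) + lowpass_tr P1 false rho (y, r) =
   \int[leb R d]_t (ct true (tdot t y) * (lowpass rho t * P2 (t, r)) + ct false (tdot t y) * (lowpass rho t * P1 (t, r))).
  exact: esym (bms_RintD (B2 true) (B1 false)).
have E (g h : d.-tuple T -> R) : (forall t, h t = lowpass rho t * g t) ->
    \int[leb R d]_(t in [set t | enorm (rvec t) <= rho]) g t = \int[leb R d]_t h t.
  move=> gh; rewrite Rintegral_mkcond; apply: eq_Rintegral => t _; rewrite gh lowpassE /patch.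
  have [h1|h1] := boolP (enorm (rvec t) <= rho).
    by rewrite (mem_set (A := [set t | enorm (rvec t) <= rho]) h1) mul1r.
  by rewrite (memNset (A := [set t | enorm (rvec t) <= rho]) (negP h1)) mul0r.
have sym (t : d.-tuple T) : edot (rvec y) (rvec t) = tdot t y.
  by rewrite /tdot /edot; apply: eq_bigr => i _; rewrite mulrC.
rewrite (E _ (fun t => ct true (tdot t y) * (lowpass rho t * P1 (t, r)) - ct false (tdot t y) * (lowpass rho t * P2 (t, r)))); last first.
  move=> t; rewrite [tfourier _ _ _](tfourierE t r0) /fst sym /expi /P1 /P2 /FL /=.
  by move: (half_tr _ _ _) (half_tr _ _ _) (half_tr _ _ _) (half_tr _ _ _) (f _) (lowpass _ _) (cos _) (sin _) => *; ring.
rewrite (E _ (fun t => ct true (tdot t y) * (lowpass rho t * P2 (t, r)) + ct false (tdot t y) * (lowpass rho t * P1 (t, r)))); last first.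
  move=> t; rewrite [tfourier _ _ _](tfourierE t r0) /fst sym /expi /P1 /P2 /FL /=.
  by move: (half_tr _ _ _) (half_tr _ _ _) (half_tr _ _ _) (half_tr _ _ _) (f _) (lowpass _ _) (cos _) (sin _) => *; ring.
exact: scaleC.
Qed.

Let m2 (h : d.-tuple T * T -> R) : measurable_fun setT h -> measurable_fun setT (fun x => (h x ^+ 2)%:E).
Proof. by move=> mh; apply/measurable_EFinP; exact: measurable_funX. Qed.

Let sq0 (z : R) : (0 <= (z ^+ 2)%:E)%E. Proof. by rewrite lee_fin sqr_ge0. Qed.

Let half_sqr (v : Y -> R[i]) (q : d.-tuple T * T) : R :=
  \1_[set x : R | x < 0] q.2 * normc (v (rvec q.1, q.2)).

Let norm4 (h1 h2 h3 h4 : d.-tuple T * T -> R) (v : Y -> R[i]) :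
  measurable_fun setT h1 -> measurable_fun setT h2 -> measurable_fun setT h3 -> measurable_fun setT h4 ->
  (forall x, x.2 < 0 -> v (rvec x.1, x.2) = ((kap * (h1 x - h2 x)) +i* (kap * (h3 x + h4 x)))%C) ->
  (\int[mu]_x (half_sqr v x ^+ 2)%:E <= (2 * kap ^+ 2)%:E *
     (\int[mu]_x (h1 x ^+ 2)%:E + \int[mu]_x (h2 x ^+ 2)%:E +
      (\int[mu]_x (h3 x ^+ 2)%:E + \int[mu]_x (h4 x ^+ 2)%:E)))%E.
Proof.
move=> mh1 mh2 mh3 mh4 hv.
pose g x := (kap * (h1 x - h2 x)) ^+ 2 + (kap * (h3 x + h4 x)) ^+ 2.
have mg : measurable_fun setT (fun x => (g x)%:E).
  apply/measurable_EFinP; apply: measurable_funD; apply: measurable_funX; apply: measurable_funM => //.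
    exact: measurable_funB.
  exact: measurable_funD.
have g0 x : 0 <= g x by apply: addr_ge0; exact: sqr_ge0.
have E x : (half_sqr v x ^+ 2)%:E = ((fun x => (g x)%:E) \_ (setT `*` [set x : T | x < 0])) x.
  rewrite /half_sqr /patch indicE; have [h|h] := boolP (x.2 < 0).
    rewrite (mem_set (A := [set x : R | x < 0]) h) (mem_set (A := setT `*` _)); last by split.
    rewrite mul1r hv//= sqr_sqrtr //; exact: (g0 x).
  rewrite (memNset (A := [set x : R | x < 0]) (negP h)) (memNset (A := setT `*` _)); last by case=> _; exact/negP.
  by rewrite mul0r expr0n.
have mA : measurable ([set: d.-tuple T] `*` [set x : T | x < 0]).
  apply: measurableX => //; apply: open_measurable; exact: (@open_lt R^o).
under eq_integral do rewrite E.
rewrite -integral_mkcond.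
apply: (@le_trans _ _ (\int[mu]_x (g x)%:E)%E).
  by apply: ge0_subset_integral => // x _; rewrite lee_fin.
rewrite -!ge0_integralD//; try (exact: m2); try (apply: emeasurable_funD; exact: m2);
  try (by move=> x _; apply: adde_ge0).
rewrite -ge0_integralZl_EFin//; last 3 first.
- by move=> x _; do 2 ?apply: adde_ge0.
- by do 2 ?apply: emeasurable_funD; exact: m2.
- by apply: mulr_ge0 => //; exact: sqr_ge0.
apply: ge0_le_integral => //.
- by move=> x _; rewrite lee_fin.
- by apply: measurable_funeM; do 2 ?apply: emeasurable_funD; exact: m2.
move=> x _; rewrite -!EFinD -EFinM lee_fin /g !exprMn.
have := sqr_ge0 kap; have := sqr_ge0 (h1 x + h2 x); have := sqr_ge0 (h3 x - h4 x).
by move: (kap ^+ 2) (h1 x) (h2 x) (h3 x) (h4 x) => k a b c e; nra.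
Qed.

(** The factor 16 is the 2 of [norm4], the number 4 of transforms, and the 2 in the bounds of [P1]
    and [P2]. Bessel's constant enters twice: in [D] for the partial Fourier transform, and as [C]
    for its inversion. *)
Theorem slab_fLambda : exists w, is_fLambda f u w /\
  (\int[mu]_q (half_sqr w q ^+ 2)%:E <= (16 * kap ^+ 2 * C * D)%:E * J)%E.
Proof.
have P1oo := le_lt_trans estP1 Joo; have P2oo := le_lt_trans estP2 Joo.
have [w1 [mw1 w1le w1lim]] := lowpass_tr_limit C0 HC mP1 P1oo bP1 true.
have [w2 [mw2 w2le w2lim]] := lowpass_tr_limit C0 HC mP2 P2oo bP2 false.
have [w3 [mw3 w3le w3lim]] := lowpass_tr_limit C0 HC mP2 P2oo bP2 true.
have [w4 [mw4 w4le w4lim]] := lowpass_tr_limit C0 HC mP1 P1oo bP1 false.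
pose w (y : Y) : R[i] := let x := (tuple_of y.1, y.2) in
  ((kap * (w1 x - w2 x)) +i* (kap * (w3 x + w4 x)))%C.
have wE (x : d.-tuple T * T) : w (rvec x.1, x.2) = ((kap * (w1 x - w2 x)) +i* (kap * (w3 x + w4 x)))%C.
  by case: x => y r; rewrite /w /= rvecK.
exists w; split; last first.
  apply: le_trans (norm4 mw1 mw2 mw3 mw4 (fun x _ => wE x)) _.
  have -> : ((16 * kap ^+ 2 * C * D)%:E * J =
      (2 * kap ^+ 2)%:E * (4%:E * (C%:E * ((2 * D)%:E * J))))%E.
    by rewrite !muleA -!EFinM; congr (_%:E * _)%E; ring.
  apply: lee_wpmul2l; first by rewrite lee_fin mulr_ge0// sqr_ge0.
  have K (h P : d.-tuple T * T -> R) :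
    (\int[mu]_x (P x ^+ 2)%:E <= (2 * D)%:E * J)%E ->
    (\int[mu]_x (h x ^+ 2)%:E <= C%:E * \int[mu]_x (P x ^+ 2)%:E)%E ->
    (\int[mu]_x (h x ^+ 2)%:E <= C%:E * ((2 * D)%:E * J))%E.
    by move=> H1 H2; apply: le_trans H2 _; apply: lee_wpmul2l; rewrite ?lee_fin.
  set B := (C%:E * _)%E in K *; have B0 : (0 <= B)%E.
    apply: mule_ge0; rewrite ?lee_fin//; apply: mule_ge0; last exact: adde_ge0.
    by rewrite lee_fin; exact: mulr_ge0.
  have -> : (4%:E * B = (B + B) + (B + B))%E.
    rewrite -[X in (X + X + _)%E]mul1e -[X in (_ + (X + X))%E]mul1e -!ge0_muleDl -?EFinD ?lee_fin//.
    by congr (_%:E * _)%E; ring.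
  by apply: leeD; apply: leeD; [exact: (K _ _ estP1 w1le)|exact: (K _ _ estP2 w2le)|exact: (K _ _ estP2 w3le)|exact: (K _ _ estP1 w4le)].
split.
  split.
    apply: (eq_measurable_fun (fun x => kap * (w1 x - w2 x))); first by move=> x _; rewrite wE.
    apply: measurable_funTS.
    by apply: measurable_funM => //; exact: measurable_funB.
  apply: (eq_measurable_fun (fun x => kap * (w3 x + w4 x))); first by move=> x _; rewrite wE.
  apply: measurable_funTS.
  by apply: measurable_funM => //; exact: measurable_funD.
pose B (e : R) := ((2 * kap ^+ 2)%:E * ((e%:E + e%:E) + (e%:E + e%:E)))%E.
have small (e : R) : 0 < e -> exists rho0 : R, forall rho : R, rho0 <= rho ->
    (L2norm_half (fun p => fLambda_trunc f u rho p - w p)%R <= e%:E)%E.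
  (* Chosen so that [8 kap^2 e' <= e^2]: four errors [e'], each multiplied by [2 kap^2]. The [+ 1]
     avoids a division by zero. *)
  move=> e0; pose e' := e ^+ 2 / (8 * kap ^+ 2 + 1).
  have k0 : 0 < 8 * kap ^+ 2 + 1 by rewrite ltr_wpDl// mulr_ge0// sqr_ge0.
  have e'0 : 0 < e' by rewrite divr_gt0// exprn_gt0.
  have [r1 H1] := w1lim e' e'0; have [r2 H2] := w2lim e' e'0.
  have [r3 H3] := w3lim e' e'0; have [r4 H4] := w4lim e' e'0.
  exists (Num.max (Num.max r1 r2) (Num.max r3 r4)) => rho.
  rewrite !ge_max => /andP[/andP[l1 l2] /andP[l3 l4]].
  rewrite /L2norm_half -[leRHS]mule1; apply: Lnorm2_le => //; first exact: ltW.
  rewrite mule1 mule1.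
  have mB b (P v : d.-tuple T * T -> R) : measurable_fun setT P -> measurable_fun setT v ->
      measurable_fun setT (fun x => lowpass_tr P b rho x - v x).
    by move=> mP mv; apply: measurable_funB => //; exact: measurable_lowpass_tr.
  have Hd (x : d.-tuple T * T) : x.2 < 0 ->
      fLambda_trunc f u rho (rvec x.1, x.2) - w (rvec x.1, x.2) =
      ((kap * ((lowpass_tr P1 true rho x - w1 x) - (lowpass_tr P2 false rho x - w2 x))) +i*
       (kap * ((lowpass_tr P2 true rho x - w3 x) + (lowpass_tr P1 false rho x - w4 x))))%C.
    case: x => y r r0; rewrite wE truncE//.
    apply/eqP; rewrite eq_complex /=; apply/andP; split; apply/eqP;
      by move: (lowpass_tr _ _ _ _) (lowpass_tr _ _ _ _) => *; ring.
  apply: (le_trans (norm4 (v := fun p => fLambda_trunc f u rho p - w p)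
    (mB true _ _ mP1 mw1) (mB false _ _ mP2 mw2) (mB true _ _ mP2 mw3) (mB false _ _ mP1 mw4) Hd)).
  apply: (@le_trans _ _ (B e')).
    apply: lee_wpmul2l; first by rewrite lee_fin mulr_ge0// sqr_ge0.
    by apply: leeD; apply: leeD; [exact: H1|exact: H2|exact: H3|exact: H4].
  rewrite /B -!EFinD -EFinM lee_fin.
  have -> : e ^+ 2 = e' * (8 * kap ^+ 2 + 1) by rewrite /e' divfK// gt_eqF.
  by nra.
apply/fine_cvgP; split.
  have [rho0 H] := small 1 ltr01; exists rho0; split; first exact: num_real.
  by move=> rho /ltW /H h; rewrite ge0_fin_numE ?Lnorm_ge0//; apply: le_lt_trans h _; rewrite ltry.
apply/cvgrPdist_le => e e0; have [rho0 H] := small e e0.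
exists rho0; split; first exact: num_real.
move=> rho /ltW /H h; rewrite sub0r normrN /= ger0_norm ?fine_ge0 ?Lnorm_ge0//.
by rewrite -lee_fin fineK// ge0_fin_numE ?Lnorm_ge0//; apply: le_lt_trans h _; rewrite ltry.
Qed.

End propA.

(** * The operator in a chart *)

Lemma sum_sqr_le (R : realType) (I : finType) (x : I -> R) :
  (\sum_i x i) ^+ 2 <= #|I|%:R * \sum_i x i ^+ 2.
Proof.
have -> : (\sum_i x i) ^+ 2 = \sum_i \sum_j x i * x j.
  by rewrite expr2 mulr_suml; apply: eq_bigr => i _; rewrite mulr_sumr.
have -> : #|I|%:R * \sum_i x i ^+ 2 = \sum_i \sum_j ((x i ^+ 2 + x j ^+ 2) / 2).
  under [RHS]eq_bigr do rewrite -mulr_suml big_split /= sumr_const.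
  rewrite -mulr_suml big_split /= sumr_const sumrMnl -mulr_natl.
  by set t := \sum_i _; rewrite (_ : #|xpredT| = #|I|)//; field.
by apply: ler_sum => i _; apply: ler_sum => j _; have := sqr_ge0 (x i - x j); lra.
Qed.

Lemma measurable_indic_open (R : realType) N (O : set 'rV[R]_N) (G : 'rV[R]_N -> R) : open O ->
  (forall x, O x -> {for x, continuous G}) ->
  measurable_fun setT (fun t : N.-tuple (measurableTypeR R) => \1_O (rvec t) * G (rvec t) : measurableTypeR R).
Proof.
move=> oO cG.
have -> : (fun t : N.-tuple (measurableTypeR R) => \1_O (rvec t) * G (rvec t)) =
    (G \o @rvec R N) \_ (@rvec R N @^-1` O).
  apply/funext => t; rewrite /patch indicE; have [h|h] := pselect (O (rvec t)).
    by rewrite (mem_set h) (mem_set (A := rvec (N:=N) @^-1` O)) ?mul1r.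
  by rewrite (memNset h) (memNset (A := rvec (N:=N) @^-1` O)) ?mul0r.
apply/(measurable_restrictT _ (measurable_rvec oO)).
by apply: measurable_comp_open => //; exact: measurable_rvec.
Qed.

(** * From the domain to the slab *)

Section bridge.
Context (R : realType) (d N : nat).
Local Notation T := (measurableTypeR R).
Local Notation leb1 := (@lebesgue_measure R).
Local Notation X := 'rV[R]_N.
Local Notation Y := ('rV[R]_d * R)%type.

Lemma within_bounded (A B : set X) (h : X -> R) : {within B, continuous h} -> compact A -> A `<=` B ->
  exists2 M : R, 0 <= M & forall z, A z -> `|h z| <= M.
Proof.
move=> ch cA AB; have cA' : {within A, continuous h} by exact: continuous_subspaceW ch.
have [M0 [_ HM]] := compact_bounded (continuous_compact cA' cA).
exists (Num.max 0 (M0 + 1)); first by rewrite le_max lexx.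
move=> z Az; have H : M0 < M0 + 1 by rewrite ltrDl.
have := HM _ H (h z) (ex_intro2 _ _ z Az erefl) => /= /le_trans; apply.
by rewrite le_max lexx orbT.
Qed.

Lemma within_open (B O : set X) (h : X -> R) z : {within B, continuous h} -> open O -> O `<=` B -> O z ->
  {for z, continuous h}.
Proof.
move=> ch oO OB Oz; have cO : {within O, continuous h} by exact: continuous_subspaceW ch.
by move: cO; rewrite continuous_open_subspace// => /(_ z (mem_set Oz)).
Qed.

Hypothesis dN : N = d.+1.
Variables (Omega U A : set X) (a : X -> 'rV[R]_d) (r : X -> R) (K K1 S : R).
Hypothesis oOmega : open Omega.
Hypothesis oU : open U.
Hypothesis cA : compact A.
Hypothesis AU : A `<=` closure Omega `&` U.
Hypothesis aC1 : forall k, C1_on U (fun z => a z 0 k).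
Hypothesis rC1 : C1_on U r.
Hypothesis rneg : forall z, U z -> r z < 0 -> Omega z.
Hypothesis negr : forall z, U z -> Omega z -> r z < 0.
Hypothesis injU : forall x y, U x -> U y -> (a x, r x) = (a y, r y) -> x = y.
Hypothesis K0 : 0 < K.
Hypothesis HK : forall z, U z -> forall v, `|v| <= K * `|DPhi a r z v|.
Hypothesis K10 : 0 < K1.
Hypothesis aK1 : forall z k i, U z -> `|pd i (fun z => a z 0 k) z| <= K1.
Hypothesis rK1 : forall z i, U z -> `|pd i r z| <= K1.
Hypothesis rS : forall z, U z -> - r z < S.
Hypothesis S0 : 0 < S.

Let Phi (x : X) : Y := (a x, r x).
Let O := Omega `&` U.

Let oO : open O. Proof. exact: openI. Qed.
Let OU z : O z -> U z. Proof. by case. Qed.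
Let C1_O (g : X -> R) : C1_on U g -> C1_on O g.
Proof. by move=> gC z /OU; exact: gC. Qed.

Lemma chart_support : exists2 L : R, 0 < L & forall z, A z -> forall i, `|a z 0 i| <= L.
Proof.
have cA' i : {within A, continuous (fun z => a z 0 i)}.
  apply: continuous_in_subspaceT => z /set_mem/AU[_ Uz]; exact: (C1_continuous oU (@aC1 i) Uz).
have /choice[M HM] : forall i, exists M : R, 0 <= M /\ forall z, A z -> `|a z 0 i| <= M.
  by move=> i; have [M M0 HM] := within_bounded (cA' i) cA (@subset_refl _ A); exists M.
exists (1 + \sum_i M i); first by rewrite ltr_pwDl// sumr_ge0// => i _; case: (HM i).
move=> z Az i; apply: le_trans ((HM i).2 z Az) _.
rewrite (bigD1 i)//= addrCA lerDl addr_ge0// sumr_ge0// => j _; by case: (HM j).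
Qed.

Let image_closed : closed (Phi @` A).
Proof.
apply: compact_closed; first exact: (@norm_hausdorff _ Y).
apply: continuous_compact => //; apply: continuous_in_subspaceT => z /set_mem/AU[_ Uz].
exact: (Phi_continuous oU aC1 rC1 Uz).
Qed.

Section one.
Variables (F : X -> R) (P : Y -> R).
Hypothesis cF : {within closure Omega `&` U, continuous F}.
Hypothesis dF : forall i, (forall z, (Omega `&` U) z -> derivable F z (delta_mx 0 i)) /\
  exists2 h : X -> R, {within closure Omega `&` U, continuous h} & forall z, (Omega `&` U) z -> h z = pd i F z.
Hypothesis FA : forall z, ~ A z -> F z = 0.
Hypothesis PF : forall z, U z -> P (Phi z) = F z.
Hypothesis P0 : forall y, (forall z, U z -> Phi z <> y) -> P y = 0.

Lemma closure_C1_on : C1_on O F.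
Proof.
move=> z Oz i; have [dFi [h ch hE]] := dF i.
split; first exact: dFi.
apply: (@near_eq_continuous _ _ _ h); last first.
  by apply: (within_open ch oO) => // x [Ox Ux]; split => //; exact: subset_closure.
have : nbhs z O by exact: open_nbhs_nbhs.
by apply: filterS => x Ox; rewrite hE.
Qed.

Let off_A z : ~ A z -> forall i, pd i F z = 0.
Proof.
move=> Az i; transitivity ('D_(delta_mx 0 i) (cst (0 : R)) z); last exact: derive_cst.
apply: near_eq_derive; have : nbhs z (~` A).
  by apply: open_nbhs_nbhs; split => //; apply: closed_openC; apply: compact_closed => //; exact: norm_hausdorff.
by apply: filterS => x; exact: FA.
Qed.

(** On the compact [A] the continuous extensions of the derivatives are bounded, and off [A] the
    function is locally zero. *)
Lemma closure_C1_bound : exists2 M : R, 0 <= M &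
  (forall z, O z -> `|F z| <= M) /\ (forall z, O z -> \sum_i `|pd i F z| <= M).
Proof.
have [M M0 HM] := within_bounded cF cA AU.
have /choice[B HB] : forall i, exists B : R, 0 <= B /\ forall z, O z -> `|pd i F z| <= B.
  move=> i; have [_ [h ch hE]] := dF i; have [B B0 HB] := within_bounded ch cA AU.
  exists B; split=> // z Oz; have [Az|nA] := pselect (A z); last by rewrite off_A// normr0.
  by rewrite -hE//; exact: HB.
have sB : 0 <= \sum_i B i by apply: sumr_ge0 => i _; case: (HB i).
exists (M + \sum_i B i); first exact: addr_ge0.
split=> z Oz.
  have [Az|nA] := pselect (A z); last by rewrite FA// normr0 addr_ge0.
  by apply: le_trans (HM z Az) _; rewrite lerDl.
apply: le_trans (_ : \sum_i B i <= _); last by rewrite lerDr.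
by apply: ler_sum => i _; apply: (HB i).2.
Qed.

(** The image of [A] is compact, hence closed, and misses [y]: a preimage in [A] would have [r < 0],
    so it would lie in Omega. This makes the extension of [P] by zero C^1 in [r < 0]. *)
Let far y : y.2 < 0 -> (forall z, O z -> Phi z <> y) -> \forall x \near y, P x = 0.
Proof.
move=> y0 ny.
have nA : ~ (Phi @` A) y.
  by move=> [z /AU[_ Uz] E]; apply: (ny z) => //; split=> //; apply: rneg => //; rewrite -E in y0.
have : nbhs y (~` (Phi @` A)) by apply: open_nbhs_nbhs; split => //; exact: closed_openC.
apply: filterS => x nx; have [[z [Uz E]]|h] := pselect (exists z, U z /\ Phi z = x).
  by rewrite -E PF// FA// => Az; apply: nx; exists z.
by apply: P0 => z Uz E; apply: h; exists z.
Qed.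

Let dich y : y.2 < 0 -> (exists2 z, O z & Phi z = y) \/ (forall z, O z -> Phi z <> y).
Proof.
move=> y0; have [[z [Oz E]]|h] := pselect (exists z, O z /\ Phi z = y); first by left; exists z.
by right => z Oz E; apply: h; exists z.
Qed.

Let PC1 z e : O z ->
  [/\ {for Phi z, continuous P}, derivable P (Phi z) e,
      {for Phi z, continuous ('D_e P)} &
      `|'D_e P (Phi z)| <= (\sum_i `|pd i F z|) * (K * `|e|)].
Proof.
move=> Oz; apply: (pullback_C1 dN oO _ _ K0 _ _ e closure_C1_on) => //.
- by move=> k; exact: C1_O.
- exact: C1_O.
- by move=> x /OU; exact: HK.
- by move=> x y /OU Ux /OU Uy; exact: injU.
- by move=> x /OU; exact: PF.
Qed.

Let far_cst y e : y.2 < 0 -> (forall z, O z -> Phi z <> y) ->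
  [/\ {for y, continuous P}, derivable P y e, {for y, continuous ('D_e P)} & 'D_e P y = 0].
Proof.
move=> y0 ny; have E := far y0 ny.
have DE : \forall x \near y, 'D_e P x = 0.
  move/nbhs_norm : (E) => [dl dl0 H]; apply/nbhs_norm; exists dl => // x xy.
  transitivity ('D_e (cst (0 : R)) x); last exact: derive_cst.
  apply: near_eq_derive; apply/nbhs_norm; exists (dl - `|x - y|); first by rewrite subr_gt0.
  move=> z zx; apply: H; rewrite -(subrKA x) (le_lt_trans (ler_normD _ _))//; lra.
split.
- by apply: (near_eq_continuous E); exact: cvg_cst.
- by apply: (near_eq_derivable _ (derivable_cst (0 : R) y e)); apply: filterS E => x ->.
- by apply: (near_eq_continuous DE); exact: cvg_cst.
- exact: nbhs_singleton DE.
Qed.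

(** All larger [M'] are allowed, so that the real and the imaginary part can be given a common
    bound. *)
Lemma bridge_slab_C1 (L : R) : (forall z, A z -> forall i, `|a z 0 i| <= L) ->
  exists2 M : R, 0 <= M & forall M', M <= M' -> slab_C1 M' L S P.
Proof.
move=> HL; have [M M0 [FM dFM]] := closure_C1_bound.
exists (M + M * K); first by rewrite addr_ge0// mulr_ge0// ltW.
move=> M' MM'; split.
- move=> y y0; have [[z Oz <-]|ny] := dich y0.
    have [cP _ _ _] := PC1 0 Oz; split => //; rewrite PF; last exact: OU.
    by apply: le_trans (FM z Oz) _; apply: le_trans MM'; rewrite lerDl mulr_ge0// ltW.
  have [cP _ _ _] := far_cst 0 y0 ny; split => //.
  rewrite (nbhs_singleton (far y0 ny)) normr0; apply: le_trans MM'.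
  by rewrite addr_ge0// mulr_ge0// ltW.
- move=> y e y0; have [[z Oz <-]|ny] := dich y0.
    have [_ dP cdP bd] := PC1 e Oz; split => //.
    apply: le_trans bd _; rewrite mulrA; apply: ler_wpM2r => //; apply: le_trans MM'.
    apply: le_trans (_ : M * K <= _); last by rewrite lerDr.
    by apply: ler_wpM2r; [exact: ltW|exact: dFM].
  have [_ dP cdP ->] := far_cst e y0 ny; split => //.
  by rewrite normr0 mulr_ge0//; apply: le_trans MM'; rewrite addr_ge0// mulr_ge0// ltW.
- move=> y y0 H; have [[z Oz E]|ny] := dich y0; last by rewrite (nbhs_singleton (far y0 ny)).
  rewrite -E PF; last exact: OU.
  apply: FA => Az; case: H => [[j]|]; rewrite -E /=.
    by rewrite ltNge HL.
  by have := rS (OU Oz); lra.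
Qed.

Section energy.
Variable f : R -> R.
Hypothesis f0 : forall t : R, 0 < t -> 0 <= f t.
Hypothesis f_decr : decreasing_pos (fun t => f t / t).
Hypothesis cf : forall t : R, 0 < t -> {for t, continuous f}.

Let grad2 (x : X) : R := \sum_i pd i F x ^+ 2.

Let grad20 x : 0 <= grad2 x. Proof. by apply: sumr_ge0 => i _; exact: sqr_ge0. Qed.

Let cgrad x : O x -> {for x, continuous (fun x => wgt f (r x) * grad2 x)}.
Proof.
move=> Ox; have [OmX Ux] := Ox; apply: for_continuousM.
  apply: continuous_comp; first exact: (C1_continuous oU rC1 Ux).
  by apply: wgt_continuous => //; exact: negr.
apply: continuous_sum_fin => i; have [_ c] := closure_C1_on Ox i.
by apply: (for_continuousM c c).
Qed.

Lemma measurable_weighted_grad :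
  measurable_fun setT (fun t : N.-tuple T => \1_O (rvec t) * (wgt f (r (rvec t)) * grad2 (rvec t)) : T).
Proof. exact: (measurable_indic_open oO cgrad). Qed.

(** [chart_integral_le] with the Lipschitz constant [N K1] gives the first factor. For the second,
    each of the [N = d + 1] derivatives of [P] is at most [K] times the sum of the [|pd i F|], whose
    square costs another [N] by Cauchy-Schwarz. *)
Lemma bridge_energy L M : slab_C1 M L S P ->
  (slab_energy f P <= ((3 * (N%:R * K1)) ^+ N * (N%:R ^+ 2 * K ^+ 2))%:E *
    \int[leb R N]_t (\1_O (rvec t) * (wgt f (r (rvec t)) * grad2 (rvec t)))%:E)%E.
Proof.
move=> PS; have [_ dP _] := PS.
pose H (y : Y) : R := if y.2 < 0 then wgt f y.2 * (pdr P y ^+ 2 + \sum_k pda k P y ^+ 2) else 0.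
pose c : R := N%:R ^+ 2 * K ^+ 2.
have c0 : 0 <= c by apply: mulr_ge0; exact: sqr_ge0.
pose G (x : X) : R := \1_O x * (c * (wgt f (r x) * grad2 x)).
have Lc0 : 0 < N%:R * K1 by rewrite mulr_gt0// ltr0n dN.
have G0 x : 0 <= G x.
  rewrite /G indicE; apply: mulr_ge0 => //; apply: mulr_ge0 => //.
  by apply: mulr_ge0 => //; exact: wgt_ge0.
have GE x : O x -> G x = c * (wgt f (r x) * grad2 x) by move=> Ox; rewrite /G indicE mem_set// mul1r.
have HE (q : d.-tuple T * T) : H (rvecR q) =
    wgt_neg f q.2 * (half_ext (pdr P) q ^+ 2 + \sum_k half_ext (pda k P) q ^+ 2).
  rewrite /H /wgt_neg /half_ext /=; case: ifP => q0; last by rewrite mul0r.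
  by rewrite /rvecR.
have -> : slab_energy f P = (\int[(leb R d \x leb1)%E]_q (H (rvecR q))%:E)%E.
  by apply: eq_integral => q _; rewrite HE.
have := @chart_integral_le R d N dN O a r (N%:R * K1) oO Lc0 _ G H G0 _ _ _ _ _.
have -> : (((3 * (N%:R * K1)) ^+ N * c)%:E *
    \int[leb R N]_t (\1_O (rvec t) * (wgt f (r (rvec t)) * grad2 (rvec t)))%:E =
  ((3 * (N%:R * K1)) ^+ N)%:E * \int[leb R N]_t (G (rvec t))%:E)%E.
  rewrite EFinM -muleA; congr (_ * _)%E; rewrite -ge0_integralZl_EFin //.
  - by apply: eq_integral => t _; rewrite -EFinM /G; congr EFin; ring.
  - move=> t _; rewrite lee_fin indicE; apply: mulr_ge0 => //.
    by apply: mulr_ge0 => //; exact: wgt_ge0.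
  - by apply/measurable_EFinP; exact: measurable_weighted_grad.
apply.
- move=> x y Oxy.
  have B (g : X -> R) : C1_on U g -> (forall z i, U z -> `|pd i g z| <= K1) ->
      `|g y - g x| <= N%:R * K1 * `|y - x|.
    move=> gC gK; apply: (C1_lipschitz oO (C1_O gC)) => //.
    by move=> i t t01; apply: gK; apply: OU; exact: Oxy.
  split; last exact: B.
  apply: norm_le_coord => [|k]; first by rewrite mulr_ge0// ltW.
  rewrite !mxE; apply: (B (fun z => a z 0 k)) => // z i; exact: aK1.
- by move=> x nO; rewrite /G indicE memNset// mul0r.
- move=> x Ox; apply: (@near_eq_continuous _ _ _ (fun x => c * (wgt f (r x) * grad2 x))).
    have : nbhs x O by exact: open_nbhs_nbhs.
    by apply: filterS => z; exact: GE.
  by apply: for_continuousM; [exact: for_continuous_cst|exact: cgrad].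
- move=> y; rewrite /H; case: ifP => // _; apply: mulr_ge0; first exact: wgt_ge0.
  by apply: addr_ge0; [exact: sqr_ge0|apply: sumr_ge0 => k _; exact: sqr_ge0].
- have cdP e (y : Y) : y.2 < 0 -> {for y, continuous ('D_e P)} by move=> /(dP y e)[].
  under eq_fun do rewrite HE; apply: measurable_funM.
    exact: (measurableT_comp (measurable_wgt_neg cf) measurable_snd).
  apply: measurable_funD; first by apply: measurable_funX; apply: measurable_half_ext; exact: cdP.
  by apply: measurable_sum => k; apply: measurable_funX; apply: measurable_half_ext; exact: cdP.
- move=> y; rewrite /H; case: ifPn => y0; last by left.
  have [[z Oz E]|ny] := dich y0; last first.
    left; have z0 e : 'D_e P y = 0 by have [_ _ _ ->] := far_cst e y0 ny.
    by rewrite /pdr /pda z0 big1 ?expr0n ?addr0 ?mulr0// => k _; rewrite z0 expr0n.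
  right; exists z => //; split => //; rewrite GE// -E /=.
  rewrite mulrCA; apply: ler_wpM2l; first exact: wgt_ge0.
  pose s := \sum_i `|pd i F z|.
  have bd e : `|e| <= 1 -> 'D_e P (Phi z) ^+ 2 <= (s * K) ^+ 2.
    move=> e1; rewrite -[leLHS]real_normK ?num_real// lerXn2r ?nnegrE//.
      by rewrite mulr_ge0 ?sumr_ge0// ltW.
    have [_ _ _ h] := PC1 e Oz; apply: le_trans h _; apply: ler_wpM2l; first by rewrite sumr_ge0.
    by rewrite ler_piMr// ltW.
  have n1 : `|((0, 1) : Y)| <= 1 by rewrite prod_normE /= normr0 normr1 ge_max ler01 lexx.
  have nk k : `|((delta_mx 0 k, 0) : Y)| <= 1.
    rewrite prod_normE /= normr0 ge_max ler01 andbT; apply: norm_le_coord => // i.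
    by rewrite mxE eqxx /=; case: (i == k); rewrite ?normr1 ?normr0.
  apply: (@le_trans _ _ (N%:R * (s * K) ^+ 2)).
    rewrite dN -natr1 mulrDl mul1r addrC; apply: lerD; last exact: bd.
    apply: (@le_trans _ _ (\sum_(k < d) (s * K) ^+ 2)); first by apply: ler_sum => k _; exact: bd.
    by rewrite sumr_const card_ord mulr_natl.
  have := sum_sqr_le (fun i => `|pd i F z|); rewrite card_ord -/s.
  under [X in _ <= _ * X]eq_bigr do rewrite real_normK ?num_real//.
  rewrite -/(grad2 z) => h.
  have -> : c * grad2 z = N%:R * (K ^+ 2 * (N%:R * grad2 z)) by rewrite /c; ring.
  rewrite exprMn [s ^+ 2 * _]mulrC; apply: ler_wpM2l => //.
  by apply: ler_wpM2l => //; exact: sqr_ge0.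
Qed.

(** [s f(1/s)] increases with [s], so the weight is at most [(S f(1/S))^2], and [U] is bounded. The
    bound on the gradient depends on the function; only finiteness is taken from here. *)
Lemma weighted_grad_finite (B : R) : 0 < B -> (forall z i, U z -> `|z 0 i| <= B) ->
  (\int[leb R N]_t (\1_O (rvec t) * (wgt f (r (rvec t)) * grad2 (rvec t)))%:E < +oo)%E.
Proof.
move=> B0 UB; have [M M0 [_ dFM]] := closure_C1_bound.
pose c : R := (S * f S^-1) ^+ 2 * (N%:R * M ^+ 2).
pose h (t : N.-tuple T) : R := c * \1_(tbox B) t.
have c0 : 0 <= c by apply: mulr_ge0; [exact: sqr_ge0|apply: mulr_ge0 => //; exact: sqr_ge0].
have bh : bms (leb R N) h.
  apply: bmsZ; split; [split|exists (tbox B); split].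
  - apply: measurable_indic; exact: measurable_tbox.
  - by exists 1 => y; rewrite indicE; case: (_ \in _); rewrite ?normr0 ?normr1.
  - exact: measurable_tbox.
  - by apply: (eq_ind_r (fun z => z < +oo)%E _ (leb_tbox N B0)); rewrite ltry.
  - by move=> y ny; rewrite indicE memNset.
apply: (@le_lt_trans _ _ (\int[leb R N]_t (h t)%:E)%E); last by rewrite bms_EFin ?ltry.
apply: ge0_le_integral => //.
- move=> t _; rewrite lee_fin indicE; apply: mulr_ge0 => //.
  by apply: mulr_ge0 => //; exact: wgt_ge0.
- by apply/measurable_EFinP; exact: measurable_weighted_grad.
- by apply/measurable_EFinP; case: bh => -[].
move=> t _; rewrite lee_fin /h indicE; have [Ot|nO] := pselect (O (rvec t)); last first.
  by rewrite memNset// mul0r mulr_ge0// indicE.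
have tB : tbox B t.
  apply: contrapT => /ntbox[j]; rewrite ltNge => /negP; apply.
  by have := UB _ j (OU Ot); rewrite mxE.
rewrite mem_set// mul1r indicE mem_set// mulr1 /c.
have [OmT Ut] := Ot; have rt := negr Ut OmT; have rS' := rS Ut.
apply: ler_pM => //; first exact: wgt_ge0.
  have s0 : 0 < - r (rvec t) by rewrite oppr_gt0.
  have e : f (- r (rvec t))^-1 / (- r (rvec t))^-1 <= f S^-1 / S^-1.
    by apply: f_decr; rewrite ?invr_gt0// lef_pV2 ?posrE// ltW.
  rewrite /wgt lerXn2r ?nnegrE//; try (by apply: mulr_ge0; [exact: ltW|apply: f0; rewrite invr_gt0]).
  by rewrite !invrK in e; rewrite mulrC [leRHS]mulrC.
apply: (@le_trans _ _ (\sum_(i < N) M ^+ 2)); last by rewrite sumr_const card_ord mulr_natl.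
apply: ler_sum => i _; rewrite -[leLHS]real_normK ?num_real// lerXn2r ?nnegrE//.
by apply: le_trans (dFM _ Ot); rewrite (bigD1 i)//= lerDl sumr_ge0.
Qed.

End energy.
End one.
End bridge.

(** * Lipschitz defining functions and the distance to the boundary *)

Section lambda.
Context (R : realType).
Local Notation T := (measurableTypeR R).

Lemma Lambda_ge1 N (x : 'rV[R]_N) : 1 <= Lambda x.
Proof.
rewrite -[leLHS]sqrtr1; apply: ler_wsqrtr; rewrite lerDl.
by apply: sumr_ge0 => i _; rewrite -expr2 sqr_ge0.
Qed.

Lemma coord_le_Lambda N (x : 'rV[R]_N) i : `|x 0 i| <= Lambda x.
Proof.
rewrite -sqrtr_sqr; apply: ler_wsqrtr; rewrite /edot (bigD1 i)//= -expr2.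
by rewrite addrCA lerDl addr_ge0// sumr_ge0// => j _; rewrite -expr2 sqr_ge0.
Qed.

Lemma measurable_Lambda_inv N m : measurable_fun setT (fun t : N.-tuple T => Lambda (rvec t) ^- m : T).
Proof.
apply: (measurable_pos (h := fun x : R => x ^- m) (g := fun t : N.-tuple T => Lambda (rvec t))).
- by move=> t t0; apply: cvgV; [rewrite expf_neq0// gt_eqF|exact: exprn_continuous].
- exact: measurable_Lambda.
- by move=> t; exact: Lambda_gt0.
Qed.

(* The shells max|xi_i| ~ 2^k contribute 2^(- k (N + 1)) times a volume of order 2^(k N). *)
Lemma Lambda_integrable N :
  (\int[leb R N]_t (Lambda (rvec t) ^- N.+1)%:E < +oo)%E.
Proof.
(* A point of the [k]-th shell is known to be large only at scale [2^(k-1)]; [c] compensates this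
   shift by one. *)
pose c : R := 2 ^+ N.+1.
pose F (k : nat) (t : N.-tuple T) : R := c * (2 ^- (k * N.+1)) * \1_(tbox (2 ^+ k)) t.
have p2 m : 0 < 2 ^+ m :> R by exact: exprn_gt0.
have F0 k t : (0 <= (F k t)%:E)%E.
  by rewrite lee_fin /F !mulr_ge0 ?invr_ge0 ?exprn_ge0// indicE.
have mF k : measurable_fun setT (fun t => (F k t)%:E).
  apply/measurable_EFinP; apply: measurable_funM => //.
  by apply: measurable_indic; exact: measurable_tbox.
apply: (@le_lt_trans _ _ (\int[leb R N]_t (\sum_(k <oo) (F k t)%:E))%E).
  apply: ge0_le_integral => //.
  - by move=> t _; rewrite lee_fin invr_ge0 exprn_ge0// ltW// Lambda_gt0.
  - by apply/measurable_EFinP; exact: measurable_Lambda_inv.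
  - by apply: ge0_emeasurable_sum.
  move=> t _; have [k tk] : exists k, tbox (2 ^+ k) t.
    exists (Num.truncn (Lambda (rvec t))).+1; apply: contrapT => /ntbox [j].
    apply/negP; rewrite -leNgt; have := coord_le_Lambda (rvec t) j; rewrite mxE => /le_trans; apply.
    apply: (le_trans (ltW (truncnS_gt _))); rewrite -natrX ler_nat.
    by rewrite ltnW// ltn_expl.
  (* Minimality supplies a coordinate larger than [2^(k0 - 1)]; for [k0 = 0] the bound [Lambda >= 1]
     is enough. *)
  have [k0 tk0 mk0] := ex_minnP (P := fun k => `[< tbox (2 ^+ k) t >]) (ex_intro _ k (asboolT tk)).
  have {}tk0 := asboolW tk0.
  apply: (@le_trans _ _ (F k0 t)%:E); last first.
    by rewrite (nneseriesD1 (n := k0))//; rewrite leeDl// nneseries_ge0.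
  rewrite lee_fin /F indicE mem_set// mulr1 /c.
  have Li := Lambda_gt0 (rvec t).
  case: k0 tk0 mk0 => [|k1] tk0 mk0.
    rewrite mul0n expr0 invr1 mulr1; apply: (@le_trans _ _ 1); last by rewrite exprn_ege1// ler1n.
    by rewrite invf_le1 ?exprn_gt0// exprn_ege1// Lambda_ge1.
  have [j tj] : exists j, 2 ^+ k1 < `|tnth t j|.
    by apply: ntbox => h; have := mk0 k1 (asboolT h); rewrite ltnn.
  have kL : 2 ^+ k1 <= Lambda (rvec t).
    by apply: (le_trans (ltW tj)); have := coord_le_Lambda (rvec t) j; rewrite mxE.
  have -> : 2 ^+ N.+1 * 2 ^- (k1.+1 * N.+1) = (2 ^+ k1) ^- N.+1 :> R.
    by rewrite mulSn exprD invfM mulrA mulfV ?gt_eqF// mul1r exprM.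
  rewrite lef_pV2 ?posrE ?exprn_gt0//; apply: lerXn2r => //; rewrite nnegrE; exact: ltW.
rewrite integral_nneseries//.
apply: (@le_lt_trans _ _ (\sum_(k <oo) (geometric (c * 4 ^+ N) (2^-1 : R) k)%:E)%E).
  apply: lee_nneseries => [k _ _|k _]; first exact: integral_ge0.
  have b0 : 0 <= c * 2 ^- (k * N.+1) by rewrite mulr_ge0 ?invr_ge0 ?exprn_ge0.
  rewrite /F; under eq_integral do rewrite EFinM.
  rewrite ge0_integralZl_EFin//; last first.
    by apply/measurable_EFinP; apply: measurable_indic; exact: measurable_tbox.
  rewrite integral_indic//; last exact: measurable_tbox.
  rewrite setIT; apply: (eq_ind_r (fun z => (_ * z <= _)%E) _ (leb_tbox N (p2 k))).
  rewrite -EFinM lee_fin /geometric /= -mulrA [leRHS]mulrAC -[leRHS]mulrA mulrC [leRHS]mulrC.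
  apply: ler_wpM2r; first exact: exprn_ge0.
  have h : (2 * (2 ^+ k + 1)) ^+ N <= (4 * 2 ^+ k) ^+ N :> R.
    rewrite lerXn2r ?nnegrE ?mulr_ge0 ?addr_ge0 ?exprn_ge0//.
    by have : 1 <= 2 ^+ k :> R; [rewrite exprn_ege1// ler1n|lra].
  apply: le_trans (ler_wpM2l _ h) _; first by rewrite invr_ge0 exprn_ge0.
  rewrite exprMn exprVn mulnS exprD exprM le_eqVlt; apply/orP; left; apply/eqP.
  have pn : (2 ^+ k) ^+ N != 0 :> R by rewrite gt_eqF// exprn_gt0.
  by rewrite invfM mulrCA -mulrA mulVf// mulr1 mulrC.
have -> : (fun n => \sum_(0 <= k < n) (geometric (c * 4 ^+ N) (2^-1 : R) k)%:E)%E =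
    EFin \o series (geometric (c * 4 ^+ N) (2^-1 : R)).
  by apply/funext => n; rewrite sumEFin.
rewrite EFin_lim ?ltry//.
by apply: is_cvg_geometric_series; rewrite ger0_norm ?invr_ge0// invf_lt1// ltr1n.
Qed.

End lambda.

Section trig_lipschitz.
Context (R : realType).

Lemma ct_lipschitz b (x y : R) : `|ct b x - ct b y| <= `|x - y|.
Proof.
have [|t _] := @MVT_line R R (ct b) y (x - y).
  by move=> t _; have [] := derivable_scale (x - y) (_ : derivable (ct b) (y + t *: (x - y)) 1);
    rewrite ?scaler1 //; case: (b); exact: ex_derive.
rewrite [y + _]addrC subrK => ->.
have -> : 'D_(x - y) (ct b) (y + t *: (x - y)) = (x - y) * 'D_1 (ct b) (y + t *: (x - y)).
  have dct : derivable (ct b) (y + t *: (x - y)) 1 by case: (b); exact: ex_derive.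
  by have [_] := derivable_scale (x - y) dct; rewrite scaler1.
rewrite normrM ler_piMr//; set z := y + _.
have -> : 'D_1 (ct b) z = if b then - sin z else cos z.
  by case: (b); rewrite /ct derive_val.
by case: (b); rewrite ?normrN; [exact: (ct_le1 false)|exact: (ct_le1 true)].
Qed.

End trig_lipschitz.

Section sobolev_lipschitz.
Context (R : realType) (n : nat) (eps M : R).
Local Notation T := (measurableTypeR R).
Local Notation N := (n + n)%N.
Local Notation X := 'rV[R]_N.
Hypothesis eps0 : 0 < eps.

Let s : R := 2 + n%:R + eps.

Let I0 : R := fine (\int[leb R N]_t (Lambda (rvec t) ^- N.+1)%:E)%E.

Let I0E : (\int[leb R N]_t (Lambda (rvec t) ^- N.+1)%:E = I0%:E)%E.
Proof.
rewrite fineK// ge0_fin_numE ?Lambda_integrable//; apply: integral_ge0 => t _.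
by rewrite lee_fin invr_ge0 exprn_ge0// ltW// Lambda_gt0.
Qed.

(* By Cauchy-Schwarz, since |xi|^2 (1 + |xi|^2)^(- s) is integrable, |xi| times the Fourier
   transform of r is integrable. *)
Lemma sobolev_lipschitz : exists2 Lr : R, 0 < Lr & forall r : X -> R, sobolev s r M ->
  forall x y, `|r x - r y| <= Lr * `|x - y|.
Proof.
pose kap : R := (2 * pi) ^- N.
pose A : R := I0 + M ^+ 2.
have kap0 : 0 <= kap by rewrite invr_ge0 exprn_ge0// mulr_ge0// pi_ge0.
have I00 : 0 <= I0.
  rewrite -lee_fin -I0E; apply: integral_ge0 => t _.
  by rewrite lee_fin invr_ge0 exprn_ge0// ltW// Lambda_gt0.
have A0 : 0 <= A by rewrite addr_ge0// sqr_ge0.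
exists (kap * (N%:R * A) + 1).
  by rewrite ltr_wpDl// mulr_ge0// mulr_ge0.
move=> r [g [[mg1 mg2] rg gM]] x y.
pose g1 (t : N.-tuple T) : R := complex.Re (g (rvec t)).
pose g2 (t : N.-tuple T) : R := complex.Im (g (rvec t)).
pose gn (t : N.-tuple T) : R := normc (g (rvec t)).
have gnE t : gn t = Num.sqrt (g1 t ^+ 2 + g2 t ^+ 2) by rewrite /gn /g1 /g2; case: (g _).
have g1n t : `|g1 t| <= gn t.
  by rewrite gnE -sqrtr_sqr; apply: ler_wsqrtr; rewrite lerDl sqr_ge0.
have g2n t : `|g2 t| <= gn t.
  by rewrite gnE -sqrtr_sqr; apply: ler_wsqrtr; rewrite lerDr sqr_ge0.
have gn0 t : 0 <= gn t by apply: le_trans (g1n t).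
have mgn : measurable_fun setT (gn : _ -> T).
  rewrite (_ : gn = fun t => Num.sqrt (g1 t ^+ 2 + g2 t ^+ 2)); last by apply/funext.
  apply: (measurableT_comp (f := (Num.sqrt : T -> T))).
    by apply: continuous_measurable_fun; exact: sqrt_continuous.
  by apply: measurable_funD; apply: measurable_funX.
pose h (t : N.-tuple T) : R := Lambda (rvec t) `^ s * gn t.
have mh : measurable_fun setT (h : _ -> T).
  apply: measurable_funM => //; apply: (measurableT_comp (measurable_powR _)).
  exact: measurable_Lambda.
have mLg : measurable_fun setT (fun t => Lambda (rvec t) * gn t : T).
  by apply: measurable_funM => //; exact: measurable_Lambda.
have Lp (t : N.-tuple T) := Lambda_gt0 (rvec t).
(* Cauchy-Schwarz in pointwise form: the left side is [Lambda^(1-s) h], and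
   [2 (1 - s) = - 2 - 2n - 2 eps] is below [- (2n + 1)], the exponent of [Lambda_integrable]. *)
have Lg t : Lambda (rvec t) * gn t <= 2^-1 * (Lambda (rvec t) ^- N.+1 + h t ^+ 2).
  have -> : Lambda (rvec t) * gn t = Lambda (rvec t) `^ (1 - s) * h t.
    rewrite /h mulrA -powRD; last by apply/implyP => _; rewrite gt_eqF.
    by rewrite subrK powRr1// ltW.
  have : (Lambda (rvec t) `^ (1 - s)) ^+ 2 <= Lambda (rvec t) ^- N.+1.
    have -> : Lambda (rvec t) ^- N.+1 = Lambda (rvec t) `^ (- N.+1%:R) by rewrite powRN powR_mulrn// ltW.
    rewrite -powR_mulrn ?powR_ge0// -powRrM.
    apply: ler_powR; first exact: Lambda_ge1.
    have E : N.+1%:R = n%:R + n%:R + 1 :> R by rewrite -natr1 natrD.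
    by rewrite E /s; have e0 := eps0; lra.
  by have := sqr_ge0 (Lambda (rvec t) `^ (1 - s) - h t); lra.
have ILg : (\int[leb R N]_t (Lambda (rvec t) * gn t)%:E <= (2^-1 * A)%:E)%E.
  apply: (@le_trans _ _ (\int[leb R N]_t ((2^-1)%:E * ((Lambda (rvec t) ^- N.+1)%:E + (h t ^+ 2)%:E))%E)%E).
    apply: ge0_le_integral => //.
    - by move=> t _; rewrite lee_fin mulr_ge0// ltW.
    - exact/measurable_EFinP.
    - apply: measurable_funeM; apply: emeasurable_funD; apply/measurable_EFinP; first exact: measurable_Lambda_inv.
      exact: measurable_funX.
    - by move=> t _; rewrite -EFinD -EFinM lee_fin.
  have L0 (t : N.-tuple T) : (0 <= (Lambda (rvec t) ^- N.+1)%:E)%E.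
    by rewrite lee_fin invr_ge0 exprn_ge0// ltW.
  have h0 t : (0 <= (h t ^+ 2)%:E)%E by rewrite lee_fin sqr_ge0.
  rewrite ge0_integralZl_EFin ?invr_ge0//; last 2 first.
  - by move=> t _; exact: adde_ge0.
  - apply: emeasurable_funD; apply/measurable_EFinP; first exact: measurable_Lambda_inv.
    exact: measurable_funX.
  rewrite ge0_integralD//; last 2 first.
  - by apply/measurable_EFinP; exact: measurable_Lambda_inv.
  - by apply/measurable_EFinP; exact: measurable_funX.
  rewrite I0E EFinM; apply: lee_wpmul2l; first by rewrite lee_fin invr_ge0.
  rewrite /A EFinD; apply: leeD => //; rewrite sqr_Lnorm2.
  rewrite expr2 EFinM; apply: lee_pmul => //; exact: Lnorm_ge0.
pose E z (t : N.-tuple T) : R := complex.Re (expi (edot z (rvec t)) * g (rvec t)).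
have EE z t : E z t = ct true (edot z (rvec t)) * g1 t - ct false (edot z (rvec t)) * g2 t.
  by rewrite /E /expi /g1 /g2; case: (g _).
have medot z : measurable_fun setT (fun t : N.-tuple T => edot z (rvec t) : T).
  rewrite /edot; apply: measurable_sum => i; apply: measurable_funM => //.
  exact: measurable_rvec_coord.
have mE z : measurable_fun setT (E z : _ -> T).
  rewrite (_ : E z = fun t => ct true (edot z (rvec t)) * g1 t - ct false (edot z (rvec t)) * g2 t); last exact/funext.
  by apply: measurable_funB; apply: measurable_funM => //; apply: (measurableT_comp (ct_measurable _)).
have iLg : (leb R N).-integrable setT (EFin \o (fun t => 2 * (Lambda (rvec t) * gn t))).
  apply/integrableP; split; first by apply/measurable_EFinP; apply: measurable_funM.
  have -> : (\int[leb R N]_t `|(EFin \o (fun t => 2 * (Lambda (rvec t) * gn t))%R) t| =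
      \int[leb R N]_t (2%:E * (Lambda (rvec t) * gn t)%:E))%E.
    apply: eq_integral => t _; rewrite /= ger0_norm ?EFinM//.
    by apply: mulr_ge0 => //; apply: mulr_ge0 => //; exact: ltW.
  rewrite ge0_integralZl_EFin//; last 2 first.
  - by move=> t _; rewrite lee_fin mulr_ge0// ltW.
  - exact/measurable_EFinP.
  by rewrite lte_mul_pinfty// (le_lt_trans ILg)// ltry.
have iE z : (leb R N).-integrable setT (EFin \o E z).
  apply: (le_integrable _ _ _ iLg) => //; first by apply/measurable_EFinP; exact: mE.
  move=> t _; rewrite /= lee_fin [leRHS]ger0_norm; last by apply: mulr_ge0 => //; apply: mulr_ge0 => //; exact: ltW.
  rewrite EE (le_trans (ler_normB _ _))// !normrM.
  have l1 : 1 <= Lambda (rvec t) by exact: Lambda_ge1.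
  have c1 c : `|ct c (edot z (rvec t))| <= 1 by exact: ct_le1.
  have := ler_pM (normr_ge0 _) (normr_ge0 _) (c1 true) (g1n t).
  have := ler_pM (normr_ge0 _) (normr_ge0 _) (c1 false) (g2n t).
  by have := gn0 t; nra.
have rE z : r z = kap * \int[leb R N]_t E z t.
  have := rg z; rewrite /cintegral => /(congr1 (@complex.Re R)) /=.
  by rewrite mul0r subr0.
rewrite !rE -mulrBr -RintegralB// normrM ger0_norm//.
apply: (@le_trans _ _ (kap * (N%:R * A * `|x - y|))); last first.
  rewrite mulrA -[leLHS]addr0 mulrDl mul1r; exact: lerD.
apply: ler_wpM2l => //.
have iB : (leb R N).-integrable setT (EFin \o (fun t => E x t - E y t)) by exact: (integrableB measurableT (iE x) (iE y)).
apply: (le_trans (le_normr_Rintegral _ iB)) => //.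
rewrite -lee_fin; have -> : ((\int[leb R N]_t `|E x t - E y t|)%:E = \int[leb R N]_t `|E x t - E y t|%:E)%E.
  by rewrite /Rintegral fineK//; apply: integrable_fin_num => //; exact: integrable_norm iB.
apply: (@le_trans _ _ (\int[leb R N]_t ((2 * N%:R * `|x - y|)%:E * (Lambda (rvec t) * gn t)%:E))%E).
  apply: ge0_le_integral => //.
  - by apply/measurable_EFinP; apply: measurableT_comp => //; apply: measurable_funB; exact: mE.
  - by apply: measurable_funeM; exact/measurable_EFinP.
  move=> t _; rewrite -EFinM lee_fin !EE.
  have dxy : `|edot x (rvec t) - edot y (rvec t)| <= N%:R * `|x - y| * Lambda (rvec t).
    rewrite /edot -sumrB (le_trans (ler_norm_sum _ _ _))//.
    apply: (@le_trans _ _ (\sum_(i < N) `|x - y| * Lambda (rvec t))).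
      apply: ler_sum => i _; rewrite -mulrBl normrM; apply: ler_pM => //; last exact: coord_le_Lambda.
      by have := coord_le_norm (x - y) i; rewrite !mxE.
    by rewrite sumr_const card_ord -mulrA mulr_natl.
  have dc c := le_trans (ct_lipschitz c (edot x (rvec t)) (edot y (rvec t))) dxy.
  have -> : ct true (edot x (rvec t)) * g1 t - ct false (edot x (rvec t)) * g2 t -
     (ct true (edot y (rvec t)) * g1 t - ct false (edot y (rvec t)) * g2 t) =
     (ct true (edot x (rvec t)) - ct true (edot y (rvec t))) * g1 t -
     (ct false (edot x (rvec t)) - ct false (edot y (rvec t))) * g2 t by ring.
  rewrite (le_trans (ler_normB _ _))// !normrM.
  have := ler_pM (normr_ge0 _) (normr_ge0 _) (dc true) (g1n t).
  have := ler_pM (normr_ge0 _) (normr_ge0 _) (dc false) (g2n t).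
  by lra.
have Lg0 t : (0 <= (Lambda (rvec t) * gn t)%:E)%E by rewrite lee_fin mulr_ge0// ltW.
rewrite ge0_integralZl_EFin//; last exact/measurable_EFinP.
apply: le_trans (lee_wpmul2l _ ILg) _; first by rewrite lee_fin !mulr_ge0.
by rewrite -EFinM lee_fin; lra.
Qed.

End sobolev_lipschitz.

Section norms.
Context (R : realType) (N : nat).
Local Notation X := 'rV[R]_N.
Implicit Types (v : X).

Lemma norm_le_enorm v : `|v| <= enorm v.
Proof.
apply: norm_le_coord; first exact: sqrtr_ge0.
move=> i; rewrite -sqrtr_sqr; apply: ler_wsqrtr; rewrite /edot (bigD1 i)//= -expr2 lerDl.
by apply: sumr_ge0 => j _; rewrite -expr2 sqr_ge0.
Qed.

Lemma sqrt_sum_le (I : finType) (x : I -> R) (m : R) : 0 <= m -> (forall i, `|x i| <= m) ->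
  Num.sqrt (\sum_i x i ^+ 2) <= #|I|%:R * m.
Proof.
move=> m0 xm; rewrite -[leRHS]ger0_norm ?mulr_ge0// -sqrtr_sqr; apply: ler_wsqrtr.
apply: (@le_trans _ _ (\sum_(i : I) m ^+ 2)).
  by apply: ler_sum => i _; rewrite -[leLHS]real_normK ?num_real// lerXn2r ?nnegrE.
have -> : \sum_(i : I) m ^+ 2 = #|I|%:R * m ^+ 2 by rewrite sumr_const mulr_natl.
rewrite exprMn; apply: ler_wpM2r; first exact: sqr_ge0.
by rewrite -natrX ler_nat; case: #|_| => // k; rewrite -[leqLHS]expn1 leq_pexp2l.
Qed.

Lemma enorm_le_norm v : enorm v <= N%:R * `|v|.
Proof.
rewrite /enorm /edot; under eq_bigr do rewrite -expr2.
apply: le_trans (sqrt_sum_le (normr_ge0 v) _) _; first by move=> i; exact: coord_le_norm.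
by rewrite card_ord.
Qed.

(** The positive distance between a compact set and the complement of an open one, which may be
    empty. It involves neither the domain nor its defining function. *)
Lemma compact_margin (A W : set X) : compact A -> open W -> A `<=` W ->
  exists2 e : R, 0 < e & forall z w, A z -> `|w - z| < e -> W w.
Proof.
move=> cA oW AW.
have nc := (compact_near_coveringP A).1 cA.
have := @nc R (0^'+) (fun e z => forall w, `|w - z| < e -> W w) _ _.
case=> [z Az|e /= e0 H].
  have /nbhs_norm[d d0 Hd] : nbhs z W by apply: open_nbhs_nbhs; split => //; exact: AW.
  have d2 : 0 < d / 2 by rewrite divr_gt0.
  exists ([set x | `|x - z| < d / 2], [set e : R | e < d / 2]).
    split; first by apply/nbhs_norm; exists (d / 2).
    by exists (d / 2) => // y /=; rewrite sub0r normrN => yd _; apply: le_lt_trans yd; exact: ler_norm.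
  move=> [x e'] /= [xz e'd] w wx; apply: Hd.
  by rewrite -(subrKA x) (le_lt_trans (ler_normD _ _))//; lra.
exists (e / 2); first by rewrite divr_gt0.
move=> z w Az wz; apply: (H (e / 2)) Az _ wz => /=; last by rewrite divr_gt0.
by rewrite sub0r normrN ger0_norm ?divr_ge0 ?ltW//; lra.
Qed.

End norms.

(** * The depth - r and the distance to the boundary *)

Section distance.
Context (R : realType) (d N : nat).
Local Notation X := 'rV[R]_N.
Hypothesis dN : N = d.+1.
Variables (Omega U W V : set X) (z0 : X) (a : X -> 'rV[R]_d) (r : X -> R) (K Lr e0 D : R).
Hypothesis oOmega : open Omega.
Hypothesis bz0 : boundary Omega z0.
Hypothesis Uz0 : U z0.
Hypothesis oW : open W.
Hypothesis oV : open V.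
Hypothesis WV : W `<=` V.
Hypothesis OmegaV : Omega `&` V = [set z | r z < 0] `&` V.
Hypothesis rLip : forall x y, `|r x - r y| <= Lr * `|x - y|.
Hypothesis e0_gt0 : 0 < e0.
Hypothesis Ue0 : forall z w, U z -> `|w - z| < e0 -> W w.
Hypothesis D0 : 0 < D.
Hypothesis UD : forall z, U z -> `|z - z0| <= D.
Hypothesis Lr0 : 0 < Lr.

Lemma in_domain z : V z -> (Omega z <-> r z < 0).
Proof.
move=> Vz; have E : (Omega `&` V) z = ([set z | r z < 0] `&` V) z by rewrite OmegaV.
split=> h; first by have : (Omega `&` V) z by []; rewrite E => -[].
by have : ([set z | r z < 0] `&` V) z by []; rewrite -E => -[].
Qed.

Let cr : continuous r.
Proof.
move=> x; apply/cvg_at_norm => e e_gt0; exists (e / Lr); first by rewrite divr_gt0.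
by move=> y; rewrite ltr_pdivlMr// mulrC => h; apply: le_lt_trans (rLip y x) h.
Qed.

Lemma boundary_r0 w : V w -> boundary Omega w -> r w = 0.
Proof.
move=> Vw [clw niw]; apply/eqP; rewrite eq_le; apply/andP; split.
  rewrite leNgt; apply/negP => rw.
  have : nbhs w (V `&` [set x | 0 < r x]).
    apply: filterI; first exact: open_nbhs_nbhs.
    have H : nbhs (r w) [set y : R | 0 < y] by apply: open_nbhs_nbhs; split => //; exact: (@open_gt R^o).
    exact: (cr H).
  move=> /clw[x [Omx [Vx /= rx]]]; have /in_domain/iffLR/(_ Omx) := Vx.
  by move=> h; move: (lt_trans h rx); rewrite ltxx.
rewrite leNgt; apply/negP => rw; apply: niw.
by apply: open_nbhs_nbhs; split => //; apply/in_domain.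
Qed.

Let r0 : r z0 = 0.
Proof. by apply: boundary_r0 => //; apply: WV; apply: (Ue0 Uz0); rewrite subrr normr0. Qed.

Lemma depth_bound z : U z -> - r z <= Lr * D.
Proof.
move=> Uz; have := rLip z0 z; rewrite r0 sub0r => /(le_trans (ler_norm _)) h.
by apply: le_trans h _; rewrite distrC ler_pM2l//; exact: UD.
Qed.

Let has_boundary : [set enorm (z0 - w) | w in boundary Omega] !=set0.
Proof. by exists (enorm (z0 - z0)), z0. Qed.

Lemma delta_lb z (c : R) : (forall w, boundary Omega w -> c <= enorm (z - w)) -> c <= delta Omega z.
Proof.
move=> H; apply: lb_le_inf; first by exists (enorm (z - z0)), z0.
by move=> _ [w bw <-]; exact: H.
Qed.

Lemma delta_ub z w : boundary Omega w -> delta Omega z <= enorm (z - w).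
Proof.
move=> bw; apply: ge_inf; last by exists w.
by exists 0 => _ [x _ <-]; exact: sqrtr_ge0.
Qed.

(** For a boundary point [w] in [W], [r w = 0] and the Lipschitz bound applies. A boundary point
    outside [W] is at distance at least [e0] from [z], while the depth is at most [Lr D]; hence the
    term [Lr D / e0]. *)
Lemma depth_le_delta z : U z -> - r z <= (Lr + Lr * D / e0) * delta Omega z.
Proof.
move=> Uz; have c0 : 0 < Lr + Lr * D / e0 by rewrite addr_gt0// divr_gt0// mulr_gt0.
rewrite -ler_pdivrMl// mulrC ler_pdivrMr//; have -> : forall x : R, x * (Lr + Lr * D / e0) = (Lr + Lr * D / e0) * x by move=> x; rewrite mulrC.
rewrite -ler_pdivrMl//; apply: delta_lb => w bw; rewrite ler_pdivrMl//.
have [Ww|nW] := pselect (W w).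
  have rw := boundary_r0 (WV Ww) bw.
  have := rLip w z; rewrite rw sub0r distrC => /(le_trans (ler_norm _)) h.
  apply: le_trans h _; apply: ler_pM => //; first exact: ltW.
    by rewrite lerDl divr_ge0// ?mulr_ge0// ltW.
  exact: norm_le_enorm.
have ez : e0 <= `|w - z| by rewrite leNgt; apply/negP => h; apply: nW; exact: Ue0 h.
apply: le_trans (depth_bound Uz) _.
have {}ez : e0 <= enorm (z - w) by apply: le_trans (norm_le_enorm _); rewrite distrC.
have E : Lr * D = Lr * D / e0 * e0 by rewrite divfK// gt_eqF.
rewrite [leLHS]E; apply: ler_pM => //; first by rewrite divr_ge0// ?mulr_ge0// ltW.
  exact: ltW.
by rewrite lerDr ltW.
Qed.

Hypothesis K0 : 0 < K.
Hypothesis aC1 : forall k, C1_on W (fun z => a z 0 k).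
Hypothesis rC1 : C1_on W r.
Hypothesis HK : forall z, W z -> forall v, `|v| <= K * `|DPhi a r z v|.

(* Moving by v = DPhi^{-1}(0, +-1) changes r at unit rate. *)
Let ascent z (c : R) : W z -> `|c| <= 1 -> exists2 v : X, `|v| <= K & is_derive z v r c.
Proof.
move=> Wz c1; have [v Ev] := DPhi_surj dN HK (0, c) Wz.
exists v; last by have := C1_derive v oW rC1 Wz; have -> : dir r z v = c by rewrite -[RHS]/((0, c) : 'rV[R]_d * R).2 -Ev.
apply: le_trans (HK Wz v) _; rewrite Ev ler_piMr//; first exact: ltW.
by rewrite prod_normE /= normr0 ge_max ler01.
Qed.

(** [ascent] with [c = - 1] produces points with [r < 0], hence of Omega, arbitrarily close to [w];
    and [w] is not in Omega, as [r w] is not negative. *)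
Let zero_boundary w : W w -> r w = 0 -> boundary Omega w.
Proof.
move=> Ww rw; split; last first.
  move=> /interior_subset/(in_domain (WV Ww)).1; by rewrite rw ltxx.
have [|v vK [dv Dv]] := ascent (c := -1) Ww; first by rewrite normrN normr1.
move=> B nB.
have [dl dl0 Hdl] := eps_derivable dv (e := 2^-1) ltac:(by rewrite invr_gt0).
have /nbhs_norm[db db0 Hdb] : nbhs w (B `&` V).
  by apply: filterI => //; apply: open_nbhs_nbhs; split => //; exact: WV.
pose h := Num.min dl (db / K) / 2.
have m0 : 0 < Num.min dl (db / K) by rewrite lt_min dl0 divr_gt0.
have h0 : 0 < h by rewrite divr_gt0.
have hm : h < Num.min dl (db / K) by rewrite /h; lra.
have /andP[hdl hdb] : (h < dl) && (h < db / K) by rewrite -lt_min.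
have [Bx Vx] : (B `&` V) (h *: v + w).
  apply: Hdb; rewrite addrK normrZ gtr0_norm//; apply: le_lt_trans (_ : h * K < _).
    by apply: ler_wpM2l => //; exact: ltW.
  by rewrite -ltr_pdivlMr.
exists (h *: v + w); split => //; apply/(in_domain Vx).
have := Hdl h; rewrite gtr0_norm// => /(_ hdl); rewrite Dv rw subr0 => /(le_trans (ler_norm _)).
by lra.
Qed.

(* The function r x - th |x - z| has no critical point when th < 1/K, so its maximum on a ball
   around z lies on the sphere, where r has become nonnegative. *)
Lemma delta_le_depth z : U z -> Omega z ->
  delta Omega z <= (N%:R * (4 * K) * (1 + D / (e0 / 2))) * (- r z).
Proof.
move=> Uz Omz; have Wz : W z by apply: (Ue0 Uz); rewrite subrr normr0.
have rz : r z < 0 by apply/(in_domain (WV Wz)).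
pose s := - r z; have s0 : 0 < s by rewrite oppr_gt0.
(* With [th = 1/(2K)] the penalty on the sphere of radius [rho] is [2 s], so a maximum attained
   there has [r >= - s + 2 s > 0]. *)
pose rho := 4 * K * s; have rho0 : 0 < rho by rewrite !mulr_gt0.
have e1 : 0 < e0 / 2 by rewrite divr_gt0.
(* When [rho] is too large the ball may leave [W]; then [z0] is a good enough boundary point, its
   distance [D] being at most [D / (e0 / 2)] times [rho]. *)
have [big|small] := ltP (e0 / 2) rho.
  apply: le_trans (delta_ub z bz0) _; apply: le_trans (enorm_le_norm _) _.
  rewrite -!mulrA; apply: ler_wpM2l => //; apply: le_trans (UD Uz) _.
  have -> : 4 * (K * ((1 + D / (e0 / 2)) * s)) = (1 + D / (e0 / 2)) * rho by rewrite /rho; ring.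
  rewrite mulrDl mul1r; apply: le_trans (_ : D / (e0 / 2) * rho <= _); last by rewrite lerDr ltW.
  have E : D = D / (e0 / 2) * (e0 / 2) by rewrite divfK// gt_eqF.
  by rewrite [leLHS]E; apply: ler_wpM2l; [rewrite divr_ge0// ltW|exact: ltW].
have BW x : `|x - z| <= rho -> W x by move=> h; apply: (Ue0 Uz); lra.
pose th := (2 * K)^-1; have th0 : 0 < th by rewrite invr_gt0 mulr_gt0.
have [x xB rx] : exists2 x : X, `|x - z| <= rho & 0 <= r x.
  have [||c cB Hc] := @compact_EVT_max _ R (fun x => r x - th * `|x - z|) [set x | `|x - z| <= rho] _
    (@compact_ball_rV R N z rho).
  - by exists z; rewrite /= subrr normr0 ltW.
  - apply: continuous_subspaceT => x; have c2 : {for x, continuous (fun x : X => th * `|x - z|)}.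
      by apply: for_continuousM; [exact: for_continuous_cst|exact: norm_sub_continuous].
    exact: (cvgB (@cr x) c2).
  rewrite inE /= in cB; have := Hc z; rewrite inE /= subrr normr0 mulr0 subr0 => /(_ (ltW rho0)) rzc.
  exists c => //; move: cB; rewrite le_eqVlt => /predU1P[cE|cB].
    have thr : th * rho = 2 * s by rewrite /th /rho; field; rewrite gt_eqF.
    by rewrite cE thr in rzc; rewrite /s in s0 rzc *; lra.
  exfalso; have [|v vK [dv Dv]] := ascent (c := 1) (BW c (ltW cB)); first by rewrite normr1.
  have [dl dl0 Hdl] := eps_derivable dv (e := 4^-1) ltac:(by rewrite invr_gt0).
  pose m := Num.min dl ((rho - `|c - z|) / K).
  have m0 : 0 < m by rewrite lt_min dl0 divr_gt0// subr_gt0.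
  pose h := m / 2; have h0 : 0 < h by rewrite divr_gt0.
  have hm : h < m by rewrite /h; lra.
  have /andP[hdl hdb] : (h < dl) && (h < (rho - `|c - z|) / K) by rewrite -lt_min.
  have hv : `|h *: v| <= h * K by rewrite normrZ gtr0_norm//; apply: ler_wpM2l => //; exact: ltW.
  have hvr : h * K < rho - `|c - z| by rewrite -ltr_pdivlMr.
  have tri : `|h *: v + c - z| <= `|h *: v| + `|c - z| by rewrite -addrA; exact: ler_normD.
  have := Hc (h *: v + c); rewrite inE /= => /(_ _) H.
  have {}H : r (h *: v + c) - th * `|h *: v + c - z| <= r c - th * `|c - z| by apply: H; lra.
  have := Hdl h; rewrite gtr0_norm// => /(_ hdl); rewrite Dv mulr1 ler_norml => /andP[lo _].
  have thh : th * (h * K) = h / 2 by rewrite /th; field; rewrite gt_eqF.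
  have t1 : th * `|h *: v + c - z| <= th * (h * K) + th * `|c - z|.
    by rewrite -mulrDr; apply: ler_wpM2l; [exact: ltW|lra].
  lra.
pose g (t : R) := r (z + t *: (x - z)).
have cg : continuous g.
  move=> t; apply: (@continuous_comp _ _ _ (fun t : R => z + t *: (x - z)) r); last exact: cr.
  by apply: cvgD; [exact: cvg_cst|apply: cvgZr_tmp; exact: cvg_id].
(* [r] goes from a negative to a nonnegative value between [z] and [x]; a zero on the segment is a
   boundary point within [rho] of [z]. *)
have [|t t01 gt] := @IVT R g 0 1 0 ler01 (continuous_subspaceT cg).
  rewrite /g scale0r addr0 scale1r addrC subrK ge_min (ltW rz) /= le_max rx orbT //.
have wz : `|z + t *: (x - z) - z| <= rho.
  rewrite addrAC subrr add0r normrZ; move: t01; rewrite in_itv /= => /andP[t0 t1].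
  rewrite ger0_norm//; apply: le_trans (_ : 1 * `|x - z| <= _); last by rewrite mul1r.
  exact: ler_wpM2r.
apply: le_trans (delta_ub z (zero_boundary (BW _ wz) gt)) _.
apply: le_trans (enorm_le_norm _) _; rewrite -!mulrA; apply: ler_wpM2l => //.
rewrite distrC; apply: le_trans wz _; rewrite /rho -/s -!mulrA.
apply: ler_wpM2l => //; apply: ler_wpM2l; first exact: ltW.
by rewrite mulrDl mul1r lerDl; apply: mulr_ge0; [rewrite divr_ge0// ltW|exact: ltW].
Qed.

End distance.

(** * The dbar operator *)

Section symmetry.
Context (R : realType) (N : nat).
Local Notation T := (measurableTypeR R).
Local Notation X := 'rV[R]_N.
Implicit Types (p q : X -> R).

Lemma is_derive_shift p (c x v : X) : derivable p (x + c) v ->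
  is_derive x v (fun x => p (x + c)) ('D_v p (x + c)).
Proof.
move=> dp; apply: derivable_eps => e e0; have [dl dl0 H] := eps_derivable dp e0.
by exists dl => // h /H; rewrite addrA.
Qed.

Lemma C1c_shift p (c : X) : C1c p ->
  C1c (fun x => p (x + c)) /\ forall k x, pd k (fun x => p (x + c)) x = pd k p (x + c).
Proof.
move=> [cp dp cdp [L L0 pL]].
have D k x := is_derive_shift (dp k (x + c)).
have E k x : pd k (fun x => p (x + c)) x = pd k p (x + c) by rewrite /pd; have [_ ->] := D k x.
have cs (g : X -> R) : continuous g -> continuous (fun x : X => g (x + c)).
  move=> cg x; apply: (@continuous_comp _ _ _ (fun x : X => x + c) g); last exact: cg.
  by apply/cvg_at_norm => e e0; exists e => // y; rewrite opprD addrACA subrr addr0.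
split; last exact: E.
split.
- exact: cs.
- by move=> k x; have [] := D k x.
- by move=> k; rewrite (_ : pd k _ = fun x => pd k p (x + c)); [exact: cs|apply/funext].
- exists (L + `|c|); first by rewrite ltr_pwDl.
  move=> x [j xj]; apply: pL; exists j; rewrite mxE.
  have := coord_le_norm c j; have := ler_normB (x 0 j + c 0 j) (c 0 j); rewrite addrK; lra.
Qed.

Lemma Rint_shift_row (c : X) (g : X -> R) : measurable_fun setT (fun t : N.-tuple T => g (rvec t)) ->
  \int[leb R N]_t g (rvec t + c) = \int[leb R N]_t g (rvec t).
Proof.
move=> mg; rewrite -(Rint_tshift (fun i => c 0 i) mg); apply: eq_Rintegral => t _.
by rewrite rvec_tshift; congr (g (_ + _)); apply/rowP => i; rewrite mxE.
Qed.

Lemma is_derive_opp (G : R -> R) (l : R) : is_derive (0 : R) 1 G l -> is_derive (0 : R) 1 (fun s => G (- s)) (- l).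
Proof.
move=> [dG DG]; apply: derivable_eps => e e0; have [dl dl0 H] := eps_derivable dG e0.
exists dl => // h hdl; have := H (- h); rewrite normrN => /(_ hdl).
by rewrite DG !scaler1 !addr0 oppr0 mulNr mulrN.
Qed.

Lemma C1c_measurable p : C1c p -> measurable_fun setT (fun t : N.-tuple T => p (rvec t) : T).
Proof. by move=> [cp _ _ _]; exact: continuous_measurable_rvec. Qed.

(** Both sides are derivatives at 0 of the same function of [s], the integral of
    [p(x + s e_k) q(x)], which by translation invariance is also that of [p(x) q(x - s e_k)]. *)
Lemma integration_by_parts_C1c k p q : C1c p -> C1c q ->
  \int[leb R N]_t (pd k p (rvec t) * q (rvec t)) = - \int[leb R N]_t (pd k q (rvec t) * p (rvec t)).
Proof.
move=> pC qC.
have [_ <-] := C1c_translate k pC (C1c_bbs qC).1.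
have [_ <-] := is_derive_opp (C1c_translate k qC (C1c_bbs pC).1).
congr ('D_1 _ (0 : R)); apply/funext => s.
pose e : X := s *: delta_mx 0 k.
rewrite -(@Rint_shift_row (- e) (fun x => p (x + e) * q x)); last first.
  apply: measurable_funM; last exact: C1c_measurable.
  exact: C1c_measurable (C1c_shift e pC).1.
by apply: eq_Rintegral => t _; rewrite subrK mulrC scaleNr.
Qed.

(* Both sides are the derivative at t = 0 of the integral of (d_i p)(x) q(x + t e_j);
   only first derivatives of p and q are used. *)
Lemma pd_symmetry i j p q : C1c p -> C1c q ->
  \int[leb R N]_t (pd i p (rvec t) * pd j q (rvec t)) =
  \int[leb R N]_t (pd j p (rvec t) * pd i q (rvec t)).
Proof.
move=> pC qC.
have H1 := C1c_translate j qC (C1c_pd_bbs i pC).1.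
have H2 := is_derive_opp (C1c_translate j pC (C1c_pd_bbs i qC).1).
transitivity (- (- \int[leb R N]_t (pd j p (rvec t) * pd i q (rvec t)))); last by rewrite opprK.
transitivity (\int[leb R N]_t (pd j q (rvec t) * pd i p (rvec t))).
  by apply: eq_Rintegral => t _; rewrite mulrC.
have {}H2 := is_deriveN H2.
have [_ <-] := H1; have [_ <-] := H2.
congr ('D_1 _ (0 : R)); apply/funext => s /=.
pose e : X := s *: delta_mx 0 j.
have [qs qsE] := C1c_shift e qC.
transitivity (\int[leb R N]_t (pd i p (rvec t) * q (rvec t + e))).
  by apply: eq_Rintegral => t _; rewrite mulrC.
rewrite (integration_by_parts_C1c i pC qs); congr (- _).
rewrite -(@Rint_shift_row (- e) (fun x => pd i (fun x => q (x + e)) x * p x)).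
  by apply: eq_Rintegral => t _; rewrite qsE subrK mulrC scaleNr.
apply: measurable_funM; last exact: C1c_measurable.
by have [_ _ c _] := qs; exact: continuous_measurable_rvec (c i).
Qed.

End symmetry.

Section dbar.
Context (R : realType) (n : nat).
Local Notation T := (measurableTypeR R).
Local Notation N := (n + n)%N.
Local Notation X := 'rV[R]_N.
Variables (p q : X -> R).
Hypothesis pC : C1c p.
Hypothesis qC : C1c q.

Let dp i (t : N.-tuple T) := pd i p (rvec t).
Let dq i (t : N.-tuple T) := pd i q (rvec t).

Let bdp i : bbs (dp i). Proof. exact: C1c_pd_bbs. Qed.
Let bdq i : bbs (dq i). Proof. exact: C1c_pd_bbs. Qed.
Let bm (g h : N.-tuple T -> R) : bbs g -> bbs h -> bms (leb R N) (fun t => g t * h t).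
Proof. by move=> bg bh; apply: bmsMr; [exact: bbs_bms|case: bh]. Qed.

(* The left-hand side is the sum of the |d/dzbar_k (p + i q)|^2. *)
Lemma dbar_gradient :
  4 * \int[leb R N]_t (\sum_(k < n) (2^-1) ^+ 2 * ((dp (lshift n k) t - dq (rshift n k) t) ^+ 2 +
     (dq (lshift n k) t + dp (rshift n k) t) ^+ 2)) =
  \int[leb R N]_t (\sum_(i < N) (dp i t ^+ 2 + dq i t ^+ 2)).
Proof.
(* Expanding the squares leaves a quarter of the squared gradient and half of a sum of Jacobian
   determinants, whose integral vanishes by [pd_symmetry]. *)
have E t : \sum_(k < n) (2^-1) ^+ 2 * ((dp (lshift n k) t - dq (rshift n k) t) ^+ 2 +
     (dq (lshift n k) t + dp (rshift n k) t) ^+ 2) =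
   4^-1 * (\sum_(i < N) (dp i t ^+ 2 + dq i t ^+ 2)) +
   2^-1 * \sum_(k < n) (dp (rshift n k) t * dq (lshift n k) t - dp (lshift n k) t * dq (rshift n k) t).
  rewrite big_split_ord /= -big_split /= !mulr_sumr -big_split /=; apply: eq_bigr => k _.
  by move: (dp _ t) (dp _ t) (dq _ t) (dq _ t) => x1 x2 y1 y2; field.
under eq_Rintegral do rewrite E.
have b1 : bms (leb R N) (fun t => \sum_(i < N) (dp i t ^+ 2 + dq i t ^+ 2)).
  by apply: bms_sum => i; apply: bmsD; under eq_fun do rewrite expr2; exact: bm.
have b2 : bms (leb R N) (fun t => \sum_(k < n) (dp (rshift n k) t * dq (lshift n k) t - dp (lshift n k) t * dq (rshift n k) t)).
  by apply: bms_sum => k; apply: bmsB; exact: bm.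
rewrite bms_RintD; try exact: bmsZ.
have Z : \int[leb R N]_t (\sum_(k < n) (dp (rshift n k) t * dq (lshift n k) t - dp (lshift n k) t * dq (rshift n k) t)) = 0.
  rewrite bms_Rint_sum; last by move=> k; apply: bmsB; exact: bm.
  rewrite big1// => k _; rewrite bms_RintB; try exact: bm.
  by rewrite [X in X - _](pd_symmetry (rshift n k) (lshift n k) pC qC) subrr.
rewrite (bms_RintZ _ b1) (bms_RintZ _ b2) Z mulr0 addr0 mulrA mulfV ?mul1r//.
Qed.

End dbar.

(** * The weight with its cutoff *)

Section cutoff.
Context (R : realType).

Lemma line_is_derive (V : normedModType R) (F : V -> R) z v (l : R) :
  is_derive (0 : R) 1 (fun t : R => F (z + t *: v)) l -> is_derive z v F l.
Proof.
move=> [dF DF]; apply: derivable_eps => e e0; have [dl dl0 H] := eps_derivable dF e0.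
exists dl => // h /H; rewrite DF scaler1 addr0 scale0r addr0.
by rewrite [h *: v + z]addrC.
Qed.

Lemma is_derive_comp_real (V : normedModType R) (phi : R -> R) (r : V -> R) z v (m l : R) :
  is_derive z v r l -> is_derive (r z) 1 phi m -> is_derive z v (phi \o r) (m * l).
Proof.
move=> [dr Dr] dphi; apply: line_is_derive.
have H : is_derive (0 : R) 1 (fun t : R => r (z + t *: v)) l.
  by rewrite -Dr -[X in 'D_v r X](addr0 z) -(scale0r v); apply: is_derive_line; rewrite scale0r addr0.
have dphi' : is_derive ((fun t : R => r (z + t *: v)) 0) 1 phi m by rewrite scale0r addr0.
exact: is_derive1_comp.
Qed.

(** The remainder is at most [h^2], also across 0, where the positive part itself has a corner. *)
Lemma is_derive_pos_part_sqr (y : R) : is_derive y 1 (fun y : R => Num.max y 0 ^+ 2) (2 * Num.max y 0).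
Proof.
apply: derivable_eps => e e0; exists e => // h he; rewrite scaler1.
apply: (@le_trans _ _ (`|h| * `|h|)); last by apply: ler_wpM2r => //; exact: ltW.
rewrite -normrM -expr2 [leRHS]ger0_norm ?sqr_ge0//.
by rewrite ler_norml; case: (leP (h + y) 0); case: (leP y 0) => h1 h2; apply/andP; split; nra.
Qed.

Variable f : R -> R.
Hypothesis f0 : forall t : R, 0 < t -> 0 <= f t.
Hypothesis f_incr : increasing_pos f.
Hypothesis f_decr : decreasing_pos (fun t => f t / t).
Hypothesis df : forall t : R, 0 < t -> derivable f t 1.
Hypothesis cdf : forall t : R, 0 < t -> {for t, continuous ('D_1 f)}.

(** The infinitesimal forms of the two monotonicity assumptions: a derivative of the wrong sign
    would contradict them at a nearby point. *)
Lemma derive_bounds (t : R) : 0 < t -> 0 <= 'D_1 f t /\ t * 'D_1 f t <= f t.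
Proof.
move=> t0; split.
  rewrite leNgt; apply/negP => neg.
  have [|dl dl0 H] := eps_derivable (df t0) (e := - 'D_1 f t / 2); first by rewrite divr_gt0// oppr_gt0.
  have h0 : 0 < dl / 2 by rewrite divr_gt0.
  have := H (dl / 2); rewrite gtr0_norm// scaler1 ler_norml => /(_ _)/andP[|_]; first lra.
  have := @f_incr t (dl / 2 + t) t0; nra.
rewrite leNgt; apply/negP => neg.
have [|dl dl0 H] := eps_derivable (df t0) (e := ('D_1 f t - f t / t) / 2).
  by rewrite divr_gt0// subr_gt0 ltr_pdivrMr// mulrC.
have h0 : 0 < dl / 2 by rewrite divr_gt0.
have := H (dl / 2); rewrite gtr0_norm// scaler1 ler_norml => /(_ _)/andP[|lo _]; first lra.
have ht : 0 < dl / 2 + t by rewrite addr_gt0.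
have := @f_decr t (dl / 2 + t) t0; rewrite ler_pdivrMr// => /(_ _) h.
have {}h : f (dl / 2 + t) <= f t / t * (dl / 2 + t) by apply: h; lra.
have E : f t / t * t = f t by rewrite divfK// gt_eqF.
have g0 : 0 < 'D_1 f t - f t / t by rewrite subr_gt0 ltr_pdivrMr// mulrC.
by move: (dl / 2) (f t / t) ('D_1 f t) h0 h E g0 lo => h q D *; nra.
Qed.

(* Equals omega(s) ((1 - eps/s)_+)^2 for s = - rho > 0, with omega(s) = s f(1/s). *)
Definition cutoff (eps rho : R) : R := f (- rho)^-1 / (- rho) * Num.max (- rho - eps) 0 ^+ 2.

Definition cutoff' (eps rho : R) : R :=
  ('D_1 f (- rho)^-1 / (- rho) ^+ 3 + f (- rho)^-1 / (- rho) ^+ 2) * Num.max (- rho - eps) 0 ^+ 2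
  - f (- rho)^-1 / (- rho) * (2 * Num.max (- rho - eps) 0).

Lemma is_derive_cutoff eps (rho : R) : rho < 0 -> is_derive rho 1 (cutoff eps) (cutoff' eps rho).
Proof.
move=> rho0; have s0 : 0 < - rho by lra.
have sn0 : - rho != 0 by rewrite gt_eqF.
have dN : is_derive rho 1 (fun x : R => - x) (-1) by apply: is_deriveN.
have di : is_derive rho 1 (fun x : R => (- x)^-1) ((- rho) ^- 2).
  have := is_deriveV (f := fun x : R => - x) sn0; rewrite /GRing.scale /= => H.
  by apply: is_derive_eq; rewrite /GRing.scale /= mulrN1 opprK.
have dfc : is_derive rho 1 (fun x : R => f (- x)^-1) ('D_1 f (- rho)^-1 * (- rho) ^- 2).
  have Hf : is_derive ((fun x : R => (- x)^-1) rho) 1 f ('D_1 f (- rho)^-1).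
    by apply/derivableP; apply: df; rewrite invr_gt0.
  exact: is_derive1_comp.
have dm : is_derive rho 1 (fun x : R => Num.max (- x - eps) 0 ^+ 2) (2 * Num.max (- rho - eps) 0 * -1).
  have D1 : is_derive rho 1 (fun x : R => - x - eps) (-1) by apply: is_derive_eq; rewrite subr0.
  exact: (is_derive_comp_real (phi := fun y : R => Num.max y 0 ^+ 2) D1 (is_derive_pos_part_sqr _)).
rewrite /cutoff /cutoff'.
apply: is_derive_eq; rewrite /GRing.scale /=.
move: ('D_1 f _) (f _) (Num.max _ _) => x y z; move: (- rho) sn0 => s sn0.
by field.
Qed.

Lemma cutoff'_continuous eps (rho : R) : rho < 0 -> {for rho, continuous (cutoff' eps)}.
Proof.
move=> rho0; have s0 : 0 < - rho by lra.
have sn0 : - rho != 0 by rewrite gt_eqF.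
have cN : {for rho, continuous (fun x : R => - x)} by apply: cvgN; exact: cvg_id.
have ci : {for rho, continuous (fun x : R => (- x)^-1)} by apply: cvgV.
have cfi : {for rho, continuous (fun x : R => f (- x)^-1)}.
  by apply: (@continuous_comp _ _ _ (fun x : R => (- x)^-1) f) => //; apply: derivable_cvg; apply: df; rewrite invr_gt0.
have cdfi : {for rho, continuous (fun x : R => 'D_1 f (- x)^-1)}.
  by apply: (@continuous_comp _ _ _ (fun x : R => (- x)^-1) ('D_1 f)) => //; apply: cdf; rewrite invr_gt0.
have cX m : {for rho, continuous (fun x : R => (- x) ^- m)}.
  apply: cvgV; first by rewrite expf_neq0.
  by apply: (@continuous_comp _ _ _ (fun x : R => - x) (fun y : R => y ^+ m)) => //; exact: exprn_continuous.
have cm : {for rho, continuous (fun x : R => Num.max (- x - eps) 0)}.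
  apply: (@continuous_max R _ (fun x : R => - x - eps) (fun=> 0)); last exact: cvg_cst.
  by apply: cvgB; [exact: cN|exact: cvg_cst].
apply: cvgB.
  apply: cvgM; last by apply: cvgM.
  by apply: cvgD; apply: cvgM => //; exact: cX.
by apply: cvgM; [exact: cvgM|apply: cvgM; [exact: cvg_cst|]].
Qed.

Variables (eps rho : R).
Hypothesis eps0 : 0 < eps.
Hypothesis rho0 : rho < 0.
Let s := - rho.
Let s0 : 0 < s. Proof. by rewrite oppr_gt0. Qed.
Let m := Num.max (s - eps) 0.
Let m0 : 0 <= m. Proof. by rewrite le_max lexx orbT. Qed.
Let ms : m <= s. Proof. by rewrite ge_max (ltW s0) andbT gerBl ltW. Qed.

Lemma cutoff_sqr_le : cutoff eps rho ^+ 2 <= wgt f rho.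
Proof.
have fs := f0 (t := s^-1); rewrite invr_gt0 in fs; have {}fs := fs s0.
have q1 : m / s <= 1 by rewrite ler_pdivrMr// mul1r.
have q0 : 0 <= m / s by rewrite divr_ge0// ltW.
have E : cutoff eps rho = s * f s^-1 * (m / s) ^+ 2.
  by rewrite /cutoff -/s -/m; field; rewrite gt_eqF.
rewrite E /wgt -/s [leRHS]expr2 exprMn -expr2; rewrite ler_piMr ?sqr_ge0//.
by apply: exprn_ile1; [exact: sqr_ge0|exact: exprn_ile1].
Qed.

(** With [q = m / s] in [[0, 1]], [F = f(1/s)] and [D = f'(1/s) / s], the derivative is
    [(D + F) q^2 - 2 F q]. By [derive_bounds] [0 <= D <= F], so both terms lie in [[0, 2 F]]. The
    bound does not depend on [eps]. *)
Lemma cutoff'_sqr_le : cutoff' eps rho ^+ 2 <= 4 * f s^-1 ^+ 2.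
Proof.
have si : 0 < s^-1 by rewrite invr_gt0.
have fs := f0 si; have [D0 D1] := derive_bounds si.
have q1 : m / s <= 1 by rewrite ler_pdivrMr// mul1r.
have q0 : 0 <= m / s by rewrite divr_ge0// ltW.
have -> : cutoff' eps rho = (s^-1 * 'D_1 f s^-1 + f s^-1) * (m / s) ^+ 2 - 2 * f s^-1 * (m / s).
  by rewrite /cutoff' -/s -/m; field; rewrite gt_eqF.
move: D1 (mulr_ge0 (ltW si) D0); move: (s^-1 * 'D_1 f s^-1) (m / s) (f s^-1) q0 q1 fs => D q F q0 q1 F0 DF D00.
have q2 : 0 <= q ^+ 2 by exact: sqr_ge0.
have q21 : q ^+ 2 <= 1 by rewrite exprn_ile1.
have lo : - (2 * F) <= (D + F) * q ^+ 2 - 2 * F * q by nra.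
have hi : (D + F) * q ^+ 2 - 2 * F * q <= 2 * F by nra.
by nra.
Qed.

(** For [s >= 2 eps] the ratio [m / s] is at least 1/2; it occurs to the power 4 in the square,
    whence 16. *)
Lemma cutoff_large : 2 * eps <= s -> wgt f rho <= 16 * cutoff eps rho ^+ 2.
Proof.
move=> es; have fs := f0 (t := s^-1); rewrite invr_gt0 in fs; have {}fs := fs s0.
have e0 := eps0; have mE : m = s - eps by rewrite /m max_l// subr_ge0; lra.
have q : 2^-1 <= m / s by rewrite ler_pdivlMr// mE; lra.
have E : cutoff eps rho = s * f s^-1 * (m / s) ^+ 2.
  by rewrite /cutoff -/s -/m; field; rewrite gt_eqF.
rewrite E /wgt -/s; have w0 := sqr_ge0 (s * f s^-1).
rewrite exprMn; move: ((s * f s^-1) ^+ 2) (m / s) w0 q => w x w0 x2.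
have x4 : 4^-1 <= x ^+ 2 by nra.
have : 16^-1 <= (x ^+ 2) ^+ 2 by nra.
by nra.
Qed.

End cutoff.

(** * The weighted gradient is controlled by dbar *)

Section cutoff_gradient.
Context (R : realType) (n : nat).
Local Notation T := (measurableTypeR R).
Local Notation N := (n + n)%N.
Local Notation X := 'rV[R]_N.
Variables (Omega U A : set X) (r : X -> R) (K1 B : R) (f : R -> R).
Hypothesis oOmega : open Omega.
Hypothesis oU : open U.
Hypothesis cA : compact A.
Hypothesis AU : A `<=` closure Omega `&` U.
Hypothesis rC1 : C1_on U r.
Hypothesis rneg : forall z, U z -> r z < 0 -> Omega z.
Hypothesis negr : forall z, U z -> Omega z -> r z < 0.
Hypothesis K10 : 0 < K1.
Hypothesis rK1 : forall z i, U z -> `|pd i r z| <= K1.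
Hypothesis B0 : 0 < B.
Hypothesis UB : forall z i, U z -> `|z 0 i| <= B.
Hypothesis f0 : forall t : R, 0 < t -> 0 <= f t.
Hypothesis f_incr : increasing_pos f.
Hypothesis f_decr : decreasing_pos (fun t => f t / t).
Hypothesis df : forall t : R, 0 < t -> derivable f t 1.
Hypothesis cdf : forall t : R, 0 < t -> {for t, continuous ('D_1 f)}.

Let O := Omega `&` U.
Let oO : open O. Proof. exact: openI. Qed.
Let rO z : O z -> r z < 0. Proof. by case=> Om Uz; exact: negr. Qed.
Let crO z : O z -> {for z, continuous r}. Proof. by case=> _ Uz; exact: (C1_continuous oU rC1). Qed.
Let cf (t : R) : 0 < t -> {for t, continuous f}. Proof. by move=> t0; apply: derivable_cvg; exact: df. Qed.

Let cadd (g h : X -> R) (x : X) : {for x, continuous g} -> {for x, continuous h} ->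
  {for x, continuous (fun x => g x + h x)}.
Proof. by move=> cg ch; exact: (cvgD cg ch). Qed.

Definition cutoff_fun (eps : R) (F : X -> R) (x : X) : R := \1_O x * (cutoff f eps (r x) * F x).

Section one.
Variable (eps : R) (F : X -> R).
Hypothesis eps0 : 0 < eps.
Hypothesis FC : C1_on O F.
Hypothesis FA : forall z, ~ A z -> F z = 0.
Let P := cutoff_fun eps F.
Let Q (i : 'I_N) (x : X) : R := cutoff f eps (r x) * pd i F x + F x * (cutoff' f eps (r x) * pd i r x).

Let inO x : O x -> P x = cutoff f eps (r x) * F x.
Proof. by move=> Ox; rewrite /P /cutoff_fun indicE mem_set// mul1r. Qed.

Let nearO x (G H : X -> R) : (forall z, O z -> G z = H z) -> O x -> \forall z \near x, G z = H z.
Proof.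
move=> GH Ox; have : nbhs x O by exact: open_nbhs_nbhs.
by apply: filterS.
Qed.

(** Either [x] is off the closed set [A], or it lies in [U] with [r x >= 0]; then [r > - eps] near
    [x], where the cutoff is zero. Thus the extension by zero is C^1 across the boundary. *)
Let offO x : ~ O x -> \forall z \near x, P z = 0.
Proof.
move=> nO; have [Ax|nA] := pselect (A x); last first.
  have : nbhs x (~` A).
    by apply: open_nbhs_nbhs; split => //; apply: closed_openC; apply: compact_closed => //; exact: norm_hausdorff.
  by apply: filterS => z nz; rewrite /P /cutoff_fun FA// !mulr0.
have [_ Ux] := AU Ax.
have rx : 0 <= r x by rewrite leNgt; apply/negP => /(rneg Ux) Ox; apply: nO.
have : nbhs x [set z | - eps < r z].
  have H : nbhs (r x) [set y : R | - eps < y].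
    apply: open_nbhs_nbhs; split; first exact: (@open_gt R^o).
    by apply: lt_le_trans rx; rewrite oppr_lt0.
  exact: (C1_continuous oU rC1 Ux H).
apply: filterS => z /= rz; rewrite /P /cutoff_fun /cutoff max_r; last by lra.
by rewrite expr0n mulr0 mul0r mulr0.
Qed.

Lemma cutoff_fun_C1c : [/\ C1c P, forall i x, O x -> pd i P x = Q i x & forall i x, ~ O x -> pd i P x = 0].
Proof.
have DO i x : O x -> is_derive x (delta_mx 0 i) P (Q i x).
  move=> Ox; have [Om Ux] := Ox.
  have dF : is_derive x (delta_mx 0 i) F (pd i F x) by apply: DeriveDef => //; have [] := FC Ox i.
  have dr : is_derive x (delta_mx 0 i) r (pd i r x) by apply: DeriveDef => //; have [] := rC1 Ux i.
  have dc := is_derive_comp_real dr (is_derive_cutoff df eps (rO Ox)).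
  apply: (near_eq_is_derive (f := fun x => (cutoff f eps \o r) x * F x)).
    by apply: nearO Ox => z /inO.
  by apply: is_derive_eq; rewrite /GRing.scale /= /Q; ring.
have D0 i x : ~ O x -> is_derive x (delta_mx 0 i) P 0.
  move=> nO; have H : is_derive x (delta_mx 0 i) (fun=> 0 : R) 0.
    by split; [exact: derivable_cst|exact: derive_cst].
  by apply: near_eq_is_derive H; apply: filterS (offO nO) => z ->.
have EO i x : O x -> pd i P x = Q i x by move=> /(DO i)[].
have E0 i x : ~ O x -> pd i P x = 0 by move=> /(D0 i)[].
have ccut x : O x -> {for x, continuous (fun x => cutoff f eps (r x))}.
  move=> Ox; apply: (@continuous_comp _ _ _ r (cutoff f eps)); first exact: crO.
  by apply: derivable_cvg; have [] := is_derive_cutoff df eps (rO Ox).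
have ccut' x : O x -> {for x, continuous (fun x => cutoff' f eps (r x))}.
  move=> Ox; apply: (@continuous_comp _ _ _ r (cutoff' f eps)); first exact: crO.
  by apply: cutoff'_continuous => //; exact: rO.
have cF x : O x -> {for x, continuous F} by move=> Ox; exact: (C1_continuous oO FC Ox).
split => //; split.
- move=> x; have [Ox|nO] := pselect (O x); last first.
    by apply: (@near_eq_continuous _ _ _ (fun=> 0)); [exact: offO|exact: for_continuous_cst].
  apply: (near_eq_continuous (nearO inO Ox)).
  by apply: for_continuousM; [exact: ccut|exact: cF].
- move=> i x; have [Ox|nO] := pselect (O x); first by have [] := DO i x Ox.
  by have [] := D0 i x nO.
- move=> i x; have [Ox|nO] := pselect (O x); last first.
    apply: (@near_eq_continuous _ _ _ (fun=> 0)); last exact: for_continuous_cst.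
    have /near_join := offO nO; apply: filterS => z Hz.
    transitivity ('D_(delta_mx 0 i) (cst (0 : R)) z); last exact: derive_cst.
    exact: near_eq_derive.
  apply: (near_eq_continuous (nearO (EO i) Ox)).
  have [_ cdF] := FC Ox i; have [_ cdr] := rC1 Ox.2 i.
  apply: cadd; apply: for_continuousM; [exact: ccut|exact: cdF|exact: cF|].
  by apply: for_continuousM => //; exact: ccut'.
- exists B => // x [i xi]; rewrite /P /cutoff_fun indicE memNset ?mul0r// => -[_ Ux].
  by move: xi; rewrite ltNge UB.
Qed.

End one.

Variables F G : X -> R.
Hypothesis FC : C1_on O F.
Hypothesis GC : C1_on O G.
Hypothesis FA : forall z, ~ A z -> F z = 0.
Hypothesis GA : forall z, ~ A z -> G z = 0.

(** The sum of the [|d/dzbar_k (p + i q)|^2] in real terms, the integrand on the left of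
    [dbar_gradient]; see [sum_normc_dzbar]. *)
Definition dbar_sqr (p q : X -> R) (x : X) : R := \sum_(k < n) (2^-1) ^+ 2 *
  ((pd (lshift n k) p x - pd (rshift n k) q x) ^+ 2 + (pd (lshift n k) q x + pd (rshift n k) p x) ^+ 2).

Definition grad_sqr (p q : X -> R) (x : X) : R := \sum_(i < N) (pd i p x ^+ 2 + pd i q x ^+ 2).

Let err x : R := N%:R * K1 ^+ 2 * (f (- r x)^-1 ^+ 2 * (F x ^+ 2 + G x ^+ 2)).

Let err0 x : 0 <= err x.
Proof. by apply: mulr_ge0; [exact: mulr_ge0 (sqr_ge0 _)|apply: mulr_ge0 (sqr_ge0 _) _; apply: addr_ge0; exact: sqr_ge0]. Qed.

Let grad0 p q x : 0 <= grad_sqr p q x.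
Proof. by apply: sumr_ge0 => i _; apply: addr_ge0; exact: sqr_ge0. Qed.

Let dbar0 p q x : 0 <= dbar_sqr p q x.
Proof. by apply: sumr_ge0 => k _; apply: mulr_ge0 (sqr_ge0 _) _; apply: addr_ge0; exact: sqr_ge0. Qed.

Let sum_pdr x (J : finType) (g : J -> 'I_N) : O x -> \sum_(k : J) pd (g k) r x ^+ 2 <= #|J|%:R * K1 ^+ 2.
Proof.
move=> Ox; apply: (@le_trans _ _ (\sum_(k : J) K1 ^+ 2)); last by rewrite sumr_const mulr_natl.
apply: ler_sum => k _; rewrite -[leLHS]real_normK ?num_real// lerXn2r ?nnegrE//; first exact: ltW.
by apply: rK1; case: Ox.
Qed.

(** With [u = F + i G], dbar of the product is [c dbar u + u c' dbar r]; its square is at most twice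
    the sum of the squares, and [|dbar r|^2] is a quarter of the squared gradient of [r]. Then use
    [c^2 <= wgt] and the bound of [c']. *)
Let pw_dbar (eps : R) (x : X) : 0 < eps -> O x ->
  dbar_sqr (cutoff_fun eps F) (cutoff_fun eps G) x <= 2 * (wgt f (r x) * dbar_sqr F G x) + 2 * err x.
Proof.
move=> e0 Ox; have [_ EF _] := cutoff_fun_C1c e0 FC FA; have [_ EG _] := cutoff_fun_C1c e0 GC GA.
have c1 := cutoff_sqr_le f0 e0 (rO Ox).
have c2 := cutoff'_sqr_le f0 f_incr f_decr df e0 (rO Ox).
rewrite /err /dbar_sqr.
set c := cutoff f eps (r x) in c1 *; set c' := cutoff' f eps (r x) in c2 *.
set m := F x ^+ 2 + G x ^+ 2.
have m0 : 0 <= m by apply: addr_ge0; exact: sqr_ge0.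
apply: (@le_trans _ _ (2 * (c ^+ 2 * dbar_sqr F G x) + 2^-1 * (c' ^+ 2 * m * \sum_(i < N) pd i r x ^+ 2))).
  rewrite /dbar_sqr big_split_ord /= -big_split /= !mulr_sumr -big_split /=; apply: ler_sum => k _.
  rewrite !EF// !EG// /m -/c -/c'.
  have alg (x1 x2 y1 y2 u v s t : R) :
    2^-1 ^+ 2 * ((c * x1 + u * (c' * s) - (c * y2 + v * (c' * t))) ^+ 2 +
                 (c * y1 + v * (c' * s) + (c * x2 + u * (c' * t))) ^+ 2) <=
    2 * (c ^+ 2 * (2^-1 ^+ 2 * ((x1 - y2) ^+ 2 + (y1 + x2) ^+ 2))) +
    2^-1 * (c' ^+ 2 * (u ^+ 2 + v ^+ 2) * (s ^+ 2 + t ^+ 2)).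
    have h1 := sqr_ge0 (c * (x1 - y2) - c' * (u * s - v * t)).
    have h2 := sqr_ge0 (c * (y1 + x2) - c' * (v * s + u * t)).
    rewrite -subr_ge0; set z := (X in 0 <= X).
    have -> : z = 4^-1 * ((c * (x1 - y2) - c' * (u * s - v * t)) ^+ 2 + (c * (y1 + x2) - c' * (v * s + u * t)) ^+ 2).
      by rewrite /z; field.
    by apply: mulr_ge0 => //; exact: addr_ge0.
  exact: alg.
apply: lerD.
  by apply: ler_wpM2l => //; apply: ler_wpM2r.
have H := @sum_pdr x _ id Ox; rewrite card_ord in H.
have h1 := ler_pM (sqr_ge0 _) m0 c2 (lexx m).
have h2 := ler_pM (mulr_ge0 (sqr_ge0 c') m0) (sumr_ge0 _ (fun i _ => sqr_ge0 (pd i r x))) h1 H.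
apply: le_trans (ler_wpM2l _ h2) _; first by rewrite invr_ge0.
by rewrite le_eqVlt; apply/orP; left; apply/eqP; field.
Qed.

(** Where [16 c^2] dominates the weight, write [c grad u = grad (c u) - u c' grad r] and square:
    this gives 32 for each term, and [c'^2 <= 4 f(1/s)^2] turns the second into 128. *)
Let pw_grad (eps : R) (x : X) : 0 < eps -> O x -> 2 * eps <= - r x ->
  wgt f (r x) * grad_sqr F G x <= 32 * grad_sqr (cutoff_fun eps F) (cutoff_fun eps G) x + 128 * err x.
Proof.
move=> e0 Ox er; have [_ EF _] := cutoff_fun_C1c e0 FC FA; have [_ EG _] := cutoff_fun_C1c e0 GC GA.
have c1 := cutoff_large f0 e0 (rO Ox) er.
have c2 := cutoff'_sqr_le f0 f_incr f_decr df e0 (rO Ox).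
have g0 := grad0 F G x.
apply: (le_trans (ler_wpM2r g0 c1)).
set c := cutoff f eps (r x); set c' := cutoff' f eps (r x) in c2 *.
set m := F x ^+ 2 + G x ^+ 2.
have m0 : 0 <= m by apply: addr_ge0; exact: sqr_ge0.
apply: (@le_trans _ _ (32 * grad_sqr (cutoff_fun eps F) (cutoff_fun eps G) x +
    32 * (c' ^+ 2 * m * \sum_(i < N) pd i r x ^+ 2))).
  rewrite /grad_sqr !mulr_sumr -big_split /=; apply: ler_sum => i _.
  rewrite !EF// !EG// /m -/c -/c'.
  move: (pd i F x) (pd i G x) (pd i r x) (F x) (G x) => a b s u v.
  have h1 := sqr_ge0 (c * a + 2 * (u * (c' * s))).
  have h2 := sqr_ge0 (c * b + 2 * (v * (c' * s))).
  rewrite -subr_ge0; set z := (X in 0 <= X).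
  have -> : z = 16 * ((c * a + 2 * (u * (c' * s))) ^+ 2 + (c * b + 2 * (v * (c' * s))) ^+ 2).
    by rewrite /z; ring.
  by apply: mulr_ge0 => //; exact: addr_ge0.
apply: lerD => //.
have H := @sum_pdr x _ id Ox; rewrite card_ord in H.
have h1 := ler_pM (sqr_ge0 _) m0 c2 (lexx m).
have h2 := ler_pM (mulr_ge0 (sqr_ge0 c') m0) (sumr_ge0 _ (fun i _ => sqr_ge0 (pd i r x))) h1 H.
apply: le_trans (ler_wpM2l _ h2) _ => //.
by rewrite le_eqVlt; apply/orP; left; apply/eqP; rewrite /err -/m; ring.
Qed.

Let J (g : X -> R) := (\int[leb R N]_t (\1_O (rvec t) * g (rvec t))%:E)%E.

Let csq (g : X -> R) (x : X) : {for x, continuous g} -> {for x, continuous (fun x => g x ^+ 2)}.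
Proof.
move=> cg; have -> : (fun x => g x ^+ 2) = (fun x => g x * g x) by apply/funext => y; rewrite expr2.
exact: for_continuousM.
Qed.

Lemma weighted_gradient_continuous x : O x -> {for x, continuous (fun x => wgt f (r x) * grad_sqr F G x)}.
Proof.
move=> Ox; apply: for_continuousM.
  apply: (@continuous_comp _ _ _ r (wgt f)); first exact: crO.
  by apply: wgt_continuous => //; exact: rO.
apply: continuous_sum_fin => i; have [_ c] := FC Ox i; have [_ c'] := GC Ox i.
by apply: cadd; exact: csq.
Qed.

Let cdbar x : O x -> {for x, continuous (fun x => wgt f (r x) * dbar_sqr F G x)}.
Proof.
move=> Ox; apply: for_continuousM.
  apply: (@continuous_comp _ _ _ r (wgt f)); first exact: crO.
  by apply: wgt_continuous => //; exact: rO.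
have c i := (FC Ox i).2; have c' i := (GC Ox i).2.
apply: continuous_sum_fin => i; apply: for_continuousM; first exact: for_continuous_cst.
apply: cadd; apply: csq; last exact: cadd.
exact: (cvgB (c _) (c' _)).
Qed.

Lemma cutoff_error_continuous x : O x -> {for x, continuous (fun x =>
  N%:R * K1 ^+ 2 * (f (- r x)^-1 ^+ 2 * (F x ^+ 2 + G x ^+ 2)))}.
Proof.
move=> Ox; apply: for_continuousM; first exact: for_continuous_cst.
have cfr : {for x, continuous (fun x => f (- r x)^-1)}.
  have rx : 0 < - r x by rewrite oppr_gt0; exact: rO.
  have rn : - r x != 0 by rewrite gt_eqF.
  have cN : {for r x, continuous (fun y : R => - y)} by apply: cvgN; exact: cvg_id.
  have ci : {for r x, continuous (fun y : R => (- y)^-1)} by apply: cvgV.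
  apply: (@continuous_comp _ _ _ r (fun y : R => f (- y)^-1)); first exact: crO.
  by apply: (@continuous_comp _ _ _ (fun y : R => (- y)^-1) f) => //; apply: cf; rewrite invr_gt0.
have cF := C1_continuous oO FC Ox; have cG := C1_continuous oO GC Ox.
by apply: for_continuousM; [exact: csq|apply: cadd; exact: csq].
Qed.

Let mI (g : X -> R) : (forall x, O x -> {for x, continuous g}) ->
  measurable_fun setT (fun t : N.-tuple T => (\1_O (rvec t) * g (rvec t))%:E).
Proof. by move=> cg; apply/measurable_EFinP; exact: measurable_indic_open. Qed.

Let I0 (g : X -> R) : (forall x, 0 <= g x) -> forall t : N.-tuple T, (0 <= (\1_O (rvec t) * g (rvec t))%:E)%E.
Proof. by move=> g0 t; rewrite lee_fin indicE mulr_ge0. Qed.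

Let wd0 x : 0 <= wgt f (r x) * dbar_sqr F G x. Proof. by apply: mulr_ge0 => //; exact: wgt_ge0. Qed.

Let level_open (eps : R) : open [set x : X | O x /\ 2 * eps < - r x].
Proof.
rewrite openE => z [Oz rz]; apply: filterI; first exact: open_nbhs_nbhs.
have H : nbhs (r z) [set y : R | y < - (2 * eps)].
  by apply: open_nbhs_nbhs; split; [exact: (@open_lt R^o)|rewrite /= ltrNr].
have {}H : nbhs z (r @^-1` [set y : R | y < - (2 * eps)]) := crO Oz H.
by apply: filterS H => y /=; rewrite ltrNr.
Qed.

Let level_measurable (eps : R) : measurable_fun setT (fun t : N.-tuple T =>
  (\1_[set x : X | O x /\ 2 * eps < - r x] (rvec t) * (wgt f (r (rvec t)) * grad_sqr F G (rvec t)))%R%:E).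
Proof.
apply/measurable_EFinP.
apply: (measurable_indic_open (G := fun x => wgt f (r x) * grad_sqr F G x) (@level_open eps)).
by move=> x [Ox _]; exact: weighted_gradient_continuous.
Qed.

(** [384 = 32 * 4 * 2 + 128]: the factor 32 of [pw_grad], 4 from [dbar_gradient], 2 from [pw_dbar],
    and the error term of [pw_grad]. The bound is uniform in [eps]. *)
Let level (eps : R) : 0 < eps ->
  (\int[leb R N]_t (\1_[set x : X | O x /\ 2 * eps < - r x] (rvec t) * (wgt f (r (rvec t)) * grad_sqr F G (rvec t)))%R%:E
   <= 384%:E * (J (fun x => (wgt f (r x) * dbar_sqr F G x)%R) + J err))%E.
Proof.
move=> e0.
have [pC pE p0] := cutoff_fun_C1c e0 FC FA; have [qC qE q0] := cutoff_fun_C1c e0 GC GA.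
set p := cutoff_fun eps F in pC pE p0 *; set q := cutoff_fun eps G in qC qE q0 *.
have key := dbar_gradient pC qC.
have b1 : bms (leb R N) (fun t => grad_sqr p q (rvec t)).
  apply: bms_sum => i; apply: bmsD; under eq_fun do rewrite expr2.
    by apply: bmsMr; [exact: bbs_bms (C1c_pd_bbs i pC)|case: (C1c_pd_bbs i pC)].
  by apply: bmsMr; [exact: bbs_bms (C1c_pd_bbs i qC)|case: (C1c_pd_bbs i qC)].
have b2 : bms (leb R N) (fun t => dbar_sqr p q (rvec t)).
  apply: bms_sum => k; apply: bmsZ.
  have bp i := bbs_bms (C1c_pd_bbs i pC); have bq i := bbs_bms (C1c_pd_bbs i qC).
  by apply: bmsD; under eq_fun do rewrite expr2; apply: bmsMr;
    solve [exact: bmsB|exact: bmsD|apply: bms_bdm; exact: bmsB|apply: bms_bdm; exact: bmsD].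
have m1 := bms_bdm b1; have m2 := bms_bdm b2.
have key' : (\int[leb R N]_t (grad_sqr p q (rvec t))%:E = 4%:E * \int[leb R N]_t (dbar_sqr p q (rvec t))%:E)%E.
  by rewrite (bms_EFin b1) (bms_EFin b2) -EFinM; congr EFin; exact: esym key.
have le2 : (\int[leb R N]_t (dbar_sqr p q (rvec t))%:E <=
    2%:E * (J (fun x => (wgt f (r x) * dbar_sqr F G x)%R) + J err))%E.
  rewrite /J -ge0_integralD//; try (by move=> t _; exact: (I0 wd0 t)); try (by move=> t _; exact: (I0 err0 t)); try (solve [exact: (mI cdbar)|exact: (mI cutoff_error_continuous)]).
  rewrite -ge0_integralZl_EFin//; last 2 first.
  - by move=> t _; apply: adde_ge0; [exact: (I0 wd0 t)|exact: (I0 err0 t)].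
  - by apply: emeasurable_funD; [exact: (mI cdbar)|exact: (mI cutoff_error_continuous)].
  apply: ge0_le_integral => //.
  - by move=> t _; rewrite lee_fin.
  - by apply/measurable_EFinP; case: m2.
  - by apply: measurable_funeM; apply: emeasurable_funD; [exact: (mI cdbar)|exact: (mI cutoff_error_continuous)].
  move=> t _; rewrite -EFinD -EFinM lee_fin indicE; have [Ot|nO] := pselect (O (rvec t)).
    by rewrite mem_set// !mul1r mulrDr; exact: pw_dbar.
  rewrite memNset// !mul0r addr0 mulr0 /dbar_sqr big1// => k _.
  by rewrite !p0// !q0// subr0 addr0 expr0n addr0 mulr0.
apply: (@le_trans _ _ (32%:E * \int[leb R N]_t (grad_sqr p q (rvec t))%:E + 128%:E * J err)%E).
  rewrite /J -!ge0_integralZl_EFin//; try (by move=> t _; rewrite lee_fin); try (by move=> t _; exact: (I0 wd0 t)); try (by move=> t _; exact: (I0 err0 t)); try (exact: (mI cutoff_error_continuous));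
    try (by apply/measurable_EFinP; case: m1); try (by move=> t _; exact: I0).
  rewrite -ge0_integralD//; last 4 first.
  - by move=> t _; rewrite -EFinM lee_fin mulr_ge0.
  - by apply: measurable_funeM; apply/measurable_EFinP; case: m1.
  - by move=> t _; apply: mule_ge0 => //; exact: I0.
  - by apply: measurable_funeM; exact: (mI cutoff_error_continuous).
  apply: ge0_le_integral => //.
  - move=> t _; rewrite lee_fin indicE; apply: mulr_ge0 => //; apply: mulr_ge0 => //; exact: wgt_ge0.
  - by apply: emeasurable_funD; apply: measurable_funeM; [apply/measurable_EFinP; case: m1|exact: (mI cutoff_error_continuous)].
  move=> t _; rewrite -!EFinM -EFinD lee_fin !indicE.
  have [[Ot rt]|nO] := pselect (O (rvec t) /\ 2 * eps < - r (rvec t)); last first.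
    rewrite (memNset (A := [set x : X | O x /\ 2 * eps < - r x]))// mul0r.
    by apply: addr_ge0; apply: mulr_ge0 => //; apply: mulr_ge0.
  rewrite (mem_set (A := [set x : X | O x /\ 2 * eps < - r x]))// (mem_set Ot) !mul1r.
  by apply: pw_grad => //; exact: ltW.
set J1 := J _ in le2 *; set J2 := J err in le2 *.
have J10 : (0 <= J1)%E by apply: integral_ge0 => t _; exact: (I0 wd0 t).
have J20 : (0 <= J2)%E by apply: integral_ge0 => t _; exact: (I0 err0 t).
rewrite key' muleA -EFinM.
apply: (@le_trans _ _ ((32 * 4)%:E * (2%:E * (J1 + J2)) + 128%:E * (J1 + J2))%E).
  by apply: leeD; apply: lee_wpmul2l => //; rewrite leeDr.
have J12 : (0 <= J1 + J2)%E by exact: adde_ge0.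
rewrite muleA -EFinM -ge0_muleDl ?lee_fin// -EFinD lee_wpmul2r// lee_fin.
by lra.
Qed.

(* Applies dbar_gradient to the product of F + i G with the cutoff and lets eps tend to 0. *)
Theorem cutoff_gradient_estimate :
  (J (fun x => (wgt f (r x) * grad_sqr F G x)%R) <=
   384%:E * (J (fun x => (wgt f (r x) * dbar_sqr F G x)%R) + J err))%E.
Proof.
pose e (k : nat) : R := k.+1%:R^-1.
have e0 k : 0 < e k by rewrite invr_gt0.
pose D k := [set x : X | O x /\ 2 * e k < - r x].
pose g (x : X) := wgt f (r x) * grad_sqr F G x.
have g0 x : 0 <= g x by apply: mulr_ge0 => //; exact: wgt_ge0.
apply: (@fatou_le _ _ _ (leb R N) _ (fun k t => (\1_(D k) (rvec t) * g (rvec t))%:E)).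
- exact: (mI weighted_gradient_continuous).
- exact: (I0 g0).
- by move=> k; exact: level_measurable.
- by move=> k t; rewrite lee_fin indicE mulr_ge0.
- move=> t; rewrite indicE; have [Ot|nO] := pselect (O (rvec t)); last first.
    by rewrite memNset// mul0r; apply: (@limn_einf_ge _ _ _ 0) => k _; rewrite lee_fin indicE mulr_ge0.
  have rt : 0 < - r (rvec t) by rewrite oppr_gt0; exact: rO.
  have [k0 Hk0] : exists k0 : nat, 2 / (- r (rvec t)) < k0%:R.
    by exists (Num.bound (2 / (- r (rvec t)))); apply: archi_boundP; rewrite divr_ge0// ltW.
  apply: (@limn_einf_ge _ _ _ k0) => k kk; rewrite lee_fin indicE !mem_set//; split => //.
  rewrite /e ltr_pdivrMr// -ltr_pdivrMl// mulrC; apply: lt_le_trans Hk0 _.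
  by rewrite ler_nat; exact: leq_trans kk _.
- by move=> k; exact: level.
Qed.

End cutoff_gradient.

(** * The two estimates *)

Section generic.
Context (R : realType).

(* The weights involving delta are not known to be measurable. *)
Lemma ge0_le_integral_nonmeasurable d (X : measurableType d) (mu : {measure set X -> \bar R})
    (f1 f2 : X -> \bar R) : (forall x, 0 <= f1 x)%E -> (forall x, f1 x <= f2 x)%E ->
  (\int[mu]_x f1 x <= \int[mu]_x f2 x)%E.
Proof.
move=> f10 f12; have f20 x : (0 <= f2 x)%E := le_trans (f10 x) (f12 x).
rewrite !ge0_integralTE//; apply: le_ereal_sup => _ [h /= hf <-].
by exists h => // x; exact: le_trans (hf x) (f12 x).
Qed.

(** The factor is taken out on the side of [g], since [h], which will contain the distance to the
    boundary, is not known to be measurable. *)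
Lemma ge0_le_integral_scale d (X : measurableType d) (mu : {measure set X -> \bar R})
    (g h : X -> R) (c : R) : measurable_fun setT g -> (forall x, 0 <= g x) -> 0 < c ->
  (forall x, g x <= c * h x) -> (\int[mu]_x (g x)%:E <= c%:E * \int[mu]_x (h x)%:E)%E.
Proof.
move=> mg g0 c0 gh.
have -> : (\int[mu]_x (g x)%:E = c%:E * \int[mu]_x (c^-1 * g x)%:E)%E.
  rewrite -ge0_integralZl_EFin//; last 3 first.
  - by move=> x _; rewrite lee_fin mulr_ge0// invr_ge0 ltW.
  - by apply/measurable_EFinP; exact: measurable_funM.
  - exact: ltW.
  by apply: eq_integral => x _; rewrite -EFinM mulVKf// gt_eqF.
apply: lee_wpmul2l; first by rewrite lee_fin ltW.
apply: ge0_le_integral_nonmeasurable => x; rewrite lee_fin.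
  by rewrite mulr_ge0// invr_ge0 ltW.
by rewrite ler_pdivrMl.
Qed.

Lemma lipschitz_derive_le (V : normedModType R) (g : V -> R) (l : R) (z v : V) :
  (forall x y, `|g x - g y| <= l * `|x - y|) -> derivable g z v -> `|'D_v g z| <= l * `|v|.
Proof.
move=> gl dg; apply/ler_addgt0Pr => e e0; have [dl dl0 H] := eps_derivable dg e0.
have h0 : 0 < dl / 2 by rewrite divr_gt0.
have hd : `|dl / 2| < dl by rewrite gtr0_norm//; lra.
have := H _ hd; have := gl ((dl / 2) *: v + z) z; rewrite addrK normrZ gtr0_norm//.
move: (g ((dl / 2) *: v + z) - g z) => x; move: (dl / 2) ('D_v g z) h0 => h D h0 h1 h2.
have : h * `|D| <= h * (l * `|v| + e).
  have -> : h * `|D| = `|h * D| by rewrite normrM gtr0_norm.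
  have := ler_normD (x - (x - h * D)) (x - h * D); have := ler_normB x (x - h * D).
  by rewrite subKr; nra.
by rewrite ler_pM2l.
Qed.

Lemma smooth_pos_C1 (f : R -> R) : smooth_pos f ->
  (forall t : R, 0 < t -> derivable f t 1) /\ (forall t : R, 0 < t -> {for t, continuous ('D_1 f)}).
Proof.
move=> sf; split=> [t t0|t t0]; first exact: (sf 0%N t t0).
have := derivable_cvg (sf 1%N t t0).
have -> : 'D_1 f = derive1n 1 f by apply/funext => x; rewrite -derive1E.
exact.
Qed.

(** [controlled] is stated with Euclidean norms and a [K] of any sign; the chart lemmas need sup
    norms and a positive constant. *)
Lemma enorm_le_frame d N (a : 'rV[R]_N -> 'rV[R]_d) (r : 'rV[R]_N -> R) (W : set 'rV[R]_N) (K : R) z v :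
  N = d.+1 -> open W -> (forall k, C1_on W (fun z => a z 0 k)) -> C1_on W r -> W z ->
  enorm v <= K * Num.sqrt (\sum_k 'D_v (fun z => a z 0 k) z ^+ 2 + 'D_v r z ^+ 2) ->
  `|v| <= (`|K| + 1) * N%:R * `|DPhi a r z v|.
Proof.
move=> dN oW aC rC Wz H; apply: le_trans (norm_le_enorm v) _; apply: le_trans H _.
set m := `|DPhi a r z v|; have m0 : 0 <= m by exact: normr_ge0.
have ar : `|'D_v r z| <= m.
  have [_ ->] := C1_derive v oW rC Wz; rewrite /m prod_normE /= le_max; apply/orP; right; exact: lexx.
have ak k : `|'D_v (fun z => a z 0 k) z| <= m.
  have [_ ->] := C1_derive v oW (aC k) Wz; rewrite /m prod_normE /= le_max; apply/orP; left.
  by have := coord_le_norm (DPhi a r z v).1 k; rewrite mxE.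
apply: (@le_trans _ _ (`|K| * (N%:R * m))); last first.
  by rewrite -mulrA; apply: ler_wpM2r; [exact: mulr_ge0|rewrite lerDl].
apply: le_trans (ler_wpM2r (sqrtr_ge0 _) (ler_norm K)) _; apply: ler_wpM2l => //.
rewrite -[leRHS]ger0_norm ?mulr_ge0// -sqrtr_sqr; apply: ler_wsqrtr.
have sq (x : R) : `|x| <= m -> x ^+ 2 <= m ^+ 2.
  by move=> xm; rewrite -[leLHS]real_normK ?num_real// lerXn2r ?nnegrE.
apply: (@le_trans _ _ (\sum_(k < d) m ^+ 2 + m ^+ 2)).
  by apply: lerD; [apply: ler_sum => k _; exact: sq|exact: sq].
have -> : \sum_(k < d) m ^+ 2 + m ^+ 2 = N%:R * m ^+ 2.
  by rewrite sumr_const card_ord dN -natr1 mulrDl mul1r mulr_natl.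
rewrite exprMn.
apply: ler_wpM2r; first exact: sqr_ge0.
by rewrite -natrX ler_nat dN -[leqLHS]expn1 leq_pexp2l.
Qed.


Definition ccontinuous (V : topologicalType) (g : V -> R[i]) (x : V) :=
  {for x, continuous (fun y => complex.Re (g y))} /\ {for x, continuous (fun y => complex.Im (g y))}.

Lemma ccontinuous_cst (V : topologicalType) (c : R[i]) (x : V) : ccontinuous (fun=> c) x.
Proof. by split; exact: for_continuous_cst. Qed.

Lemma ccontinuousD (V : topologicalType) (g h : V -> R[i]) (x : V) :
  ccontinuous g x -> ccontinuous h x -> ccontinuous (fun y => g y + h y) x.
Proof.
move=> [g1 g2] [h1 h2]; split.
  have E y : complex.Re (g y + h y) = complex.Re (g y) + complex.Re (h y) by case: (g y) (h y) => a b [c e].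
  by have -> := funext E; exact: (cvgD g1 h1).
have E y : complex.Im (g y + h y) = complex.Im (g y) + complex.Im (h y) by case: (g y) (h y) => a b [c e].
by have -> := funext E; exact: (cvgD g2 h2).
Qed.

Lemma ccontinuousM (V : topologicalType) (g h : V -> R[i]) (x : V) :
  ccontinuous g x -> ccontinuous h x -> ccontinuous (fun y => g y * h y) x.
Proof.
move=> [g1 g2] [h1 h2]; split.
  have E y : complex.Re (g y * h y) = complex.Re (g y) * complex.Re (h y) - complex.Im (g y) * complex.Im (h y).
    by case: (g y) (h y) => a b [c e].
  have -> := funext E; exact: (cvgB (for_continuousM g1 h1) (for_continuousM g2 h2)).
have E y : complex.Im (g y * h y) = complex.Re (g y) * complex.Im (h y) + complex.Im (g y) * complex.Re (h y).
  by case: (g y) (h y) => a b [c e].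
have -> := funext E; exact: (cvgD (for_continuousM g1 h2) (for_continuousM g2 h1)).
Qed.

Lemma ccontinuous_conj (V : topologicalType) (g : V -> R[i]) (x : V) :
  ccontinuous g x -> ccontinuous (fun y => conjc (g y)) x.
Proof.
move=> [g1 g2]; split.
  have E y : complex.Re (conjc (g y)) = complex.Re (g y) by case: (g y).
  by have -> := funext E.
have E y : complex.Im (conjc (g y)) = - complex.Im (g y) by case: (g y).
by have -> := funext E; exact: (cvgN g2).
Qed.

Lemma ccontinuous_sum (V : topologicalType) (I : finType) (g : I -> V -> R[i]) (x : V) :
  (forall i, ccontinuous (g i) x) -> ccontinuous (fun y => \sum_i g i y) x.
Proof.
move=> cg; elim: (index_enum I) => [|i s IH].
  have -> : (fun y => \sum_(i <- [::]) g i y) = (fun=> 0) by apply/funext => y; rewrite big_nil.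
  exact: ccontinuous_cst.
have -> : (fun y => \sum_(i <- i :: s) g i y) = (fun y => g i y + \sum_(i <- s) g i y).
  by apply/funext => y; rewrite big_cons.
exact: ccontinuousD.
Qed.

Lemma normc_sqr (z : R[i]) : normc z ^+ 2 = complex.Re z ^+ 2 + complex.Im z ^+ 2.
Proof. by case: z => a b; rewrite /= sqr_sqrtr// addr_ge0// sqr_ge0. Qed.

Lemma normc_ge0 (z : R[i]) : 0 <= normc z.
Proof. by case: z => a b; exact: sqrtr_ge0. Qed.

Lemma normc_conj (z : R[i]) : normc (conjc z) = normc z.
Proof. by case: z => a b; rewrite /= sqrrN. Qed.

Lemma le_normc_sum (I : finType) (x : I -> R[i]) : normc (\sum_i x i) <= \sum_i normc (x i).
Proof.
elim/big_ind2: _ => [|y1 y2 z1 z2 h1 h2|//]; first by rewrite normc0.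
by apply: le_trans (le_normcD _ _) _; exact: lerD.
Qed.

(** Recovers the [d/dzbar_k] from the conjugate frame, with [A] the inverse of the coefficient
    matrix [B]. *)
Lemma conj_mulmx n (A B : 'M[R[i]]_n) (D : 'I_n -> R[i]) k : A *m B = 1%:M ->
  D k = \sum_j conjc (A k j) * \sum_l conjc (B j l) * D l.
Proof.
move=> AB; under eq_bigr do rewrite mulr_sumr; rewrite exchange_big /=.
transitivity (\sum_l conjc ((A *m B) k l) * D l).
  rewrite AB (bigD1 k)//= big1 => [|l lk]; first by rewrite mxE eqxx conjc1 mul1r addr0.
  by rewrite mxE eq_sym (negbTE lk) conjc0 mul0r.
apply: eq_bigr => l _; rewrite mxE rmorph_sum mulr_suml; apply: eq_bigr => j _.
by rewrite rmorphM mulrA.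
Qed.

Section frame.
Variables (n : nat) (L : 'rV[R]_(n + n) -> 'M[R[i]]_n) (u : 'rV[R]_(n + n) -> R[i]).
Local Notation F := (fun x => complex.Re (u x)).
Local Notation G := (fun x => complex.Im (u x)).

Lemma dzbarE k z : dzbar k u z =
  (((pd (lshift n k) F z - pd (rshift n k) G z) / 2) +i* ((pd (lshift n k) G z + pd (rshift n k) F z) / 2))%C.
Proof.
rewrite /dzbar /cpd; move: (pd _ _ _) (pd _ _ _) (pd _ _ _) (pd _ _ _) => a b c e.
have n2 : 2 != 0 :> R[i] by rewrite pnatr_eq0.
apply: (mulIf n2); rewrite divfK// [RHS]mulr_natr mulr2n.
by apply/eqP; rewrite eq_complex /=; apply/andP; split; apply/eqP; field.
Qed.

Lemma sum_normc_dzbar z : \sum_k normc (dzbar k u z) ^+ 2 = dbar_sqr F G z.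
Proof. by apply: eq_bigr => k _; rewrite dzbarE normc_sqr !expr_div_n -mulrDl mulrC exprVn. Qed.

(** One factor [n] comes from Cauchy-Schwarz in the sum over the frame, the other from summing over
    [k]. *)
Lemma dbar_sqr_frame (K : R) z : L z \in unitmx -> (forall j k, normc (invmx (L z) j k) <= K) ->
  dbar_sqr F G z <= n%:R ^+ 2 * K ^+ 2 * \sum_j normc (vfbar L j u z) ^+ 2.
Proof.
move=> uL LK; rewrite -sum_normc_dzbar.
have Dk k : normc (dzbar k u z) ^+ 2 <= n%:R * K ^+ 2 * \sum_j normc (vfbar L j u z) ^+ 2.
  rewrite (conj_mulmx (fun k => dzbar k u z) k (mulVmx uL)) -/(vfbar L).
  apply: (@le_trans _ _ ((\sum_j K * normc (vfbar L j u z)) ^+ 2)).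
    rewrite lerXn2r ?nnegrE ?normc_ge0//.
      by apply: sumr_ge0 => j _; apply: mulr_ge0 (normc_ge0 _); exact: le_trans (normc_ge0 _) (LK j j).
    apply: le_trans (le_normc_sum _) _; apply: ler_sum => j _.
    by rewrite normcM normc_conj; apply: ler_wpM2r => //; exact: normc_ge0.
  have -> : \sum_j K * normc (vfbar L j u z) = K * \sum_j normc (vfbar L j u z) by rewrite mulr_sumr.
  set s1 := \sum_j _; set s2 := \sum_j _.
  have -> : (K * s1) ^+ 2 = K ^+ 2 * s1 ^+ 2 by ring.
  have -> : n%:R * K ^+ 2 * s2 = K ^+ 2 * (n%:R * s2) by ring.
  apply: ler_wpM2l; first exact: sqr_ge0.
  by have := sum_sqr_le (fun j => normc (vfbar L j u z)); rewrite card_ord.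
apply: le_trans (ler_sum _ (fun k _ => Dk k)) _.
rewrite sumr_const card_ord -mulr_natl.
by rewrite le_eqVlt; apply/orP; left; apply/eqP; ring.
Qed.

End frame.

End generic.

(** * The estimates on the domain, with constants uniform in the domain *)

Section estimates.
Context (R : realType) (n : nat).
Local Notation T := (measurableTypeR R).
Local Notation N := (n + n)%N.
Local Notation X := 'rV[R]_N.
Local Notation Rt := 'rV[R]_N.-1.
Variables (Omega U W V : set X) (z0 : X) (r : X -> R) (a : X -> Rt) (L : X -> 'M[R[i]]_n).
Variables (K Lr e0 B : R) (f : R -> R).
Hypothesis n_gt0 : (0 < n)%N.
Hypothesis oU : open U.
Hypothesis Uz0 : U z0.
Hypothesis oW : open W.
Hypothesis e0_gt0 : 0 < e0.
Hypothesis Ue0 : forall z w, U z -> `|w - z| < e0 -> W w.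
Hypothesis B0 : 0 < B.
Hypothesis UB : forall z i, U z -> `|z 0 i| <= B.
Hypothesis Lr0 : 0 < Lr.
Hypothesis rLip : forall x y, `|r x - r y| <= Lr * `|x - y|.
Hypothesis f_smooth : smooth_pos f.
Hypothesis f0 : forall t : R, 0 < t -> 0 <= f t.
Hypothesis f_incr : increasing_pos f.
Hypothesis f_decr : decreasing_pos (fun t => f t / t).
Hypothesis oOmega : open Omega.
Hypothesis bz0 : boundary Omega z0.
Hypothesis oV : open V.
Hypothesis WV : W `<=` V.
Hypothesis dfn : defining_function Omega V r.
Hypothesis crd : coordinates V a r.
Hypothesis frm : frame V r L.
Hypothesis ctr : controlled W a r L K.

Let dN : N = N.-1.+1. Proof. by rewrite prednK// addn_gt0 n_gt0. Qed.
Let O := Omega `&` U.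
Let oO : open O. Proof. exact: openI. Qed.
Let UW : U `<=` W. Proof. by move=> z Uz; apply: (Ue0 Uz); rewrite subrr normr0. Qed.
Let UV : U `<=` V. Proof. exact: subset_trans UW WV. Qed.
Let OmegaV : Omega `&` V = [set z | r z < 0] `&` V. Proof. by case: dfn. Qed.
Let aC1V k : C1_on V (fun z => a z 0 k). Proof. by case: crd => /(_ k)[]. Qed.
Let rC1V : C1_on V r. Proof. by case: crd => _ []. Qed.
Let C1_sub (Y : set X) g : Y `<=` V -> C1_on V g -> C1_on Y g.
Proof. by move=> YV gC z /YV; exact: gC. Qed.
Let aC1U k := C1_sub UV (@aC1V k).
Let rC1U := C1_sub UV rC1V.
Let aC1W k := C1_sub WV (@aC1V k).
Let rC1W := C1_sub WV rC1V.
Let rneg z : U z -> r z < 0 -> Omega z. Proof. by move=> /UV Vz; exact: (in_domain OmegaV Vz).2. Qed.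
Let negr z : U z -> Omega z -> r z < 0. Proof. by move=> /UV Vz; exact: (in_domain OmegaV Vz).1. Qed.
Let injU x y : U x -> U y -> (a x, r x) = (a y, r y) -> x = y.
Proof. by move=> Ux Uy E; have [_ _ inj _] := crd; apply: inj => //; rewrite inE; exact: UV. Qed.

Let K' := (`|K| + 1) * N%:R.
Let K'0 : 0 < K'. Proof. by rewrite /K' mulr_gt0// ?ltr_wpDl// ltr0n dN. Qed.
Let HKW z : W z -> forall v, `|v| <= K' * `|DPhi a r z v|.
Proof. by move=> Wz v; apply: (enorm_le_frame dN oW aC1W rC1W Wz); have [_ _ /(_ v)] := ctr Wz. Qed.
Let HKU z : U z -> forall v, `|v| <= K' * `|DPhi a r z v|. Proof. by move=> /UW; exact: HKW. Qed.

(** One bound for all components of the chart: [K] controls the derivatives of [a], and the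
    Lipschitz constant of [r] controls those of [r]. *)
Let K1 := `|K| + Lr.
Let K10 : 0 < K1. Proof. by rewrite ltr_wpDl. Qed.
Let aK1 z k i : U z -> `|pd i (fun z => a z 0 k) z| <= K1.
Proof.
move=> /UW Wz; have [H _ _ _] := ctr Wz; apply: le_trans (H k i) _.
by apply: le_trans (ler_norm K) _; rewrite lerDl ltW.
Qed.
Let rK1 z i : U z -> `|pd i r z| <= K1.
Proof.
move=> Uz; have [dr _] := rC1U Uz i.
apply: le_trans (lipschitz_derive_le rLip dr) _.
apply: (@le_trans _ _ Lr); last by rewrite lerDr.
rewrite ler_piMr//; first exact: ltW.
apply: norm_le_coord => // j; rewrite mxE eqxx /=; by case: (j == i); rewrite ?normr1 ?normr0.
Qed.

Let D := 2 * B.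
Let D0 : 0 < D. Proof. exact: mulr_gt0. Qed.
Let UD z : U z -> `|z - z0| <= D.
Proof.
move=> Uz; apply: norm_le_coord; first exact: ltW.
move=> i; rewrite !mxE; apply: le_trans (ler_normB _ _) _.
by have := UB i Uz; have := UB i Uz0; rewrite /D; lra.
Qed.

(** The depth is at most [Lr D] on [U]; the [+ 1] makes the inequality strict, so the function
    vanishes from [r = - S] on downwards. *)
Let S := Lr * D + 1.
Let S0 : 0 < S. Proof. by rewrite /S addr_gt0// mulr_gt0. Qed.
Let rS z : U z -> - r z < S.
Proof.
move=> Uz; have h := depth_bound oOmega bz0 Uz0 oV WV OmegaV rLip e0_gt0 Ue0 UD Lr0 Uz.
by apply: le_lt_trans h _; rewrite ltrDl.
Qed.

Let df (t : R) : 0 < t -> derivable f t 1. Proof. exact: (smooth_pos_C1 f_smooth).1. Qed.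
Let cdf (t : R) : 0 < t -> {for t, continuous ('D_1 f)}. Proof. exact: (smooth_pos_C1 f_smooth).2. Qed.
Let cf (t : R) : 0 < t -> {for t, continuous f}. Proof. by move=> t0; apply: derivable_cvg; exact: df. Qed.

Section one.
Variable u : X -> R[i].
Hypothesis tu : test_function Omega U u.
Let F x := complex.Re (u x).
Let G x := complex.Im (u x).
Let uh := in_coordinates U a r u.
Let J (g : X -> R) := (\int[leb R N]_t (\1_O (rvec t) * g (rvec t))%:E)%E.

Let uhE z : U z -> uh (a z, r z) = u z.
Proof.
move=> Uz; rewrite /uh /in_coordinates /patch mem_set; last by exists z.
rewrite /=; congr u; have := @pinvKV _ _ (fun=> 0) U (chart a r).
apply; last by rewrite inE.
by move=> x y; rewrite !inE => Ux Uy; exact: injU.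
Qed.

Let uh0 y : (forall z, U z -> (a z, r z) <> y) -> uh y = 0.
Proof.
move=> ny; rewrite /uh /in_coordinates /patch memNset// => -[z Uz E]; exact: ny E.
Qed.

(** The constant of [slab_fLambda] in dimension [N.-1] times that of [bridge_energy]; [C] stands for
    Bessel's constant. *)
Definition chart_const (C : R) : R :=
  16 * ((2 * pi) ^- N.-1) ^+ 2 * C * (8 * (1 + S ^+ 2) * C) * ((3 * (N%:R * K1)) ^+ N * (N%:R ^+ 2 * K' ^+ 2)).

Let ReC : C1_closure Omega U F. Proof. by case: tu. Qed.
Let ImC : C1_closure Omega U G. Proof. by case: tu. Qed.

(** The real and imaginary parts are carried to the slab separately, with a common bound. The
    weighted integrals are finite, which lets [slab_fLambda] construct [w]. *)
Lemma chart_fLambda (C : R) : 0 <= C ->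
  (forall b (g : N.-1.-tuple T -> R), bbs g ->
     (\int[leb R N.-1]_y (tr b g y ^+ 2)%:E <= C%:E * \int[leb R N.-1]_x (g x ^+ 2)%:E)%E) ->
  exists2 w, is_fLambda f uh w &
   (\int[leb R N.-1 \x (@lebesgue_measure R)]_q ((\1_[set x : R | x < 0] q.2 * normc (w (rvec q.1, q.2))) ^+ 2)%:E <=
   (chart_const C)%:E * J (fun x => (wgt f (r x) * grad_sqr F G x)%R))%E.
Proof.
move=> C0 HC; have [_ _ [A [cA AU] uA]] := tu.
have FA z : ~ A z -> F z = 0 by move=> /uA; rewrite /F => ->.
have GA z : ~ A z -> G z = 0 by move=> /uA; rewrite /G => ->.
have [l l0 Hl] := chart_support oU cA AU aC1U.
pose P y := complex.Re (uh y); pose Q y := complex.Im (uh y).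
have PF z : U z -> P (a z, r z) = F z by move=> Uz; rewrite /P uhE.
have QG z : U z -> Q (a z, r z) = G z by move=> Uz; rewrite /Q uhE.
have P0 y : (forall z, U z -> (a z, r z) <> y) -> P y = 0 by move=> /uh0; rewrite /P => ->.
have Q0 y : (forall z, U z -> (a z, r z) <> y) -> Q y = 0 by move=> /uh0; rewrite /Q => ->.
have [M1 M10 H1] := bridge_slab_C1 dN oOmega oU cA AU aC1U rC1U rneg injU K'0 HKU rS ReC.1 ReC.2 FA PF P0 Hl.
have [M2 M20 H2] := bridge_slab_C1 dN oOmega oU cA AU aC1U rC1U rneg injU K'0 HKU rS ImC.1 ImC.2 GA QG Q0 Hl.
have {}H1 : slab_C1 (Num.max M1 M2) l S P by apply: H1; rewrite le_max lexx.
have {}H2 : slab_C1 (Num.max M1 M2) l S Q by apply: H2; rewrite le_max lexx orbT.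
have E1 := bridge_energy dN oOmega oU cA AU aC1U rC1U rneg negr injU K'0 HKU K10 aK1 rK1 ReC.2 FA PF P0 cf H1.
have E2 := bridge_energy dN oOmega oU cA AU aC1U rC1U rneg negr injU K'0 HKU K10 aK1 rK1 ImC.2 GA QG Q0 cf H2.
have F1 := weighted_grad_finite oOmega oU cA AU rC1U negr rS S0 ReC.1 ReC.2 FA f0 f_decr cf B0 UB.
have F2 := weighted_grad_finite oOmega oU cA AU rC1U negr rS S0 ImC.1 ImC.2 GA f0 f_decr cf B0 UB.
have m1 := measurable_weighted_grad oOmega oU rC1U negr ReC.2 cf.
have m2 := measurable_weighted_grad oOmega oU rC1U negr ImC.2 cf.
set I1 := (\int[leb R N]_t _)%E in E1 F1; set I2 := (\int[leb R N]_t _)%E in E2 F2.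
set k := (3 * _) ^+ N * _ in E1 E2.
have k0 : 0 <= k.
  apply: mulr_ge0; first by apply: exprn_ge0; rewrite !mulr_ge0// ltW.
  by apply: mulr_ge0; exact: sqr_ge0.
have pos (H : X -> R) t : (0 <= (\1_O (rvec t) * (wgt f (r (rvec t)) * \sum_i pd i H (rvec t) ^+ 2))%:E)%E.
  rewrite lee_fin indicE; apply: mulr_ge0 => //; apply: mulr_ge0; first exact: wgt_ge0.
  by apply: sumr_ge0 => i _; exact: sqr_ge0.
have I10 : (0 <= I1)%E by apply: integral_ge0 => t _; exact: pos.
have I20 : (0 <= I2)%E by apply: integral_ge0 => t _; exact: pos.
have fin I : (0 <= I)%E -> (I < +oo)%E -> (k%:E * I < +oo)%E.
  by move=> I0 Ioo; rewrite lte_mul_pinfty.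
have [w [Lw wle]] := slab_fLambda f0 f_incr f_decr cf l0 S0 C0 H1 H2 HC
  (le_lt_trans E1 (fin _ I10 F1)) (le_lt_trans E2 (fin _ I20 F2)).
exists w => //; apply: le_trans wle _.
have -> : J (fun x => (wgt f (r x) * grad_sqr F G x)%R) = (I1 + I2)%E.
  rewrite -ge0_integralD//; try exact/measurable_EFinP; try (by move=> t _; exact: pos).
  apply: eq_integral => t _; rewrite -EFinD; congr EFin.
  by rewrite /grad_sqr big_split /= !mulrDr.
set c := 16 * _ * _ * _; have -> : (chart_const C)%:E = (c%:E * k%:E)%E by rewrite -EFinM.
rewrite -muleA; apply: lee_wpmul2l.
  rewrite lee_fin; apply: mulr_ge0; last by rewrite !mulr_ge0// addr_ge0// sqr_ge0.
  by rewrite mulr_ge0// mulr_ge0// sqr_ge0.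
clearbody I1 I2 k; rewrite (ge0_muleDr k%:E I10 I20); exact: leeD E1 E2.
Qed.

Lemma grad_norm_sqr z : grad_norm u z ^+ 2 = grad_sqr F G z.
Proof.
rewrite /grad_norm sqr_sqrtr; last by apply: sumr_ge0 => i _; exact: sqr_ge0.
by apply: eq_bigr => i _; rewrite normc_sqr.
Qed.

Let FC : C1_on O F. Proof. exact: (closure_C1_on oOmega oU ReC.2). Qed.
Let GC : C1_on O G. Proof. exact: (closure_C1_on oOmega oU ImC.2). Qed.

Let delta_gt0 z : O z -> 0 < delta Omega z.
Proof.
move=> [Omz Uz]; have := depth_le_delta oOmega bz0 Uz0 oV WV OmegaV rLip e0_gt0 Ue0 D0 UD Lr0 Uz.
have rz := negr Uz Omz; have c0 : 0 < Lr + Lr * D / e0 by rewrite addr_gt0// divr_gt0// mulr_gt0.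
by move=> h; rewrite -(pmulr_rgt0 _ c0); apply: lt_le_trans h; rewrite oppr_gt0.
Qed.

Let gradC x : O x -> {for x, continuous (fun x => wgt f (r x) * grad_sqr F G x)}.
Proof. exact: (weighted_gradient_continuous oU rC1U negr df FC GC). Qed.

(** The square of the constant of [depth_le_delta] increased by 1, so that it is at least 1 as the
    proof of [gradient_le_delta] requires. *)
Definition gradient_const : R := (Lr + Lr * D / e0 + 1) ^+ 2.

(** From [s <= c delta] the decrease of [f t / t] gives [s f(1/s) <= c delta f(1/(c delta))], and
    [f(1/(c delta)) <= f(1/delta)] because [c >= 1] and [f] increases. *)
Lemma gradient_le_delta : (J (fun x => (wgt f (r x) * grad_sqr F G x)%R) <=
  gradient_const%:E *
  (L2norm Omega (fun z => (delta Omega z * f (delta Omega z)^-1 * grad_norm u z)%R) *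
   L2norm Omega (fun z => (delta Omega z * f (delta Omega z)^-1 * grad_norm u z)%R)))%E.
Proof.
rewrite -sqr_Lnorm2; set c := Lr + Lr * D / e0 + 1.
have c1 : 0 < Lr + Lr * D / e0 by rewrite addr_gt0// divr_gt0// mulr_gt0.
have c0 : 0 < c by rewrite /c addr_gt0.
apply: ge0_le_integral_scale.
- exact: (measurable_indic_open oO gradC).
- move=> t; rewrite indicE; apply: mulr_ge0 => //; apply: mulr_ge0; first exact: wgt_ge0.
  by apply: sumr_ge0 => i _; apply: addr_ge0; exact: sqr_ge0.
- exact: exprn_gt0.
move=> t; rewrite [leLHS]mulrC indicE; have [Ot|nO] := pselect (O (rvec t)); last first.
  by rewrite memNset// mulr0; apply: mulr_ge0; exact: sqr_ge0.
have [Omt Ut] := Ot; rewrite mem_set// mulr1 indicE mem_set// mul1r.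
rewrite [X in _ <= _ * X]exprMn grad_norm_sqr mulrA -exprMn.
apply: ler_wpM2r; first by apply: sumr_ge0 => i _; apply: addr_ge0; exact: sqr_ge0.
have dl := delta_gt0 Ot; have s0 : 0 < - r (rvec t) by rewrite oppr_gt0; exact: negr.
have fd : 0 <= f (delta Omega (rvec t))^-1 by apply: f0; rewrite invr_gt0.
rewrite /wgt lerXn2r ?nnegrE//.
- by apply: mulr_ge0; [exact: ltW|apply: f0; rewrite invr_gt0].
- by apply: mulr_ge0; [exact: ltW|apply: mulr_ge0 => //; exact: ltW].
have sd : - r (rvec t) <= c * delta Omega (rvec t).
  apply: le_trans (depth_le_delta oOmega bz0 Uz0 oV WV OmegaV rLip e0_gt0 Ue0 D0 UD Lr0 Ut) _.
  by apply: ler_wpM2r; [exact: ltW|rewrite lerDl].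
have cd : 0 < c * delta Omega (rvec t) by exact: mulr_gt0.
have h1 : f (- r (rvec t))^-1 / (- r (rvec t))^-1 <= f (c * delta Omega (rvec t))^-1 / (c * delta Omega (rvec t))^-1.
  by apply: f_decr; rewrite ?invr_gt0// lef_pV2 ?posrE.
rewrite !invrK in h1; rewrite mulrC; apply: le_trans h1 _.
rewrite -/c [leRHS]mulrA [leRHS]mulrC; apply: ler_wpM2r; first exact: ltW.
apply: f_incr; first by rewrite invr_gt0.
rewrite lef_pV2 ?posrE//; apply: ler_peMl; first exact: ltW.
by rewrite lerDr ltW.
Qed.

(** The constant of [delta_le_depth], again increased by 1 to be at least 1. *)
Definition depth_const : R := N%:R * (4 * K') * (1 + D / (e0 / 2)) + 1.
Definition error_const : R := N%:R * K1 ^+ 2 * depth_const ^+ 2.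

Let depth_const0 : 0 < depth_const.
Proof.
by apply: ltr_wpDl => //; rewrite !mulr_ge0 ?addr_ge0 ?divr_ge0 ?divr_ge0// ltW.
Qed.

(** Put [q = depth_const]. Then [f(1/s) <= q f(1/(q s))] by [f_scale], and [delta <= q s] gives
    [f(1/(q s)) <= f(1/delta)]. *)
Lemma error_le_delta : (J (fun x => (N%:R * K1 ^+ 2 * (f (- r x)^-1 ^+ 2 * (F x ^+ 2 + G x ^+ 2)))%R) <=
  error_const%:E * (L2norm Omega (fun z => (f (delta Omega z)^-1 * normc (u z))%R) *
   L2norm Omega (fun z => (f (delta Omega z)^-1 * normc (u z))%R)))%E.
Proof.
rewrite -sqr_Lnorm2; have N0 : 0 < N%:R :> R by rewrite ltr0n dN.
apply: ge0_le_integral_scale.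
- exact: (measurable_indic_open oO (@cutoff_error_continuous _ _ _ _ _ K1 _ oOmega oU rC1U negr df _ _ FC GC)).
- move=> t; rewrite indicE; apply: mulr_ge0 => //; apply: mulr_ge0; first by apply: mulr_ge0 => //; exact: sqr_ge0.
  by apply: mulr_ge0; [exact: sqr_ge0|apply: addr_ge0; exact: sqr_ge0].
- by rewrite /error_const !mulr_gt0// exprn_gt0.
move=> t; rewrite [leLHS]mulrC indicE; have [Ot|nO] := pselect (O (rvec t)); last first.
  rewrite memNset// mulr0; apply: mulr_ge0; last exact: sqr_ge0.
  by apply: mulr_ge0; [apply: mulr_ge0 => //; exact: sqr_ge0|exact: sqr_ge0].
have [Omt Ut] := Ot; rewrite mem_set// mulr1 indicE mem_set// mul1r.
rewrite [X in _ <= _ * X]exprMn normc_sqr -/(F _) -/(G _) /error_const.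
rewrite -[leRHS]mulrA; apply: ler_wpM2l; first by apply: mulr_ge0; [exact: ltW|exact: sqr_ge0].
rewrite mulrA -exprMn; apply: ler_wpM2r; first by apply: addr_ge0; exact: sqr_ge0.
have dl := delta_gt0 Ot; have s0 : 0 < - r (rvec t) by rewrite oppr_gt0; exact: negr.
have cs : 0 < depth_const * - r (rvec t) by exact: mulr_gt0.
rewrite lerXn2r ?nnegrE//.
- by apply: f0; rewrite invr_gt0.
- by apply: mulr_ge0; [exact: ltW|apply: f0; rewrite invr_gt0].
have sd : delta Omega (rvec t) <= depth_const * - r (rvec t).
  apply: le_trans (delta_le_depth dN bz0 oW oV WV OmegaV rLip e0_gt0 Ue0 D0 UD Lr0 K'0 rC1W HKW Ut Omt) _.
  by apply: ler_wpM2r; [exact: ltW|rewrite /depth_const lerDl].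
have h := @f_scale R f f_decr (depth_const * - r (rvec t))^-1 (- r (rvec t))^-1.
apply: (le_trans (h _ _)); first by rewrite invr_gt0.
  rewrite lef_pV2 ?posrE//; apply: ler_peMl; first exact: ltW.
  rewrite lerDr.
  by rewrite !mulr_ge0 ?addr_ge0 ?divr_ge0 ?divr_ge0// ltW.
have alg (s q y : R) : s != 0 -> s^-1 / (q * s)^-1 * y = q * y by move=> sn; rewrite invrK; field.
rewrite alg ?gt_eqF//.
apply: ler_wpM2l; first exact: ltW.
by apply: f_incr; rewrite ?invr_gt0// lef_pV2 ?posrE.
Qed.

Definition dbar_const : R := (S * f S^-1) ^+ 2 * (n%:R ^+ 2 * K ^+ 2).

Let vfbar_measurable j : measurable_fun setT
  (fun t : N.-tuple T => \1_O (rvec t) * normc (vfbar L j u (rvec t)) ^+ 2 : T).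
Proof.
have cvf x : O x -> ccontinuous (vfbar L j u) x.
  move=> Ox; have [Omx Ux] := Ox; have cc i : ccontinuous (cpd i u) x.
    by split; [exact: (FC Ox i).2|exact: (GC Ox i).2].
  apply: ccontinuous_sum => k; apply: ccontinuousM.
    by apply: ccontinuous_conj; have [H _ _] := frm; exact: H (UV Ux).
  apply: ccontinuousM; last exact: ccontinuous_cst.
  apply: ccontinuousD; first exact: cc.
  by apply: ccontinuousM; [exact: ccontinuous_cst|exact: cc].
apply: (measurable_indic_open (G := fun x => normc (vfbar L j u x) ^+ 2) oO) => x /cvf[c1 c2].
rewrite (_ : (fun x => _) = fun x => complex.Re (vfbar L j u x) * complex.Re (vfbar L j u x) +
    complex.Im (vfbar L j u x) * complex.Im (vfbar L j u x)); last first.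
  by apply/funext => y; rewrite normc_sqr !expr2.
exact: (cvgD (for_continuousM c1 c1) (for_continuousM c2 c2)).
Qed.

(** On [U] the weight is at most [(S f(1/S))^2], because [s f(1/s)] increases with [s] and [s < S];
    [dbar_sqr_frame] does the rest. *)
Lemma dbar_le_frame : (J (fun x => (wgt f (r x) * dbar_sqr F G x)%R) <=
  dbar_const%:E * \sum_(j < n) (L2norm Omega (fun z => normc (vfbar L j u z)) *
     L2norm Omega (fun z => normc (vfbar L j u z))))%E.
Proof.
have c0 : 0 <= dbar_const.
  by apply: mulr_ge0; [exact: sqr_ge0|apply: mulr_ge0; exact: sqr_ge0].
have db0 z : 0 <= dbar_sqr F G z.
  by apply: sumr_ge0 => k _; apply: mulr_ge0 (sqr_ge0 _) _; apply: addr_ge0; exact: sqr_ge0.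
pose h j (t : N.-tuple T) := \1_O (rvec t) * normc (vfbar L j u (rvec t)) ^+ 2.
have h0 j t : 0 <= h j t by rewrite /h indicE; apply: mulr_ge0 => //; exact: sqr_ge0.
apply: (@le_trans _ _ (\int[leb R N]_t (dbar_const%:E * \sum_(j < n) (h j t)%:E))%E).
  apply: ge0_le_integral_nonmeasurable => t.
    by rewrite lee_fin indicE; apply: mulr_ge0 => //; apply: mulr_ge0 => //; exact: wgt_ge0.
  rewrite sumEFin -EFinM lee_fin /h -mulr_sumr mulrCA indicE.
  have [Ot|nO] := pselect (O (rvec t)); last by rewrite memNset// !(mul0r, mulr0).
  have [Omt Ut] := Ot; rewrite mem_set// !mul1r /dbar_const -[leRHS]mulrA.
  have Wt := UW Ut; have Vt := WV Wt; have [_ _ _ LK] := ctr Wt; have [_ uL _] := frm.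
  apply: ler_pM; [exact: wgt_ge0|exact: db0| |]; last first.
    by apply: dbar_sqr_frame (uL _ Vt) _ => i j; exact: (LK i j).2.
  have s0 : 0 < - r (rvec t) by rewrite oppr_gt0; exact: negr.
  have e : f (- r (rvec t))^-1 / (- r (rvec t))^-1 <= f S^-1 / S^-1.
    by apply: f_decr; rewrite ?invr_gt0// lef_pV2 ?posrE// ltW// rS.
  rewrite /wgt lerXn2r ?nnegrE//; try (by apply: mulr_ge0; [exact: ltW|apply: f0; rewrite invr_gt0]).
  by rewrite !invrK in e; rewrite mulrC [leRHS]mulrC.
rewrite ge0_integralZl_EFin//; last 2 first.
- by move=> t _; apply: sume_ge0 => j _; rewrite lee_fin.
- by apply: emeasurable_sum => j; apply/measurable_EFinP; exact: vfbar_measurable.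
apply: lee_wpmul2l => //; rewrite ge0_integral_sum//; last 2 first.
- by move=> j; apply/measurable_EFinP; exact: vfbar_measurable.
- by move=> j t _; rewrite lee_fin.
apply: lee_sum => j _; rewrite -sqr_Lnorm2; apply: ge0_le_integral_nonmeasurable => t; rewrite lee_fin//.
rewrite /h exprMn !indicE; apply: ler_wpM2r; first exact: sqr_ge0.
have [Ot|nO] := pselect (O (rvec t)); last by rewrite memNset// sqr_ge0.
by have [Omt _] := Ot; rewrite !mem_set// expr1n.
Qed.

Lemma gradient_le_dbar : (J (fun x => (wgt f (r x) * grad_sqr F G x)%R) <= 384%:E *
  (J (fun x => (wgt f (r x) * dbar_sqr F G x)%R) +
   J (fun x => (N%:R * K1 ^+ 2 * (f (- r x)^-1 ^+ 2 * (F x ^+ 2 + G x ^+ 2)))%R)))%E.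
Proof.
have [_ _ [A [cA AU] uA]] := tu.
have FA z : ~ A z -> F z = 0 by move=> /uA; rewrite /F => ->.
have GA z : ~ A z -> G z = 0 by move=> /uA; rewrite /G => ->.
exact: (cutoff_gradient_estimate oOmega oU cA AU rC1U rneg negr K10 rK1 B0 UB f0 f_incr f_decr df cdf FC GC FA GA).
Qed.

Lemma chart_const_ge0 (C : R) : 0 <= C -> 0 <= chart_const C.
Proof.
move=> C0; have S2 : 0 <= 1 + S ^+ 2 by apply: addr_ge0 => //; exact: sqr_ge0.
have K1' := ltW K10; have p2 := sqr_ge0 ((2 * pi : R) ^- N.-1).
rewrite /chart_const; apply: mulr_ge0.
  by apply: mulr_ge0; [apply: mulr_ge0 => //; exact: mulr_ge0|apply: mulr_ge0 => //; exact: mulr_ge0].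
apply: mulr_ge0; last by apply: mulr_ge0; exact: sqr_ge0.
by apply: exprn_ge0; apply: mulr_ge0 => //; exact: mulr_ge0.
Qed.

Let L2_ge0 (g : X -> R) : (0 <= L2norm Omega g)%E. Proof. exact: Lnorm_ge0. Qed.

Section bessel_constant.
Variable C : R.
Hypothesis C0 : 0 <= C.
Hypothesis HC : forall b (g : N.-1.-tuple T -> R), bbs g ->
  (\int[leb R N.-1]_y (tr b g y ^+ 2)%:E <= C%:E * \int[leb R N.-1]_x (g x ^+ 2)%:E)%E.

(** From squares to norms: [k <= (k + 1)^2] gives the constant [k + 1] without a square root. *)
Let conclude (c : R) (Q : \bar R) : 0 <= c -> (0 <= Q)%E ->
  (J (fun x => (wgt f (r x) * grad_sqr F G x)%R) <= c%:E * (Q * Q))%E ->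
  exists2 w, is_fLambda f uh w & (L2norm_half w <= (chart_const C * c + 1)%:E * Q)%E.
Proof.
move=> c0 Q0 JQ; have [w Lw wle] := chart_fLambda C0 HC; exists w => //.
have k0 := chart_const_ge0 C0; have kc : 0 <= chart_const C * c by exact: mulr_ge0.
apply: Lnorm2_le => //; first by rewrite addr_ge0.
apply: le_trans wle _; apply: le_trans (lee_wpmul2l _ JQ) _ => //.
rewrite muleA -EFinM; apply: lee_wpmul2r; first exact: mule_ge0.
by rewrite lee_fin; nra.
Qed.

Lemma weighted_gradient_estimate : exists2 w, is_fLambda f uh w &
  (L2norm_half w <= (chart_const C * gradient_const + 1)%:E *
    (L2norm Omega (fun z => (delta Omega z * f (delta Omega z)^-1 * grad_norm u z)%R) +
     \sum_(j < n) L2norm Omega (fun z => normc (vfbar L j u z))))%E.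
Proof.
set Q1 := L2norm _ _; set Q2 := (\sum_j _)%E.
have Q10 : (0 <= Q1)%E by exact: L2_ge0.
have Q20 : (0 <= Q2)%E by apply: sume_ge0 => j _; exact: L2_ge0.
apply: conclude; [exact: sqr_ge0|exact: adde_ge0|].
apply: le_trans gradient_le_delta _; apply: lee_wpmul2l; first by rewrite lee_fin sqr_ge0.
by apply: lee_pmul => //; exact: leeDl.
Qed.

Lemma weighted_dbar_estimate : exists2 w, is_fLambda f uh w &
  (L2norm_half w <= (chart_const C * (384 * (dbar_const + error_const)) + 1)%:E *
    (L2norm Omega (fun z => (f (delta Omega z)^-1 * normc (u z))%R) +
     \sum_(j < n) L2norm Omega (fun z => normc (vfbar L j u z))))%E.
Proof.
set Q1 := L2norm _ _; set Q2 := (\sum_j _)%E.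
have Y0 j : (0 <= L2norm Omega (fun z => normc (vfbar L j u z)))%E by exact: L2_ge0.
have Q10 : (0 <= Q1)%E by exact: L2_ge0.
have Q20 : (0 <= Q2)%E by apply: sume_ge0 => j _; exact: Y0.
have Q0 : (0 <= Q1 + Q2)%E by exact: adde_ge0.
have db0 : 0 <= dbar_const by apply: mulr_ge0; [exact: sqr_ge0|apply: mulr_ge0; exact: sqr_ge0].
have er0 : 0 <= error_const by apply: mulr_ge0; [apply: mulr_ge0 => //; exact: sqr_ge0|exact: sqr_ge0].
have k0 : 0 <= 384 * (dbar_const + error_const) by apply: mulr_ge0; [exact: ler0n|exact: addr_ge0].
apply: (conclude k0 Q0).
apply: le_trans gradient_le_dbar _; rewrite [(384 * _)%:E]EFinM -muleA; apply: lee_wpmul2l; first by rewrite lee_fin ler0n.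
rewrite EFinD ge0_muleDl ?lee_fin//; apply: leeD.
  apply: le_trans dbar_le_frame _; apply: lee_wpmul2l => //.
  (* A sum of squares of nonnegative terms is at most the square of their sum. *)
  apply: (@le_trans _ _ (Q2 * Q2)%E); last by apply: lee_pmul => //; exact: leeDr.
  rewrite ge0_sume_distrl//; apply: lee_sum => j _; apply: lee_wpmul2l => //.
  rewrite /Q2 (bigD1 j)//= leeDl//; apply: sume_ge0 => i _; exact: Y0.
apply: le_trans error_le_delta _; apply: lee_wpmul2l => //.
by apply: lee_pmul => //; exact: leeDl.
Qed.

End bessel_constant.
End one.
End estimates.

(** For [s <= t] the ratio [t / s] is at least 1, so its power [eta] is at most [t / s] itself. *)
Lemma decreasing_quotient (R : realType) (f : R -> R) (eta : R) : (forall t : R, 0 < t -> 0 <= f t) ->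
  eta <= 1 -> decreasing_pos (fun t => f t / t `^ eta) -> decreasing_pos (fun t => f t / t).
Proof.
move=> f0 eta1 fd s t s0 st; have t0 := lt_le_trans s0 st.
have ts : 1 <= t / s by rewrite ler_pdivlMr// mul1r.
have se0 : 0 < s `^ eta by exact: powR_gt0.
have := fd _ _ s0 st; rewrite ler_pdivrMr ?powR_gt0// => h.
rewrite ler_pdivrMr//; apply: (le_trans h).
have -> : t `^ eta = (t / s) `^ eta * s `^ eta.
  by rewrite -powRM ?divfK ?gt_eqF//; apply: ltW => //; exact: divr_gt0.
rewrite mulrA mulrAC divfK ?gt_eqF// -mulrA; apply: ler_wpM2l; first exact: f0.
apply: (@le_trans _ _ ((t / s) `^ 1)); first exact: ler_powR.
rewrite powRr1; first by rewrite mulrC.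
by apply: divr_ge0; exact: ltW.
Qed.

Theorem theorem4p1 (R : realType) (n : nat) (eps : R) (f : R -> R)
    (z0 : 'rV[R]_(n + n)) (U W : set 'rV[R]_(n + n)) (K M : R)
    (n_gt0 : (0 < n)%N) (eps_gt0 : 0 < eps)
    (f_smooth : smooth_pos f) (f_ge0 : forall t : R, 0 < t -> 0 <= f t)
    (f_incr : increasing_pos f)
    (oU : open U) (Uz0 : U z0) (oW : open W)
    (UW : closure U `<=` W) (cW : compact (closure W)) :
  (decreasing_pos (fun t => f t / t) ->
    exists2 c : R, 0 < c &
    forall (Omega V : set 'rV[R]_(n + n)) (r : 'rV[R]_(n + n) -> R)
      (a : 'rV[R]_(n + n) -> 'rV[R]_(n + n).-1)
      (L : 'rV[R]_(n + n) -> 'M[R[i]]_n),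
    open Omega -> connected Omega -> boundary Omega z0 ->
    open V -> closure W `<=` V ->
    defining_function Omega V r -> sobolev (2 + n%:R + eps) r M ->
    coordinates V a r -> frame V r L -> controlled W a r L K ->
    forall u : 'rV[R]_(n + n) -> R[i], test_function Omega U u ->
    exists2 w, is_fLambda f (in_coordinates U a r u) w &
      (L2norm_half w <=
        c%:E * (L2norm Omega (fun z =>
                  (delta Omega z * f (delta Omega z)^-1 * grad_norm u z)%R) +
                \sum_(j < n) L2norm Omega (fun z => normc (vfbar L j u z))))%E) /\
  (forall eta : R, eta < 2^-1 -> decreasing_pos (fun t => f t / t `^ eta) ->
    exists2 c : R, 0 < c &
    forall (Omega V : set 'rV[R]_(n + n)) (r : 'rV[R]_(n + n) -> R)
      (a : 'rV[R]_(n + n) -> 'rV[R]_(n + n).-1)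
      (L : 'rV[R]_(n + n) -> 'M[R[i]]_n),
    open Omega -> connected Omega -> boundary Omega z0 ->
    open V -> closure W `<=` V ->
    defining_function Omega V r -> sobolev (2 + n%:R + eps) r M ->
    coordinates V a r -> frame V r L -> controlled W a r L K ->
    forall u : 'rV[R]_(n + n) -> R[i], test_function Omega U u ->
    exists2 w, is_fLambda f (in_coordinates U a r u) w &
      (L2norm_half w <=
        c%:E * (L2norm Omega (fun z =>
                  (f (delta Omega z)^-1 * normc (u z))%R) +
                \sum_(j < n) L2norm Omega (fun z => normc (vfbar L j u z))))%E).

Proof.
have cU : compact (closure U).
  apply: (subclosed_compact _ cW); first exact: closed_closure.
  exact: subset_trans UW (@subset_closure _ W).
(* [e0], [B], [Lr] and [C] are obtained from [U], [W], [M], [eps] and [n] before any domain is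
   introduced; this makes the constants uniform. *)
have [e0 e0_gt0 He0] := compact_margin cU oW UW.
have Ue0 z w : U z -> `|w - z| < e0 -> W w by move=> Uz; apply: He0; exact: subset_closure.
have [B B0 UB] : exists2 B : R, 0 < B & forall z i, U z -> `|z 0 i| <= B.
  have [M0 [_ HM]] := compact_bounded cU.
  exists (`|M0| + 1); first by rewrite ltr_wpDl.
  move=> z i Uz; apply: le_trans (coord_le_norm z i) _.
  apply: (HM (`|M0| + 1)); last exact: subset_closure.
  by apply: le_lt_trans (ler_norm _) _; rewrite ltrDl.
have [Lr Lr0 HLr] := sobolev_lipschitz n M eps_gt0.
have [C C0 HC] := bessel R (n + n).-1.
split=> [f_decr|eta eta_half f_eta].
  exists (chart_const n K Lr B C * gradient_const Lr e0 B + 1).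
    by apply: (ltr_wpDl _ ltr01); apply: mulr_ge0; [exact: chart_const_ge0|exact: sqr_ge0].
  move=> Omega V r a L oOmega _ bz0 oV WV dfn rM crd frm ctr u tu.
  have WV' : W `<=` V := subset_trans (@subset_closure _ W) WV.
  exact: (weighted_gradient_estimate n_gt0 oU Uz0 oW e0_gt0 Ue0 B0 UB Lr0 (HLr r rM) f_smooth f_ge0 f_incr
    f_decr oOmega bz0 oV WV' dfn crd ctr tu C0 HC).
have eta1 : eta <= 1 by lra.
have f_decr := decreasing_quotient f_ge0 eta1 f_eta.
exists (chart_const n K Lr B C * (384 * (dbar_const n K Lr B f + error_const n K Lr e0 B)) + 1).
  apply: (ltr_wpDl _ ltr01); apply: mulr_ge0; first exact: chart_const_ge0.
  apply: mulr_ge0; [exact: ler0n|apply: addr_ge0].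
    by apply: mulr_ge0; [exact: sqr_ge0|apply: mulr_ge0; exact: sqr_ge0].
  by apply: mulr_ge0; [apply: mulr_ge0 => //; exact: sqr_ge0|exact: sqr_ge0].
move=> Omega V r a L oOmega _ bz0 oV WV dfn rM crd frm ctr u tu.
have WV' : W `<=` V := subset_trans (@subset_closure _ W) WV.
exact: (weighted_dbar_estimate n_gt0 oU Uz0 oW e0_gt0 Ue0 B0 UB Lr0 (HLr r rM) f_smooth f_ge0 f_incr
  f_decr oOmega bz0 oV WV' dfn crd frm ctr tu C0 HC).
Qed.
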